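(* Let $X_1,\dots,X_n$ be an i.i.d. sample from a fixed unknown probability density $p_0:[-1,1]^d\to(0,\infty)$. Suppose $p_0=p_{z_{0,H}\circ\cdots\circ z_{0,1}}$, where $z_{0,h}=(z_{0,h,1},\dots,z_{0,h,d_{h+1}})$ for $h=1,\dots,H$ and $z_{0,h,i}\in\mathbb B_{c,h,i}$ for $(h,i)\in\mathcal I$. Assume that for $h=2,\dots,H$ and $i=1,\dots,d_{h+1}$, $z_{0,h,i}$ is in the closure of $\mathbb H_{h,i}$ in $(\mathcal C^1([-1,1]^{d_h},\mathbb R),\|\cdot\|_{\infty,1})$, and that for $i=1,\dots,d_2$, $z_{0,1,i}$ is in the closure of $\mathbb H_{1,i}$ in $(\mathcal C^0([-1,1]^{d},\mathbb R),\|\cdot\|_\infty)$. Assume moreover that $\|z_{0,h,i}\|_\infty<1$ for $h=1,\dots,H-1$, $i=1,\dots,d_{h+1}$, and that $\|\partial z_{0,h,i}/\partial x_j\|_\infty\le K_{\min}/2$ for $h=2,\dots,H$, $i=1,\dots,d_{h+1}$, $j=1,\dots,d_h$. Let $(\varepsilon_{c,n})$ be a sequence with $\varepsilon_{c,n}>0$, $\varepsilon_{c,n}\to0$, $n\varepsilon_{c,n}^2\to\infty$ and $\Phi_{c,z_0}(\varepsilon_{c,n})\le n\varepsilon_{c,n}^2$. Then, for the prior $p_{Z_{c,H}\circ\cdots\circ Z_{c,1}}$, the posterior distribution satisfies $$\mathbb P\left(h(p_{Z_{c,H}\circ\cdots\circ Z_{c,1}},p_0)>M_n\varepsilon_{c,n}\,\middle|\,X_1,\dots,X_n\right)\to0$$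 in probability as $n\to\infty$ (under $X_1,X_2,\dots$ i.i.d. with density $p_0$), for any sequence $(M_n)$ with $M_n\to\infty$.
   Context: Norms: for $f=(f_1,\dots,f_m):A\to\mathbb R^m$, $\|f\|_{\infty,A}=\sup_{t\in A}\max_\ell|f_\ell(t)|$, written $\|f\|_\infty$ when $A$ is the cube $[-1,1]^{k}$ on which $f$ is considered. $\mathcal C^0$ denotes continuous functions; $\mathcal C^1([-1,1]^k,\mathbb R)$ denotes continuously differentiable functions with norm $\|f\|_{\infty,1}=\|f\|_\infty+\sum_{j=1}^k\|\partial f/\partial x_j\|_\infty$. Setting: $H\ge2$ and $d\ge1$ are fixed integers, $d_1=d$, $d_{H+1}=1$, and $d_2,\dots,d_H\ge1$ are integers. $\mathcal I=\{(h,i):h\in\{1,\dots,H\},\,i\in\{1,\dots,d_{h+1}\}\}$. For $(h,i)\in\mathcal I$, $Z_{h,i}:\mathbb R^{d_h}\to\mathbb R$ is a centered Gaussian process with continuous realizations; all the $Z_{h,i}$ are independent; for $h\ge2$, $Z_{h,i}$ has continuously differentiable realizations. Fixed constants $K_{h,i,j}>0$ are given for $h=2,\dots,H$, $i=1,\dots,d_{h+1}$, $j=1,\dots,d_h$, and $K_{\min}=\min_{h,i,j}K_{h,i,j}$. Constraint sets: $\mathbb B_{c,1,i}$ is the set of continuous $z:[-1,1]^{d_1}\to\mathbb R$ with $\|z\|_\infty\le1$. For $2\le h\le H-1$, $\mathbb B_{c,h,i}$ is the set of $\mathcal C^1$ functions $z:[-1,1]^{d_h}\to\mathbb R$ with $\|z\|_\infty\le1$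 and $\|\partial z/\partial x_j\|_\infty\le K_{h,i,j}$ for all $j$. $\mathbb B_{c,H,1}$ is the set of $\mathcal C^1$ functions $z:[-1,1]^{d_H}\to\mathbb R$ with $\|\partial z/\partial x_j\|_\infty\le K_{H,1,j}$ for all $j$. Constrained processes: $(Z_{c,h,i})_{(h,i)\in\mathcal I}$ are independent, and the law of $Z_{c,h,i}$ is that of $Z_{h,i}$ (restricted to $[-1,1]^{d_h}$) conditioned on the (positive probability) event $Z_{h,i}\in\mathbb B_{c,h,i}$. $Z_{c,h}=(Z_{c,h,1},\dots,Z_{c,h,d_{h+1}})$. RKHS: $\mathbb H_{h,i}$ is the reproducing kernel Hilbert space of the covariance function of $Z_{h,i}$ on $[-1,1]^{d_h}\times[-1,1]^{d_h}$, with norm $\|\cdot\|_{\mathbb H_{h,i}}$. Concentration function: for $\varepsilon>0$, $$\Phi_{c,z_0}(\varepsilon)=\sum_{i=1}^{d_2}\Big(\tfrac32\inf_{g\in\mathbb H_{1,i},\ \|g-z_{0,1,i}\|_\infty<\varepsilon}\|g\|_{\mathbb H_{1,i}}^2-2\log\mathbb P(\|Z_{1,i}\|_\infty<\varepsilon)\Big)$$ $$+\sum_{(h,i)\in\mathcal I,\,h\ge2}\Big(\tfrac32\inf_{g}\|g\|_{\mathbb H_{h,i}}^2-2\log\mathbb P(\|Z_{h,i}\|_\infty\le\tfrac\varepsilon2)-2\sum_{j=1}^{d_h}\log\mathbb P(\|\partial Z_{h,i}/\partial x_j\|_\infty\le\tfrac{K_{\min}}4)\Big),$$ where the last infimum is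 over $g\in\mathbb H_{h,i}$ with $\|g-z_{0,h,i}\|_\infty<\varepsilon/2$ and $\|\partial g/\partial x_j-\partial z_{0,h,i}/\partial x_j\|_\infty<K_{\min}/4$ for $j=1,\dots,d_h$. All sup norms are over $[-1,1]^{d_h}$. Densities: for continuous $z:[-1,1]^d\to\mathbb R$, $p_z(t)=e^{z(t)}/\int_{[-1,1]^d}e^{z(s)}ds$. The Hellinger distance between densities is $h(f,g)=\big(\int_{[-1,1]^d}(\sqrt{f(t)}-\sqrt{g(t)})^2dt\big)^{1/2}$. The posterior is given by Bayes' rule: with $\Pi$ the law of the random density $p_{Z_{c,H}\circ\cdots\circ Z_{c,1}}$, the posterior mass of a set $A$ is $\int_A\prod_{k=1}^np(X_k)\,d\Pi(p)\big/\int\prod_{k=1}^np(X_k)\,d\Pi(p)$. *)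

(* Defs.v *)
From HB Require Import structures.
From mathcomp Require Import all_boot all_order all_algebra.
From mathcomp Require Import all_classical all_reals all_analysis.
Set Implicit Arguments. Unset Strict Implicit. Unset Printing Implicit Defensive.
Import Order.TTheory GRing.Theory Num.Theory.
Import numFieldNormedType.Exports.
Local Open Scope classical_set_scope.
Local Open Scope ring_scope.

Definition mx_display : measure_display -> measure_display.
Proof. exact. Qed.

(* The product sigma-algebra on m x n matrices, generated by the entries; for
   T = R it is the Borel sigma-algebra of R^(m x n). *)
Section measurable_matrix.
Context {d} {T : measurableType d} (m n : nat).

Definition mx_cylinders : set (set 'M[T]_(m, n)) :=
  [set B | exists i j, exists2 A : set T,
    measurable A & B = [set M : 'M[T]_(m, n) | A (M i j)]].

Let mx_set0 : <<s mx_cylinders >> set0.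
Proof. exact: sigma_algebra0. Qed.

Let mx_setC A : <<s mx_cylinders >> A -> <<s mx_cylinders >> (~` A).
Proof. exact: sigma_algebraC. Qed.

Let mx_bigcup (F : _^nat) : (forall i, <<s mx_cylinders >> (F i)) ->
  <<s mx_cylinders >> (\bigcup_i (F i)).
Proof. exact: sigma_algebra_bigcup. Qed.

HB.instance Definition _ := @isMeasurable.Build (mx_display d)
  'M[T]_(m, n) (<<s mx_cylinders >>) mx_set0 mx_setC mx_bigcup.

End measurable_matrix.

Section matrix_measurability.
Context {d} {T : measurableType d} (m n : nat).

Lemma measurable_entry i j :
  measurable_fun [set: 'M[T]_(m, n)] (fun M : 'M[T]_(m, n) => M i j).
Proof.
move=> _ Y mY; rewrite setTI; apply: sub_sigma_algebra.
by exists i, j, Y.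
Qed.

Lemma measurable_fun_entries d1 (T1 : measurableType d1)
    (f : T1 -> 'M[T]_(m, n)) :
  (forall i j, measurable_fun [set: T1] (fun x => f x i j)) ->
  measurable_fun [set: T1] f.
Proof.
move=> mf; apply: (@measurability _ _ _ _ _ _ (@mx_cylinders d T m n)) => //.
move=> _ [_ [i [j [A mA ->]] <-]].
exact: (mf i j measurableT A mA).
Qed.

End matrix_measurability.

(* Lebesgue measure on R^n, as the n-fold product of lebesgue_measure. *)
Section lebesgue_rV.
Context {R : realType}.
Local Open Scope ereal_scope.

Definition rV_cons n (p : R * 'rV[R]_n) : 'rV[R]_n.+1 :=
  \row_(j < n.+1) oapp (fun i => p.2 ord0 i) p.1 (unlift ord0 j).

Definition rV_uncons n (v : 'rV[R]_n.+1) : R * 'rV[R]_n :=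
  (v ord0 ord0, \row_(i < n) v ord0 (lift ord0 i)).

Lemma rV_consK n : cancel (@rV_cons n) (@rV_uncons n).
Proof.
move=> [x v]; rewrite /rV_uncons /rV_cons mxE unlift_none /=; congr pair.
by apply/rowP => i; rewrite !mxE liftK.
Qed.

Lemma measurable_rV_cons n : measurable_fun [set: R * 'rV[R]_n] (@rV_cons n).
Proof.
apply: measurable_fun_entries => i j.
under eq_fun do rewrite mxE.
case: (unliftP ord0 j) => [k _|_] /=; last exact: measurable_fst.
exact: (measurableT_comp (measurable_entry ord0 k) measurable_snd).
Qed.

Lemma measurable_rV_uncons n :
  measurable_fun [set: 'rV[R]_n.+1] (@rV_uncons n).
Proof.
apply: measurable_fun_pair; first exact: measurable_entry.
apply: measurable_fun_entries => i j.
under eq_fun do rewrite mxE.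
exact: measurable_entry.
Qed.


Section step.
Variables (n : nat) (mu : {sigma_finite_measure set 'rV[R]_n -> \bar R}).

Definition lebesgue_rV_step : set 'rV[R]_n.+1 -> \bar R :=
  pushforward (lebesgue_measure \x mu) (@rV_cons n).

Let step0 : lebesgue_rV_step set0 = 0.
Proof. by rewrite /lebesgue_rV_step /pushforward preimage_set0 measure0. Qed.

Let step_ge0 A : 0 <= lebesgue_rV_step A.
Proof. by rewrite /lebesgue_rV_step /pushforward measure_ge0. Qed.

Let step_sigma_additive : semi_sigma_additive lebesgue_rV_step.
Proof.
move=> F mF tF mUF; rewrite /lebesgue_rV_step /pushforward preimage_bigcup.
have mc := @measurable_rV_cons n.
apply: measure_semi_sigma_additive.
- by move=> k; rewrite -[X in measurable X]setTI; exact: mc.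
- apply/trivIsetP => /= i j _ _ ij; rewrite -preimage_setI.
  by move/trivIsetP : tF => /(_ _ _ _ _ ij) ->//; rewrite preimage_set0.
- by rewrite -preimage_bigcup -[X in measurable X]setTI; exact: mc.
Qed.

HB.instance Definition _ := isMeasure.Build _ _ _
  lebesgue_rV_step step0 step_ge0 step_sigma_additive.

Let step_sigma_finite : sigma_finite setT lebesgue_rV_step.
Proof.
have /sigma_finiteP[F [FT ndF Foo]] := sigma_finiteT (@lebesgue_measure R).
have /sigma_finiteP[G [GT ndG Goo]] := sigma_finiteT mu.
exists (fun k => @rV_uncons n @^-1` (F k `*` G k)).
  rewrite -preimage_bigcup (_ : \bigcup_k (F k `*` G k) = setT) ?preimage_setT//.
  rewrite -subTset => -[x y] _.
  have [a _ Fa] : (\bigcup_k F k) x by rewrite -FT.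
  have [b _ Gb] : (\bigcup_k G k) y by rewrite -GT.
  exists (maxn a b) => //; split.
  - by move: x Fa; exact/subsetPset/ndF/leq_maxl.
  - by move: y Gb; exact/subsetPset/ndG/leq_maxr.
move=> k; have [mF Fk] := Foo k; have [mG Gk] := Goo k; split.
  rewrite -[X in measurable X]setTI; apply: measurable_rV_uncons => //.
  exact: measurableX.
rewrite /lebesgue_rV_step /pushforward -comp_preimage.
rewrite (_ : _ \o _ = id); last by apply/funext => x /=; rewrite rV_consK.
by rewrite preimage_id product_measure1E// lte_mul_pinfty// ge0_fin_numE.
Qed.

HB.instance Definition _ := Measure_isSigmaFinite.Build _ _ _
  lebesgue_rV_step step_sigma_finite.
End step.

Fixpoint lebesgue_rV n : {sigma_finite_measure set 'rV[R]_n -> \bar R} :=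
  match n with
  | 0 => \d_(0%R : 'rV[R]_0)
  | k.+1 => lebesgue_rV_step (lebesgue_rV k)
  end.

Lemma lebesgue_rV_box n (A : 'I_n -> set R) :
  (forall i, measurable (A i)) ->
  lebesgue_rV n [set v : 'rV[R]_n | forall i, A i (v ord0 i)] =
  \prod_(i < n) lebesgue_measure (A i).
Proof.
elim: n A => [|n IH] A mA.
  rewrite big_ord0 /= diracE mem_set// => i.
  by case: i.
rewrite big_ord_recl -(IH (fun i => A (lift ord0 i)))//.
rewrite /= /lebesgue_rV_step /pushforward.
rewrite -product_measure1E; [|exact: mA|]; last first.
  rewrite (_ : [set _ | _] = \bigcap_(i in [set: 'I_n])
      (fun v : 'rV[R]_n => v ord0 i) @^-1` A (lift ord0 i)).
    apply: fin_bigcap_measurable => // i _; rewrite -[X in measurable X]setTI.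
    exact: measurable_entry.
  by apply/seteqP; split=> v /= h i => [_|]; exact: h.
congr (_ _); apply/seteqP; split => -[x v] /=.
  move=> h; split=> [|i]; first by have := h ord0; rewrite mxE unlift_none.
  by have := h (lift ord0 i); rewrite mxE liftK.
move=> [h0 h] i; rewrite mxE.
by case: (unliftP ord0 i) => [j|] -> //=; exact: h.
Qed.
End lebesgue_rV.

Section cube_functions.
Context {R : realType} (k : nat).
Implicit Types (f z : 'rV[R]_k -> R) (x : 'rV[R]_k) (j : 'I_k).

Definition cube : set 'rV[R]_k := [set x | forall j, `|x ord0 j| <= 1].

(* Elements of function spaces on [-1,1]^k are represented by functions on R^k;
   every notion below depends only on their values on the cube. *)
Definition csup f : \bar R := ereal_sup [set `|f x|%:E | x in cube].

Definition cube_continuous f : Prop := {within cube, continuous f}.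

(* Increments leaving the cube are excluded: at a boundary point the partial
   derivative is one-sided. *)
Definition cube_quotient f j x :=
  (fun t : R => t^-1 * (f (x + t *: delta_mx ord0 j) - f x))
    @ within [set t | cube (x + t *: delta_mx ord0 j)] 0^'.

Definition cube_partial f j x : R := lim (cube_quotient f j x).

Definition cube_C1 f : Prop :=
  cube_continuous f /\
  forall j, (forall x, cube x -> cvg (cube_quotient f j x)) /\
            cube_continuous (cube_partial f j).

Definition c1norm f : \bar R :=
  (csup f + \sum_(j < k) csup (cube_partial f j))%E.

Definition in_C0_closure (S : set ('rV[R]_k -> R)) z : Prop :=
  forall e : R, 0 < e ->
    exists g, [/\ S g, cube_continuous g & (csup (g \- z)%R < e%:E)%E].

Definition in_C1_closure (S : set ('rV[R]_k -> R)) z : Prop :=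
  forall e : R, 0 < e ->
    exists g, [/\ S g, cube_C1 g & (c1norm (g \- z)%R < e%:E)%E].

Definition space_C1 f : Prop :=
  forall j, (forall x, derivable (f : 'rV[R]_k -> R^o) x (delta_mx ord0 j)) /\
            continuous (fun x => 'D_(delta_mx ord0 j) (f : 'rV[R]_k -> R^o) x).

End cube_functions.
Arguments cube {R k}.

(* The reproducing kernel Hilbert space of a kernel K on D, built as the
   completion of the span of the functions K(t, .), t in D, for the inner
   product <K(s, .), K(t, .)> = K(s, t): it consists of the pointwise limits on
   D of Cauchy sequences of this pre-Hilbert space, and the norm of a limit is
   the limit of the norms. A finite combination sum_i a_i K(t_i, .) is encoded
   by the sequence of the pairs (a_i, t_i). *)
Section rkhs.
Context {R : realType} {T : eqType} (D : set T) (K : T -> T -> R).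

Definition kcomb (s : seq (R * T)) (x : T) : R := \sum_(p <- s) p.1 * K p.2 x.

Definition kinner (s s' : seq (R * T)) : R :=
  \sum_(p <- s) \sum_(q <- s') p.1 * q.1 * K p.2 q.2.

Definition knorm (s : seq (R * T)) : R := Num.sqrt (kinner s s).

Definition ksub (s s' : seq (R * T)) : seq (R * T) :=
  s ++ [seq (- p.1, p.2) | p <- s'].

Definition rkhs_approx (u : nat -> seq (R * T)) (f : T -> R) : Prop :=
  [/\ forall n p, p \in u n -> D p.2,
      forall e : R, 0 < e -> exists N : nat, forall m n : nat,
        (N <= m)%N -> (N <= n)%N -> knorm (ksub (u m) (u n)) < e
    & forall x, D x -> kcomb (u n) x @[n --> \oo] --> f x].

Definition rkhs : set (T -> R) := [set f | exists u, rkhs_approx u f].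

Definition rkhs_norm (f : T -> R) : R :=
  get [set r : R | exists2 u, rkhs_approx u f &
                     knorm (u n) @[n --> \oo] --> r].

End rkhs.

Section processes.
Context {R : realType} {d : measure_display} {W : measurableType d}.
Variable P : probability W R.

Definition realization {T : Type} (Z : T -> {RV P >-> R}) (w : W) : T -> R :=
  fun t => Z t w.

(* normal_prob 0 0 is not a Dirac mass in the library, hence the case split. *)
Definition centered_gaussian_law (Y : W -> R) : Prop :=
  exists s : R, forall A : set R, measurable A ->
    P (Y @^-1` A) = if s == 0 then \d_(0 : R) A else normal_prob 0 s A.

Definition centered_gaussian_process {T : Type} (Z : T -> {RV P >-> R}) :=
  forall (n : nat) (t : 'I_n -> T) (a : 'I_n -> R),
    centered_gaussian_law (fun w => \sum_(i < n) a i * Z (t i) w).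

Definition cov_kernel {T : Type} (Z : T -> {RV P >-> R}) (s t : T) : R :=
  fine (covariance P (Z s) (Z t)).

Definition sigma_process {T : Type} (D : set T) (Z : T -> {RV P >-> R}) :
    set (set W) :=
  <<s [set E | exists2 t, D t & exists2 A : set R,
                 measurable A & E = Z t @^-1` A] >>.

(* Mutual independence of the sigma-algebras F h i with 1 <= h <= H; each of
   them contains the whole space, so that the product rule for the full family
   contains the one for every subfamily. *)
Definition layers_independent (H : nat) (dim : nat -> nat)
    (F : forall h, 'I_(dim h.+1) -> set (set W)) : Prop :=
  forall E : forall h, 'I_(dim h.+1) -> set W,
    (forall h i, (1 <= h <= H)%N -> F h i (E h i)) ->
    P (\bigcap_(h in [set h | (1 <= h <= H)%N]) \bigcap_(i in setT) E h i) =
    (\prod_(1 <= h < H.+1) \prod_(i < dim h.+1) P (E h i))%E.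

End processes.

Definition cylinders {R : realType} {T : Type} (D : set T) : set (set (T -> R)) :=
  <<s [set C | exists2 t, D t & exists2 A : set R,
                 measurable A & C = [set f | A (f t)]] >>.

(* Zc is a process on D with all its realizations in B, the law of which is that
   of Z restricted to D, conditioned on the event that Z belongs to B. *)
Definition conditioned_process {R : realType} {d d' : measure_display}
    {W : measurableType d} {W' : measurableType d'}
    (P : probability W R) (P' : probability W' R) {T : Type} (D : set T)
    (B : set (T -> R)) (Z : T -> {RV P >-> R}) (Zc : T -> {RV P' >-> R}) : Prop :=
  let inB := [set w | B (realization Z w)] in
  [/\ (0 < P inB)%E,
      forall w, B (realization Zc w)
    & forall C, cylinders D C ->
        P' [set w | C (realization Zc w)] =
        (P ([set w | C (realization Z w)] `&` inB) / P inB)%E].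

Section deep_model.
Context {R : realType} (H : nat) (dim : nat -> nat).

(* Families indexed by (h, i) are defined for all h : nat, but only their
   entries with 1 <= h <= H are used. *)
Definition layer_functions :=
  forall h, 'I_(dim h.+1) -> 'rV[R]_(dim h) -> R.

Definition constraint_bounds := forall h, 'I_(dim h.+1) -> 'I_(dim h) -> R.

(* compose z h = z_h o ... o z_1 *)
Fixpoint compose (z : layer_functions) h (x : 'rV[R]_(dim 1%N)) :
    'rV[R]_(dim h.+1) :=
  match h with
  | 0 => x
  | h'.+1 => \row_i z h'.+1 i (compose z h' x)
  end.

Definition deep (dimH : dim H.+1 = 1%N) (z : layer_functions)
    (x : 'rV[R]_(dim 1%N)) : R :=
  compose z H x ord0 (cast_ord (esym dimH) ord0).

Definition Bc (K : constraint_bounds) h (i : 'I_(dim h.+1)) :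
    set ('rV[R]_(dim h) -> R) :=
  [set z | if h == 1%N then cube_continuous z /\ (csup z <= 1)%E
           else [/\ cube_C1 z,
                    (h < H)%N -> (csup z <= 1)%E
                  & forall j, (csup (cube_partial z j) <= (K h i j)%:E)%E]].

Definition Kmin (K : constraint_bounds) : R :=
  inf [set r | exists h (i : 'I_(dim h.+1)) (j : 'I_(dim h)),
                 (2 <= h <= H)%N /\ r = K h i j].

End deep_model.

Section concentration.
Context {R : realType} {d : measure_display} {W : measurableType d}.
Context (P : probability W R) (H : nat) (dim : nat -> nat).
Variable Z : forall h, 'I_(dim h.+1) -> 'rV[R]_(dim h) -> {RV P >-> R}.
Variables (K : @constraint_bounds R dim) (z0 : @layer_functions R dim).
Local Open Scope ereal_scope.

Definition layer_rkhs h (i : 'I_(dim h.+1)) : set ('rV[R]_(dim h) -> R) :=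
  rkhs cube (cov_kernel (Z i)).

Definition layer_rkhs_norm h (i : 'I_(dim h.+1)) : ('rV[R]_(dim h) -> R) -> R :=
  rkhs_norm cube (cov_kernel (Z i)).

Definition first_layer_term (e : R) (i : 'I_(dim 2%N)) : \bar R :=
  (3 / 2)%:E * ereal_inf [set (layer_rkhs_norm i g ^+ 2)%:E |
      g in [set g | @layer_rkhs 1%N i g /\ csup (g \- @z0 1%N i)%R < e%:E]]
  - 2%:E * lne (P [set w | csup (realization (@Z 1%N i) w) < e%:E]).

Definition layer_term (e : R) h (i : 'I_(dim h.+1)) : \bar R :=
  (3 / 2)%:E * ereal_inf [set (layer_rkhs_norm i g ^+ 2)%:E |
      g in [set g | [/\ layer_rkhs i g,
          csup (g \- z0 i)%R < (e / 2)%:E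
        & forall j, csup (cube_partial g j \- cube_partial (z0 i) j)%R
                    < (Kmin H K / 4)%:E]]]
  - 2%:E * lne (P [set w | csup (realization (Z i) w) <= (e / 2)%:E])
  - 2%:E * \sum_(j < dim h)
      lne (P [set w | csup (cube_partial (realization (Z i) w) j)
                      <= (Kmin H K / 4)%:E]).

Definition concentration (e : R) : \bar R :=
  \sum_(i < dim 2%N) first_layer_term e i +
  \sum_(2 <= h < H.+1) \sum_(i < dim h.+1) layer_term e i.

End concentration.

Section densities.
Context {R : realType} (k : nat).
Implicit Types (f g p z : 'rV[R]_k -> R).

Definition is_density p : Prop :=
  [/\ measurable_fun cube p, (forall t, cube t -> 0 < p t)
    & (\int[lebesgue_rV k]_(t in cube) (p t)%:E = 1)%E].

Definition density_of z (t : 'rV[R]_k) : R :=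
  expR (z t) / \int[lebesgue_rV k]_(s in cube) expR (z s).

Definition hellinger f g : R :=
  Num.sqrt (\int[lebesgue_rV k]_(t in cube)
              (Num.sqrt (f t) - Num.sqrt (g t)) ^+ 2).

Definition iid_sample {d : measure_display} {W : measurableType d}
    (P : probability W R) (X : nat -> {RV P >-> 'rV[R]_k}) p : Prop :=
  [/\ forall m w, cube (X m w),
      forall m (A : set 'rV[R]_k), measurable A ->
        P (X m @^-1` A) = (\int[lebesgue_rV k]_(t in A `&` cube) (p t)%:E)%E
    & forall n (A : nat -> set 'rV[R]_k), (forall m, measurable (A m)) ->
        P (\bigcap_(m in [set m | (m < n)%N]) X m @^-1` A m) =
        (\prod_(m < n) P (X m @^-1` A m))%E].

(* Posterior mass of A after observing x 0, ..., x (n - 1), when the prior is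
   the law under P of the random density p; the integrals with respect to the
   prior are written on the underlying probability space. *)
Definition posterior {d : measure_display} {W : measurableType d}
    (P : probability W R) (p : W -> 'rV[R]_k -> R) (n : nat)
    (x : nat -> 'rV[R]_k) (A : set ('rV[R]_k -> R)) : R :=
  (\int[P]_(w in [set w | A (p w)]) \prod_(m < n) p w (x m)) /
  (\int[P]_w \prod_(m < n) p w (x m)).

End densities.

(* Main.v *)
(* The rate only has to hold up to a factor [M n] tending to infinity, so every
   sharp inequality about Gaussian measures can be traded for a weaker one whose
   loss is a constant in the exponent.

   Prior mass: shifting a symmetric set by an RKHS function [g] costs at most
   [exp(- c |g|^2)] (Cameron-Martin), and a rotation argument gives
   [P(C) >= (P(A) P(B))^2] in place of the Gaussian correlation inequality, so
   that sup-norm and Lipschitz constraints can be treated separately.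

   Sieve: let [A] be the ball of radius [eta], [V] a centered Gaussian path and
   [h r z = P(r z + sqrt (1 - r^2) V \in A)].  For [r >= 1/4] the points of an
   [8 eta]-separated subset of [{h r >= delta}] give disjoint events, hence there
   are at most [1 / delta] of them.  The complement [D] of the union of these
   sets over a grid of values of [r] is small: the means of [1_D(X) 1_A(Y)] over
   pairs of paths sharing a random part of their independent components average
   to at least [P(D)^2 P(A)^2] (a form of reverse hypercontractivity), whereas
   on [D] each of them is small.  This replaces Borell's isoperimetric
   inequality and the entropy of the RKHS ball.  A change of measure by a factor
   [1 / P(B)] passes to the conditioned processes.

   Posterior: compositions are Lipschitz in the layers for the sup norm, since
   the constraints bound the derivatives.  The likelihood ratio is then close to
   1 near the truth, and codes of the sieve provide finitely many tests
   [prod sqrt (p / p0)(X_m) > 1]. *)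
From HB Require Import structures.
From mathcomp Require Import all_boot all_order all_algebra.
From mathcomp Require Import all_classical all_reals all_analysis.
From mathcomp Require Import measurable_realfun ring lra.
Require Import Defs.
Set Implicit Arguments. Unset Strict Implicit. Unset Printing Implicit Defensive.
Import Order.TTheory GRing.Theory Num.Theory.
Import numFieldNormedType.Exports.
Local Open Scope classical_set_scope.
Local Open Scope ring_scope.
Import HBNNSimple.

(** * Expectations of bounded functions *)

(** Three obstacles shape the development. The law of a conditioned process is specified only on
    cylinders of the cube, so events are read off the values at the countable dense set [cubept];
    continuity then returns to the whole cube, and derivative constraints, which are not
    evaluations, become Lipschitz inequalities between points of that set. Gaussian laws on a path
    space have no density, so they are handled through the functions [cos (l x + th)] of linear
    forms [l], which determine the law ([law_unique]); the rotation invariance of two independent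
    copies, proved in this way, is the source of the sieve and of the correlation bound. Finally the
    number of sieve codes is polynomial in [1 / tau] and in the inverse of a small ball probability.
    Both are exponentials of constant multiples of [n eps^2], hence so are the number of codes, the
    prior mass and the prior mass missed by the sieve, while the tests gain [M^2 n eps^2]. *)

Definition bm {d} {T : measurableType d} {R : realType} (f : T -> R) : Prop :=
  measurable_fun [set: T] f /\ exists M : R, forall x, `|f x| <= M.

HB.lock Definition Ex {d} {T : measurableType d} {R : realType}
  (P : probability T R) (f : T -> R) : R := \int[P]_x f x.

Section bounded_measurable.
Context {d} {T : measurableType d} {R : realType}.
Implicit Types (f g : T -> R).

Lemma bm_meas f : bm f -> measurable_fun setT f. Proof. by case. Qed.

Lemma bm_cst c : @bm _ _ R (fun _ : T => c).
Proof. by split=> //; exists `|c|. Qed.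

Lemma bmD f g : bm f -> bm g -> bm (fun x => f x + g x).
Proof.
move=> [mf [A fA]] [mg [B gB]]; split; first exact: measurable_funD.
by exists (A + B) => x; rewrite (le_trans (ler_normD _ _))// lerD.
Qed.

Lemma bmM f g : bm f -> bm g -> bm (fun x => f x * g x).
Proof.
move=> [mf [A fA]] [mg [B gB]]; split; first exact: measurable_funM.
by exists (A * B) => x; rewrite normrM ler_pM.
Qed.

Lemma bmZ c f : bm f -> bm (fun x => c * f x).
Proof. by move=> bf; exact: (bmM (bm_cst c)). Qed.

Lemma bmN f : bm f -> bm (fun x => - f x).
Proof.
by move=> /(bmZ (-1)); congr bm; apply/funext => x; rewrite mulN1r.
Qed.

Lemma bmB f g : bm f -> bm g -> bm (fun x => f x - g x).
Proof. by move=> bf bg; apply: bmD => //; exact: bmN. Qed.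

Lemma bmX f n : bm f -> bm (fun x => f x ^+ n).
Proof.
move=> bf; elim: n => [|n IH]; first exact: bm_cst.
by under eq_fun do rewrite exprS; exact: bmM.
Qed.

Lemma bm_indic (A : set T) : measurable A -> bm (\1_A : T -> R).
Proof.
move=> mA; split; first exact: measurable_indic.
by exists 1 => x; rewrite indicE normr_nat; case: (_ \in _).
Qed.

Lemma bm_sum (I : Type) (s : seq I) (F : I -> T -> R) :
  (forall i, bm (F i)) -> bm (fun x => \sum_(i <- s) F i x).
Proof.
move=> bF; elim: s => [|i s IH].
  by under eq_fun do rewrite big_nil; exact: bm_cst.
by under eq_fun do rewrite big_cons; exact: bmD.
Qed.

Lemma bm_prod (I : Type) (s : seq I) (F : I -> T -> R) :
  (forall i, bm (F i)) -> bm (fun x => \prod_(i <- s) F i x).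
Proof.
move=> bF; elim: s => [|i s IH].
  by under eq_fun do rewrite big_nil; exact: bm_cst.
by under eq_fun do rewrite big_cons; exact: bmM.
Qed.

Lemma bm_lim (f_ : nat -> T -> R) f (M : R) :
  (forall n, measurable_fun setT (f_ n)) -> (forall n x, `|f_ n x| <= M) ->
  (forall x, f_ n x @[n --> \oo] --> f x) -> bm f.
Proof.
move=> mf fM fc; split.
  by apply: (measurable_fun_cvg (h := f_)) => // x _; exact: fc.
exists M => x.
have /cvg_norm h := fc x; rewrite -(cvg_lim _ h)//.
by apply: limr_le; [apply/cvg_ex; eexists; exact: h|exact: nearW].
Qed.

Variable P : probability T R.

Lemma bm_integrable f : bm f -> P.-integrable setT (EFin \o f).
Proof.
move=> [mf [M fM]]; apply: (@le_integrable _ _ _ _ _ _ _ (EFin \o cst M)) => //.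
- exact/measurable_EFinP.
- move=> x _ /=; rewrite lee_fin (le_trans (fM x))//.
  exact: ler_norm.
- apply: finite_measure_integrable_cst => //.
Qed.

Lemma Ex_cst c : Ex P (fun=> c) = c.
Proof. rewrite Ex.unlock Rintegral_cst// [X in fine X](_ : _ = 1%E) ?mulr1//.
exact: probability_setT. Qed.

Lemma ExD f g : bm f -> bm g -> Ex P (fun x => f x + g x) = Ex P f + Ex P g.
Proof. by move=> bf bg; rewrite Ex.unlock RintegralD//; exact: bm_integrable. Qed.

Lemma ExZ c f : bm f -> Ex P (fun x => c * f x) = c * Ex P f.
Proof. by move=> bf; rewrite Ex.unlock RintegralZl//; exact: bm_integrable. Qed.

Lemma ExN f : bm f -> Ex P (fun x => - f x) = - Ex P f.
Proof.
move=> bf; rewrite -mulN1r -ExZ//; congr (Ex P _).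
by apply/funext => x; rewrite mulN1r.
Qed.

Lemma ExB f g : bm f -> bm g -> Ex P (fun x => f x - g x) = Ex P f - Ex P g.
Proof. by move=> bf bg; rewrite ExD ?ExN//; exact: bmN. Qed.

Lemma Ex_sum (I : Type) (s : seq I) (F : I -> T -> R) :
  (forall i, bm (F i)) ->
  Ex P (fun x => \sum_(i <- s) F i x) = \sum_(i <- s) Ex P (F i).
Proof.
move=> bF; elim: s => [|i s IH].
  by rewrite big_nil; under [X in Ex _ X]eq_fun do rewrite big_nil; exact: Ex_cst.
rewrite big_cons -IH -ExD//; last exact: bm_sum.
by congr (Ex P _); apply/funext => x; rewrite big_cons.
Qed.

Lemma le_Ex f g : bm f -> bm g -> (forall x, f x <= g x) -> Ex P f <= Ex P g.
Proof.
by move=> bf bg fg; rewrite Ex.unlock; apply: le_Rintegral => //; exact: bm_integrable.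
Qed.

Lemma Ex_ge0 f : (forall x, 0 <= f x) -> 0 <= Ex P f.
Proof. by move=> f0; rewrite Ex.unlock; exact: Rintegral_ge0. Qed.

Lemma Ex_le_cst f c : bm f -> (forall x, f x <= c) -> Ex P f <= c.
Proof. by move=> bf fc; rewrite -[leRHS]Ex_cst le_Ex//; exact: bm_cst. Qed.

Lemma Ex_ge_cst f c : bm f -> (forall x, c <= f x) -> c <= Ex P f.
Proof. by move=> bf fc; rewrite -[leLHS]Ex_cst le_Ex//; exact: bm_cst. Qed.

Lemma Ex_norm_le f M : bm f -> (forall x, `|f x| <= M) -> `|Ex P f| <= M.
Proof.
move=> bf fM; rewrite ler_norml; apply/andP; split.
  by apply: Ex_ge_cst => // x; have := fM x; rewrite ler_norml => /andP[].
by apply: Ex_le_cst => // x; have := fM x; rewrite ler_norml => /andP[].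
Qed.

Lemma Ex_indic (A : set T) : measurable A -> Ex P \1_A = fine (P A).
Proof. by move=> mA; rewrite Ex.unlock /Rintegral integral_indic// setIT. Qed.

Lemma Ex_indicE (A : set T) : measurable A -> (Ex P \1_A)%:E = P A.
Proof. by move=> mA; rewrite Ex_indic// fineK// fin_num_measure. Qed.

Lemma EFin_Ex f : bm f -> (Ex P f)%:E = (\int[P]_x (f x)%:E)%E.
Proof.
move=> bf; rewrite Ex.unlock /Rintegral fineK//.
exact: integrable_fin_num (bm_integrable bf).
Qed.

Lemma Ex_lim (f_ : nat -> T -> R) f (M : R) :
  (forall n, measurable_fun setT (f_ n)) -> (forall n x, `|f_ n x| <= M) ->
  (forall x, f_ n x @[n --> \oo] --> f x) ->
  Ex P (f_ n) @[n --> \oo] --> Ex P f.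
Proof.
move=> mf fM fc; have bf := bm_lim mf fM fc.
have bfn n : bm (f_ n) by split => //; exists M.
suff /fine_cvgP[_] : (\int[P]_x (f_ n x)%:E)%E @[n --> \oo] --> (Ex P f)%:E.
  by rewrite [in X in X -> _]Ex.unlock Ex.unlock.
rewrite EFin_Ex//.
apply: (@dominated_cvg _ _ _ P setT measurableT
  (fun n x => (f_ n x)%:E) (EFin \o f) (EFin \o cst M)) => //.
- by move=> n; apply/measurable_EFinP.
- by move=> x _; apply: cvg_EFin; [exact: nearW|exact: fc].
- exact: finite_measure_integrable_cst.
- by move=> n x _; rewrite lee_fin.
Qed.

End bounded_measurable.

Lemma bm_comp {d d'} {T : measurableType d} {S : measurableType d'}
  {R : realType} (f : S -> R) (phi : T -> S) :
  bm f -> measurable_fun setT phi -> bm (fun x => f (phi x)).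
Proof.
move=> [mf [M fM]] mphi; split; first exact: (measurableT_comp mf mphi).
by exists M.
Qed.

Lemma bm_cos {d} {T : measurableType d} {R : realType} (f : T -> R) :
  measurable_fun setT f -> bm (fun x => cos (f x)).
Proof.
move=> mf; split; last by exists 1 => x; rewrite ler_norml cos_geN1 cos_le1.
apply: (measurableT_comp _ mf).
by apply: continuous_measurable_fun; exact: continuous_cos.
Qed.

(** A functional monotone class principle: simple functions come from indicators by linearity,
    nonnegative bounded functions are limits of simple ones, and a shift by the bound reduces the
    general case to these. Change of variables, Fubini, densities and independence are all obtained
    through it. *)
Lemma bm_ind {d} {T : measurableType d} {R : realType} (Q : (T -> R) -> Prop) :
  (forall A, measurable A -> Q \1_A) ->
  (forall f g, bm f -> bm g -> Q f -> Q g -> Q (fun x => f x + g x)) ->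
  (forall c f, bm f -> Q f -> Q (fun x => c * f x)) ->
  (forall (f_ : nat -> T -> R) (f : T -> R) (M : R),
     (forall n, bm (f_ n)) -> (forall n x, `|f_ n x| <= M) ->
     (forall x, f_ n x @[n --> \oo] --> f x) ->
     (forall n, Q (f_ n)) -> Q f) ->
  forall f, bm f -> Q f.
Proof.
move=> Q1 QD QZ Qlim.
have Qsum (I : Type) (s : seq I) (F : I -> T -> R) :
    (forall i, bm (F i)) -> (forall i, Q (F i)) ->
    Q (fun x => \sum_(i <- s) F i x).
  move=> bF QF; elim: s => [|i s IH].
    rewrite (_ : (fun _ => _) = \1_set0); first exact: Q1.
    by apply/funext => x; rewrite big_nil indic0.
  by under eq_fun do rewrite big_cons; apply: QD => //; exact: bm_sum.
have Qnn (f : T -> R) (M : R) : measurable_fun setT f -> (forall x, 0 <= f x < M) -> Q f.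
  move=> mf fM.
  have f0 x : 0 <= f x by have /andP[] := fM x.
  pose e : {nnsfun T >-> R}^nat := nnsfun_approx measurableT
    (proj2 (measurable_EFinP _ _) mf).
  have ec x : e n x @[n --> \oo] --> f x.
    have f0E y : setT y -> (0 <= (f y)%:E)%E by rewrite lee_fin.
    by have /fine_cvgP[] := cvg_nnsfun_approx measurableT
      (proj2 (measurable_EFinP _ _) mf) f0E (I : setT x).
  have ee x n : e n x <= f x.
    rewrite -(cvg_lim _ (ec x))//; apply: nondecreasing_cvgn_le.
      by move=> i j ij; exact/lefP/nd_nnsfun_approx.
    by apply/cvg_ex; exists (f x); exact: ec.
  have eb n : bm (e n).
    split; first exact: measurable_funP.
    exists M => x; rewrite ger0_norm// (le_trans (ee _ _))// ltW//.
    by have /andP[] := fM x.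
  apply: (Qlim e f M) => //.
  - move=> n x; rewrite ger0_norm// (le_trans (ee _ _))// ltW//.
    by have /andP[] := fM x.
  - move=> n.
    rewrite (_ : (e n : T -> R) = (fun x => \sum_(y <- finmap.enum_fset (fset_set (range (e n))))
         y * \1_(e n @^-1` [set y]) x)).
      apply: Qsum => y; first by apply: bmZ; apply: bm_indic.
      by apply: QZ; [exact: bm_indic|exact: Q1].
    apply/funext => x; rewrite [LHS]fimfunE fsbig_finite//=.
move=> f [mf [M fM]].
have -> : f = (fun x => (f x + M) + (- M) * \1_setT x).
  by apply/funext => x; rewrite indicT /=; ring.
have bM : bm (fun x => f x + M) by apply: bmD; [split => //; exists M|exact: bm_cst].
apply: QD => //.
- by apply: bmZ; exact: bm_indic.
- apply: (Qnn _ (M + M + 1)); first exact: (bm_meas bM).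
  by move=> x; have := fM x; rewrite ler_norml => /andP[]; lra.
- by apply: QZ; [exact: bm_indic|exact: Q1].
Qed.

Lemma Ex_eq_law {d1 d2 d} {T1 : measurableType d1} {T2 : measurableType d2}
  {S : measurableType d} {R : realType}
  (P1 : probability T1 R) (P2 : probability T2 R) (h1 : T1 -> S) (h2 : T2 -> S) :
  measurable_fun setT h1 -> measurable_fun setT h2 ->
  (forall A, measurable A -> P1 (h1 @^-1` A) = P2 (h2 @^-1` A)) ->
  forall f, bm f -> Ex P1 (fun x => f (h1 x)) = Ex P2 (fun x => f (h2 x)).
Proof.
move=> m1 m2 h; apply: bm_ind.
- move=> A mA.
  have -> : (fun x => \1_A (h1 x)) = \1_(h1 @^-1` A) :> (T1 -> R) by [].
  have -> : (fun x => \1_A (h2 x)) = \1_(h2 @^-1` A) :> (T2 -> R) by [].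
  by rewrite !Ex_indic ?h// -[X in measurable X]setTI; [exact: m2|exact: m1].
- by move=> f g bf bg ef eg; rewrite !ExD ?ef ?eg//; exact: bm_comp.
- by move=> c f bf ef; rewrite !ExZ ?ef//; exact: bm_comp.
- move=> f_ f M bf fM fc ef.
  have c1 : Ex P1 (fun x => f_ n (h1 x)) @[n --> \oo] --> Ex P1 (fun x => f (h1 x)).
    apply: (@Ex_lim _ _ _ _ (fun n x => f_ n (h1 x)) _ M) => //.
    by move=> n; exact: (bm_meas (bm_comp (bf n) m1)).
  have c2 : Ex P2 (fun x => f_ n (h2 x)) @[n --> \oo] --> Ex P2 (fun x => f (h2 x)).
    apply: (@Ex_lim _ _ _ _ (fun n x => f_ n (h2 x)) _ M) => //.
    by move=> n; exact: (bm_meas (bm_comp (bf n) m2)).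
  rewrite -(cvg_lim _ c1)// -(cvg_lim _ c2)//.
  by under eq_fun do rewrite ef.
Qed.

Section fubini.
Context {d1 d2} {T1 : measurableType d1} {T2 : measurableType d2} {R : realType}.
Variables (P1 : probability T1 R) (P2 : probability T2 R).
Implicit Types F : T1 * T2 -> R.

Lemma bm_pair1 F x : bm F -> bm (fun y => F (x, y)).
Proof. by move=> bF; apply: (bm_comp bF); exact: measurable_pair1. Qed.

Lemma bm_pair2 F y : bm F -> bm (fun x => F (x, y)).
Proof. by move=> bF; apply: (bm_comp bF); exact: measurable_pair2. Qed.

Lemma bm_Ex F : bm F -> bm (fun x => Ex P2 (fun y => F (x, y))).
Proof.
move=> bF; split; last first.
  have [mF [M FM]] := bF; exists M => x.
  by apply: Ex_norm_le => //; exact: bm_pair1.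
move: F bF; apply: bm_ind.
- move=> A mA.
  rewrite (_ : (fun x => _) = fine \o (fun x => P2 (xsection A x))).
    apply: measurableT_comp => //.
    exact: measurable_fun_xsection.
  apply/funext => x /=; rewrite -Ex_indic; last exact: measurable_xsection.
  by congr Ex; apply/funext => y; rewrite !indicE mem_xsection.
- move=> f g bf bg mf mg.
  rewrite (_ : (fun x => Ex _ _) = (fun x => Ex P2 (fun y => f (x, y)) +
    Ex P2 (fun y => g (x, y)))).
    exact: measurable_funD.
  by apply/funext => x; rewrite ExD//; exact: bm_pair1.
- move=> c f bf mf.
  rewrite (_ : (fun x => Ex _ _) = (fun x => c * Ex P2 (fun y => f (x, y)))).
    exact: measurable_funM.
  by apply/funext => x; rewrite ExZ//; exact: bm_pair1.
- move=> f_ f M bf fM fc mf.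
  apply: (measurable_fun_cvg (h := fun n x => Ex P2 (fun y => f_ n (x, y)))) => //.
  move=> x _; apply: (@Ex_lim _ _ _ _ (fun n y => f_ n (x, y)) _ M) => //.
  by move=> n; exact: (bm_meas (bm_pair1 _ (bf n))).
Qed.

Lemma Ex_fubini F : bm F ->
  Ex (P1 \x P2)%E F = Ex P1 (fun x => Ex P2 (fun y => F (x, y))).
Proof.
move: F; apply: bm_ind.
- move=> A mA.
  apply: EFin_inj; rewrite Ex_indicE// EFin_Ex; last by apply: bm_Ex; exact: bm_indic.
  apply: eq_integral => x _ /=.
  rewrite -Ex_indicE; last exact: measurable_xsection.
  by congr (_ %:E); congr Ex; apply/funext => y; rewrite !indicE mem_xsection.
- move=> f g bf bg ef eg; rewrite (ExD _ bf bg) ef eg -(ExD _ (bm_Ex bf) (bm_Ex bg)).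
  by congr Ex; apply/funext => x; rewrite ExD//; exact: bm_pair1.
- move=> c f bf ef; rewrite (ExZ _ _ bf) ef -(ExZ _ _ (bm_Ex bf)).
  by congr Ex; apply/funext => x; rewrite ExZ//; exact: bm_pair1.
- move=> f_ f M bf fM fc ef.
  have c1 : Ex (P1 \x P2)%E (f_ n) @[n --> \oo] --> Ex (P1 \x P2)%E f.
    by apply: (@Ex_lim _ _ _ (P1 \x P2)%E f_ f M) => // n; exact: (bm_meas (bf n)).
  have c2 : Ex P1 (fun x => Ex P2 (fun y => f_ n (x, y))) @[n --> \oo] -->
            Ex P1 (fun x => Ex P2 (fun y => f (x, y))).
    apply: (@Ex_lim _ _ _ _ (fun n x => Ex P2 (fun y => f_ n (x, y))) _ M) => //.
    + by move=> n; exact: (bm_meas (bm_Ex (bf n))).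
    + by move=> n x; apply: Ex_norm_le => //; exact: bm_pair1.
    + move=> x; apply: (@Ex_lim _ _ _ _ (fun n y => f_ n (x, y)) _ M) => //.
      by move=> n; exact: (bm_meas (bm_pair1 _ (bf n))).
  rewrite -(cvg_lim _ c1)// -(cvg_lim _ c2)//.
  by under eq_fun do rewrite ef.
Qed.
End fubini.

(** The product measure is an iterated integral in one order, which is what [Ex_fubini] unfolds; the
    exchange itself is Tonelli for indicators, extended by [bm_ind]. *)
Lemma Ex_swap {d1 d2} {T1 : measurableType d1} {T2 : measurableType d2}
  {R : realType} (P1 : probability T1 R) (P2 : probability T2 R)
  (F : T1 * T2 -> R) : bm F ->
  Ex P1 (fun x => Ex P2 (fun y => F (x, y))) =
  Ex P2 (fun y => Ex P1 (fun x => F (x, y))).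
Proof.
have msw : measurable_fun setT (fun z : T2 * T1 => (z.2, z.1)).
  exact: measurable_fun_pair.
have bsw F' : bm F' -> bm (fun z : T2 * T1 => F' (z.2, z.1) : R).
  by move=> bF; exact: (bm_comp bF).
move: F; apply: bm_ind.
- move=> A mA; have bA : bm (\1_A : T1 * T2 -> R) by exact: bm_indic.
  have := @fubini_tonelli _ _ _ _ R P1 P2 (EFin \o \1_A).
  rewrite /fubini_F /fubini_G /= => /(_ (proj2 (measurable_EFinP _ _) (bm_meas bA))).
  move=> /(_ (fun _ => _)) h; apply: EFin_inj.
  rewrite (EFin_Ex _ (bm_Ex _ bA)) (EFin_Ex _ (bm_Ex _ (bsw _ bA))).
  transitivity (\int[P1]_x \int[P2]_y (\1_A (x, y))%:E)%E.
    by apply: eq_integral => x _; rewrite (EFin_Ex _ (bm_pair1 x bA)).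
  rewrite h; last by move=> x; rewrite lee_fin.
  by apply: eq_integral => y _; rewrite (EFin_Ex _ (bm_pair2 y bA)).
- move=> f g bf bg ef eg.
  transitivity (Ex P1 (fun x => Ex P2 (fun y => f (x, y)) +
      Ex P2 (fun y => g (x, y)))).
    by congr Ex; apply/funext => x; rewrite ExD//; exact: bm_pair1.
  transitivity (Ex P2 (fun y => Ex P1 (fun x => f (x, y)) +
      Ex P1 (fun x => g (x, y)))); last first.
    by congr Ex; apply/funext => x; rewrite ExD//; exact: bm_pair2.
  by rewrite !ExD ?ef ?eg//;
    [exact: (bm_Ex _ (bsw _ _))|exact: (bm_Ex _ (bsw _ _))|exact: bm_Ex|exact: bm_Ex].
- move=> c f bf ef.
  transitivity (Ex P1 (fun x => c * Ex P2 (fun y => f (x, y)))).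
    by congr Ex; apply/funext => x; rewrite ExZ//; exact: bm_pair1.
  transitivity (Ex P2 (fun y => c * Ex P1 (fun x => f (x, y)))); last first.
    by congr Ex; apply/funext => x; rewrite ExZ//; exact: bm_pair2.
  by rewrite !ExZ ?ef//; [exact: (bm_Ex _ (bsw _ _))|exact: bm_Ex].
- move=> f_ f M bf fM fc ef.
  have c1 : Ex P1 (fun x => Ex P2 (fun y => f_ n (x, y))) @[n --> \oo] -->
            Ex P1 (fun x => Ex P2 (fun y => f (x, y))).
    apply: (@Ex_lim _ _ _ _ (fun n x => Ex P2 (fun y => f_ n (x, y))) _ M) => //.
    + by move=> n; exact: (bm_meas (bm_Ex _ (bf n))).
    + by move=> n x; apply: Ex_norm_le => //; exact: bm_pair1.
    + move=> x; apply: (@Ex_lim _ _ _ _ (fun n y => f_ n (x, y)) _ M) => //.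
      by move=> n; exact: (bm_meas (bm_pair1 _ (bf n))).
  have c2 : Ex P2 (fun y => Ex P1 (fun x => f_ n (x, y))) @[n --> \oo] -->
            Ex P2 (fun y => Ex P1 (fun x => f (x, y))).
    apply: (@Ex_lim _ _ _ _ (fun n y => Ex P1 (fun x => f_ n (x, y))) _ M) => //.
    + by move=> n; exact: (bm_meas (bm_Ex _ (bsw _ (bf n)))).
    + by move=> n x; apply: Ex_norm_le => //; exact: bm_pair2.
    + move=> y; apply: (@Ex_lim _ _ _ _ (fun n x => f_ n (x, y)) _ M) => //.
      by move=> n; exact: (bm_meas (bm_pair2 _ (bf n))).
  rewrite -(cvg_lim _ c1)// -(cvg_lim _ c2)//.
  by under eq_fun do rewrite ef.
Qed.

(** * Laws determined by linear forms *)

(* The iterates of [x (3 - x^2) / 2] on [-1, 1] converge to the sign function,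
   so the sign of a function is a limit of polynomials in it. *)
Section sign_iteration.
Context {R : realType}.
Implicit Types x y : R.

Definition sgstep x := x * (3 - x ^+ 2) / 2.

Lemma sgstep_bound x : `|x| <= 1 -> `|sgstep x| <= 1.
Proof.
rewrite !ler_norml => /andP[a b].
have h1 : 0 <= 1 - sgstep x.
  have -> : 1 - sgstep x = (1 - x) ^+ 2 * ((2 + x) / 2) by rewrite /sgstep; field.
  by rewrite mulr_ge0 ?sqr_ge0//; lra.
have h2 : 0 <= 1 + sgstep x.
  have -> : 1 + sgstep x = (1 + x) ^+ 2 * ((2 - x) / 2) by rewrite /sgstep; field.
  by rewrite mulr_ge0 ?sqr_ge0//; lra.
by apply/andP; split; lra.
Qed.

Lemma iter_sgstep_bound x n : `|x| <= 1 -> `|iter n sgstep x| <= 1.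
Proof. by move=> x1; elim: n => //= n; exact: sgstep_bound. Qed.

(** One step multiplies [1 - y] by [(1 - y) (2 + y) / 2], which is at most [1 - x / 2] as long as
    [x <= y <= 1]; the convergence to 1 is geometric, at a rate given by the starting point. *)
Lemma iter_sgstep_gt0 x n : 0 < x <= 1 ->
  x <= iter n sgstep x <= 1 /\ 1 - iter n sgstep x <= (1 - x / 2) ^+ n.
Proof.
move=> /andP[x0 x1]; elim: n => [|n /=]; first by rewrite /= expr0; split; lra.
set y := iter n sgstep x => -[/andP[xy y1] yn].
have s1 : `|sgstep y| <= 1 by apply: sgstep_bound; rewrite ler_norml; lra.
split; first by rewrite (ler_normlW s1) andbT /sgstep; nra.
have -> : 1 - sgstep y = (1 - y) * ((1 - y) * (2 + y) / 2) by rewrite /sgstep; field.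
rewrite exprSr; apply: ler_pM => //; nra.
Qed.

Lemma cvg_sgstep x : `|x| <= 1 -> iter n sgstep x @[n --> \oo] --> Num.sg x.
Proof.
have pos y : 0 < y <= 1 -> iter n sgstep y @[n --> \oo] --> (1 : R).
  move=> y01; have /andP[y0 y1] := y01.
  apply/cvgrPdist_le => e e0.
  have : (1 - y / 2) ^+ n @[n --> \oo] --> 0.
    by apply: cvg_expr; rewrite ltr_norml; lra.
  move=> /cvgrPdist_le/(_ e e0); apply: filterS => n /=.
  have [/andP[_ h1] h2] := iter_sgstep_gt0 n y01.
  rewrite sub0r normrN => h; rewrite ger0_norm; last lra.
  by rewrite (le_trans h2)// (le_trans (ler_norm _)).
have neg y n : iter n sgstep (- y) = - iter n sgstep y.
  by elim: n => //= n ->; rewrite /sgstep; ring.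
move=> x1; have [x0|x0|x0] := ltgtP x 0.
- rewrite ltr0_sg//; rewrite -[x]opprK; under eq_fun do rewrite neg.
  by apply: cvgN; apply: pos; move: x1; rewrite ler_norml; lra.
- by rewrite gtr0_sg//; apply: pos; rewrite x0 (ler_normlW x1).
- rewrite x0 sgr0; under eq_fun => n.
    rewrite (_ : iter n _ _ = 0); first over.
    by elim: n => //= n ->; rewrite /sgstep mul0r mul0r.
  exact: cvg_cst.
Qed.
End sign_iteration.

Section trigonometric_closure.
Context {d} {S : measurableType d} {R : realType} (L : set (S -> R)).
Hypothesis L0 : L (fun=> 0).
Hypothesis LD : forall f g, L f -> L g -> L (fun x => f x + g x).
Hypothesis LZ : forall c f, L f -> L (fun x => c * f x).
Hypothesis mL : forall f, L f -> measurable_fun setT f.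

(** The phase [th] brings in the sines and makes the class stable under products. An identity
    between expectations can follow the four constructors, and yet bounded limits make the class
    rich enough to contain indicators. *)
Inductive trigcl : (S -> R) -> Prop :=
| trigcl_cos l th : L l -> trigcl (fun x => cos (l x + th))
| trigclD f g : trigcl f -> trigcl g -> trigcl (fun x => f x + g x)
| trigclZ c f : trigcl f -> trigcl (fun x => c * f x)
| trigcl_lim (f_ : nat -> S -> R) (f : S -> R) (M : R) :
    (forall n, trigcl (f_ n)) -> (forall n x, `|f_ n x| <= M) ->
    (forall x, f_ n x @[n --> \oo] --> f x) -> trigcl f.

Lemma trigcl_bm f : trigcl f -> bm f.
Proof.
elim=> {f}.
- by move=> l th Ll; apply: bm_cos; apply: measurable_funD => //; exact: mL.
- by move=> f g _ bf _ bg; exact: bmD.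
- by move=> c f _ bf; exact: bmZ.
- by move=> f_ f M _ bf fM fc; apply: (bm_lim _ fM fc) => n; exact: bm_meas.
Qed.

(** Two cosines are handled by the product-to-sum formula, because [L] is a vector space; the other
    constructors follow by induction on each factor, the boundedness of the fixed factor serving for
    the limits. *)
Lemma trigclM f g : trigcl f -> trigcl g -> trigcl (fun x => f x * g x).
Proof.
move=> cf; elim: cf g => {f}.
- move=> l th Ll g; elim=> {g}.
  + move=> l' th' Ll'.
    have -> : (fun x => cos (l x + th) * cos (l' x + th')) =
      (fun x => 2^-1 * (cos ((l x + l' x) + (th + th')) +
                        cos ((l x + (-1) * l' x) + (th - th')))).
      apply/funext => x.
      have -> : l x + l' x + (th + th') = (l x + th) + (l' x + th') by ring.
      have -> : l x + -1 * l' x + (th - th') = (l x + th) - (l' x + th') by ring.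
      by move: (_ + th) (_ + th') => a b; rewrite cosD cosB; field.
    apply: trigclZ; apply: trigclD.
      by apply: (trigcl_cos (l := fun x => l x + l' x)); exact: LD.
    apply: (trigcl_cos (l := fun x => l x + -1 * l' x)).
    by apply: LD => //; exact: LZ.
  + move=> f g _ hf _ hg; under eq_fun do rewrite mulrDr; exact: trigclD.
  + move=> c f _ hf; under eq_fun do rewrite mulrCA; exact: trigclZ.
  + move=> f_ f M _ hf fM fc.
    apply: (trigcl_lim hf (M := M)) => [n x|x]; last by apply: cvgMr; exact: fc.
    rewrite normrM -[M]mul1r ler_pM//; first by rewrite ler_norml cos_geN1 cos_le1.
- move=> f1 f2 _ h1 _ h2 g cg; under eq_fun do rewrite mulrDl.
  by apply: trigclD; [exact: h1|exact: h2].
- by move=> c f _ h g cg; under eq_fun do rewrite -mulrA; apply: trigclZ; exact: h.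
- move=> f_ f M _ hf fM fc g cg.
  have [_ [B gB]] := trigcl_bm cg.
  apply: (trigcl_lim (f_ := fun n x => f_ n x * g x) (M := M * B)).
  + by move=> n; exact: hf.
  + by move=> n x; rewrite normrM ler_pM.
  + by move=> x; apply: cvgMl; exact: fc.
Qed.

Lemma trigcl_cst c : trigcl (fun=> c).
Proof.
have := trigclZ c (trigcl_cos 0 L0).
by under eq_fun do rewrite addr0 cos0 mulr1.
Qed.

Lemma trigcl_sg f : trigcl f -> (forall x, `|f x| <= 1) ->
  trigcl (fun x => Num.sg (f x)).
Proof.
move=> cf f1.
apply: (trigcl_lim (f_ := fun n x => iter n sgstep (f x)) (M := 1)).
- elim=> //= n h.
  have -> : (fun x => sgstep (iter n sgstep (f x))) =
     (fun x => (3 / 2) * iter n sgstep (f x) + (- 2^-1) *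
      (iter n sgstep (f x) * (iter n sgstep (f x) * iter n sgstep (f x)))).
    by apply/funext => x; rewrite /sgstep; field.
  apply: trigclD; apply: trigclZ => //.
  by apply: trigclM => //; exact: trigclM.
- by move=> n x; exact: iter_sgstep_bound.
- by move=> x; exact: cvg_sgstep.
Qed.

(** For [n] larger than [|l x - c|] the angle [(l x - c) / n.+1] lies in []-1, 1[], inside []-pi,
    pi[], so its sine has the sign [s] of [l x - c]; and [(s + s^2) / 2] is 1 for [s = 1] and 0 for
    [s = 0] and [s = -1]. *)
Lemma trigcl_ray l (c : R) : L l -> trigcl \1_(l @^-1` [set y | c < y]).
Proof.
move=> Ll.
pose g n (x : S) : R := cos (n.+1%:R^-1 * l x + (- (n.+1%:R^-1 * c) - pi / 2)).
have gE n x : g n x = sin ((l x - c) / n.+1%:R).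
  rewrite /g -cosBpihalf; congr cos; ring.
have cg n : trigcl (g n) by apply: (trigcl_cos (l := fun x => n.+1%:R^-1 * l x)); exact: LZ.
have sg1 (y : R) : `|Num.sg y| <= 1.
  by case: sgrP => _; rewrite ?normr0 ?normr1 ?normrN1.
apply: (trigcl_lim (M := 1)
  (f_ := fun n x => 2^-1 * (Num.sg (g n x) + Num.sg (g n x) * Num.sg (g n x)))).
- move=> n; apply: trigclZ; have s1 : trigcl (fun x => Num.sg (g n x)).
    by apply: trigcl_sg => // x; rewrite gE ler_norml sin_geN1 sin_le1.
  by apply: trigclD => //; exact: trigclM.
- move=> n x.
  by case: sgrP => _; rewrite ?(mulr0, mul0r, addr0, normr0)// ler_norml; lra.
- move=> x; apply: cvg_near_cst.
  have [N Nl] : exists N : nat, `|l x - c| < N%:R.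
    by exists (Num.truncn `|l x - c|).+1; rewrite truncnS_gt.
  exists N => // n /= Nn; rewrite gE indicE.
  have nl : `|(l x - c) / n.+1%:R| < 1.
    rewrite normrM normfV [X in _ / X]ger0_norm// ltr_pdivrMr// mul1r.
    by rewrite (lt_le_trans Nl)// ler_nat (leq_trans Nn).
  have pi1 : 1 < pi :> R by rewrite (lt_le_trans _ (pi_ge2 R))// ltr1n.
  have n0 : 0 < n.+1%:R^-1 :> R by rewrite invr_gt0.
  have [lc|lc|lc] := ltgtP c (l x).
  + rewrite mem_set// gtr0_sg; first by rewrite /=; lra.
    apply: sin_gt0_pi; rewrite mulr_gt0 ?subr_gt0//=.
    exact: lt_trans (ltr_normlW nl) pi1.
  + rewrite memNset /=; last by apply/negP; rewrite -leNgt ltW.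
    rewrite -[_ / _]opprK sinN sgrN.
    rewrite gtr0_sg; first by rewrite /=; lra.
    apply: sin_gt0_pi; apply/andP; split.
      by rewrite oppr_gt0 pmulr_llt0// subr_lt0.
    by rewrite -normrN in nl; exact: lt_trans (ltr_normlW nl) pi1.
  + rewrite lc subrr mul0r sin0 sgr0 memNset /=; first lra.
    by apply/negP; rewrite ltxx.
Qed.

Lemma trigcl_sigma_algebra : sigma_algebra setT [set A | trigcl (\1_A : S -> R)].
Proof.
split => /=.
- by rewrite indic0; exact: trigcl_cst.
- move=> A cA; have := trigclD (trigcl_cst 1) (trigclZ (-1) cA).
  congr trigcl; apply/funext => x; rewrite !indicE in_setD in_setT /=.
  by case: (x \in A) => /=; lra.
- move=> F cF.
  (* Finite unions are written with complements and products, under which the class is stable;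
     pointwise they are eventually constant. *)
  pose g n (x : S) : R := 1 + -1 * \prod_(i < n) (1 + -1 * \1_(F i) x).
  have pE n (x : S) : \prod_(i < n) (1 + -1 * \1_(F i) x) =
      (x \notin \bigcup_(i < n) F i)%:R :> R.
    elim: n => [|n IH]; first by rewrite big_ord0 bigcup_mkord big_ord0 in_set0.
    rewrite big_ord_recr/= IH !bigcup_mkord big_ord_recr/= in_setU negb_or indicE.
    by case: (x \in F n); case: (x \in _) => /=; lra.
  apply: (trigcl_lim (f_ := g) (M := 1)).
  + move=> n; apply: trigclD; first exact: trigcl_cst.
    apply: trigclZ; elim: n => [|n IH].
      by under eq_fun do rewrite big_ord0; exact: trigcl_cst.
    under eq_fun do rewrite big_ord_recr/=; apply: trigclM => //.
    by apply: trigclD; [exact: trigcl_cst|exact: trigclZ].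
  + by move=> n x; rewrite /g pE ler_norml; case: (_ \notin _) => /=; lra.
  + move=> x; have [[i _ Fix]|nF] := pselect ((\bigcup_i F i) x).
      apply: cvg_near_cst; exists i.+1 => // n /= ni.
      rewrite /g pE indicE !mem_set/=; [lra|by exists i|by exists i].
    rewrite (_ : (fun n => g n x) = fun=> \1_(\bigcup_i F i) x); first exact: cvg_cst.
    apply/funext => n; rewrite /g pE indicE !memNset//=; first lra.
    by move=> [i /= _ Fix]; apply: nF; exists i.
Qed.

Lemma trigcl_preimage l (A : set R) : L l -> measurable A -> trigcl \1_(l @^-1` A).
Proof.
move=> Ll mA; have {mA} : <<s @RGenOInfty.G R >> A.
  suff : (@RGenOInfty.G R).-sigma.-measurable A by [].
  by rewrite -RGenOInfty.measurableE.
have sa : sigma_algebra setT [set A | trigcl (\1_(l @^-1` A) : S -> R)].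
  have [s0 sC sU] := trigcl_sigma_algebra; split => /=.
  - by rewrite preimage_set0.
  - by move=> B cB; rewrite setTD preimage_setC -setTD; exact: sC.
  - by move=> F cF; rewrite preimage_bigcup; exact: sU.
move: A; apply: (smallest_sub sa) => _ [x ->] /=.
rewrite (_ : _ @^-1` _ = l @^-1` [set y | x < y]); first exact: trigcl_ray.
by apply/seteqP; split => y /=; rewrite in_itv /= andbT.
Qed.

Lemma trigcl_gen A :
  <<s [set B | exists2 l, L l & exists2 C, measurable C & B = l @^-1` C] >> A ->
  trigcl \1_A.
Proof.
move: A; apply: (smallest_sub trigcl_sigma_algebra) => _ [l Ll [C mC ->]].
exact: trigcl_preimage.
Qed.

Hypothesis genL : forall A : set S, measurable A ->
  <<s [set B | exists2 l, L l & exists2 C, measurable C & B = l @^-1` C] >> A.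

(** The Cramer-Wold device together with the uniqueness of characteristic functions: equality on
    cosines passes to [trigcl] by induction, [trigcl] contains the indicators of the sigma-algebra
    generated by [L], and [genL] says that this is the whole sigma-algebra. *)
Lemma law_unique {d1 d2} {T1 : measurableType d1} {T2 : measurableType d2}
    (P1 : probability T1 R) (P2 : probability T2 R) (h1 : T1 -> S) (h2 : T2 -> S) :
  measurable_fun setT h1 -> measurable_fun setT h2 ->
  (forall l th, L l -> Ex P1 (fun x => cos (l (h1 x) + th)) =
                       Ex P2 (fun x => cos (l (h2 x) + th))) ->
  forall f, bm f -> Ex P1 (fun x => f (h1 x)) = Ex P2 (fun x => f (h2 x)).
Proof.
move=> m1 m2 e.
suff cl f : trigcl f -> Ex P1 (fun x => f (h1 x)) = Ex P2 (fun x => f (h2 x)).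
  apply: Ex_eq_law => // A mA; rewrite -!Ex_indicE.
  - by have /cl := trigcl_gen (genL mA) => h; congr (_ %:E).
  - by rewrite -[X in measurable X]setTI; exact: m2.
  - by rewrite -[X in measurable X]setTI; exact: m1.
elim=> {f}.
- by move=> l th Ll; exact: e.
- move=> f g cf ef cg eg; have bf := trigcl_bm cf; have bg := trigcl_bm cg.
  by rewrite !ExD ?ef ?eg//; exact: bm_comp.
- by move=> c f cf ef; have bf := trigcl_bm cf; rewrite !ExZ ?ef//; exact: bm_comp.
- move=> f_ f M cf ef fM fc.
  have c1 : Ex P1 (fun x => f_ n (h1 x)) @[n --> \oo] --> Ex P1 (fun x => f (h1 x)).
    apply: (@Ex_lim _ _ _ _ (fun n x => f_ n (h1 x)) _ M) => //.
    by move=> n; exact: (bm_meas (bm_comp (trigcl_bm (cf n)) m1)).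
  have c2 : Ex P2 (fun x => f_ n (h2 x)) @[n --> \oo] --> Ex P2 (fun x => f (h2 x)).
    apply: (@Ex_lim _ _ _ _ (fun n x => f_ n (h2 x)) _ M) => //.
    by move=> n; exact: (bm_meas (bm_comp (trigcl_bm (cf n)) m2)).
  rewrite -(cvg_lim _ c1)// -(cvg_lim _ c2)//.
  by under eq_fun do rewrite ef.
Qed.
End trigonometric_closure.

(** * The normal law *)

(* [normal_prob] is a measure on [measurableTypeR R]; transporting it along the
   identity gives a probability on the canonical measurable structure of [R]. *)
Definition idR {R : realType} : measurableTypeR R -> R := id.
Lemma measurable_idR {R : realType} : measurable_fun setT (@idR R).
Proof. by move=> _ A mA; rewrite setTI. Qed.
HB.instance Definition _ {R : realType} := @isMeasurableFun.Build _ _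
  (measurableTypeR R) R (@idR R) measurable_idR.

HB.lock Definition nrm {R : realType} (m s : R) : probability R R :=
  distribution (normal_prob m s) idR.

Lemma nrmE {R : realType} (m s : R) (A : set R) :
  nrm m s A = (\int[lebesgue_measure]_(x in A) (normal_pdf m s x)%:E)%E.
Proof. by rewrite nrm.unlock. Qed.

Section normal_law.
Context {R : realType}.
Implicit Types (m s t a b c th x y : R).
Notation leb := (@lebesgue_measure R).
Notation N1 := (nrm (0 : R) 1).

Lemma bm_normal_integrable m s (f : R -> R) : bm f ->
  leb.-integrable setT (fun x : measurableTypeR R => (f x * normal_pdf m s x)%:E).
Proof.
move=> [mf [M fM]].
have iM : leb.-integrable setT (fun x : measurableTypeR R => (M%:E * (normal_pdf m s x)%:E)%E).
  by apply: integrableZl => //; exact: integrable_normal_pdf.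
apply: (le_integrable _ _ _ iM) => //.
  apply/measurable_EFinP; apply: measurable_funM => //.
  exact: measurable_normal_pdf.
move=> x _ /=; rewrite lee_fin !normrM ler_wpM2r//.
by rewrite (le_trans (fM x))// ler_norm.
Qed.

Lemma Ex_normal m s (f : R -> R) : bm f ->
  Ex (nrm m s) f = \int[leb]_x (f x * normal_pdf m s x).
Proof.
move: f; apply: bm_ind.
- move=> A mA; rewrite Ex_indic// /Rintegral nrmE; congr fine.
  rewrite [LHS]integral_mkcond; apply: eq_integral => x _.
  rewrite patchE indicE; case: (x \in A); by rewrite ?mul1r ?mul0r.
- move=> f g bf bg ef eg; rewrite ExD// ef eg -RintegralD//.
  + by apply: eq_Rintegral => x _; rewrite mulrDl.
  + exact: bm_normal_integrable.
  + exact: bm_normal_integrable.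
- move=> c f bf ef; rewrite ExZ// ef -RintegralZl//.
  + by apply: eq_Rintegral => x _; rewrite mulrA.
  + exact: bm_normal_integrable.
- move=> f_ f M bf fM fc ef.
  have c1 : Ex (nrm m s) (f_ n) @[n --> \oo] --> Ex (nrm m s) f.
    by apply: (@Ex_lim _ _ _ _ f_ f M) => // n; exact: (bm_meas (bf n)).
  have bff : bm f by apply: (bm_lim _ fM fc) => n; exact: (bm_meas (bf n)).
  have c2 : \int[leb]_x (f_ n x * normal_pdf m s x) @[n --> \oo] -->
            \int[leb]_x (f x * normal_pdf m s x).
    suff /fine_cvgP[] : (\int[leb]_x (f_ n x * normal_pdf m s x)%:E)%E @[n --> \oo]
       --> (\int[leb]_x (f x * normal_pdf m s x))%:E by [].
    rewrite [X in X%:E]/Rintegral fineK; last first.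
      apply: (@integrable_fin_num _ (measurableTypeR R) _ leb setT) => //.
      exact: bm_normal_integrable.
    apply: (@dominated_cvg _ _ _ leb setT measurableT
      (fun n x => (f_ n x * normal_pdf m s x)%:E) _
      (fun x => (M%:E * (normal_pdf m s x)%:E)%E)) => //.
    + move=> n; apply/measurable_EFinP; apply: measurable_funM.
        exact: (bm_meas (bf n)).
      exact: measurable_normal_pdf.
    + move=> x _; apply: cvg_EFin; first exact: nearW.
      by apply: cvgMl; exact: fc.
    + by apply: integrableZl => //; exact: integrable_normal_pdf.
    + move=> n x _ /=; rewrite lee_fin normrM (ger0_norm (normal_pdf_ge0 _ _ _)).
      by rewrite ler_wpM2r// normal_pdf_ge0.
  rewrite -(cvg_lim _ c1)// -(cvg_lim _ c2)//.
  by under eq_fun do rewrite ef.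
Qed.

Lemma EFin_Ex_normal m s (f : R -> R) : bm f ->
  (Ex (nrm m s) f)%:E = (\int[leb]_x (f x * normal_pdf m s x)%:E)%E.
Proof.
move=> bf; rewrite Ex_normal// /Rintegral fineK//.
apply: (@integrable_fin_num _ (measurableTypeR R) _ leb setT) => //.
exact: bm_normal_integrable.
Qed.

Lemma normal_peakE s : normal_peak s = (`|s| * Num.sqrt (pi *+ 2))^-1.
Proof. by rewrite /normal_peak -mulrnAr sqrtrM ?sqr_ge0// sqrtr_sqr. Qed.

Lemma normal_pdf_affine m s x : 0 < s ->
  normal_pdf m s (m + s * x) * s = normal_pdf 0 1 x.
Proof.
move=> s0; rewrite !normal_pdfE ?gt_eqF// !normal_peakE normr1 mul1r (ger0_norm (ltW s0)).
have -> : normal_fun m s (m + s * x) = normal_fun 0 1 x.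
  by congr expR; field; rewrite gt_eqF.
by field; rewrite !gt_eqF// sqrtr_gt0 pmulrn_lgt0// pi_gt0.
Qed.

Lemma bm_cosl c th : bm (fun x => cos (c * x + th)).
Proof. by apply: bm_cos; apply: measurable_funD => //; exact: measurable_funM. Qed.

Lemma continuous_1Dcos c th : continuous (fun x => 1 + cos (c * x + th)).
Proof.
move=> x; apply: cvgD; first exact: cvg_cst.
apply: (@continuous_comp _ _ _ (fun x => c * x + th) (@cos R)); last exact: continuous_cos.
apply: cvgD; last exact: cvg_cst.
by apply: cvgM; [exact: cvg_cst|exact: cvg_id].
Qed.

Let cosD1_ge0 x : 0 <= 1 + cos x.
Proof. by rewrite -lerBlDl sub0r cos_geN1. Qed.

Lemma Ex_1D {d} {T : measurableType d} (P : probability T R) (f : T -> R) :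
  bm f -> Ex P (fun w => 1 + f w) = 1 + Ex P f.
Proof. by move=> bf; rewrite ExD ?Ex_cst//; exact: bm_cst. Qed.

Let derivF m s : (fun x : R => m + s * x)^`()%classic = cst s.
Proof.
apply/funext => x; rewrite derive1E.
have -> : (fun x => m + s * x) = cst m + s *: (id : R -> R^o) by [].
by rewrite deriveD// deriveZ// derive_cst derive_id add0r /GRing.scale/= mulr1.
Qed.

(** The substitution formula and Tonelli are applied to nonnegative integrands, hence the passage
    through [1 + cos], here and below. By [law_unique] the cosines suffice for the general affine
    rule [Ex_normal_affine]. *)
Lemma Ex_normal_cos m s c th : 0 < s ->
  Ex (nrm m s) (fun x => cos (c * x + th)) =
  Ex N1 (fun x => cos (c * (m + s * x) + th)).
Proof.
move=> s0.
have b1 : bm (fun x => cos (c * x + th)) by exact: bm_cosl.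
have b2 : bm (fun x => cos (c * (m + s * x) + th)).
  apply: bm_cos; apply: measurable_funD => //; apply: measurable_funM => //.
  by apply: measurable_funD => //; exact: measurable_funM.
suff : (Ex (nrm m s) (fun x => 1 + cos (c * x + th)))%:E =
       (Ex N1 (fun x => 1 + cos (c * (m + s * x) + th)))%:E.
  by rewrite (Ex_1D (nrm m s) b1) (Ex_1D N1 b2) => -[] /addrI.
have b3 : bm (fun x : R => 1 + cos (c * x + th)) by exact: (bmD (bm_cst 1)).
rewrite (EFin_Ex_normal _ _ b3) (EFin_Ex_normal _ _ (bmD (bm_cst 1) b2)).
have := @increasing_ge0_integration_by_substitutionT R (fun x => m + s * x)
   (fun x => (1 + cos (c * x + th)) * normal_pdf m s x).
rewrite derivF => ->//.
- apply: eq_integral => x _ /=; rewrite !fctE -mulrA.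
  by rewrite normal_pdf_affine.
- by move=> x y xy; rewrite ltrD2l ltr_pM2l.
- by move=> x; exact: cvg_cst.
- exact: is_cvg_cst.
- exact: is_cvg_cst.
- apply/cvgrNyPle => A; exists ((A - m) / s); split; first exact: num_real.
  move=> x xA; have {xA} : x < (A - m) / s by [].
  by rewrite ltr_pdivlMr// => h; lra.
- apply/cvgryPge => A; exists ((A - m) / s); split; first exact: num_real.
  move=> x xA; have {xA} : (A - m) / s < x by [].
  by rewrite ltr_pdivrMr// => h; lra.
- move=> x; apply: cvgM; first exact: continuous_1Dcos.
  by apply: continuous_normal_pdf; rewrite gt_eqF.
- by move=> x; rewrite mulr_ge0// normal_pdf_ge0.
Qed.

Lemma real_gen (A : set R) : measurable A ->
  <<s [set B | exists2 l, [set l | exists c, l = (fun x : R => c * x)] l &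
      exists2 C, measurable C & B = l @^-1` C] >> A.
Proof.
move=> mA; apply: sub_sigma_algebra; exists (fun x => 1 * x); first by exists 1.
by exists A => //; apply/seteqP; split => x /=; rewrite mul1r.
Qed.

Let linD (f g : R -> R) : (exists c, f = (fun x : R => c * x)) ->
  (exists c, g = (fun x : R => c * x)) -> exists c, (fun x => f x + g x) = (fun x : R => c * x).
Proof.
by move=> [a ->] [b ->]; exists (a + b); apply/funext => x; rewrite mulrDl.
Qed.

Let linZ c (f : R -> R) : (exists c, f = (fun x : R => c * x)) ->
  exists c', (fun x => c * f x) = (fun x : R => c' * x).
Proof. by move=> [a ->]; exists (c * a); apply/funext => x; rewrite mulrA. Qed.

Let lin0 : exists c, (fun=> 0) = (fun x : R => c * x).
Proof. by exists 0; apply/funext => x; rewrite mul0r. Qed.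

Let linm (f : R -> R) : (exists c, f = (fun x : R => c * x)) -> measurable_fun setT f.
Proof. by move=> [a ->]; exact: measurable_funM. Qed.

Lemma Ex_normal_affine m s (f : R -> R) : 0 < s -> bm f ->
  Ex (nrm m s) f = Ex N1 (fun x => f (m + s * x)).
Proof.
move=> s0; apply: (@law_unique _ _ R [set l | exists c, l = (fun x : R => c * x)]
  lin0 linD linZ linm real_gen _ _ _ _ (nrm m s) N1 id (fun x => m + s * x)).
- exact: measurable_id.
- by apply: measurable_funD => //; exact: measurable_funM.
- by move=> l th [c ->]; exact: Ex_normal_cos.
Qed.

Lemma Ex_N1_sym (f : R -> R) : bm f -> Ex N1 (fun x => f (- x)) = Ex N1 f.
Proof.
have key c th : Ex N1 (fun x => cos (c * - x + th)) = Ex N1 (fun x => cos (c * x + th)).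
  have b1 := bm_cosl c th.
  have b2 : bm (fun x => cos (c * - x + th)).
    by under eq_fun do rewrite mulrN -mulNr; exact: bm_cosl.
  suff : (Ex N1 (fun x => 1 + cos (c * - x + th)))%:E =
         (Ex N1 (fun x => 1 + cos (c * x + th)))%:E.
    by rewrite (Ex_1D N1 b2) (Ex_1D N1 b1) => -[] /addrI.
  have b3 : bm (fun x : R => 1 + cos (c * x + th)) by exact: (bmD (bm_cst 1)).
  have b4 : bm (fun x : R => 1 + cos (c * - x + th)) by exact: (bmD (bm_cst 1)).
  rewrite (EFin_Ex_normal _ _ b4) (EFin_Ex_normal _ _ b3).
  pose G x : \bar R := ((1 + cos (c * x + th)) * normal_pdf 0 1 x)%:E.
  have mG : measurable_fun setT G.
    apply/measurable_EFinP; apply: measurable_funM; first exact: (bm_meas b3).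
    exact: measurable_normal_pdf.
  have G0 x : (0 <= G x)%E by rewrite lee_fin; apply: mulr_ge0;
    [exact: cosD1_ge0|exact: normal_pdf_ge0].
  transitivity (\int[leb]_x G (- x)%R)%E.
    apply: eq_integral => x _; rewrite /G; congr (_ * _)%:E.
    by rewrite !normal_pdfE ?oner_neq0// /normal_fun !subr0 sqrrN.
  rewrite -(@ge0_integral_pushforward _ _ (measurableTypeR R) (measurableTypeR R) _
    (-%R : measurableTypeR R -> measurableTypeR R) _ leb setT G)//.
  by apply: eq_measure_integral => /= A mA _; exact: lebesgue_measureN.
apply: (@law_unique _ _ R [set l | exists c, l = (fun x : R => c * x)]
  lin0 linD linZ linm real_gen _ _ _ _ N1 N1 -%R id) => //.
by move=> l th [c ->]; exact: key.
Qed.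

(** The characteristic function of the standard normal law, real by symmetry. It is kept abstract
    and enters through the product rule [gcosM]. *)
Definition gcos t := Ex N1 (fun x => cos (t * x)).

Lemma gcosN t : gcos (- t) = gcos t.
Proof. by congr Ex; apply/funext => x; rewrite mulNr cosN. Qed.

Lemma gcos_abs t : gcos `|t| = gcos t.
Proof. by case: (ger0P t) => // _; exact: gcosN. Qed.

Lemma gcos0 : gcos 0 = 1.
Proof. by rewrite /gcos; under [X in Ex _ X]eq_fun do rewrite mul0r cos0; rewrite Ex_cst. Qed.

Lemma Ex_N1_cos t th : Ex N1 (fun x => cos (t * x + th)) = gcos t * cos th.
Proof.
have b1 := bm_cosl t th.
have b2 : bm (fun x => cos (t * - x + th)).
  by under eq_fun do rewrite mulrN -mulNr; exact: bm_cosl.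
have b0 : bm (fun x => cos (t * x)).
  by have := bm_cosl t 0; under eq_fun do rewrite addr0.
apply: (@mulfI _ 2) => //.
rewrite mulr_natl mulr2n -{1}(Ex_N1_sym b1) -ExD//.
transitivity (Ex N1 (fun x => 2 * cos th * cos (t * x))).
  by congr Ex; apply/funext => x; rewrite mulrN !cosD cosN sinN; ring.
by rewrite ExZ// /gcos; ring.
Qed.

(** For independent standard [x] and [y], the density of the pair [(x, a x + b y)] can be
    disintegrated along either coordinate; Tonelli applied to [1 + cos] of the second coordinate
    compares the two results. *)
Lemma gcosM_gt0 a b : 0 < b -> gcos a * gcos b = gcos (Num.sqrt (a ^+ 2 + b ^+ 2)).
Proof.
move=> b0; set r := Num.sqrt _.
have r2 : r ^+ 2 = a ^+ 2 + b ^+ 2.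
  by rewrite sqr_sqrtr// addr_ge0 ?sqr_ge0.
have r0 : 0 < r by rewrite sqrtr_gt0 ltr_wpDl ?sqr_ge0// exprn_gt0.
pose F (z : R * R) : R := cos (1 * z.2 + 0).
(* The two disintegrations of the joint density; the right-hand one comes from completing the square
   in [x]. *)
have pdfE x y : normal_pdf 0 1 x * normal_pdf (a * x) b y =
    normal_pdf 0 r y * normal_pdf (a * y / r ^+ 2) (b / r) x.
  rewrite !normal_pdfE ?gt_eqF ?divr_gt0// /normal_fun.
  rewrite mulrACA [RHS]mulrACA -!expRD; congr (_ * expR _).
    rewrite !normal_peakE -!invfM; congr (_^-1).
    rewrite normr1 (ger0_norm (ltW b0)) (ger0_norm (ltW r0)).
    by rewrite (ger0_norm (ltW (divr_gt0 b0 r0))); field; rewrite gt_eqF.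
  have -> : (b / r) ^+ 2 = b ^+ 2 / r ^+ 2 by rewrite expr_div_n.
  rewrite r2; field.
  by rewrite -r2 !gt_eqF// exprn_gt0.
pose G (z : measurableTypeR R * measurableTypeR R) : \bar R :=
  ((1 + cos (1 * z.2 + 0)) * (normal_pdf 0 1 z.1 * normal_pdf (a * z.1) b z.2))%:E.
have mG : measurable_fun setT G.
  apply/measurable_EFinP; apply: measurable_funM.
    apply: measurable_funD => //.
    exact: (measurableT_comp (bm_meas (bm_cosl 1 0)) measurable_snd).
  apply: measurable_funM.
    exact: (measurableT_comp (measurable_normal_pdf 0 1) measurable_fst).
  under eq_fun do rewrite normal_pdfE ?gt_eqF//.
  apply: measurable_funM => //; apply: measurableT_comp => //.
  apply: measurable_funM => //; apply: measurableT_comp => //.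
  apply: measurable_funX; apply: measurable_funB; first exact: measurable_snd.
  by apply: measurable_funM => //; exact: measurable_fst.
have G0 z : (0 <= G z)%E.
  by rewrite lee_fin !mulr_ge0// normal_pdf_ge0.
have := @fubini_tonelli _ _ (measurableTypeR R) (measurableTypeR R) R leb leb G mG G0;
  rewrite /fubini_F /fubini_G /= => fub.
have bc : bm (fun y => 1 + cos (1 * y + 0)).
  exact: (bmD (bm_cst 1) (bm_cosl 1 0)).
have mpos m s : measurable_fun setT (fun y => (normal_pdf m s y)%:E).
  by apply/measurable_EFinP; exact: measurable_normal_pdf.
have hE x : Ex (nrm (a * x) b) (fun w => cos (1 * w + 0)) = gcos b * cos (a * x + 0).
  rewrite (Ex_normal_cos _ _ _ b0) -(Ex_N1_cos b (a * x + 0)).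
  suff -> : (fun y => cos (1 * (a * x + b * y) + 0)) =
    (fun y => cos (b * y + (a * x + 0))) by [].
  by apply/funext => z; congr cos; ring.
have E1 : (\int[leb]_x \int[leb]_y G (x, y))%E = (1 + gcos a * gcos b)%:E.
  rewrite -[gcos a * gcos b]mulr1 -{1}cos0.
  transitivity (\int[leb]_x ((1 + gcos b * cos (a * x + 0)) * normal_pdf 0 1 x)%:E)%E.
    apply: eq_integral => x _.
    transitivity (\int[leb]_y ((normal_pdf 0 1 x)%:E *
        ((1 + cos (1 * y + 0)) * normal_pdf (a * x) b y)%:E))%E.
      by apply: eq_integral => y _; rewrite /G /= -EFinM; congr (_%:E); ring.
    rewrite (@ge0_integralZl_EFin _ (measurableTypeR R) R leb setT measurableT); first last.
    - exact: normal_pdf_ge0.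
    - apply/measurable_EFinP; apply: measurable_funM; last exact: measurable_normal_pdf.
      exact: (bm_meas bc).
    - by move=> y _; rewrite lee_fin; apply: mulr_ge0; [exact: cosD1_ge0|exact: normal_pdf_ge0].
    rewrite -EFin_Ex_normal; last exact: bc.
    rewrite Ex_1D; last exact: bm_cosl.
    by rewrite hE -EFinM mulrC.
  rewrite -EFin_Ex_normal; last first.
    exact: (bmD (bm_cst 1) (bmZ _ (bm_cosl a 0))).
  rewrite Ex_1D; last by apply: bmZ; exact: bm_cosl.
  rewrite ExZ; last exact: bm_cosl.
  by rewrite Ex_N1_cos cos0; congr (_%:E); ring.
have E2 : (\int[leb]_y \int[leb]_x G (x, y))%E = (1 + gcos r)%:E.
  transitivity (\int[leb]_y ((1 + cos (1 * y + 0)) * normal_pdf 0 r y)%:E)%E.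
    apply: eq_integral => y _.
    transitivity (\int[leb]_x (((1 + cos (1 * y + 0)) * normal_pdf 0 r y)%:E *
        (normal_pdf (a * y / r ^+ 2) (b / r) x)%:E))%E.
      by apply: eq_integral => x _; rewrite /G /= pdfE -EFinM; congr (_%:E); ring.
    rewrite (@ge0_integralZl_EFin _ (measurableTypeR R) R leb setT measurableT); first last.
    - by apply: mulr_ge0; [exact: cosD1_ge0|exact: normal_pdf_ge0].
    - exact: mpos.
    - by move=> x _; rewrite lee_fin normal_pdf_ge0.
    by rewrite integral_normal_pdf mule1.
  rewrite -EFin_Ex_normal; last exact: bc.
  rewrite Ex_1D; last exact: bm_cosl.
  rewrite (Ex_normal_cos _ _ _ r0) /gcos.
  suff -> : (fun x : R => cos (1 * (0 + r * x) + 0)) = (fun x => cos (r * x)) by [].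
  by apply/funext => z; congr cos; ring.
by move: fub; rewrite E1 E2 => -[]; exact: addrI.
Qed.

Lemma gcosM a b : gcos a * gcos b = gcos (Num.sqrt (a ^+ 2 + b ^+ 2)).
Proof.
have [->|b0] := eqVneq b 0.
  by rewrite gcos0 mulr1 expr0n addr0 sqrtr_sqr gcos_abs.
by rewrite -(gcos_abs b) gcosM_gt0 ?normr_gt0// real_normK// num_real.
Qed.

End normal_law.

(** * Scaling and moments of normal variables *)

Section gaussian_variables.
Context {R : realType}.
Implicit Types (s x y eta : R).
Notation leb := (@lebesgue_measure R).
Notation N1 := (nrm (0 : R) 1).

Lemma nrm_scale s (A : set R) : 0 < s -> measurable A ->
  nrm 0 s A = N1 ((fun x => s * x) @^-1` A).
Proof.
move=> s0 mA; have msx : measurable_fun setT (fun x : R => s * x).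
  exact: measurable_funM.
rewrite -Ex_indicE// -Ex_indicE; last by rewrite -[X in measurable X]setTI; exact: msx.
rewrite (Ex_normal_affine 0 s0 (bm_indic mA)); congr (_%:E); congr Ex.
by apply/funext => x; rewrite add0r.
Qed.

Lemma nrm_abs s (A : set R) : measurable A -> nrm 0 s A = nrm 0 `|s| A.
Proof.
move=> mA; rewrite !nrmE; apply: eq_integral => x _; congr (_%:E).
have [->|s0] := eqVneq s 0; first by rewrite normr0.
rewrite !normal_pdfE ?normr_eq0// /normal_peak /normal_fun.
by rewrite !real_normK// num_real.
Qed.

Lemma nrm_sym (A : set R) : measurable A -> N1 A = N1 (-%R @^-1` A).
Proof.
move=> mA.
rewrite -Ex_indicE// -Ex_indicE; last first.
  by rewrite -[X in measurable X]setTI; exact: oppr_measurable.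
by rewrite -(Ex_N1_sym (bm_indic mA)).
Qed.

Lemma gaussian_lawE {d} {W : measurableType d} (P : probability W R) (Y : W -> R) :
  centered_gaussian_law P Y ->
  exists2 s, 0 <= s & forall A : set R, measurable A ->
    P (Y @^-1` A) = N1 ((fun x => s * x) @^-1` A).
Proof.
move=> [s h]; exists `|s| => // A mA; rewrite h//; case: ifPn => [/eqP ->|s0].
  rewrite normr0 diracE.
  have [A0|A0] := pselect (A 0).
    rewrite mem_set// (_ : _ @^-1` _ = setT); last first.
      by apply/seteqP; split => x //= _; rewrite mul0r.
    by rewrite probability_setT.
  rewrite memNset// (_ : _ @^-1` _ = set0) ?measure0//.
  by apply/seteqP; split => x //=; rewrite mul0r.
rewrite -nrm_scale ?normr_gt0// -nrm_abs//.
by rewrite nrmE.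
Qed.

Section law_transfer.
Context {d} {W : measurableType d} (P : probability W R) (Y : W -> R).
Hypothesis mY : measurable_fun setT Y.
Variable s : R.
Hypothesis Ys : forall A : set R, measurable A ->
    P (Y @^-1` A) = N1 ((fun x => s * x) @^-1` A).

Let ms : measurable_fun setT (fun x : R => s * x).
Proof. exact: measurable_funM. Qed.

Lemma gaussian_Ex (f : R -> R) : bm f -> Ex P (fun w => f (Y w)) = Ex N1 (fun x => f (s * x)).
Proof. exact: Ex_eq_law. Qed.

Lemma gaussian_ge0_integral (f : R -> \bar R) : measurable_fun setT f ->
  (forall x, 0 <= f x)%E -> (\int[P]_w f (Y w) = \int[N1]_x f (s * x)%R)%E.
Proof.
move=> mf f0.
rewrite -(ge0_integral_pushforward mY P measurableT mf)//.
rewrite -(ge0_integral_pushforward ms N1 measurableT mf)//.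
by apply: eq_measure_integral => A mA _; exact: Ys.
Qed.

Lemma gaussian_integral (f : R -> R) : measurable_fun setT f ->
  P.-integrable setT (fun w => (f (Y w))%:E) ->
  N1.-integrable setT (fun x => (f (s * x)%R)%:E) ->
  (\int[P]_w (f (Y w))%:E = \int[N1]_x (f (s * x)%R)%:E)%E.
Proof.
move=> mf i1 i2; have mf' : measurable_fun setT (EFin \o f) by exact/measurable_EFinP.
rewrite -(integral_pushforward mY mf' i1 measurableT).
rewrite -(integral_pushforward ms mf' i2 measurableT).
by apply: eq_measure_integral => A mA _; exact: Ys.
Qed.
End law_transfer.

Lemma nrm_small_ball eta : 0 <= eta ->
  (N1 [set x : R | (`|x| <= eta)%R] <= (eta *+ 2 * normal_peak 1)%:E)%E.
Proof.
move=> eta0; rewrite nrmE.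
have -> : [set x : R | `|x| <= eta] = `[- eta, eta]%classic.
  by apply/seteqP; split => x /=; rewrite in_itv/= ler_norml.
apply: (@le_trans _ _ (\int[leb]_(x in `[(- eta)%R, eta]) (cst (normal_peak 1)%:E x))%E).
  apply: ge0_le_integral => //=.
  - by move=> x _; rewrite lee_fin normal_pdf_ge0.
  - by apply/measurable_EFinP/measurable_funTS; exact: measurable_normal_pdf.
  - by move=> x _; rewrite lee_fin normal_pdf_ub// oner_neq0.
rewrite integral_cst//= lebesgue_measure_itv/= lte_fin.
case: ifPn => [_|_]; last by rewrite mule0 lee_fin mulr_ge0 ?mulrn_wge0 ?normal_peak_ge0.
by rewrite opprK -mulr2n -EFinM mulrC.
Qed.

Definition normal_moment2 : \bar R := (\int[N1]_x (x ^+ 2)%:E)%E.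

(** The bound [x^2 <= 8 / 3 * expR (3 / 8 * x^2)] is used, where [3 / 8] is the difference of the
    coefficients [1 / 2] and [1 / 8] in the exponents of the centered normal densities of standard
    deviations 1 and 2; the integrand is dominated by a multiple of the second density. *)
Lemma Ex_N1_truncated_sqr (n : nat) :
  Ex N1 (fun x => Order.min (x ^+ 2) n%:R) <= 8 / 3 * (normal_peak 1 / normal_peak 2).
Proof.
have bf : bm (fun x : R => Order.min (x ^+ 2) n%:R).
  split; first by apply: measurable_minr => //; exact: measurable_funX.
  by exists n%:R => x; rewrite ger0_norm ?ge_min ?lexx ?orbT// le_min sqr_ge0 ler0n.
rewrite Ex_normal//.
have p2 : normal_peak 2 != 0 :> R by rewrite gt_eqF// normal_peak_gt0.
set C := _ * _.
have -> : C = \int[leb]_x (C * normal_pdf 0 2 x).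
  rewrite RintegralZl//; last exact: integrable_normal_pdf.
  by rewrite /Rintegral integral_normal_pdf mulr1.
apply: le_Rintegral => //.
- exact: bm_normal_integrable.
- have := integrable_normal_pdf 0 (2 : R).
  by move=> /(integrableZl measurableT C); under eq_fun do rewrite -EFinM.
move=> x _; rewrite !normal_pdfE ?oner_neq0// /normal_fun /C.
rewrite -[leRHS]mulrA [X in _ <= _ * X]mulrA divfK//.
rewrite [leRHS]mulrCA [leLHS]mulrCA ler_wpM2l ?normal_peak_ge0//.
rewrite !subr0 expr1n.
have h : x ^+ 2 * 3 / 8 <= expR (x ^+ 2 * 3 / 8).
  by rewrite (le_trans _ (expR_ge1Dx _))// ler_wpDl.
have -> : expR (- x ^+ 2 / (1 *+ 2)) = expR (- (x ^+ 2 * 3 / 8)) * expR (- x ^+ 2 / (2 ^+ 2 *+ 2)).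
  by rewrite -expRD; congr expR; field.
rewrite mulrA ler_wpM2r ?expR_ge0//.
apply: (@le_trans _ _ (x ^+ 2 * expR (- (x ^+ 2 * 3 / 8)))).
  by rewrite ler_wpM2r ?expR_ge0// ge_min lexx.
by rewrite expRN ler_pdivrMr ?expR_gt0//; lra.
Qed.

Lemma normal_moment2_fin : normal_moment2 \is a fin_num.
Proof.
rewrite ge0_fin_numE; last first.
  by apply: integral_ge0 => x _; rewrite lee_fin sqr_ge0.
have mg n : measurable_fun setT (fun x : R => (Order.min (x ^+ 2) n%:R)%:E).
  by apply/measurable_EFinP/measurable_minr => //; exact: measurable_funX.
rewrite /normal_moment2; have := @cvg_monotone_convergence _ _ _ N1 setT measurableT
  (fun n x => (Order.min (x ^+ 2) n%:R)%:E) mg.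
have -> // : (fun x : R => limn (fun n => (Order.min (x ^+ 2) n%:R)%:E)) =
   (fun x => (x ^+ 2)%:E).
  apply/funext => x; apply/cvg_lim => //; apply: cvg_EFin; first exact: nearW.
  apply: cvg_near_cst; exists (Num.truncn (x ^+ 2)).+1 => // n /= nx.
  apply/min_idPl; rewrite ltW// (lt_le_trans (truncnS_gt _))// ler_nat//.
move=> /(_ _ _)/cvg_lim <-//; last 2 first.
- by move=> n x _; rewrite lee_fin le_min sqr_ge0 ler0n.
- move=> x _ m n mn; rewrite lee_fin le_min !ge_min lexx/= ler_nat mn orbT//.
have bf n : bm (fun x : R => Order.min (x ^+ 2) n%:R).
  split; first by apply: measurable_minr => //; exact: measurable_funX.
  by exists n%:R => x; rewrite ger0_norm ?ge_min ?lexx ?orbT// le_min sqr_ge0 ler0n.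
apply: (@le_lt_trans _ _ (8 / 3 * (normal_peak 1 / normal_peak 2))%:E); last exact: ltry.
apply: lime_le.
  apply: ereal_nondecreasing_is_cvgn => m n mn.
  apply: ge0_le_integral => //.
  - by move=> x _; rewrite lee_fin le_min sqr_ge0 ler0n.
  - by move=> x _; rewrite lee_fin le_min !ge_min lexx/= ler_nat mn orbT.
by apply: nearW => n; rewrite -EFin_Ex// lee_fin Ex_N1_truncated_sqr.
Qed.

Lemma normal_moment2_gt0 : (0 < normal_moment2)%E.
Proof.
set B := fun eta : R => [set x : R | `|x| <= eta].
(* Chosen so that by [nrm_small_ball] the ball of radius [eta] has mass at most [1 / 2]; half of the
   mass then lies where [x^2 >= eta^2]. *)
pose eta : R := (4 * normal_peak 1)^-1.
have p1 : 0 < normal_peak 1 :> R by rewrite normal_peak_gt0// oner_neq0.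
have eta0 : 0 < eta by rewrite invr_gt0 mulr_gt0.
have mB : measurable (B eta).
  have -> : B eta = `[- eta, eta]%classic.
    by apply/seteqP; split => x; rewrite /B /= in_itv/= ler_norml.
  exact: measurable_itv.
have := nrm_small_ball (ltW eta0).
have -> : eta *+ 2 * normal_peak 1 = 2^-1 by rewrite /eta; field; rewrite gt_eqF.
move=> h.
have hC : ((2^-1)%:E <= N1 (~` (B eta)))%E.
  rewrite probability_setC// leeBrDr ?fin_num_measure//.
  apply: (le_trans (leeD2l _ h)).
  by rewrite -EFinD lee_fin; lra.
apply: (@lt_le_trans _ _ ((eta ^+ 2)%:E * N1 (~` (B eta)))%E).
  rewrite mule_gt0// ?lte_fin ?exprn_gt0//.
  by apply: lt_le_trans hC; rewrite lte_fin.
rewrite -(integral_cst N1 (measurableC mB)) /normal_moment2.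
apply: (@le_trans _ _ (\int[N1]_(x in ~` (B eta)) (x ^+ 2)%:E)%E).
  apply: ge0_le_integral => //=.
  - exact: measurableC.
  - by move=> x _; rewrite lee_fin sqr_ge0.
  - by apply/measurable_EFinP/measurable_funTS; exact: measurable_funX.
  - move=> x /= /negP; rewrite -ltNge => ex; rewrite lee_fin -(real_normK (num_real x)).
    by rewrite lerXn2r ?nnegrE// ltW.
apply: ge0_subset_integral => //=.
- exact: measurableC.
- by apply/measurable_EFinP; exact: measurable_funX.
- by move=> x _; rewrite lee_fin sqr_ge0.
Qed.

(* This variance is 1, a value that is never needed. *)
Definition gvar : R := fine normal_moment2.

Lemma gvar_gt0 : 0 < gvar.
Proof. by rewrite fine_gt0// normal_moment2_gt0 -ge0_fin_numE ?normal_moment2_fin// ltW// normal_moment2_gt0. Qed.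

Lemma normal_moment2E : normal_moment2 = gvar%:E.
Proof. by rewrite fineK// normal_moment2_fin. Qed.

Lemma N1_integrable_id : N1.-integrable setT (EFin : R -> \bar R).
Proof.
apply: (@le_integrable _ _ _ _ _ _ _ (fun x => (1 + x ^+ 2)%:E)) => //.
- move=> x _ /=; rewrite lee_fin (ger0_norm (addr_ge0 _ (sqr_ge0 _)))//.
  by rewrite -(real_normK (num_real x)); nra.
- apply/integrableP; split.
    by apply/measurable_EFinP; apply: measurable_funD => //; exact: measurable_funX.
  under eq_integral do rewrite gee0_abs ?lee_fin ?addr_ge0 ?sqr_ge0// EFinD.
  rewrite ge0_integralD//; last 2 first.
  - by move=> x _; rewrite lee_fin sqr_ge0.
  - by apply/measurable_EFinP; exact: measurable_funX.
  rewrite -/normal_moment2 normal_moment2E integral_cst// mul1e.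
  rewrite [X in (X + _)%E](_ : _ = 1%E); last exact: probability_setT.
  by rewrite -EFinD ltry.
Qed.

Lemma N1_mean0 : (\int[N1]_x x%:E = 0)%E.
Proof.
have i1 := N1_integrable_id.
have : (\int[N1]_x x%:E = \int[N1]_x (- x)%:E)%E.
  have iN : N1.-integrable setT ((EFin : R -> \bar R) \o -%R).
    by rewrite (_ : EFin \o -%R = -%E \o EFin)//; exact: integrableN.
  rewrite -(integral_pushforward (@oppr_measurable R setT) _ iN measurableT)//.
  by apply: eq_measure_integral => A mA _; exact: nrm_sym.
under [X in _ = X -> _]eq_integral do rewrite EFinN.
rewrite integralN//; last by apply: integrable_add_def.
have : (\int[N1]_x x%:E \is a fin_num)%E by exact: integrable_fin_num.
by case: (\int[N1]_x x%:E)%E => //= r _ [] rr; congr (_%:E); lra.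
Qed.

End gaussian_variables.

(** * Gaussian laws on path spaces *)

Section linear_forms.
Context {R : realType} {T : eqType}.
Implicit Types (s u : seq (R * T)) (x y : T -> R) (k : T -> T -> R).

Definition lin s x : R := \sum_(p <- s) p.1 * x p.2.

Definition lscale (c : R) s : seq (R * T) := [seq (c * p.1, p.2) | p <- s].

Lemma lin_cat s u x : lin (s ++ u) x = lin s x + lin u x.
Proof. exact: big_cat. Qed.

Lemma lin_scale c s x : lin (lscale c s) x = c * lin s x.
Proof. by rewrite /lin big_map mulr_sumr; apply: eq_bigr => p _; rewrite mulrA. Qed.

Lemma lin_comb s a x b y : lin s (fun t => a * x t + b * y t) = a * lin s x + b * lin s y.
Proof.
rewrite /lin !mulr_sumr -big_split/=; apply: eq_bigr => p _; ring.
Qed.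

Lemma linB s x y : lin s (fun t => x t - y t) = lin s x - lin s y.
Proof.
rewrite /lin -sumrB; apply: eq_bigr => p _; ring.
Qed.

Lemma lin1 c t x : lin [:: (c, t)] x = c * x t.
Proof. by rewrite /lin big_seq1. Qed.

Variable k : T -> T -> R.
Hypothesis kC : forall t t' : T, k t t' = k t' t.
Local Notation kin := (kinner k).

Lemma kin_catl s s' u : kin (s ++ s') u = kin s u + kin s' u.
Proof. by rewrite /kinner big_cat. Qed.

Lemma kin_scalel c s u : kin (lscale c s) u = c * kin s u.
Proof.
rewrite /kinner big_map mulr_sumr; apply: eq_bigr => p _.
by rewrite mulr_sumr; apply: eq_bigr => q _; rewrite !mulrA.
Qed.

Lemma kinC s u : kin s u = kin u s.
Proof.
rewrite /kinner exchange_big; apply: eq_bigr => p _; apply: eq_bigr => q _.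
by rewrite kC (mulrC q.1).
Qed.

Lemma kin_catr s u u' : kin s (u ++ u') = kin s u + kin s u'.
Proof. by rewrite kinC kin_catl !(kinC _ s). Qed.

Lemma kin_scaler c s u : kin s (lscale c u) = c * kin s u.
Proof. by rewrite kinC kin_scalel kinC. Qed.

(** The reproducing property, for finite combinations of kernel functions. *)
Lemma lin_kcomb s u : lin s (kcomb k u) = kin u s.
Proof.
rewrite kinC /kinner; apply: eq_bigr => p _.
rewrite /kcomb mulr_sumr; apply: eq_bigr => q _.
by rewrite (kC q.2) !mulrA.
Qed.

Lemma kin_lincomb a s b u :
  kin (lscale a s ++ lscale b u) (lscale a s ++ lscale b u) =
  a ^+ 2 * kin s s + 2 * a * b * kin s u + b ^+ 2 * kin u u.
Proof.
by rewrite kin_catl !kin_catr !kin_scalel !kin_scaler (kinC u s); ring.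
Qed.

End linear_forms.

Section path_space.
Context {R : realType} {T : Type}.

Definition fcyl : set (set (T -> R)) :=
  [set C | exists t, exists2 A : set R, measurable A & C = [set f | A (f t)]].

(** This is the product sigma-algebra, in which a supremum over the uncountable cube is in general
    not measurable; this is why the events below bear on countably many evaluations. *)
Definition paths := g_sigma_algebraType fcyl.

Lemma measurable_eval t : measurable_fun [set: paths] (fun x : paths => x t).
Proof.
move=> _ A mA; rewrite setTI; apply: sub_sigma_algebra.
by exists t, A.
Qed.

Lemma measurable_paths {d} {W : measurableType d} (f : W -> paths) :
  (forall t, measurable_fun setT (fun w => f w t)) -> measurable_fun setT f.
Proof.
move=> mf; apply: (@measurability _ _ W paths setT f fcyl) => //.
by move=> _ [_ [t [A mA ->]] <-]; exact: (mf t measurableT A mA).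
Qed.

Definition mixp (a : R) (x : paths) (b : R) (y : paths) : paths :=
  fun t => a * x t + b * y t.

Lemma measurable_mixp {d} {W : measurableType d} (f g : W -> paths) (a b : R) :
  measurable_fun setT f -> measurable_fun setT g ->
  measurable_fun setT (fun w => mixp a (f w) b (g w)).
Proof.
move=> mf mg; apply: measurable_paths => t.
apply: measurable_funD; apply: measurable_funM => //.
  exact: (measurableT_comp (measurable_eval t) mf).
exact: (measurableT_comp (measurable_eval t) mg).
Qed.

End path_space.
Arguments paths : clear implicits.

Section path_lin.
Context {R : realType} {T : eqType}.

Lemma measurable_lin (s : seq (R * T)) :
  measurable_fun setT (fun x : paths R T => lin s x).
Proof.
rewrite /lin; elim: s => [|p s IH].
  rewrite (_ : (fun _ => _) = cst 0)//.
  by apply/funext => x; rewrite big_nil.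
rewrite (_ : (fun _ => _) = (fun x => p.1 * x p.2 + \sum_(q <- s) q.1 * x q.2)).
  apply: measurable_funD => //.
  by apply: measurable_funM => //; exact: measurable_eval.
by apply/funext => x; rewrite big_cons.
Qed.

(* [gcos] is taken at the standard deviation divided by that of the standard
   normal law, so that [q] is a variance even though [gvar] is kept abstract. *)
Definition gcf (q : R) : R := gcos (Num.sqrt (q / gvar)).

Lemma gcfD (a b : R) : 0 <= a -> 0 <= b -> gcf a * gcf b = gcf (a + b).
Proof.
have v0 := @gvar_gt0 R.
move=> a0 b0; rewrite /gcf gcosM !sqr_sqrtr ?divr_ge0 ?(ltW v0)//.
by rewrite -mulrDl.
Qed.

(** Centered Gaussian laws are encoded by the characteristic functions of their finite linear forms,
    [kinner k s s] being the variance of the form [s]. By symmetry these functions are real, so that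
    the phase factors out as [cos th]. *)
Definition gaussian_on (mu : probability (paths R T) R) (k : T -> T -> R) : Prop :=
  [/\ forall s t, k s t = k t s, forall s, 0 <= kinner k s s
    & forall s th, Ex mu (fun x => cos (lin s x + th)) = gcf (kinner k s s) * cos th].

End path_lin.

Section gaussian_process_law.
Context {R : realType} {d : measure_display} {W : measurableType d}.
Variable P : probability W R.
Notation N1 := (nrm (0 : R) 1).

Definition path_of {T : eqType} (Z : T -> {RV P >-> R}) (w : W) : paths R T :=
  realization Z w.

Lemma measurable_path_of {T : eqType} (Z : T -> {RV P >-> R}) :
  measurable_fun setT (path_of Z).
Proof. by apply: measurable_paths => t; exact: measurable_funP. Qed.

HB.instance Definition _ {T : eqType} (Z : T -> {RV P >-> R}) :=
  @isMeasurableFun.Build _ _ W (paths R T) (path_of Z) (measurable_path_of Z).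

Definition law {T : eqType} (Z : T -> {RV P >-> R}) : probability (paths R T) R :=
  distribution P (path_of Z).

Variables (T : eqType) (Z : T -> {RV P >-> R}).
Hypothesis gZ : centered_gaussian_process Z.

Lemma Ex_law (f : paths R T -> R) : bm f -> Ex (law Z) f = Ex P (fun w => f (path_of Z w)).
Proof.
by move=> bf; rewrite -(@Ex_eq_law _ _ _ _ _ _ _ P (law Z) (path_of Z) id).
Qed.

Lemma gaussian_lin s : centered_gaussian_law P (fun w => lin s (path_of Z w)).
Proof.
case: s => [|p s].
  exists 0 => A mA; rewrite eqxx diracE (_ : (fun w => _) = cst 0); last first.
    by apply/funext => w; rewrite /lin big_nil.
  rewrite preimage_cst; case: ifPn => A0; rewrite ?(negbTE A0) ?A0 ?measure0//.
  by rewrite probability_setT.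
have := gZ (fun i : 'I_(size (p :: s)) => (tnth (in_tuple (p :: s)) i).2)
           (fun i => (tnth (in_tuple (p :: s)) i).1).
rewrite (_ : (fun w => lin _ _) = (fun w => \sum_(i < size (p :: s))
  (tnth (in_tuple (p :: s)) i).1 * Z (tnth (in_tuple (p :: s)) i).2 w))//.
by apply/funext => w; rewrite /lin big_tnth.
Qed.

Lemma mlinZ s : measurable_fun setT (fun w => lin s (path_of Z w)).
Proof. exact: (measurableT_comp (measurable_lin s) (measurable_path_of Z)). Qed.

Lemma gaussian_lin_moments s : exists2 a : R, 0 <= a &
  (forall A : set R, measurable A ->
     P ((fun w => lin s (path_of Z w)) @^-1` A) = N1 ((fun x => a * x) @^-1` A)) /\
  (\int[P]_w ((lin s (path_of Z w)) ^+ 2)%:E = (a ^+ 2 * gvar)%:E)%E.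
Proof.
have [a a0 h] := gaussian_lawE (gaussian_lin s); exists a => //; split => //.
rewrite (gaussian_ge0_integral (mlinZ s) h (f := fun x => (x ^+ 2)%:E)).
- under eq_integral do rewrite exprMn EFinM.
  rewrite ge0_integralZl_EFin ?sqr_ge0//.
  + by rewrite -/normal_moment2 normal_moment2E.
  + by move=> x _; rewrite lee_fin sqr_ge0.
  + by apply/measurable_EFinP; exact: measurable_funX.
- by apply/measurable_EFinP; exact: measurable_funX.
- by move=> x; rewrite lee_fin sqr_ge0.
Qed.

Let Z1 t w : lin [:: (1, t)] (path_of Z w) = Z t w.
Proof. by rewrite lin1 mul1r. Qed.

Lemma sqr_integrable s : P.-integrable setT (fun w => ((lin s (path_of Z w)) ^+ 2)%:E).
Proof.
apply/integrableP; split.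
  by apply/measurable_EFinP; apply: measurable_funX; exact: mlinZ.
have [a a0 [_ h]] := gaussian_lin_moments s.
by under eq_integral do rewrite gee0_abs ?lee_fin ?sqr_ge0//; rewrite h ltry.
Qed.

Lemma mul_integrable s u :
  P.-integrable setT (fun w => (lin s (path_of Z w) * lin u (path_of Z w))%:E).
Proof.
apply: (@le_integrable _ _ _ _ _ _ _
  (fun w => (lin s (path_of Z w) ^+ 2)%:E + (lin u (path_of Z w) ^+ 2)%:E)%E) => //.
- apply/measurable_EFinP; apply: measurable_funM; exact: mlinZ.
- move=> w _ /=; rewrite lee_fin (ger0_norm (addr_ge0 (sqr_ge0 _) (sqr_ge0 _))).
  by rewrite ler_norml; set a := lin _ _; set b := lin _ _; nra.
- by apply: integrableD => //; exact: sqr_integrable.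
Qed.

Lemma lin_integrable s : P.-integrable setT (fun w => (lin s (path_of Z w))%:E).
Proof.
apply: (@le_integrable _ _ _ _ _ _ _
  (fun w => 1%:E + (lin s (path_of Z w) ^+ 2)%:E)%E) => //.
- by apply/measurable_EFinP; exact: mlinZ.
- move=> w _ /=; rewrite lee_fin (ger0_norm (addr_ge0 ler01 (sqr_ge0 _))).
  by rewrite ler_norml; set a := lin _ _; nra.
- apply: integrableD => //; last exact: sqr_integrable.
  exact: finite_measure_integrable_cst.
Qed.

Lemma lin_mean0 s : (\int[P]_w (lin s (path_of Z w))%:E = 0)%E.
Proof.
have [a a0 [h _]] := gaussian_lin_moments s.
have iax : N1.-integrable setT (fun x => (a * x)%:E).
  by under eq_fun do rewrite EFinM; apply: integrableZl => //; exact: N1_integrable_id.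
rewrite (gaussian_integral (mlinZ s) h (f := id))//; last exact: lin_integrable.
under eq_integral do rewrite EFinM.
by rewrite integralZl//; [rewrite N1_mean0 mule0|exact: N1_integrable_id].
Qed.

Lemma cov_kernelE t u : cov_kernel Z t u = \int[P]_w (Z t w * Z u w).
Proof.
rewrite /cov_kernel covariance.unlock expectation.unlock /Rintegral.
have h v : (\int[P]_w (Z v w)%:E = 0)%E.
  by rewrite -[RHS](lin_mean0 [:: (1, v)]); apply: eq_integral => w _; rewrite Z1.
rewrite !h /=; congr fine; apply: eq_integral => w _.
by rewrite /= /cst/= !fctE /= !subr0.
Qed.

Lemma kinner_cov s u : kinner (cov_kernel Z) s u =
  \int[P]_w (lin s (path_of Z w) * lin u (path_of Z w)).
Proof.
rewrite /kinner; elim: s => [|p s IH].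
  rewrite big_nil (_ : (fun w => _) = cst 0) ?Rintegral_cst ?mul0r//.
  by apply/funext => w; rewrite /lin big_nil mul0r.
rewrite big_cons IH.
transitivity (\int[P]_w (lin [:: p] (path_of Z w) * lin u (path_of Z w)) +
   \int[P]_w (lin s (path_of Z w) * lin u (path_of Z w))); last first.
  rewrite -RintegralD//; [|exact: mul_integrable..].
  by apply: eq_Rintegral => w _; rewrite (lin_cat [:: p] s) mulrDl.
congr (_ + _); elim: u {IH} => [|q u IH].
  rewrite big_nil (_ : (fun w => _) = cst 0) ?Rintegral_cst ?mul0r//.
  by apply/funext => w; rewrite /lin big_nil mulr0.
rewrite big_cons IH.
transitivity (\int[P]_w (lin [:: p] (path_of Z w) * lin [:: q] (path_of Z w)) +
   \int[P]_w (lin [:: p] (path_of Z w) * lin u (path_of Z w))); last first.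
  rewrite -RintegralD//; [|exact: mul_integrable..].
  by apply: eq_Rintegral => w _; rewrite (lin_cat [:: q] u) mulrDr.
congr (_ + _); rewrite cov_kernelE -RintegralZl//.
  by apply: eq_Rintegral => w _; rewrite /lin !big_seq1 /path_of /realization; ring.
have := mul_integrable [:: (1, p.2)] [:: (1, q.2)].
by under eq_fun do rewrite !Z1.
Qed.

(** By [gaussian_lin_moments] a form is distributed as [a] times a standard normal variable and has
    second moment [a ^+ 2 * gvar]; dividing by [gvar] inside [gcf] recovers [a]. *)
Lemma gaussian_process_law : gaussian_on (law Z) (cov_kernel Z).
Proof.
split.
- move=> s t; rewrite !cov_kernelE; apply: eq_Rintegral => w _.
  by rewrite mulrC.
- move=> s; rewrite kinner_cov; apply: Rintegral_ge0 => w _.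
  by rewrite -expr2 sqr_ge0.
- move=> s th.
  rewrite Ex_law; last first.
    by apply: bm_cos; apply: measurable_funD => //; exact: measurable_lin.
  have [a a0 [h m2]] := gaussian_lin_moments s.
  have bf : bm (fun x : R => cos (x + th)).
    by apply: bm_cos; exact: measurable_funD.
  rewrite (gaussian_Ex (mlinZ s) h bf) Ex_N1_cos; congr (gcos _ * _).
  rewrite kinner_cov /Rintegral.
  under eq_integral do rewrite -expr2.
  rewrite m2 /= mulfK ?sqrtr_sqr ?ger0_norm//.
  by rewrite gt_eqF// gvar_gt0.
Qed.

(** A centered normal variable of scale [a] stays in [[-eta, eta]] with probability at most
    [2 eta / a] times the peak of the standard density, so a probability of [1 / 2] forces [a] to be
    of order [eta]. This turns smallness in probability of a form into a bound on its kernel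
    norm. *)
Lemma lin_small_variance s (eta : R) : 0 <= eta ->
  ((2^-1)%:E <= P [set w | (`|lin s (path_of Z w)| <= eta)%R])%E ->
  kinner (cov_kernel Z) s s <= (4 * eta * normal_peak 1) ^+ 2 * gvar.
Proof.
move=> eta0; have [a a0 [h m2]] := gaussian_lin_moments s.
have -> : kinner (cov_kernel Z) s s = a ^+ 2 * gvar.
  rewrite kinner_cov /Rintegral; under eq_integral do rewrite -expr2.
  by rewrite m2.
have mB : measurable [set x : R | `|x| <= eta].
  have -> : [set x : R | `|x| <= eta] = `[- eta, eta]%classic.
    by apply/seteqP; split => x /=; rewrite in_itv/= ler_norml.
  exact: measurable_itv.
have -> : P [set w | `|lin s (path_of Z w)| <= eta] = N1 [set x : R | `|a * x| <= eta].
  exact: (h _ mB).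
move: a0; rewrite le_eqVlt => /predU1P[<- _|a0].
  by rewrite expr0n mul0r mulr_ge0 ?sqr_ge0// ltW// gvar_gt0.
have -> : [set x : R | `|a * x| <= eta] = [set x | `|x| <= eta / a].
  apply/seteqP; split => x /=; rewrite normrM (ger0_norm (ltW a0)) ler_pdivlMr// mulrC//.
have e0 : 0 <= eta / a by rewrite divr_ge0// ltW.
move=> /le_trans/(_ (nrm_small_ball e0)); rewrite lee_fin => h2.
apply: ler_wpM2r; first exact: (ltW gvar_gt0).
have a1 : 0 <= a by rewrite ltW.
rewrite ler_sqr ?nnegrE ?mulr_ge0 ?normal_peak_ge0//.
have : 2^-1 * a <= (eta / a) *+ 2 * normal_peak 1 * a by rewrite ler_wpM2r// ltW.
have -> : (eta / a) *+ 2 * normal_peak 1 * a = eta *+ 2 * normal_peak 1.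
  by field; rewrite gt_eqF.
lra.
Qed.

End gaussian_process_law.

Lemma gaussian_process_comp {R : realType} {d} {W : measurableType d}
    (P : probability W R) {T U : Type} (Z : T -> {RV P >-> R}) (f : U -> T) :
  centered_gaussian_process Z -> centered_gaussian_process (fun u => Z (f u)).
Proof. by move=> gZ n t a; exact: gZ. Qed.

Section gaussian_laws.
Context {R : realType} {T : eqType} (mu : probability (paths R T) R) (k : T -> T -> R).
Hypothesis gmu : gaussian_on mu k.
Local Notation Om := (paths R T).
Local Notation kin := (kinner k).
Notation N1 := (nrm (0 : R) 1).

Let kC : forall t t', k t t' = k t' t. Proof. by case: gmu. Qed.
Let k_ge0 : forall s, 0 <= kin s s. Proof. by case: gmu. Qed.
Let Ecos : forall s th, Ex mu (fun x => cos (lin s x + th)) = gcf (kin s s) * cos th.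
Proof. by case: gmu. Qed.

Definition scalep (a : R) (x : Om) : Om := fun t => a * x t.

Lemma measurable_scalep a : measurable_fun setT (scalep a).
Proof.
apply: measurable_paths => t; apply: measurable_funM => //; exact: measurable_eval.
Qed.

Lemma mixp0 a x b y : b = 0 -> mixp a x b y = scalep a x.
Proof. by move=> ->; apply/funext => t; rewrite /mixp mul0r addr0. Qed.

Lemma lin_scalep s a (x : Om) : lin s (scalep a x) = a * lin s x.
Proof. by rewrite /lin mulr_sumr; apply: eq_bigr => p _; rewrite mulrCA. Qed.

Lemma lin_mixp s a (x : Om) b (y : Om) : lin s (mixp a x b y) = a * lin s x + b * lin s y.
Proof. exact: lin_comb. Qed.

Lemma paths_gen (A : set Om) : measurable A ->
  <<s [set B | exists2 l, [set l | exists s, l = lin s] l &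
      exists2 C, measurable C & B = l @^-1` C] >> A.
Proof.
set G := [set B | _] => mA.
(* Evaluation at [t] is the form [[:: (1, t)]], so the identity is measurable from the sigma-algebra
   generated by the forms to the path space. *)
have mid : measurable_fun [set: g_sigma_algebraType G] (fun x => x : Om).
  apply: measurable_paths => t _ B mB; rewrite setTI; apply: sub_sigma_algebra.
  exists (lin [:: (1, t)]); first by exists [:: (1, t)].
  by exists B => //; apply/seteqP; split => x /=; rewrite lin1 mul1r.
by have := mid measurableT A mA; rewrite setTI.
Qed.

Lemma gaussian_unique {d} {W : measurableType d} (P : probability W R) (h : W -> Om) :
  measurable_fun setT h ->
  (forall s th, Ex P (fun w => cos (lin s (h w) + th)) = gcf (kin s s) * cos th) ->
  forall f, bm f -> Ex P (fun w => f (h w)) = Ex mu f.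
Proof.
move=> mh hE f bf.
apply: (@law_unique _ Om R [set l | exists s, l = lin s] _ _ _ _ paths_gen
  _ _ _ _ P mu h id) => //.
- by exists [::]; apply/funext => x; rewrite /lin big_nil.
- by move=> _ _ [s ->] [s' ->]; exists (s ++ s'); apply/funext => x; rewrite lin_cat.
- by move=> c _ [s ->]; exists (lscale c s); apply/funext => x; rewrite lin_scale.
- by move=> _ [s ->]; exact: measurable_lin.
- by move=> _ th [s ->]; rewrite hE Ecos.
Qed.

Lemma Ex_opp (f : Om -> R) : bm f -> Ex mu (fun x => f (scalep (-1) x)) = Ex mu f.
Proof.
apply: gaussian_unique; first exact: measurable_scalep.
move=> s th; rewrite -[X in cos X]opprK cosN -Ecos; congr Ex; apply/funext => x.
by rewrite lin_scalep -cosN; congr cos; ring.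
Qed.

Lemma paths2_gen (A : set (Om * Om)) : measurable A ->
  <<s [set B | exists2 l, [set l | exists s s', l = (fun z : Om * Om => lin s z.1 + lin s' z.2)] l &
      exists2 C, measurable C & B = l @^-1` C] >> A.
Proof.
set G := [set B | _] => mA.
have mid : measurable_fun [set: g_sigma_algebraType G] (fun x => (x.1 : Om, x.2 : Om)).
  apply: measurable_fun_pair; apply: measurable_paths => t _ B mB; rewrite setTI;
      apply: sub_sigma_algebra.
  - exists (fun z : Om * Om => lin [:: (1, t)] z.1 + lin [::] z.2).
      by exists [:: (1, t)], [::].
    exists B => //; apply/seteqP; split => x /=;
      by rewrite lin1 mul1r /lin big_nil addr0.
  - exists (fun z : Om * Om => lin [::] z.1 + lin [:: (1, t)] z.2).
      by exists [::], [:: (1, t)].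
    exists B => //; apply/seteqP; split => x /=;
      by rewrite lin1 mul1r /lin big_nil add0r.
have := mid measurableT A mA; rewrite setTI.
by congr (<<s G >> _); apply/seteqP; split => -[].
Qed.

Lemma measurable_mix2 (a b : R) : measurable_fun setT (fun z : Om * Om => mixp a z.1 b z.2).
Proof. by apply: measurable_mixp. Qed.

(** Checked on characteristic functions: the variances of the two rotated forms add up to
    [c ^+ 2 + s ^+ 2] times the original sum, because their cross terms cancel. Conditioning
    arguments on Gaussian pairs become changes of variables of this kind. *)
Lemma Ex_rotation (c s : R) (F : Om * Om -> R) : c ^+ 2 + s ^+ 2 = 1 -> bm F ->
  Ex mu (fun x => Ex mu (fun y => F (mixp c x s y, mixp (- s) x c y))) =
  Ex mu (fun x => Ex mu (fun y => F (x, y))).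
Proof.
move=> cs bF.
pose h (z : Om * Om) : Om * Om := (mixp c z.1 s z.2, mixp (- s) z.1 c z.2).
have mh : measurable_fun setT h by apply: measurable_fun_pair; exact: measurable_mix2.
rewrite -(Ex_fubini mu mu bF) -(Ex_fubini mu mu (bm_comp bF mh)).
have bl s1 s2 th : bm (fun z : Om * Om => cos (lin s1 z.1 + lin s2 z.2 + th)).
  apply: bm_cos; apply: measurable_funD => //; apply: measurable_funD.
    exact: (measurableT_comp (measurable_lin s1) measurable_fst).
  exact: (measurableT_comp (measurable_lin s2) measurable_snd).
have e2 s1 s2 th : Ex (mu \x mu)%E (fun z => cos (lin s1 z.1 + lin s2 z.2 + th)) =
    gcf (kin s1 s1 + kin s2 s2) * cos th.
  rewrite (Ex_fubini mu mu (bl s1 s2 th)) -gcfD// -mulrA.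
  transitivity (Ex mu (fun x => gcf (kin s2 s2) * cos (lin s1 x + th))).
    congr Ex; apply/funext => x; rewrite -Ecos; congr Ex; apply/funext => y /=.
    by congr cos; ring.
  rewrite ExZ; last by apply: bm_cos; apply: measurable_funD => //; exact: measurable_lin.
  by rewrite Ecos; ring.
apply: (@law_unique _ _ R [set l | exists s s', l = (fun z : Om * Om => lin s z.1 + lin s' z.2)]
  _ _ _ _ paths2_gen _ _ _ _ (mu \x mu)%E (mu \x mu)%E h id) => //.
- by exists [::], [::]; apply/funext => x; rewrite /lin !big_nil addr0.
- move=> _ _ [s1 [s2 ->]] [s3 [s4 ->]]; exists (s1 ++ s3), (s2 ++ s4).
  by apply/funext => x; rewrite !lin_cat; ring.
- move=> e _ [s1 [s2 ->]]; exists (lscale e s1), (lscale e s2).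
  by apply/funext => x; rewrite !lin_scale mulrDr.
- move=> _ [s1 [s2 ->]]; apply: measurable_funD.
    exact: (measurableT_comp (measurable_lin s1) measurable_fst).
  exact: (measurableT_comp (measurable_lin s2) measurable_snd).
- move=> _ th [s1 [s2 ->]]; rewrite e2.
  transitivity (Ex (mu \x mu)%E (fun z =>
     cos (lin (lscale c s1 ++ lscale (- s) s2) z.1 +
          lin (lscale s s1 ++ lscale c s2) z.2 + th))).
    congr Ex; apply/funext => z; rewrite !lin_cat !lin_scale !lin_mixp.
    by congr cos; ring.
  rewrite e2 !kin_lincomb//; congr (gcf _ * _).
  transitivity ((c ^+ 2 + s ^+ 2) * (kin s1 s1 + kin s2 s2)); first ring.
  by rewrite cs mul1r.
Qed.

(** Rotate by the angle of cosine [a / r] and sine [b / r]: only the first rotated coordinate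
    remains and the other is integrated out. If [r = 0], both sides are the value of [f] at the zero
    path. *)
Lemma Ex_mix (a b : R) (f : Om -> R) : bm f ->
  Ex mu (fun x => Ex mu (fun y => f (mixp a x b y))) =
  Ex mu (fun x => f (scalep (Num.sqrt (a ^+ 2 + b ^+ 2)) x)).
Proof.
move=> bf; set r := Num.sqrt _.
have r2 : r ^+ 2 = a ^+ 2 + b ^+ 2 by rewrite sqr_sqrtr// addr_ge0 ?sqr_ge0.
have [r0|r0] := eqVneq r 0.
  move: r2; rewrite r0 expr0n => /esym/eqP; rewrite paddr_eq0 ?sqr_ge0//.
  rewrite !sqrf_eq0 => /andP[/eqP -> /eqP ->].
  congr Ex; apply/funext => x; rewrite -[RHS](Ex_cst mu); congr Ex; apply/funext => y.
  by rewrite mixp0.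
have bF : bm (fun z : Om * Om => f (scalep r z.1)).
  apply: (bm_comp bf); exact: (measurableT_comp (measurable_scalep r) measurable_fst).
have cs : (a / r) ^+ 2 + (b / r) ^+ 2 = 1.
  by rewrite !expr_div_n -mulrDl -r2 divff// sqrf_eq0.
have /= := Ex_rotation cs bF.
have -> : (fun x => Ex mu (fun=> f (scalep r x))) = (fun x => f (scalep r x)).
  by apply/funext => x; rewrite Ex_cst.
move=> <-; congr Ex; apply/funext => x; congr Ex; apply/funext => y; congr f.
by apply/funext => t; rewrite /scalep /mixp; field.
Qed.

Lemma Ex_diff (c : R) (f : Om -> R) : c ^+ 2 *+ 2 = 1 -> bm f ->
  Ex mu (fun x => Ex mu (fun y => f (mixp c x (- c) y))) = Ex mu f.
Proof.
move=> c2 bf; rewrite Ex_mix// sqrrN -mulr2n c2 sqrtr1; congr Ex.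
by apply/funext => x; congr f; apply/funext => t; rewrite /scalep mul1r.
Qed.

Let bm_indic_comp {d} {W : measurableType d} (A : set Om) (h : W -> Om) :
  measurable A -> measurable_fun setT h -> bm (fun w => \1_A (h w) : R).
Proof. by move=> mA; exact: (bm_comp (bm_indic mA)). Qed.

Let ind1 {U : Type} (A : set U) x : A x -> \1_A x = 1 :> R.
Proof. by move=> Ax; rewrite indicE mem_set. Qed.

Let ind0 {U : Type} (A : set U) x : ~ A x -> \1_A x = 0 :> R.
Proof. by move=> Ax; rewrite indicE memNset. Qed.

(** For independent [x] and [y] of law [mu], [(x - y) / sqrt 2] again has law [mu], so a set
    containing these differences for all pairs in [E] has at least the mass of [E] squared. Mass
    around an unknown centre becomes mass around the origin. *)
Lemma gaussian_diff_lb (c : R) (E A : set Om) : c ^+ 2 *+ 2 = 1 ->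
  measurable E -> measurable A ->
  (forall x y, E x -> E y -> A (mixp c x (- c) y)) ->
  (Ex mu \1_E) ^+ 2 <= Ex mu \1_A.
Proof.
move=> c2 mE mA EA.
have bE : bm (\1_E : Om -> R) by exact: bm_indic.
rewrite -(Ex_diff c2 (bm_indic mA)) expr2 -ExZ//.
have bp : bm (fun z : Om * Om => \1_E z.1 * \1_E z.2 : R).
  by apply: bmM; [exact: (bm_indic_comp mE measurable_fst)|exact: (bm_indic_comp mE measurable_snd)].
have ba : bm (fun z : Om * Om => \1_A (mixp c z.1 (- c) z.2) : R).
  exact: (bm_indic_comp mA (measurable_mix2 _ _)).
rewrite [leLHS](_ : _ = Ex mu (fun x => Ex mu (fun y => \1_E x * \1_E y))); last first.
  by congr Ex; apply/funext => x; rewrite ExZ// mulrC.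
apply: le_Ex; [exact: (bm_Ex mu bp)|exact: (bm_Ex mu ba)|move=> x].
apply: le_Ex; [exact: (bm_pair1 x bp)|exact: (bm_pair1 x ba)|move=> y].
have [Ex0|Ex0] := pselect (E x); last by rewrite (ind0 Ex0) mul0r.
have [Ey0|Ey0] := pselect (E y); last by rewrite (ind0 Ey0) mulr0.
by rewrite (ind1 Ex0) (ind1 Ey0) mulr1 ind1//; exact: EA.
Qed.

Lemma sqr_Ex_le {d} {W : measurableType d} (P : probability W R) (f : W -> R) :
  bm f -> (Ex P f) ^+ 2 <= Ex P (fun w => f w ^+ 2).
Proof.
move=> bf; set m := Ex P f.
have b1 : bm (fun w => f w ^+ 2 - (2 * m) * f w).
  by apply: bmB; [exact: bmX|exact: bmZ].
have : 0 <= Ex P (fun w => f w ^+ 2 - 2 * m * f w + m ^+ 2).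
  by apply: Ex_ge0 => w; have := sqr_ge0 (f w - m); rewrite sqrrB; lra.
rewrite ExD//; last exact: bm_cst.
by rewrite ExB ?Ex_cst ?ExZ -/m//; [lra|exact: bmX|exact: bmZ].
Qed.

(* With [X = (U - V) / sqrt 2] and [Y = (U + V) / sqrt 2], conditionally on [V]
   two independent copies of [U] compatible with [X \in A] and [Y \in B] differ
   by an element that is small for both [A] and [B]. *)
Lemma gaussian_correlation_lb (A B C : set Om) :
  measurable A -> measurable B -> measurable C ->
  (forall x y x' y', A x -> A y -> B x' -> B y' ->
     (forall t, x t - y t = x' t - y' t) -> C (mixp 1 x (-1) y)) ->
  (Ex mu \1_A * Ex mu \1_B) ^+ 2 <= Ex mu \1_C.
Proof.
move=> mA mB mC AB.
pose c : R := (Num.sqrt 2)^-1.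
have c2 : c ^+ 2 *+ 2 = 1 by rewrite exprVn sqr_sqrtr// -mulr_natr mulVf.
have cc : c ^+ 2 + (- c) ^+ 2 = 1 by rewrite sqrrN -mulr2n.
have bA : bm (\1_A : Om -> R) by exact: bm_indic.
have bB : bm (\1_B : Om -> R) by exact: bm_indic.
have bp : bm (fun z : Om * Om => \1_A z.1 * \1_B z.2 : R).
  by apply: bmM; [exact: (bm_indic_comp mA measurable_fst)|exact: (bm_indic_comp mB measurable_snd)].
pose H (z : Om * Om) : R := \1_A (mixp c z.1 (- c) z.2) * \1_B (mixp c z.1 c z.2).
have bH : bm H.
  by apply: bmM; [exact: (bm_indic_comp mA (measurable_mix2 _ _))|exact: (bm_indic_comp mB (measurable_mix2 _ _))].
have -> : Ex mu \1_A * Ex mu \1_B = Ex mu (fun v => Ex mu (fun u => H (u, v))).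
  rewrite -(Ex_swap mu mu bH).
  have /= := Ex_rotation cc bp; rewrite opprK => ->.
  rewrite mulrC -ExZ//; congr Ex; apply/funext => x.
  by rewrite ExZ// mulrC.
have bHs : bm (fun z : Om * Om => H (z.2, z.1)).
  by apply: (bm_comp bH); exact: measurable_fun_pair.
apply: (le_trans (sqr_Ex_le _ (bm_Ex mu bHs))).
rewrite -(Ex_diff c2 (bm_indic mC)).
apply: Ex_le_cst; first exact: (bmX 2 (bm_Ex mu bHs)).
move=> v /=; have bv : bm (fun u => H (u, v)) by exact: (bm_pair2 v bH).
rewrite expr2 -ExZ//.
have bvv : bm (fun z : Om * Om => H (z.1, v) * H (z.2, v)).
  by apply: bmM; [exact: (bm_comp bv)|exact: (bm_comp bv)].
have bc : bm (fun z : Om * Om => \1_C (mixp c z.1 (- c) z.2) : R).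
  exact: (bm_indic_comp mC (measurable_mix2 _ _)).
rewrite [leLHS](_ : _ = Ex mu (fun x => Ex mu (fun y => H (x, v) * H (y, v)))); last first.
  by congr Ex; apply/funext => x; rewrite ExZ// mulrC.
apply: le_Ex; [exact: (bm_Ex mu bvv)|exact: (bm_Ex mu bc)|move=> x].
apply: le_Ex; [exact: (bm_pair1 x bvv)|exact: (bm_pair1 x bc)|move=> y].
rewrite /H /=.
have [a1|a1] := pselect (A (mixp c x (- c) v)); last by rewrite (ind0 a1) !mul0r.
have [a2|a2] := pselect (A (mixp c y (- c) v)); last by rewrite (ind0 a2) mul0r mulr0.
have [a3|a3] := pselect (B (mixp c x c v)); last by rewrite (ind0 a3) mulr0 mul0r.
have [a4|a4] := pselect (B (mixp c y c v)); last by rewrite (ind0 a4) !mulr0.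
rewrite (ind1 a1) (ind1 a2) (ind1 a3) (ind1 a4) !mulr1 ind1//.
have -> : mixp c x (- c) y = mixp 1 (mixp c x (- c) v) (-1) (mixp c y (- c) v).
  by apply/funext => t; rewrite /mixp; ring.
by apply: (AB _ _ _ _ a1 a2 a3 a4) => t; rewrite /mixp; ring.
Qed.

Section cameron_martin.
Variable u : seq (R * T).
Let g := kcomb k u.
Let q := kin u u.

Definition shiftp (f : T -> R) (x : Om) : Om := fun t => x t - f t.

Lemma measurable_shiftp f : measurable_fun setT (shiftp f).
Proof.
apply: measurable_paths => t; apply: measurable_funB => //; exact: measurable_eval.
Qed.

Let kcomb0 : q = 0 -> forall t, g t = 0.
Proof.
move=> q0 t.
have gE : kin u [:: (1, t)] = g t.
  by rewrite -(lin_kcomb kC) lin1 mul1r.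
have h (c : R) : 0 <= 2 * c * g t + k t t.
  have := k_ge0 (lscale c u ++ lscale 1 [:: (1, t)]).
  rewrite kin_lincomb// -/q q0 gE mulr0 add0r mulr1 expr1n mul1r.
  by rewrite [kin [:: _] _](_ : _ = k t t)// /kinner !big_seq1/= !mul1r.
apply/eqP/negP => /negP g0.
(* The value of [c] for which the nonnegative expression would equal [-1]. *)
have := h (- (k t t + 1) / (2 * g t)).
have -> : 2 * (- (k t t + 1) / (2 * g t)) * g t = - (k t t + 1) by field.
lra.
Qed.

(** The path splits into a normal coordinate along [g] and an independent remainder, and the shift
    by [g] translates that coordinate by [a]. The coordinate enters through an even function [psi],
    so the translations by [a] and by [-a] can be averaged; the two translated densities sum to at
    least [2 * expR (- (a ^+ 2 / 2))] times the centered one because [cosh >= 1]. *)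
Lemma cameron_martin (A : set Om) : measurable A ->
  (forall x, A x -> A (scalep (-1) x)) ->
  expR (- (q * gvar / 2)) * Ex mu \1_A <= Ex mu (fun x => \1_A (shiftp g x)).
Proof.
move=> mA As.
have v0 := @gvar_gt0 R.
have [q0|q0] := eqVneq q 0.
  rewrite q0 !mul0r oppr0 expR0 mul1r le_eqVlt; apply/orP; left; apply/eqP.
  congr Ex; apply/funext => x; congr (\1_A _).
  by apply/funext => t; rewrite /shiftp kcomb0// subr0.
have qp : 0 < q by rewrite lt_def q0 k_ge0.
(* The factor [gvar] compensates for the variance of [N1]: if [z] has law [N1], the covariance of
   [(g / a) z] at two points is the product of the values of [g] divided by [q]. *)
pose a := Num.sqrt (q * gvar).
have a2 : a ^+ 2 = q * gvar by rewrite sqr_sqrtr// mulr_ge0 ?ltW.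
have a0 : 0 < a by rewrite sqrtr_gt0 mulr_gt0.
(* The term [p.2 t - (g t / q) * lin u p.2] is the part of the path that is uncorrelated with the
   form [u]; the removed component along [g] is replaced by an independent normal one. *)
pose h (p : R * Om) : Om := fun t => (g t / a) * p.1 + (p.2 t - (g t / q) * lin u p.2).
have mh : measurable_fun setT h.
  apply: measurable_paths => t; apply: measurable_funD.
    by apply: measurable_funM => //; exact: measurable_fst.
  apply: measurable_funB.
    exact: (measurableT_comp (measurable_eval t) measurable_snd).
  apply: measurable_funM => //.
  exact: (measurableT_comp (measurable_lin u) measurable_snd).
have hlin s p : lin s (h p) = (lin s g / a) * p.1 +
    lin (s ++ lscale (- (lin s g / q)) u) p.2.
  have -> : h p = (fun t => (p.1 / a - lin u p.2 / q) * g t + 1 * p.2 t).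
    by apply/funext => t; rewrite /h; ring.
  by rewrite lin_comb lin_cat lin_scale; ring.
have hlaw f : bm f -> Ex N1 (fun z => Ex mu (fun x => f (h (z, x)))) = Ex mu f.
  move=> bf; rewrite -(Ex_fubini N1 mu (bm_comp bf mh)).
  apply: gaussian_unique => // s th.
  pose al := lin s g / a; pose s' := s ++ lscale (- (lin s g / q)) u.
  have hl : (fun p : R * Om => cos (lin s (h p) + th)) =
      (fun p : R * Om => cos (lin s' p.2 + (al * p.1 + th))).
    by apply/funext => p; rewrite hlin -/al -/s'; congr cos; ring.
  rewrite hl Ex_fubini; last first.
    apply: bm_cos; apply: measurable_funD.
      exact: (measurableT_comp (measurable_lin s') measurable_snd).
    by apply: measurable_funD => //; apply: measurable_funM => //; exact: measurable_fst.
  transitivity (Ex N1 (fun z => gcf (kin s' s') * cos (al * z + th))).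
    by congr Ex; apply/funext => z; rewrite -Ecos.
  rewrite ExZ; last exact: bm_cosl.
  rewrite Ex_N1_cos mulrA; congr (_ * _).
  have -> : gcos al = gcf (al ^+ 2 * gvar).
    by rewrite /gcf mulfK ?gt_eqF// sqrtr_sqr gcos_abs.
  rewrite (gcfD (k_ge0 s') (mulr_ge0 (sqr_ge0 al) (ltW v0))); congr gcf.
  have lg : lin s g = kin s u by rewrite lin_kcomb// kinC.
  rewrite /s' kin_catl !kin_catr// !kin_scalel !kin_scaler// (kinC kC u s) -/q.
  rewrite /al lg expr_div_n a2; field.
  by rewrite q0 gt_eqF.
pose psi z := Ex mu (fun x => \1_A (h (z, x)) : R).
have bAh : bm (fun p : R * Om => \1_A (h p) : R) by exact: (bm_indic_comp mA mh).
have bpsi : bm psi by exact: (bm_Ex mu bAh).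
have psiN z : psi (- z) = psi z.
  rewrite /psi -[RHS]Ex_opp; last exact: (bm_pair1 z bAh).
  congr Ex; apply/funext => x.
  have -> : h (z, scalep (-1) x) = scalep (-1) (h (- z, x)).
    by apply/funext => t; rewrite /h /= /scalep lin_scalep; ring.
  have iff : A (h (- z, x)) <-> A (scalep (-1) (h (- z, x))).
    split; first exact: As.
    move=> /As; congr A; apply/funext => t; rewrite /scalep; ring.
  by rewrite !indicE; congr ((_ : bool)%:R); apply/idP/idP => /set_mem/iff/mem_set.
have psi0 z : 0 <= psi z by exact: Ex_ge0.
have EA : Ex mu \1_A = Ex N1 psi by rewrite -hlaw//; exact: bm_indic.
have Es : Ex mu (fun x => \1_A (shiftp g x)) = Ex N1 (fun z => psi (- a + 1 * z)).
  rewrite -hlaw; last exact: (bm_indic_comp mA (measurable_shiftp g)).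
  congr Ex; apply/funext => z; congr Ex; apply/funext => x; congr (\1_A _).
  apply/funext => t; rewrite /shiftp /h /=; field.
  by rewrite q0 gt_eqF.
have Es2 : Ex N1 (fun z => psi (- a + 1 * z)) = Ex N1 (fun z => psi (a + 1 * z)).
  rewrite -[LHS]Ex_N1_sym; last first.
    by apply: (bm_comp bpsi); apply: measurable_funD => //; exact: measurable_funM.
  by congr Ex; apply/funext => z; rewrite -psiN; congr psi; ring.
have key : expR (- (q * gvar / 2)) * Ex N1 psi *+ 2 <=
    Ex N1 (fun z => psi (- a + 1 * z)) + Ex N1 (fun z => psi (a + 1 * z)).
  rewrite -!(Ex_normal_affine _ ltr01 bpsi) !(Ex_normal _ _ bpsi).
  rewrite -RintegralD//; [|exact: bm_normal_integrable..].
  rewrite -mulr_natl mulrA -RintegralZl//; last exact: bm_normal_integrable.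
  apply: le_Rintegral => //.
  - exact: (integrableZl measurableT _ (bm_normal_integrable 0 1 bpsi)).
  - exact: (integrableD measurableT (bm_normal_integrable (- a) 1 bpsi)
                                    (bm_normal_integrable a 1 bpsi)).
  move=> y _; rewrite !normal_pdfE ?oner_neq0// /normal_fun.
  have eE (m : R) : expR (- (y - m) ^+ 2 / (1 ^+ 2 *+ 2)) =
      expR (- (y - 0) ^+ 2 / (1 ^+ 2 *+ 2)) * (expR (- (m ^+ 2 / 2)) * expR (m * y)).
    by rewrite -!expRD; congr expR; field.
  have e2 : 2 <= expR (- a * y) + expR (a * y).
    by have := expR_ge1Dx (- a * y); have := expR_ge1Dx (a * y); lra.
  rewrite (eE a) (eE (- a)) sqrrN -a2 -subr_ge0.
  set Y := expR (- (y - 0) ^+ 2 / _); set V := expR (- (a ^+ 2 / 2)).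
  rewrite [leRHS](_ : _ = psi y * normal_peak 1 * Y * V *
      (expR (- a * y) + expR (a * y) - 2)); last by ring.
  by rewrite !mulr_ge0 ?expR_ge0 ?normal_peak_ge0 ?psi0 ?subr_ge0.
by have := key; rewrite -Es2 -mulr2n lerMn2r/= EA Es.
Qed.
End cameron_martin.

End gaussian_laws.

(** * Sieves for Gaussian laws *)

Section reverse_hypercontractivity.
Context {R : realType} {T : eqType} (mu : probability (paths R T) R) (k : T -> T -> R).
Hypothesis gmu : gaussian_on mu k.
Local Notation Om := (paths R T).

(** The step for a single component, which is either shared by [F] and [G] or resampled. Jensen for
    [m G + l F] is combined with [(p - m^2) (r - l^2) >= 0] and [2 m l c <= c^2 + (m l)^2]. *)
Lemma Ex_sqr_sqr {d} {W : measurableType d} (P : probability W R) (F G : W -> R) :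
  bm F -> bm G ->
  (Ex P F) ^+ 2 * (Ex P G) ^+ 2 <=
  (Ex P (fun w => F w ^+ 2 * G w ^+ 2) +
   Ex P (fun w => F w ^+ 2) * Ex P (fun w => G w ^+ 2)) / 2.
Proof.
move=> bF bG; set m := Ex P F; set l := Ex P G.
set p := Ex P (fun w => F w ^+ 2); set r := Ex P (fun w => G w ^+ 2).
have pm : m ^+ 2 <= p by exact: sqr_Ex_le.
have rl : l ^+ 2 <= r by exact: sqr_Ex_le.
pose c := Ex P (fun w => F w * G w).
have hc : c ^+ 2 <= Ex P (fun w => F w ^+ 2 * G w ^+ 2).
  under [X in _ <= Ex P X]eq_fun do rewrite -exprMn.
  by apply: sqr_Ex_le; exact: bmM.
have hv : (2 * m * l) ^+ 2 <= m ^+ 2 * r + 2 * m * l * c + l ^+ 2 * p.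
  have bl : bm (fun w => m * G w + l * F w) by apply: bmD; exact: bmZ.
  have := sqr_Ex_le P bl.
  rewrite ExD ?ExZ//; [|exact: bmZ|exact: bmZ].
  rewrite -/m -/l (_ : m * l + l * m = 2 * m * l); last by ring.
  move=> /le_trans; apply.
  have -> : (fun w => (m * G w + l * F w) ^+ 2) = (fun w =>
      (m ^+ 2 * G w ^+ 2 + 2 * m * l * (F w * G w)) + l ^+ 2 * F w ^+ 2).
    by apply/funext => w; ring.
  have b1 : bm (fun w => m ^+ 2 * G w ^+ 2) by apply: bmZ; exact: bmX.
  have b2 : bm (fun w => 2 * m * l * (F w * G w)) by apply: bmZ; exact: bmM.
  have b3 : bm (fun w => l ^+ 2 * F w ^+ 2) by apply: bmZ; exact: bmX.
  rewrite ExD//; last exact: bmD.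
  rewrite ExD// !ExZ//; [exact: bmX|exact: bmM|exact: bmX].
have := mulr_ge0 (_ : 0 <= p - m ^+ 2) (_ : 0 <= r - l ^+ 2).
rewrite !subr_ge0 => /(_ pm rl).
have := sqr_ge0 (c - m * l).
by rewrite ler_pdivlMr// sqrrB => h1 h2; move: hv hc; rewrite !exprMn; nra.
Qed.

Variables (D A : set Om).
Hypotheses (mD : measurable D) (mA : measurable A).

Definition noised (S : set Om) (q : R) (s : Om) : R :=
  Ex mu (fun u => \1_S (mixp 1 s (Num.sqrt q) u)).

Lemma bm_noised S q : measurable S -> bm (noised S q).
Proof.
move=> mS; apply: (@bm_Ex _ _ _ _ _ mu (fun p : Om * Om => \1_S (mixp 1 p.1 (Num.sqrt q) p.2))).
by apply: (bm_comp (bm_indic mS)); exact: measurable_mixp.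
Qed.

Lemma noisedD S q a s : measurable S -> 0 <= q -> 0 <= a ->
  Ex mu (fun y => noised S q (mixp 1 s (Num.sqrt a) y)) = noised S (q + a) s.
Proof.
move=> mS q0 a0; rewrite /noised.
have bf : bm (fun z : Om => \1_S (mixp 1 s 1 z) : R).
  apply: (bm_comp (bm_indic mS)).
  by apply: measurable_mixp; [exact: measurable_cst|exact: measurable_id].
have := Ex_mix gmu (Num.sqrt a) (Num.sqrt q) bf.
rewrite !sqr_sqrtr// (addrC a) => h.
transitivity (Ex mu (fun x => Ex mu (fun y => \1_S (mixp 1 s 1 (mixp (Num.sqrt a) x (Num.sqrt q) y))))).
  congr Ex; apply/funext => y; congr Ex; apply/funext => u; congr (\1_S _).
  by apply/funext => t; rewrite /mixp; ring.
rewrite h; congr Ex; apply/funext => u; congr (\1_S _).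
by apply/funext => t; rewrite /mixp /scalep; ring.
Qed.

(* Joint law of two points sharing a component of variance [r] and having
   independent components of variance [q]. *)
Definition coupled (r q : R) (s t : Om) : R :=
  Ex mu (fun x => noised D q (mixp 1 s (Num.sqrt r) x) *
                  noised A q (mixp 1 t (Num.sqrt r) x)).

Let mix3 {d} {W : measurableType d} (f g : W -> Om) (a : R) S q : measurable S ->
  measurable_fun setT f -> measurable_fun setT g ->
  bm (fun w => noised S q (mixp 1 (f w) a (g w))).
Proof. by move=> mS mf mg; apply: (bm_comp (bm_noised q mS)); exact: measurable_mixp. Qed.

Lemma bm_coupled r q : bm (fun p : Om * Om => coupled r q p.1 p.2).
Proof.
apply: (@bm_Ex _ _ _ _ _ mu (fun z : (Om * Om) * Om =>
  noised D q (mixp 1 z.1.1 (Num.sqrt r) z.2) *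
  noised A q (mixp 1 z.1.2 (Num.sqrt r) z.2))).
have m1 : measurable_fun setT (fun z : (Om * Om) * Om => z.1.1).
  exact: (measurableT_comp measurable_fst measurable_fst).
have m2 : measurable_fun setT (fun z : (Om * Om) * Om => z.1.2).
  exact: (measurableT_comp measurable_snd measurable_fst).
by apply: bmM; apply: mix3.
Qed.

Lemma coupled_common r q a s t : 0 <= r -> 0 <= a ->
  Ex mu (fun y => coupled r q (mixp 1 s (Num.sqrt a) y) (mixp 1 t (Num.sqrt a) y)) =
  coupled (r + a) q s t.
Proof.
move=> r0 a0.
pose J z := noised D q (mixp 1 s 1 z) * noised A q (mixp 1 t 1 z).
have bJ : bm J by apply: bmM; apply: mix3 => //; exact: measurable_cst.
have := Ex_mix gmu (Num.sqrt a) (Num.sqrt r) bJ.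
rewrite !sqr_sqrtr// (addrC a) => h.
transitivity (Ex mu (fun x => Ex mu (fun y => J (mixp (Num.sqrt a) x (Num.sqrt r) y)))).
  congr Ex; apply/funext => y; congr Ex; apply/funext => u.
  by congr (noised _ _ _ * noised _ _ _); apply/funext => v; rewrite /mixp; ring.
rewrite h; congr Ex; apply/funext => u.
by congr (noised _ _ _ * noised _ _ _); apply/funext => v; rewrite /mixp /scalep; ring.
Qed.

Lemma coupled_indep r q a s t : 0 <= q -> 0 <= a ->
  Ex mu (fun y => Ex mu (fun z =>
    coupled r q (mixp 1 s (Num.sqrt a) y) (mixp 1 t (Num.sqrt a) z))) =
  coupled r (q + a) s t.
Proof.
move=> q0 a0; set sa := Num.sqrt a; set sr := Num.sqrt r.
pose f x y := noised D q (mixp 1 (mixp 1 s sr x) sa y).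
pose g x z := noised A q (mixp 1 (mixp 1 t sr x) sa z).
have mf1 : measurable_fun setT (fun p : Om * Om => mixp 1 s sr p.1).
  by apply: measurable_mixp => //; exact: measurable_cst.
have mg1 : measurable_fun setT (fun p : Om * Om => mixp 1 t sr p.1).
  by apply: measurable_mixp => //; exact: measurable_cst.
have bf : bm (fun p : Om * Om => f p.1 p.2) by apply: mix3.
have bg : bm (fun p : Om * Om => g p.1 p.2) by apply: mix3.
have bfx x : bm (f x) by exact: (bm_pair1 x bf).
have bgx x : bm (g x) by exact: (bm_pair1 x bg).
have bfy y : bm (fun x => f x y) by exact: (bm_pair2 y bf).
have bgy y : bm (fun x => g x y) by exact: (bm_pair2 y bg).
have sw (F : Om * Om -> R) : bm F -> bm (fun p => F (p.2, p.1)).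
  by move=> bF; apply: (bm_comp bF); exact: measurable_fun_pair.
have msnd1 : measurable_fun setT (fun p : Om * Om => (p.2, p.1)) by exact: measurable_fun_pair.
have step1 y : Ex mu (fun z => Ex mu (fun x => f x y * g x z)) =
    Ex mu (fun x => f x y * Ex mu (g x)).
  have bF : bm (fun p : Om * Om => f p.1 y * g p.1 p.2).
    by apply: bmM => //; exact: (bm_comp (bfy y)).
  rewrite -(Ex_swap mu mu bF) /=; congr Ex; apply/funext => x.
  by rewrite ExZ.
have bgE : bm (fun x => Ex mu (g x)) by exact: (bm_Ex mu bg).
have step2 : Ex mu (fun y => Ex mu (fun x => f x y * Ex mu (g x))) =
    Ex mu (fun x => Ex mu (f x) * Ex mu (g x)).
  have bF : bm (fun p : Om * Om => f p.1 p.2 * Ex mu (g p.1)).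
    by apply: bmM => //; exact: (bm_comp bgE).
  rewrite -(Ex_swap mu mu bF) /=; congr Ex; apply/funext => x.
  by rewrite mulrC -ExZ//; congr Ex; apply/funext => y; rewrite mulrC.
transitivity (Ex mu (fun y => Ex mu (fun z => Ex mu (fun x => f x y * g x z)))).
  congr Ex; apply/funext => y; congr Ex; apply/funext => z; congr Ex; apply/funext => x.
  rewrite /f /g /sr.
  by congr (noised _ _ _ * noised _ _ _); apply/funext => v; rewrite /mixp; ring.
under [X in Ex mu X]eq_fun do rewrite step1.
rewrite step2; congr Ex; apply/funext => x.
by rewrite !noisedD.
Qed.

Variable a : R.
Hypothesis a0 : 0 <= a.

(* Average of [coupled] over the ways of sharing or resampling each of [n]
   further independent components of variance [a]. *)
Fixpoint resampled n (j l : nat) (s t : Om) : R :=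
  if n is n'.+1 then (resampled n' j.+1 l s t + resampled n' j l.+1 s t) / 2
  else coupled (j%:R * a) (l%:R * a) s t.

Lemma bm_resampled n j l : bm (fun p : Om * Om => resampled n j l p.1 p.2).
Proof.
elim: n j l => [|n IH] j l /=; first exact: bm_coupled.
rewrite (_ : (fun p : Om * Om => _) = (fun p => 2^-1 *
    (resampled n j.+1 l p.1 p.2 + resampled n j l.+1 p.1 p.2))).
  by apply: bmZ; exact: bmD.
by apply/funext => p; rewrite mulrC.
Qed.

(** The recursion in [resampled] acts on the two counters and keeps the base points; here one
    component is drawn first and moved into the base points. The two descriptions agree since shared
    and independent variances add up ([coupled_common], [coupled_indep]). *)
Lemma resampled_peel n j l s t :
  (Ex mu (fun y => resampled n j l (mixp 1 s (Num.sqrt a) y) (mixp 1 t (Num.sqrt a) y)) +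
   Ex mu (fun y => Ex mu (fun z =>
     resampled n j l (mixp 1 s (Num.sqrt a) y) (mixp 1 t (Num.sqrt a) z)))) / 2 =
  resampled n.+1 j l s t.
Proof.
elim: n j l => [|n IH] j l.
  rewrite /= coupled_common ?mulr_ge0// coupled_indep ?mulr_ge0//.
  by rewrite -!(addn1 j) -!(addn1 l) !natrD !mulrDl !mul1r.
transitivity ((resampled n.+1 j.+1 l s t + resampled n.+1 j l.+1 s t) / 2); last by [].
rewrite -!IH.
have ms : measurable_fun setT (fun y => mixp 1 s (Num.sqrt a) y).
  by apply: measurable_mixp => //; exact: measurable_cst.
have mt : measurable_fun setT (fun y => mixp 1 t (Num.sqrt a) y).
  by apply: measurable_mixp => //; exact: measurable_cst.
have b1 j' l' : bm (fun y => resampled n j' l' (mixp 1 s (Num.sqrt a) y) (mixp 1 t (Num.sqrt a) y)).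
  by apply: (bm_comp (phi := fun y => (mixp 1 s (Num.sqrt a) y, mixp 1 t (Num.sqrt a) y)) (bm_resampled n j' l')); exact: measurable_fun_pair.
have b2 j' l' : bm (fun p : Om * Om => resampled n j' l' (mixp 1 s (Num.sqrt a) p.1)
    (mixp 1 t (Num.sqrt a) p.2)).
  apply: (bm_comp (phi := fun p : Om * Om => (mixp 1 s (Num.sqrt a) p.1, mixp 1 t (Num.sqrt a) p.2))
    (bm_resampled n j' l')); apply: measurable_fun_pair.
    by apply: measurable_mixp; [exact: measurable_cst|exact: measurable_fst].
  by apply: measurable_mixp; [exact: measurable_cst|exact: measurable_snd].
have b3 j' l' y : bm (fun z => resampled n j' l' (mixp 1 s (Num.sqrt a) y)
    (mixp 1 t (Num.sqrt a) z)) by exact: (bm_pair1 y (b2 j' l')).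
have b4 j' l' : bm (fun y => Ex mu (fun z => resampled n j' l' (mixp 1 s (Num.sqrt a) y)
    (mixp 1 t (Num.sqrt a) z))) by exact: (bm_Ex mu (b2 j' l')).
have h (F G : Om -> R) : bm F -> bm G ->
    Ex mu (fun y => (F y + G y) / 2) = (Ex mu F + Ex mu G) / 2.
  move=> bF bG; rewrite (_ : (fun y => _) = (fun y => 2^-1 * (F y + G y))); last first.
    by apply/funext => y; rewrite mulrC.
  by rewrite (ExZ _ _ (bmD bF bG)) (ExD _ bF bG) mulrC.
rewrite /= h//.
have -> : (fun y => Ex mu (fun z => (resampled n j.+1 l (mixp 1 s (Num.sqrt a) y)
      (mixp 1 t (Num.sqrt a) z) + resampled n j l.+1 (mixp 1 s (Num.sqrt a) y)
      (mixp 1 t (Num.sqrt a) z)) / 2)) =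
  (fun y => (Ex mu (fun z => resampled n j.+1 l (mixp 1 s (Num.sqrt a) y)
      (mixp 1 t (Num.sqrt a) z)) + Ex mu (fun z => resampled n j l.+1 (mixp 1 s (Num.sqrt a) y)
      (mixp 1 t (Num.sqrt a) z))) / 2).
  by apply/funext => y; rewrite h.
by rewrite h//; field.
Qed.

(** By induction on the number of components: [Ex_sqr_sqr] treats the component drawn first and
    [resampled_peel] recognizes the average. With no component left, the squares of indicators are
    the indicators themselves. *)
Lemma resampled_ge n s t :
  (noised D (n%:R * a) s) ^+ 2 * (noised A (n%:R * a) t) ^+ 2 <= resampled n 0 0 s t.
Proof.
elim: n s t => [|n IH] s t.
  have n0 S u : noised S 0 u = \1_S u.
    rewrite /noised; under [X in Ex mu X]eq_fun do rewrite sqrtr0.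
    rewrite -[RHS](Ex_cst mu); congr Ex; apply/funext => x; congr (\1_S _).
    by apply/funext => v; rewrite /mixp; ring.
  have -> : resampled 0 0 0 s t = \1_D s * \1_A t.
    rewrite /= /coupled mul0r; rewrite -[RHS](Ex_cst mu); congr Ex.
    apply/funext => x; rewrite sqrtr0 !n0; congr (\1_D _ * \1_A _);
      by apply/funext => v; rewrite /mixp; ring.
  rewrite mul0r !n0 !indicE.
  by case: (s \in D); case: (t \in A); rewrite ?expr1n ?expr0n/= ?mulr1 ?mul0r ?mulr0.
rewrite -resampled_peel.
have ms (u : Om) : measurable_fun setT (fun y : Om => mixp 1 u (Num.sqrt a) y).
  by apply: measurable_mixp => //; exact: measurable_cst.
have bF S u : measurable S -> bm (fun y => noised S (n%:R * a) (mixp 1 u (Num.sqrt a) y)).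
  by move=> mS; exact: (bm_comp (bm_noised _ mS)).
have E S u : measurable S -> noised S (n.+1%:R * a) u =
    Ex mu (fun y => noised S (n%:R * a) (mixp 1 u (Num.sqrt a) y)).
  by move=> mS; rewrite noisedD ?mulr_ge0// -addn1 natrD mulrDl mul1r.
rewrite !E//; apply: (le_trans (Ex_sqr_sqr mu (bF D s mD) (bF A t mA))).
rewrite ler_pM2r ?invr_gt0//; apply: lerD.
  apply: le_Ex => //.
  - by apply: bmM; apply: bmX; exact: bF.
  - by apply: (bm_comp (phi := fun y => (mixp 1 s (Num.sqrt a) y, mixp 1 t (Num.sqrt a) y)) (bm_resampled n 0 0)); exact: measurable_fun_pair.
have b2 : bm (fun p : Om * Om => resampled n 0 0 (mixp 1 s (Num.sqrt a) p.1)
    (mixp 1 t (Num.sqrt a) p.2)).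
  apply: (bm_comp (phi := fun p : Om * Om => (mixp 1 s (Num.sqrt a) p.1, mixp 1 t (Num.sqrt a) p.2))
    (bm_resampled n 0 0)); apply: measurable_fun_pair.
    by apply: measurable_mixp; [exact: measurable_cst|exact: measurable_fst].
  by apply: measurable_mixp; [exact: measurable_cst|exact: measurable_snd].
have bF2 : bm (fun y => noised D (n%:R * a) (mixp 1 s (Num.sqrt a) y) ^+ 2).
  by apply: bmX; exact: bF.
have bG2 : bm (fun y => noised A (n%:R * a) (mixp 1 t (Num.sqrt a) y) ^+ 2).
  by apply: bmX; exact: bF.
rewrite mulrC -ExZ//; apply: le_Ex; [exact: bmZ|exact: (bm_Ex mu b2)|move=> y].
rewrite mulrC -ExZ//; apply: le_Ex; [exact: bmZ|exact: (bm_pair1 y b2)|move=> z].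
exact: IH.
Qed.

(** The difference [j - l] performs a fair walk with steps [1] and [-1], so the mean of its square
    grows by 1 at each split, that is, by [a ^+ 2] after scaling. *)
Lemma resampled_le (N : nat) (s t : Om) (b : R) :
  (forall j l, (j + l = N)%N ->
     coupled (j%:R * a) (l%:R * a) s t <= b + 4 * ((j%:R - l%:R) * a) ^+ 2) ->
  forall n j l, (j + l + n = N)%N ->
  resampled n j l s t <= b + 4 * (((j%:R - l%:R) ^+ 2 + n%:R) * a ^+ 2).
Proof.
move=> h; elim=> [|n IH] j l; first by rewrite addn0 addr0 -exprMn; exact: h.
move=> jln /=.
have h2 : (j.+1 + l + n = N)%N by rewrite -jln addnS !addSn.
have h1 : (j + l.+1 + n = N)%N by rewrite -jln !addnS addSn.
move: {h1 h2} (IH _ _ h1) (IH _ _ h2) => h1 h2.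
rewrite ler_pdivrMr//; apply: (le_trans (lerD h2 h1)).
rewrite le_eqVlt; apply/orP; left; apply/eqP.
by rewrite -!(addn1 n) -(addn1 j) -(addn1 l) !natrD; ring.
Qed.

End reverse_hypercontractivity.

Section separated_nets.
Context {T : pointedType} (sep : T -> T -> Prop) (G : set T) (m : nat).

Definition separated (zs : seq T) : Prop :=
  (forall i, (i < size zs)%N -> G (nth point zs i)) /\
  (forall i j, (i < j < size zs)%N -> sep (nth point zs i) (nth point zs j)).

Hypothesis bounded : forall zs, separated zs -> (size zs <= m)%N.

Lemma separated_net : exists code : T -> nat,
  (forall z, G z -> (code z < m)%N) /\
  (exists c : nat -> T, forall z, G z -> ~ sep (c (code z)) z).
Proof.
have [zs [sz mz]] : exists zs, separated zs /\ forall z, G z ->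
    exists2 i, (i < size zs)%N & ~ sep (nth point zs i) z.
  apply: contrapT => /forallNP h.
  have ext zs : separated zs -> exists z, separated (rcons zs z).
    move=> sz; have /not_andP[//|/existsNP[z /not_implyP[Gz nz]]] := h zs.
    exists z; split=> [i|i j]; rewrite size_rcons ltnS.
      rewrite leq_eqVlt nth_rcons => /predU1P[->|iz]; first by rewrite ltnn eqxx.
      by rewrite iz; exact: (proj1 sz).
    move=> /andP[ij]; rewrite leq_eqVlt !nth_rcons => /predU1P[jE|jz].
      rewrite -jE ij jE ltnn eqxx; apply: contrapT => ns; apply: nz.
      by exists i => //; rewrite -jE.
    by rewrite jz (ltn_trans ij jz); apply: (proj2 sz); rewrite ij.
  have [zs [sz szE]] : exists zs, separated zs /\ size zs = m.+1.
    elim: m.+1 => [|n [zs [sz szE]]].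
      by exists [::]; split=> //; split=> // i j; rewrite ltn0 andbF.
    by have [z sz'] := ext _ sz; exists (rcons zs z); rewrite size_rcons szE.
  by have := bounded sz; rewrite szE ltnn.
have : forall z, exists i, G z -> (i < size zs)%N /\ ~ sep (nth point zs i) z.
  move=> z; have [Gz|nG] := pselect (G z); last by exists 0%N.
  by have [i iz ns] := mz z Gz; exists i.
move=> /choice[code hc]; exists code; split.
  by move=> z Gz; have [h _] := hc z Gz; exact: leq_trans (bounded sz).
by exists (nth point zs) => z Gz; have [] := hc z Gz.
Qed.
End separated_nets.

Section sieve.
Context {R : realType} {T : eqType} (mu : probability (paths R T) R) (k : T -> T -> R).
Hypothesis gmu : gaussian_on mu k.
Local Notation Om := (paths R T).

Definition hits (A : set Om) (r : R) (x : Om) : R :=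
  Ex mu (fun v => \1_A (mixp r x (Num.sqrt (1 - r ^+ 2)) v)).

Lemma bm_hits A r : measurable A -> bm (hits A r).
Proof.
move=> mA; apply: (@bm_Ex _ _ _ _ _ mu
  (fun p : Om * Om => \1_A (mixp r p.1 (Num.sqrt (1 - r ^+ 2)) p.2))).
by apply: (bm_comp (bm_indic mA)); exact: measurable_mixp.
Qed.

(** From the origin, the two coupled points are [X = sqrt r S + sqrt q U] and
    [Y = sqrt r S + sqrt q V], of correlation [r]. Given [X], the point [Y] is [r X] plus an
    independent path of scale [sqrt (1 - r^2)], which is what [hits] integrates. *)
Lemma coupledE (D A : set Om) r q : measurable D -> measurable A ->
  0 <= r -> 0 <= q -> r + q = 1 ->
  coupled mu D A r q (fun=> 0) (fun=> 0) = Ex mu (fun x => \1_D x * hits A r x).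
Proof.
move=> mD mA r0 q0 rq.
set sr := Num.sqrt r; set sq := Num.sqrt q.
have r2 : sr ^+ 2 = r by rewrite sqr_sqrtr.
have q2 : sq ^+ 2 = q by rewrite sqr_sqrtr.
have cs : sr ^+ 2 + sq ^+ 2 = 1 by rewrite r2 q2.
pose h x := Ex mu (fun v => \1_A (mixp sr x sq v)).
have bh : bm h.
  apply: (@bm_Ex _ _ _ _ _ mu (fun p : Om * Om => \1_A (mixp sr p.1 sq p.2))).
  by apply: (bm_comp (bm_indic mA)); exact: measurable_mixp.
pose K (p : Om * Om) := \1_D p.1 * h (mixp sr p.1 (- sq) p.2).
have bK : bm K.
  apply: bmM; first by apply: (bm_comp (bm_indic mD)); exact: measurable_fst.
  by apply: (bm_comp bh); exact: measurable_mixp.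
have bDx x : bm (fun u => \1_D (mixp 1 (mixp 1 (fun=> 0) sr x) sq u) : R).
  apply: (bm_comp (bm_indic mD)).
  by apply: measurable_mixp; [exact: measurable_cst|exact: measurable_id].
transitivity (Ex mu (fun x => Ex mu (fun u => K (mixp sr x sq u, mixp (- sq) x sr u)))).
  congr Ex; apply/funext => x; rewrite /noised mulrC -ExZ//; congr Ex.
  apply/funext => u; rewrite /K /= mulrC; congr (\1_D _ * _).
    by apply/funext => t; rewrite /mixp -/sr -/sq; ring.
  rewrite /h; congr Ex; apply/funext => v; congr (\1_A _).
  apply/funext => t; rewrite /mixp -/sq -/sr.
  have -> : sr * (sr * x t + sq * u t) + - sq * (- sq * x t + sr * u t) =
     (sr ^+ 2 + sq ^+ 2) * x t by ring.
  by rewrite cs; ring.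
rewrite (Ex_rotation gmu cs bK); congr Ex; apply/funext => x.
have bhx : bm (fun u => h (mixp sr x (- sq) u)).
  apply: (bm_comp bh).
  by apply: measurable_mixp; [exact: measurable_cst|exact: measurable_id].
rewrite /K /= ExZ//; congr (_ * _).
have bf : bm (fun z : Om => \1_A (mixp r x 1 z) : R).
  apply: (bm_comp (bm_indic mA)).
  by apply: measurable_mixp; [exact: measurable_cst|exact: measurable_id].
(* After the rotation the shared component is [sr x - sq u], so the second point is
   [r x - sr sq u + sq v]; the two noises have total variance [r q + q = 1 - r^2]. *)
have := Ex_mix gmu (- (sr * sq)) sq bf.
have -> : (- (sr * sq)) ^+ 2 + sq ^+ 2 = 1 - r ^+ 2.
  by rewrite sqrrN exprMn r2 q2 -(addrK r q) (addrC q) rq; ring.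
move=> hm; rewrite /h /hits.
transitivity (Ex mu (fun u => Ex mu (fun v => \1_A (mixp r x 1 (mixp (- (sr * sq)) u sq v)) : R))).
  congr Ex; apply/funext => u; congr Ex; apply/funext => v; congr (\1_A _).
  by apply/funext => t; rewrite /mixp -r2; ring.
rewrite hm; congr Ex; apply/funext => u; congr (\1_A _).
by apply/funext => t; rewrite /mixp /scalep; ring.
Qed.

Variables (t : nat -> T) (eta : R).

Definition seqball : set Om := [set x | forall i, `|x (t i)| <= eta].

Lemma measurable_seqball : measurable seqball.
Proof.
rewrite (_ : seqball = \bigcap_i [set x : Om | `|x (t i)| <= eta]); last first.
  by apply/seteqP; split => x h i; [move=> _; exact: h|exact: h].
apply: bigcap_measurable => // i _.
rewrite -[X in measurable X]setTI.
have mf : measurable_fun setT (fun x : Om => `|x (t i)|).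
  by apply: measurableT_comp => //; exact: measurable_eval.
have := mf measurableT `]-oo, eta]%classic (measurable_itv _).
by congr measurable; apply/seteqP; split => x /=; rewrite in_itv.
Qed.

(* For [r >= 1/4] and [8 eta]-separated [z], the events
   [r z + sqrt (1 - r^2) v \in seqball] are disjoint. *)
Lemma hits_separated (r delta : R) (zs : seq Om) : 4^-1 <= r -> 0 < delta ->
  separated (fun x y => exists i, 8 * eta < `|x (t i) - y (t i)|)
    [set z | delta <= hits seqball r z] zs -> (size zs)%:R <= delta^-1.
Proof.
move=> r4 d0 [Gz sepz].
pose S i : set Om := [set v | seqball (mixp r (nth point zs i) (Num.sqrt (1 - r ^+ 2)) v)].
have mS i : measurable (S i).
  have : measurable_fun setT (fun v => mixp r (nth point zs i) (Num.sqrt (1 - r ^+ 2)) v).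
    by apply: measurable_mixp; [exact: measurable_cst|exact: measurable_id].
  by move=> /(_ measurableT _ measurable_seqball); rewrite setTI.
have disj i j v : (i < j < size zs)%N -> S i v -> S j v -> False.
  move=> ij Si Sj; have [n] := sepz i j ij; rewrite ltNge => /negP; apply.
  have := Si n; have := Sj n; rewrite /mixp.
  move: (nth point zs i (t n)) (nth point zs j (t n)) (_ * v (t n)) => a b c.
  rewrite !ler_norml => /andP[h1 h2] /andP[h3 h4].
  have : r * (a - b) <= 2 * eta by lra.
  have : - (2 * eta) <= r * (a - b) by lra.
  have eta0 : 0 <= eta by lra.
  move=> h5 h6; apply/andP; split.
    rewrite leNgt; apply/negP => h7.
    have : r * (a - b) < - (2 * eta) by nra.
    lra.
  rewrite leNgt; apply/negP => h7.
  have : 2 * eta < r * (a - b) by nra.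
  lra.
have le1 : Ex mu (fun v => \sum_(i < size zs) \1_(S i) v) <= 1.
  apply: Ex_le_cst; first by apply: bm_sum => i; exact: bm_indic.
  move=> v; have [[i0 Si0]|nS] := pselect (exists i0 : 'I_(size zs), S i0 v).
    rewrite (bigD1 i0)//= big1 ?addr0 => [|i ii0].
      by rewrite indicE; case: (_ \in _).
    rewrite indicE memNset// => Si; have [ij|ji|/val_inj e] := ltngtP i i0.
    - by apply: (disj i i0 v) => //; rewrite ij ltn_ord.
    - by apply: (disj i0 i v) => //; rewrite ji ltn_ord.
    - by move: ii0; rewrite e eqxx.
  rewrite big1// => i _; rewrite indicE memNset// => Si; by apply: nS; exists i.
rewrite -[_^-1]mul1r ler_pdivlMr//; apply: le_trans le1.
rewrite Ex_sum; last by move=> i; exact: bm_indic.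
rewrite (_ : _ * delta = \sum_(i < size zs) delta); last first.
  by rewrite sumr_const card_ord mulr_natl.
by apply: ler_sum => i _; exact: Gz.
Qed.

(** If the complement of the union had mass [M > tau], the lower bound [resampled_ge] and the upper
    bound on each leaf would give [M^2 <= (tau M + tau^2) / 2], which is impossible. The values of
    [delta] and [N] make the two upper terms of exactly this size. *)
Lemma gaussian_sieve (tau : R) : 0 < tau <= 1 -> 0 < Ex mu \1_seqball ->
  exists G, measurable G /\ Ex mu \1_(~` G) <= tau /\
  exists code : Om -> nat, (forall z, G z ->
      (code z)%:R <= 20 / (tau ^+ 3 * (Ex mu \1_seqball) ^+ 4)) /\
    exists c : nat -> Om, forall z, G z -> forall i, `|c (code z) (t i) - z (t i)| <= 8 * eta.
Proof.
move=> /andP[tau0 tau1]; set a := Ex mu _ => a0.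
have mB := measurable_seqball.
have a1 : a <= 1.
  apply: Ex_le_cst; first exact: bm_indic.
  by move=> x; rewrite indicE; case: (_ \in _).
pose delta := tau * a ^+ 2 / 2.
have a20 : 0 < a ^+ 2 by rewrite exprn_gt0.
have d0 : 0 < delta by rewrite divr_gt0// mulr_gt0.
pose m := Num.truncn (delta^-1).
pose N := (Num.truncn (8 / (tau ^+ 2 * a ^+ 2))).+1.
have ta0 : 0 < tau ^+ 2 * a ^+ 2 by rewrite mulr_gt0 ?exprn_gt0.
have N0 : 0 < N%:R :> R by rewrite ltr0n.
have NP : 8 / (tau ^+ 2 * a ^+ 2) <= N%:R by rewrite ltW// truncnS_gt.
have NQ : N%:R <= 8 / (tau ^+ 2 * a ^+ 2) + 1.
  rewrite /N -natr1 lerD2r truncn_le//.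
  by rewrite divr_ge0// ltW.
pose r (j : nat) : R := j%:R / N%:R.
pose GG j := [set z : Om | 4^-1 <= r j /\ delta <= hits seqball (r j) z].
have mGG j : measurable (GG j).
  have [r4|r4] := pselect (4^-1 <= r j); last first.
    rewrite (_ : GG j = set0); first exact: measurable0.
    by apply/seteqP; split => z // [].
  have := bm_meas (bm_hits (r j) mB) measurableT (measurable_itv `[delta, +oo[).
  rewrite setTI; congr measurable; apply/seteqP; split => z /=; rewrite in_itv/= andbT//.
  by case.
pose G := \bigcup_(j in [set j | (j <= N)%N]) GG j.
have mG : measurable G by apply: bigcup_measurable => j _; exact: mGG.
have mD : measurable (~` G) by exact: measurableC.
exists G; split=> //; split.
  rewrite leNgt; apply/negP; set D := ~` G => Dtau.
  pose b := delta * Ex mu \1_D.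
  have b0 : 0 <= b by rewrite mulr_ge0 ?(ltW d0)// Ex_ge0// => x; rewrite indicE.
  have leaf j l : (j + l = N)%N ->
      coupled mu D seqball (j%:R * N%:R^-1) (l%:R * N%:R^-1) (fun=> 0) (fun=> 0) <=
      b + 4 * ((j%:R - l%:R) * N%:R^-1) ^+ 2.
    move=> jl.
    have rq : r j + r l = 1 by rewrite /r -mulrDl -natrD jl divff// gt_eqF.
    have r0 i : 0 <= r i by rewrite divr_ge0// ltW.
    rewrite -/(r j) -/(r l) coupledE// mulrBl -/(r j) -/(r l).
    have bh := bm_hits (r j) mB.
    have bp : bm (fun x => \1_D x * hits seqball (r j) x) by apply: bmM => //; exact: bm_indic.
    have hle1 x : hits seqball (r j) x <= 1.
      apply: Ex_le_cst.
        apply: (bm_comp (bm_indic mB)).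
        by apply: measurable_mixp; [exact: measurable_cst|exact: measurable_id].
      by move=> v; rewrite indicE; case: (_ \in _).
    have [r4|r4] := leP 4^-1 (r j).
      apply: (@le_trans _ _ b); last by rewrite lerDl mulr_ge0// sqr_ge0.
      rewrite /b -ExZ; last exact: bm_indic.
      apply: le_Ex => //; first by apply: bmZ; exact: bm_indic.
      move=> x; have [Dx|nDx] := pselect (D x); last by rewrite indicE memNset// mul0r mulr0.
      rewrite indicE mem_set// mul1r mulr1 leNgt; apply/negP => dx; apply: Dx.
      by exists j; [rewrite /= -jl leq_addr|split=> //; exact: ltW].
    (* Here the penalty pays: [r j < 1 / 4] gives [|r j - r l| = 1 - 2 r j > 1 / 2], so the
       quadratic term is at least 1. *)
    apply: (@le_trans _ _ 1).
      apply: Ex_le_cst => // x; rewrite indicE; case: (_ \in _); rewrite ?mul0r ?mul1r//.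
    have -> : r l = 1 - r j by rewrite -rq addrC addKr.
    by move: (r0 j) r4 b0; set x := r j => x0 x4 b0; nra.
  have Ni0 : 0 <= N%:R^-1 :> R by rewrite invr_ge0 ltW.
  have := @resampled_ge _ _ mu k gmu D seqball mD mB N%:R^-1 Ni0 N (fun=> 0) (fun=> 0).
  have nE S : noised mu S (N%:R * N%:R^-1) (fun=> 0) = Ex mu \1_S.
    rewrite divff ?gt_eqF// /noised sqrtr1; congr Ex; apply/funext => x; congr (\1_S _).
    by apply/funext => v; rewrite /mixp mulr0 add0r mul1r.
  rewrite !nE -/a => /le_trans/(_ (resampled_le leaf (erefl : (0 + 0 + N = N)%N))).
  rewrite subrr expr0n add0r.
  have -> : 4 * (N%:R * N%:R^-1 ^+ 2) = 4 / N%:R :> R by field; rewrite gt_eqF.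
  have N4 : 4 / N%:R <= tau ^+ 2 * a ^+ 2 / 2.
    rewrite ler_pdivrMr// mulrAC ler_pdivlMr// mulrC; move: NP.
    by rewrite ler_pdivrMr// => h; lra.
  rewrite /b /delta; set M := Ex mu \1_D => h.
  have : M ^+ 2 * a ^+ 2 <= (tau * M + tau ^+ 2) / 2 * a ^+ 2 by lra.
  rewrite ler_pM2r//; have : 0 < M by rewrite (lt_trans tau0).
  by move: Dtau; rewrite -/M => Dtau M0; nra.
pose sep := fun x y : Om => exists i, 8 * eta < `|x (t i) - y (t i)|.
have nets j : exists p : (Om -> nat) * (nat -> Om),
    (forall z, GG j z -> (p.1 z < m)%N) /\ (forall z, GG j z -> ~ sep (p.2 (p.1 z)) z).
  have [r4|r4] := leP 4^-1 (r j); last first.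
    by exists (fun=> 0%N, fun=> (fun=> 0)); split => z []; rewrite leNgt r4.
  have sz zs : separated sep (GG j) zs -> (size zs <= m)%N.
    move=> [g1 g2]; rewrite -(ler_nat R).
    have : (size zs)%:R <= delta^-1.
      apply: (hits_separated r4 d0); split => // i iz.
      by have [] := g1 i iz.
    by rewrite /m ler_nat truncn_ge_nat// invr_ge0 ltW.
  have [code [h1 [c h2]]] := separated_net sz.
  by exists (code, c).
move: nets => /choice[p hp].
have sel z : exists j, G z -> (j <= N)%N /\ GG j z.
  have [[j jN Gj]|nG] := pselect (G z); last by exists 0%N.
  by exists j.
move: sel => /choice[s hs].
(* The grid index and the code in the corresponding net are packed in one number, in base [m]. *)
exists (fun z => s z * m + (p (s z)).1 z)%N; split.
  move=> z Gz; have [sN Gs] := hs z Gz.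
  have cm := (proj1 (hp (s z))) z Gs.
  apply: (@le_trans _ _ ((N%:R + 1) * delta^-1)).
    apply: (@le_trans _ _ ((N%:R + 1) * m%:R)).
      rewrite natr1 -natrM ler_nat mulSn addnC leq_add// ?(ltnW cm)// leq_mul2r.
      by rewrite sN orbT.
    rewrite ler_wpM2l// ?addr_ge0//.
    by rewrite truncn_le// invr_ge0 ltW.
  (* [N + 1] is at most [8 / (tau^2 a^2) + 2], and the 2 is absorbed because [tau] and [a] are at
     most 1; the factor [1 / delta = 2 / (tau a^2)] then yields the constant 20. *)
  apply: (@le_trans _ _ (10 / (tau ^+ 2 * a ^+ 2) * delta^-1)).
    rewrite ler_wpM2r ?invr_ge0 ?(ltW d0)//.
    have : 1 <= (tau ^+ 2 * a ^+ 2)^-1.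
      rewrite invf_ge1// -(mulr1 1) ler_pM ?exprn_ge0 ?(ltW tau0) ?(ltW a0)//.
        by rewrite exprn_ile1// ltW.
      by rewrite exprn_ile1// ltW.
    by move: NQ; lra.
  rewrite le_eqVlt; apply/orP; left; apply/eqP; rewrite /delta; field.
  by rewrite !gt_eqF.
exists (fun n : nat => (p (n %/ m)%N).2 (n %% m)%N) => z Gz i.
have [sN Gs] := hs z Gz; have cm := (proj1 (hp (s z))) z Gs.
have m0 : (0 < m)%N by exact: leq_ltn_trans cm.
rewrite divnMDl// divn_small// addn0 modnMDl modn_small//.
rewrite leNgt; apply/negP => lt8; apply: ((proj2 (hp (s z))) z Gs).
by exists i.
Qed.
End sieve.

(** * Functions on the cube *)

Section cube_points.
Context {R : realType} {k : nat}.
Implicit Types (f z : 'rV[R]_k -> R) (x y : 'rV[R]_k) (j : 'I_k).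

Lemma cube0 : cube (0 : 'rV[R]_k).
Proof. by move=> j; rewrite mxE normr0. Qed.

Lemma rV_ballP x y (e : R) : ball x e y <-> 0 < e /\ forall j, `|x ord0 j - y ord0 j| < e.
Proof.
split=> [[e0 h]|[e0 h]]; first by split=> // j; exact: h.
by split=> // i j; rewrite (ord1 i); exact: h.
Qed.

Lemma cube_continuousP f : cube_continuous f <->
  forall x, cube x -> forall e : R, 0 < e -> exists2 r : R, 0 < r &
    forall y, cube y -> (forall j, `|x ord0 j - y ord0 j| < r) -> `|f x - f y| < e.
Proof.
rewrite /cube_continuous subspace_continuousP; split=> h x cx.
  move=> e e0; have /cvgrPdist_lt/(_ _ e0) := h x cx.
  rewrite /prop_near1/= /within/= -nbhs_ballE => -[r /= r0 hr]; exists r => // y cy xy.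
  by apply: hr => //; apply/rV_ballP.
apply/cvgrPdist_lt => e e0; have [r r0 hr] := h x cx e e0.
rewrite /prop_near1/= /within/= -nbhs_ballE; exists r => //= y /rV_ballP[_ xy] cy.
exact: hr.
Qed.

Lemma csup_leP f (c : R) : (csup f <= c%:E)%E <-> (forall x, cube x -> `|f x| <= c).
Proof.
split=> h.
  move=> x cx; rewrite -lee_fin; apply: le_trans h; apply: ereal_sup_ubound.
  by exists x.
by apply: ge_ereal_sup => _ [x cx <-]; rewrite lee_fin h.
Qed.

(** The cube contains 0, so the supremum is not [-oo]; lying below [c], it is a real number and
    serves as [b]. *)
Lemma csup_ltP f (c : R) : (csup f < c%:E)%E <->
  exists2 b : R, b < c & forall x, cube x -> `|f x| <= b.
Proof.
split=> [h|[b bc h]]; last first.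
  by apply: (@le_lt_trans _ _ b%:E); [exact/csup_leP|rewrite lte_fin].
have fin : csup f \is a fin_num.
  rewrite fin_numElt (lt_trans h) ?ltry// andbT.
  apply: (@lt_le_trans _ _ (`|f 0|)%:E); first exact: ltNyr.
  by apply: ereal_sup_ubound; exists 0 => //; exact: cube0.
exists (fine (csup f)); first by rewrite -lte_fin fineK.
by apply/csup_leP; rewrite fineK.
Qed.

(** A dense sequence of the cube: rational points enumerated by [unpickle] and clamped, so that
    every term, the default 0 included, belongs to the cube. *)
Definition cubept (n : nat) : 'rV[R]_k :=
  if (unpickle n : option 'rV[rat]_k) is Some q then
    \row_j Num.max (-1) (Num.min 1 (ratr (q ord0 j))) else 0.

Lemma cube_clamp (a : R) : `|Num.max (-1) (Num.min 1 a)| <= 1.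
Proof.
rewrite ler_norml le_max lexx /= ge_max ge_min lexx/= andbT.
by apply: (@le_trans _ _ 0); rewrite ?lerN10.
Qed.

Lemma cube_cubept n : cube (cubept n).
Proof.
move=> j; rewrite /cubept; case: (unpickle n) => [q|]; rewrite mxE ?normr0//.
exact: cube_clamp.
Qed.

Lemma clampE (a : R) : `|a| <= 1 -> Num.max (-1) (Num.min 1 a) = a.
Proof.
by rewrite ler_norml => /andP[a1 a2]; rewrite min_r// max_r.
Qed.

Lemma cubept_dense x (e : R) : cube x -> 0 < e ->
  exists n, forall j, `|x ord0 j - cubept n ord0 j| < e.
Proof.
move=> cx e0.
have : forall j, exists q : rat, `|x ord0 j - Num.max (-1) (Num.min 1 (ratr q))| < e.
  move=> j; have := cx j; rewrite ler_norml => /andP[h1 h2].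
  have : Num.max (-1) (x ord0 j - e) < Num.min 1 (x ord0 j + e).
    by rewrite gt_max !lt_min; apply/andP; split; apply/andP; split; lra.
  move=> /rat_in_itvoo[q]; rewrite in_itv/= gt_max lt_min.
  move=> /andP[/andP[q1 q2] /andP[q3 q4]]; exists q.
  rewrite clampE; first by rewrite ltr_norml; apply/andP; split; lra.
  by rewrite ler_norml; apply/andP; split; lra.
move=> /choice[q hq]; exists (pickle (\row_j q j)) => j.
by rewrite /cubept pickleK !mxE.
Qed.

Lemma cube_compact : compact (cube : set 'rV[R]_k).
Proof.
rewrite (_ : cube = [set v : 'rV[R]_k | forall i, `[-1, 1]%classic (v ord0 i)]).
  have h := @rV_compact (R : ptopologicalType) k (fun=> `[-1, 1]%classic).
  by apply: h => _; exact: segment_compact.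
by apply/seteqP; split=> x h i; have := h i; rewrite /= in_itv/= ler_norml.
Qed.

Lemma dense_le f (c : R) : cube_continuous f ->
  (forall n, `|f (cubept n)| <= c) -> forall x, cube x -> `|f x| <= c.
Proof.
move=> /cube_continuousP cf h x cx; apply/ler_addgt0Pr => e e0.
have [r r0 hr] := cf x cx e e0; have [n xn] := cubept_dense cx r0.
have := hr _ (cube_cubept n) xn; have := h n => h1 h2.
rewrite -(subrK (f (cubept n)) (f x)) addrC.
by apply: le_trans (ler_normD _ _) _; exact: lerD (ltW h2).
Qed.

Lemma cube_continuousB f z : cube_continuous f -> cube_continuous z -> cube_continuous (f \- z).
Proof.
move=> /cube_continuousP cf /cube_continuousP cz; apply/cube_continuousP => x cx e e0.
have e2 : 0 < e / 2 by rewrite divr_gt0.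
have [r r0 hr] := cf x cx _ e2; have [s s0 hs] := cz x cx _ e2.
exists (Num.min r s); first by rewrite lt_min r0.
move=> y cy xy; have {}hr : `|f x - f y| < e / 2.
  by apply: hr => // j; apply: lt_le_trans (xy j) _; rewrite ge_min lexx.
have {}hs : `|z x - z y| < e / 2.
  by apply: hs => // j; apply: lt_le_trans (xy j) _; rewrite ge_min lexx orbT.
have -> : (f \- z) x - (f \- z) y = (f x - f y) - (z x - z y) by rewrite /=; ring.
by apply: le_lt_trans (ler_normB _ _) _; rewrite (splitr e) ltrD.
Qed.

(** The derivative-free form of coordinatewise bounds on partial derivatives; it can be tested on a
    dense set. *)
Definition cubes_lip (K : 'I_k -> R) f := forall x y, cube x -> cube y ->
  `|f x - f y| <= \sum_j K j * `|x ord0 j - y ord0 j|.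

End cube_points.

Section countable_codes.
Context {R : realType} {k : nat} {W : Type}.

(* By compactness a continuous function is determined up to s by a finite list
   of small balls and of approximate values at their centres. *)
Lemma C0_code (F : W -> 'rV[R]_k -> R) (s : R) : 0 < s ->
  (forall w, cube_continuous (F w)) ->
  exists code : W -> nat, forall w w', code w = code w' ->
    forall x, cube x -> `|F w x - F w' x| <= s.
Proof.
move=> s0 cF; have s3 : 0 < s / 3 by rewrite divr_gt0.
pose small w (p : nat * nat) := forall x, cube x -> ball (@cubept R k p.1) (p.2.+1%:R^-1) x ->
  `|F w x - F w (cubept p.1)| <= s / 3.
have cov w : exists D : seq (nat * nat), (forall p, p \in D -> small w p) /\
    forall x, cube x -> exists2 p, p \in D & ball (@cubept R k p.1) (p.2.+1%:R^-1) x.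
  have loc (x : 'rV[R]_k) : cube x ->
      exists2 p, small w p & ball (@cubept R k p.1) (p.2.+1%:R^-1) x.
    move=> cx; have s6 : 0 < s / 6 by rewrite divr_gt0.
    have /cube_continuousP/(_ x cx _ s6)[r r0 hr] := cF w.
    pose m := Num.truncn (2 / r).
    have mr : m.+1%:R^-1 < r / 2.
      rewrite -[ltRHS]invf_div ltf_pV2 ?posrE ?divr_gt0//; exact: truncnS_gt.
    have m0 : 0 < m.+1%:R^-1 :> R by rewrite invr_gt0.
    have [n xn] := cubept_dense cx m0.
    exists (n, m); last first.
      by apply/rV_ballP; split=> // j; rewrite distrC; exact: xn.
    move=> y cy /= /rV_ballP[_ yn].
    have xy : `|F w x - F w y| < s / 6.
      apply: hr => // j; rewrite -(subrK (cubept n ord0 j) (x ord0 j)) -addrA.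
      apply: le_lt_trans (ler_normD _ _) _; rewrite (splitr r).
        exact: lt_trans (ltrD (xn j) (yn j)) (ltrD mr mr).
    have xc : `|F w x - F w (cubept n)| < s / 6.
      apply: hr => [|j]; first exact: cube_cubept.
      apply: lt_trans (xn j) (lt_trans mr _).
      by rewrite ltr_pdivrMr// ltr_pMr// ltr1n.
    rewrite (_ : _ - _ = (F w x - F w (cubept n)) - (F w x - F w y)); last by ring.
    by apply: le_trans (ler_normB _ _) _; lra.
  have := @cube_compact R k; rewrite compact_cover => /(_ _ [set p | small w p]
    (fun p => ball (@cubept R k p.1) (p.2.+1%:R^-1))) [].
  - by move=> p _; apply: ball_open; rewrite invr_gt0.
  - by move=> x /loc[p]; exists p.
  move=> D hD hc; exists (finmap.enum_fset D); split=> [p /hD|x /hc[p pD xp]].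
    by rewrite inE.
  by exists p.
move: cov => /choice[D hD].
pose code w := pickle [seq (p, Num.floor (F w (cubept p.1) / (s / 3))) | p <- D w].
exists code => w w' /(pcan_inj pickleK) ww' x cx.
have [[D1 D2] [D1' _]] := (hD w, hD w').
have DD : D w = D w'.
  by have := congr1 (map fst) ww'; rewrite -!map_comp !map_id.
have [p pD xp] := D2 x cx.
have pD' : p \in D w' by rewrite -DD.
have fE : Num.floor (F w (cubept p.1) / (s / 3)) = Num.floor (F w' (cubept p.1) / (s / 3)).
  move: ww'; rewrite -DD => /eq_in_map/(_ p pD)[]//.
have h1 := D1 p pD x cx xp; have h2 := D1' p pD' x cx xp.
have h3 : `|F w (cubept p.1) - F w' (cubept p.1)| <= s / 3.
  have := floor_itv (F w (cubept p.1) / (s / 3)); rewrite fE.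
  have := floor_itv (F w' (cubept p.1) / (s / 3)).
  set n : R := (Num.floor _)%:~R; rewrite intrD -/n.
  move=> /andP[]; rewrite ler_pdivlMr// ltr_pdivrMr// => a1 a2.
  move=> /andP[]; rewrite ler_pdivlMr// ltr_pdivrMr// => b1 b2.
  by rewrite ler_norml; apply/andP; split; lra.
rewrite (_ : _ - _ = (F w x - F w (cubept p.1)) + (F w (cubept p.1) - F w' (cubept p.1))
   - (F w' x - F w' (cubept p.1))); last by ring.
apply: le_trans (ler_normB _ _) _;
  have := ler_normD (F w x - F w (cubept p.1)) (F w (cubept p.1) - F w' (cubept p.1)).
by lra.
Qed.

Lemma C0_codes (I : finType) (F : W -> I -> 'rV[R]_k -> R) (s : R) : 0 < s ->
  (forall w i, cube_continuous (F w i)) ->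
  exists code : W -> nat, forall w w', code w = code w' ->
    forall i x, cube x -> `|F w i x - F w' i x| <= s.
Proof.
move=> s0 cF.
have : forall i, exists code : W -> nat, forall w w', code w = code w' ->
    forall x, cube x -> `|F w i x - F w' i x| <= s.
  by move=> i; exact: (@C0_code (fun w => F w i)).
move=> /choice[c hc]; exists (fun w => pickle [ffun i => c i w]).
move=> w w' /(pcan_inj pickleK)/ffunP ww' i x cx.
by apply: hc => //; have := ww' i; rewrite !ffunE.
Qed.
End countable_codes.

Section partials.
Context {R : realType} {k : nat}.
Implicit Types (f g z : 'rV[R]_k -> R) (x y : 'rV[R]_k) (j : 'I_k).
Local Notation ej j := (delta_mx ord0 j : 'rV[R]_k).

Lemma shift_entry x (t : R) j i : (x + t *: ej j) ord0 i = x ord0 i + t * (i == j)%:R.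
Proof. by rewrite !mxE eqxx. Qed.

Lemma cube_shift x (t : R) j : cube x -> `|x ord0 j + t| <= 1 -> cube (x + t *: ej j).
Proof.
move=> cx h i; rewrite shift_entry; have [->|_] := eqVneq i j; first by rewrite mulr1.
by rewrite mulr0 addr0.
Qed.

(* A sequence of increments in direction [j] staying in the cube at [x]. *)
Definition inward x j (n : nat) : R := (if x ord0 j <= 0 then 1 else -1) / n.+1%:R.

Lemma inward_norm x j n : `|inward x j n| = n.+1%:R^-1.
Proof.
by rewrite normrM (ger0_norm (x := _^-1)) ?invr_ge0//; case: ifP; rewrite ?normrN normr1 mul1r.
Qed.

Lemma inward_neq0 x j n : inward x j n != 0.
Proof. by rewrite -normr_gt0 inward_norm invr_gt0. Qed.

Lemma cube_inward x j n : cube x -> cube (x + inward x j n *: ej j).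
Proof.
move=> cx; apply: cube_shift => //.
have a1 : n.+1%:R^-1 <= 1 :> R by rewrite invf_le1// ler1n.
have a0 : 0 < n.+1%:R^-1 :> R by rewrite invr_gt0.
have := cx j; rewrite !ler_norml /inward; set a := n.+1%:R^-1 in a0 a1 *.
by case: (leP (x ord0 j) 0) => h /andP[h1 h2]; apply/andP; split; lra.
Qed.

Lemma inward_small x j (r : R) : 0 < r -> exists n, `|inward x j n| < r.
Proof.
move=> r0; exists (Num.truncn (r^-1)); rewrite inward_norm -[ltRHS]invrK.
by rewrite ltf_pV2 ?posrE ?invr_gt0//; exact: truncnS_gt.
Qed.

Definition quot f j x (t : R) : R := t^-1 * (f (x + t *: ej j) - f x).

Lemma quotP f j x (d : R) : cube_quotient f j x --> d <->
  forall e : R, 0 < e -> exists2 r : R, 0 < r &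
    forall t, t != 0 -> `|t| < r -> cube (x + t *: ej j) -> `|d - quot f j x t| < e.
Proof.
split=> h.
  move=> e e0; have /cvgrPdist_lt/(_ _ e0) := h.
  rewrite /prop_near1/= /within/= /dnbhs/= /within/= -nbhs_ballE => -[r /= r0 hr].
  exists r => // t t0 tr ct; apply: hr => //.
  by rewrite /ball/= sub0r normrN.
apply/cvgrPdist_lt => e e0; have [r r0 hr] := h e e0.
rewrite /prop_near1/= /within/= /dnbhs/= /within/= -nbhs_ballE; exists r => //= t.
by rewrite /ball/= sub0r normrN => tr t0 ct; exact: hr.
Qed.

Lemma quot_filter_proper j x : cube x ->
  ProperFilter (within [set t : R | cube (x + t *: ej j)] 0^').
Proof.
move=> cx; split; last exact: within_filter.
rewrite /within/= /dnbhs/= /within/= -nbhs_ballE => -[r /= r0 hr].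
have [n nr] := inward_small x j r0.
apply: (hr (inward x j n)); [|exact: inward_neq0|exact: cube_inward].
by rewrite /ball/= sub0r normrN.
Qed.

Lemma cube_partialP f j x : cube x -> cvg (cube_quotient f j x) ->
  cube_quotient f j x --> cube_partial f j x.
Proof. by []. Qed.

Lemma cube_partialE f j x d : cube x -> cube_quotient f j x --> d ->
  cube_partial f j x = d.
Proof.
move=> cx h; have pf := quot_filter_proper j cx.
exact: (@cvg_lim R (@norm_hausdorff _ _) _ _ pf _ _ h).
Qed.

Lemma cvg_quotB f g j x d d' : cube_quotient f j x --> d -> cube_quotient g j x --> d' ->
  cube_quotient (f \- g) j x --> d - d'.
Proof.
move=> /quotP hf /quotP hg; apply/quotP => e e0.
have e2 : 0 < e / 2 by rewrite divr_gt0.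
have [r r0 hr] := hf _ e2; have [s s0 hs] := hg _ e2.
exists (Num.min r s); first by rewrite lt_min r0.
move=> t t0; rewrite lt_min => /andP[tr ts] ct.
have -> : d - d' - quot (f \- g) j x t = (d - quot f j x t) - (d' - quot g j x t).
  by rewrite /quot /=; ring.
by apply: le_lt_trans (ler_normB _ _) _; rewrite (splitr e) ltrD ?hr ?hs.
Qed.

Lemma cube_segment x (t s : R) j : 0 <= s <= t -> cube x -> cube (x + t *: ej j) ->
  cube (x + s *: ej j).
Proof.
move=> /andP[s0 st] cx ct; apply: cube_shift => //.
have := cx j; have := ct j; rewrite shift_entry eqxx mulr1 !ler_norml.
by move=> /andP[a1 a2] /andP[b1 b2]; apply/andP; split; lra.
Qed.

(** The mean value theorem along the segment. At its interior points small increments stay in the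
    cube by convexity, so [cube_quotient] provides a two-sided derivative; continuity on the closed
    segment comes from the boundedness of the quotients near each point. *)
Lemma line_le_pos f (c : R) j x (t : R) : (forall y, cube y -> cvg (cube_quotient f j y)) ->
  (forall y, cube y -> `|cube_partial f j y| <= c) -> cube x -> 0 < t ->
  cube (x + t *: ej j) -> `|f (x + t *: ej j) - f x| <= c * t.
Proof.
move=> cf fc cx t0 ct; pose phi (s : R) : R := f (x + s *: ej j).
have cs s : 0 <= s <= t -> cube (x + s *: ej j) by move=> st; exact: cube_segment st cx ct.
have q s : 0 <= s <= t -> forall e : R, 0 < e -> exists2 r : R, 0 < r & forall h,
    h != 0 -> `|h| < r -> 0 <= s + h <= t ->
    `|cube_partial f j (x + s *: ej j) - h^-1 * (phi (s + h) - phi s)| < e.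
  move=> st e e0; have /cf/cube_partialP/quotP := cs s st.
  move=> /(_ (cs s st) _ e0)[r r0 hr]; exists r => // h h0 hrr sht.
  have := hr h h0 hrr; rewrite /quot /phi scalerDl addrA; apply.
  by rewrite -addrA -scalerDl; exact: cs.
have [s sin] : exists2 s : R, s \in `]0, t[ &
    phi t - phi 0 = cube_partial f j (x + s *: ej j) * (t - 0).
  apply: (@MVT R phi (fun s => cube_partial f j (x + s *: ej j)) 0 t t0).
- move=> s; rewrite in_itv/= => /andP[s0 st].
  have sin : 0 <= s <= t by rewrite !ltW.
  have lim1 : (fun h : R => h^-1 *: (phi (h *: 1 + s) - phi s)) @ 0^' -->
      cube_partial f j (x + s *: ej j).
    apply/cvgrPdist_lt => e e0; have [r r0 hr] := q s sin e e0.
    rewrite /prop_near1/= /dnbhs/= /within/= -nbhs_ballE.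
    exists (Num.min r (Num.min s (t - s))); first by rewrite /= !lt_min r0 s0 subr_gt0.
    move=> h; rewrite /ball/= sub0r normrN !lt_min => /andP[h1 /andP[h2 h3]] h0.
    rewrite /GRing.scale/= mulr1 (addrC h); apply: hr => //.
    move: h2 h3; rewrite !ltr_norml => /andP[? ?] /andP[? ?]; apply/andP; split; lra.
  apply: DeriveDef.
    by apply/cvg_ex; exists (cube_partial f j (x + s *: ej j)).
  exact: (@cvg_lim R (@norm_hausdorff _ _) _ _ _ _ _ lim1).
- apply/subspace_continuousP => s; rewrite /= in_itv/= => sin.
  apply/cvgrPdist_lt => e e0; have [r r0 hr] := q s sin 1 ltr01.
  have c1 : 0 < c + 1.
    by rewrite ltr_wpDl// (le_trans _ (fc _ (cs s sin))).
  rewrite /prop_near1/= /within/= -nbhs_ballE.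
  exists (Num.min r (e / (c + 1))); first by rewrite /= lt_min r0 divr_gt0.
  move=> u; rewrite /ball/= lt_min in_itv/= => /andP[u1 u2] uin; rewrite /from_subspace.
  have [->|us] := eqVneq u s; first by rewrite subrr normr0.
  have h0 : u - s != 0 by rewrite subr_eq0.
  have := hr (u - s) h0; rewrite distrC => /(_ u1); rewrite addrCA subrr addr0 => /(_ uin) hq.
  have hq2 : `|(u - s)^-1 * (phi u - phi s)| < c + 1.
    have := fc _ (cs s sin); move: hq; set a := cube_partial _ _ _; set b := _ * _.
    move=> h1 h2; rewrite -(subrK a b); apply: le_lt_trans (ler_normD _ _) _.
    by rewrite distrC addrC ler_ltD.
  rewrite distrC; apply: (@le_lt_trans _ _ (`|u - s| * (c + 1))).
    have -> : phi u - phi s = (u - s) * ((u - s)^-1 * (phi u - phi s)) by rewrite mulrA divff// mul1r.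
    by rewrite normrM ler_wpM2l// ltW.
  by rewrite -ltr_pdivlMr// distrC.
rewrite subr0 /phi scale0r addr0 => ->; rewrite normrM (gtr0_norm t0).
rewrite ler_wpM2r// ?(ltW t0)// fc//; apply: cs.
by move: sin; rewrite in_itv/= => /andP[? ?]; rewrite !ltW.
Qed.

Lemma line_le f (c : R) j x (t : R) : (forall y, cube y -> cvg (cube_quotient f j y)) ->
  (forall y, cube y -> `|cube_partial f j y| <= c) -> cube x ->
  cube (x + t *: ej j) -> `|f (x + t *: ej j) - f x| <= c * `|t|.
Proof.
move=> cf fc cx ct; have [t0|t0|->] := ltgtP t 0; last first.
- by rewrite scale0r addr0 subrr !normr0 mulr0.
- by rewrite (gtr0_norm t0); apply: line_le_pos.
have xE : x = (x + t *: ej j) + (- t) *: ej j by rewrite scaleNr addrK.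
rewrite distrC {1}xE (ltr0_norm t0); apply: line_le_pos => //; first by rewrite oppr_gt0.
by rewrite -xE.
Qed.

Definition splice x y (m : nat) : 'rV[R]_k := \row_i if (i < m)%N then x ord0 i else y ord0 i.

Lemma cube_splice x y m : cube x -> cube y -> cube (splice x y m).
Proof. by move=> cx cy i; rewrite mxE; case: ifP. Qed.

Lemma spliceS x y (i : 'I_k) :
  splice x y i.+1 = splice x y i + (x ord0 i - y ord0 i) *: ej i.
Proof.
apply/rowP => l; rewrite !mxE eqxx /= ltnS leq_eqVlt.
have [->|li] := eqVneq l i; first by rewrite eqxx ltnn mulr1 addrCA subrr addr0.
by rewrite (negbTE li : (l == i :> nat) = false) /= mulr0 addr0.
Qed.

(** [splice x y m] turns [y] into [x] one coordinate at a time and never leaves the cube, which is a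
    product; each change is a move along one axis, covered by [line_le]. *)
Lemma partial_cubes_lip f (K : 'I_k -> R) :
  (forall j y, cube y -> cvg (cube_quotient f j y)) ->
  (forall j y, cube y -> `|cube_partial f j y| <= K j) -> cubes_lip K f.
Proof.
move=> cf fK x y cx cy.
have H m : (m <= k)%N -> `|f (splice x y m) - f y| <=
    \sum_(j < k | (j < m)%N) K j * `|x ord0 j - y ord0 j|.
  elim: m => [|m IH] mk.
    rewrite big_pred0// (_ : splice x y 0 = y) ?subrr ?normr0//.
    by apply/rowP => i; rewrite mxE.
  pose i := Ordinal mk.
  have sE : splice x y m.+1 = splice x y m + (x ord0 i - y ord0 i) *: ej i := spliceS x y i.
  rewrite (bigD1 i) /=; last exact: leqnn.
  rewrite (eq_bigl (fun j : 'I_k => (j < m)%N)); last first.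
    by move=> j; rewrite -val_eqE/= ltnS ltn_neqAle andbC.
  apply: le_trans (lerD _ (IH (ltnW mk))); last first.
    apply: (@line_le f (K i) i (splice x y m) (x ord0 i - y ord0 i)) => //.
    - exact: cf.
    - exact: fK.
    - exact: cube_splice.
    - by rewrite -sE; exact: cube_splice.
  by rewrite -sE; exact: ler_distD.
have := H k (leqnn k); rewrite (_ : splice x y k = x); last first.
  by apply/rowP => i; rewrite mxE ltn_ord.
by rewrite (eq_bigl xpredT)// => j; rewrite ltn_ord.
Qed.

Lemma cubes_lip_partial f (K : 'I_k -> R) j x : cubes_lip K f -> cube x ->
  cvg (cube_quotient f j x) -> `|cube_partial f j x| <= K j.
Proof.
move=> fK cx /(cube_partialP cx)/quotP h; apply/ler_addgt0Pr => e e0.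
have [r r0 hr] := h e e0; have [n nr] := inward_small x j r0.
have ci := cube_inward j n cx.
have := hr _ (inward_neq0 x j n) nr ci; set d := cube_partial f j x; set t := inward x j n.
have t0 : 0 < `|t| by rewrite normr_gt0 inward_neq0.
have qK : `|quot f j x t| <= K j.
  rewrite /quot normrM normfV mulrC ler_pdivrMr//.
  apply: le_trans (fK _ _ ci cx) _; rewrite (bigD1 j)//= big1 ?addr0.
    by rewrite shift_entry eqxx mulr1 addrAC subrr add0r.
  by move=> i ij; rewrite shift_entry (negbTE ij) mulr0 addr0 subrr normr0 mulr0.
move=> dq; rewrite -(subrK (quot f j x t) d) addrC; apply: le_trans (ler_normD _ _) _.
by rewrite lerD// ltW.
Qed.

Lemma space_C1_quot f j x : space_C1 f ->
  cube_quotient f j x --> 'D_(ej j) (f : 'rV[R]_k -> R^o) x.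
Proof.
move=> /(_ j)[/(_ x) df _].
apply/quotP => e e0; have /cvgrPdist_lt/(_ _ e0) := df.
rewrite /prop_near1/= /dnbhs/= /within/= -nbhs_ballE => -[r /= r0 hr].
exists r => // t t0 tr _; have := hr t; rewrite /ball/= sub0r normrN => /(_ tr t0).
by rewrite /quot (addrC (t *: _)).
Qed.

Lemma space_C1_cube f : space_C1 f -> continuous f -> cube_C1 f.
Proof.
move=> c1 cf; split; first exact: continuous_subspaceT.
move=> j; split=> [x cx|].
  by apply/cvg_ex; exists ('D_(ej j) (f : 'rV[R]_k -> R^o) x); exact: space_C1_quot.
have /(_ j)[_ cD] := c1; apply/cube_continuousP => x cx e e0.
have /continuous_subspaceT/cube_continuousP/(_ x cx e e0)[r r0 hr] := cD.
exists r => // y cy xy;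
rewrite (cube_partialE cx (@space_C1_quot f j x c1)) (cube_partialE cy (@space_C1_quot f j y c1)).
exact: hr.
Qed.

(** A single sequence of increments computes the derivative, which makes partial derivatives of
    random functions measurable. *)
Lemma partial_inward_lim f j x : cube x -> cvg (cube_quotient f j x) ->
  quot f j x (inward x j n) @[n --> \oo] --> cube_partial f j x.
Proof.
move=> cx /(cube_partialP cx)/quotP h; apply/cvgrPdist_lt => e e0.
have [r r0 hr] := h e e0; near=> n; apply: hr.
- exact: inward_neq0.
- rewrite inward_norm; near: n; exact: near_infty_natSinv_lt (PosNum r0).
- exact: cube_inward.
Unshelve. all: by end_near. Qed.

End partials.

(** * Shifts by RKHS functions *)

Section kernel_space.
Context {R : realType} {T : eqType} (D : set T) (k : T -> T -> R).
Hypothesis ksym : forall s t, k s t = k t s.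
Hypothesis kpos : forall u : seq (R * T), 0 <= kinner k u u.
Implicit Types u v : seq (R * T).

Lemma ksubE u v : ksub u v = u ++ lscale (-1) v.
Proof. by rewrite /ksub /lscale; congr cat; apply: eq_map => p; rewrite mulN1r. Qed.

Lemma knorm_ge0 u : 0 <= knorm k u. Proof. exact: sqrtr_ge0. Qed.

Lemma knorm_sqr u : knorm k u ^+ 2 = kinner k u u.
Proof. by rewrite sqr_sqrtr. Qed.

Lemma kinner_sqr_le u v : (kinner k u v) ^+ 2 <= kinner k u u * kinner k v v.
Proof.
have Q (t : R) : 0 <= kinner k u u + t * kinner k u v *+ 2 + t ^+ 2 * kinner k v v.
  have := kpos (u ++ lscale t v).
  rewrite kin_catl !(kin_catr ksym) !kin_scalel !(kin_scaler ksym) (kinC ksym v u).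
  by congr (0 <= _); ring.
set a := kinner k u u in Q *; set b := kinner k u v in Q *; set c := kinner k v v in Q *.
have c0 : 0 <= c := kpos v.
have a0 : 0 <= a := kpos u.
have [c00|cn0] := eqVneq c 0.
  have [->|b0] := eqVneq b 0; first by rewrite expr0n mulr_ge0.
  have := Q (- (a + 1) / (2 * b)); rewrite c00 mulr0 addr0.
  have -> : - (a + 1) / (2 * b) * b *+ 2 = - (a + 1) by rewrite mulr2n; field.
  by lra.
have := Q (- b / c).
have -> : a + - b / c * b *+ 2 + (- b / c) ^+ 2 * c = a - b ^+ 2 / c by rewrite mulr2n; field.
by rewrite subr_ge0 ler_pdivrMr// lt_neqAle eq_sym cn0.
Qed.

Lemma kinner_norm_le u v : `|kinner k u v| <= knorm k u * knorm k v.
Proof.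
rewrite -sqrtrM// -(sqrtr_sqr (kinner k u v)) ler_sqrt ?mulr_ge0//.
exact: kinner_sqr_le.
Qed.

Lemma knorm_diff_le u v : `|knorm k u - knorm k v| <= knorm k (ksub u v).
Proof.
have uv : kinner k (ksub u v) (ksub u v) = knorm k u ^+ 2 - kinner k u v *+ 2 + knorm k v ^+ 2.
  rewrite !knorm_sqr ksubE kin_catl !(kin_catr ksym) !kin_scalel !(kin_scaler ksym) (kinC ksym v u).
  by ring.
rewrite -(sqrtr_sqr (knorm k u - knorm k v)) ler_sqrt// uv sqrrB lerD2r lerD2l lerN2.
by rewrite ler_pMn2r// (le_trans (ler_norm _))// kinner_norm_le.
Qed.

Lemma cvg_real_cauchy (F : set_system R) : ProperFilter F ->
  (forall e : R, 0 < e -> exists x, F (ball x e)) -> cvg F.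
Proof. by move=> FF h; apply/cauchy_cvgP/cauchy_exP. Qed.

(** [rkhs_norm] is a value picked by [get], so an approximating sequence realizing that very value
    is picked along with it; candidates exist because the norms along a Cauchy sequence converge, by
    the triangle inequality. *)
Lemma rkhs_seq (g : T -> R) : rkhs D k g ->
  exists u : nat -> seq (R * T), rkhs_approx D k u g /\
    knorm k (u n) @[n --> \oo] --> rkhs_norm D k g.
Proof.
move=> [u ug].
have [v vg vr] : exists2 u, rkhs_approx D k u g & knorm k (u n) @[n --> \oo] --> rkhs_norm D k g.
  apply: (@getPex _ [set r : R | exists2 u, rkhs_approx D k u g & knorm k (u n) @[n --> \oo] --> r]).
  have /cvg_ex[r hr] : cvg (knorm k (u n) @[n --> \oo]).
    apply: cvg_real_cauchy => e e0; have [_ /(_ e e0)[N hN] _] := ug.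
    exists (knorm k (u N)); exists N => // n Nn; rewrite /ball/=.
    exact: le_lt_trans (knorm_diff_le _ _) (hN _ _ (leqnn _) Nn).
  by exists r, u.
by exists v.
Qed.
End kernel_space.

Lemma lin0 {R : realType} {T : eqType} (s : seq (R * T)) : lin s (fun=> 0) = 0.
Proof. by rewrite /lin big1// => p _; rewrite mulr0. Qed.

Section cameron_martin_limit.
Context {R : realType} {T : eqType} (D : set T) (mu : probability (paths R T) R)
  (k : T -> T -> R).
Hypothesis gmu : gaussian_on mu k.
Variables (s : nat -> seq (R * T)) (c : nat -> R).
Hypothesis sD : forall i p, p \in s i -> D p.2.

(** Finitely many of the constraints of [linbox_all], with a slack: pointwise convergence of kernel
    combinations to [g] controls only finitely many forms at once. *)
Definition linbox (g : T -> R) (m : nat) (e : R) : set (paths R T) :=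
  [set x | forall i, (i < m)%N -> `|lin (s i) x - lin (s i) g| <= c i + e].

Definition linbox_all (g : T -> R) : set (paths R T) :=
  [set x | forall i, `|lin (s i) x - lin (s i) g| <= c i].

Lemma measurable_linbox g m e : measurable (linbox g m e).
Proof.
rewrite (_ : linbox g m e = \bigcap_(i in [set i | (i < m)%N])
   [set x : paths R T | `|lin (s i) x - lin (s i) g| <= c i + e]).
  apply: bigcap_measurableType => i _.
  have mf : measurable_fun setT (fun x : paths R T => `|lin (s i) x - lin (s i) g|).
    apply: measurableT_comp => //; apply: measurable_funB => //; exact: measurable_lin.
  by have := mf measurableT _ (measurable_itv `]-oo, (c i + e)]); rewrite setTI;
    congr measurable; apply/seteqP; split => x /=; rewrite in_itv.
by apply/seteqP; split.
Qed.

Lemma linbox_allE g : linbox_all g = \bigcap_m linbox g m m.+1%:R^-1.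
Proof.
apply/seteqP; split=> x /= h.
  by move=> m _ i im; apply: le_trans (h i) _; rewrite lerDl invr_ge0.
move=> i; apply/ler_addgt0Pr => e e0.
pose m := maxn i.+1 (Num.truncn e^-1).
apply: le_trans (h m I i _) _; first by rewrite leq_max leqnn.
rewrite lerD2l -[leRHS]invrK lef_pV2 ?posrE ?invr_gt0//.
apply: (le_trans (ltW (truncnS_gt _))); rewrite ler_nat ltnS leq_max leqnn orbT//.
Qed.

Lemma measurable_linbox_all g : measurable (linbox_all g).
Proof. by rewrite linbox_allE; apply: bigcapT_measurable => m; exact: measurable_linbox. Qed.

Lemma indic_linbox_cvg g (x : paths R T) :
  \1_(linbox g m m.+1%:R^-1) x @[m --> \oo] --> (\1_(linbox_all g) x : R).
Proof.
have [gx|ngx] := pselect (linbox_all g x).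
  rewrite indicE mem_set//; apply: cvg_near_cst; near=> m.
  by rewrite indicE mem_set//; move: gx; rewrite linbox_allE => /(_ m I).
rewrite indicE memNset//; move: ngx; rewrite linbox_allE => /existsNP[m /not_implyP[_ nm]].
apply: cvg_near_cst; exists m => // n /= mn; rewrite indicE memNset// => h; apply: nm.
move=> i im; apply: le_trans (h i (leq_trans im mn)) _.
by rewrite lerD2l lef_pV2 ?posrE// ler_nat ltnS.
Unshelve. all: by end_near. Qed.

(** [cameron_martin] for the combinations approximating [g] bounds each relaxed box from below, with
    the limit norm in the exponent; the relaxed boxes then decrease to [linbox_all g]. The limit in
    [n] is taken for fixed [m], before the one in [m]. *)
Lemma cameron_martin_rkhs (g : T -> R) : rkhs D k g ->
  expR (- (rkhs_norm D k g ^+ 2 * gvar / 2)) * Ex mu \1_(linbox_all (fun=> 0)) <=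
  Ex mu \1_(linbox_all g).
Proof.
have [ksym kpos _] := gmu; move=> /(rkhs_seq ksym kpos)[u [[uD _ ucv] unorm]].
set r := rkhs_norm D k g in unorm *.
have lcv i : lin (s i) (kcomb k (u n)) @[n --> \oo] --> lin (s i) g.
  rewrite /lin; have := sD (i := i); elim: (s i) => [_|p l IH sDi].
    rewrite big_nil (_ : (fun _ => _) = cst 0); first exact: cvg_cst.
    by apply/funext => n; rewrite big_nil.
  rewrite big_cons (_ : (fun _ => _) = (fun n => p.1 * kcomb k (u n) p.2 +
      \sum_(q <- l) q.1 * kcomb k (u n) q.2)); last by apply/funext => n; rewrite big_cons.
  apply: cvgD; first by apply: cvgMr; apply: ucv; apply: sDi; rewrite mem_head.
  by apply: IH => q ql; apply: sDi; rewrite in_cons ql orbT.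
set a := Ex mu \1_(linbox_all (fun=> 0)).
have step m : expR (- (r ^+ 2 * gvar / 2)) * a <= Ex mu \1_(linbox g m m.+1%:R^-1).
  have ev : \forall n \near \oo, expR (- (knorm k (u n) ^+ 2 * gvar / 2)) * a <=
       Ex mu \1_(linbox g m m.+1%:R^-1).
    have m0 : 0 < m.+1%:R^-1 :> R by rewrite invr_gt0.
    have near_all l : \forall n \near \oo, forall i, (i < l)%N ->
        `|lin (s i) (kcomb k (u n)) - lin (s i) g| <= m.+1%:R^-1.
      elim: l => [|l IH]; first by near=> n.
      have /cvgrPdist_le/(_ _ m0) hl := lcv l.
      near=> n => i; rewrite ltnS leq_eqVlt => /orP[/eqP ->|il].
        by rewrite distrC; near: n.
      by move: i il; near: n.
    apply: filterS (near_all m) => n hn; rewrite knorm_sqr//.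
    apply: le_trans (cameron_martin gmu (u n) (measurable_linbox_all (fun=> 0)) _) _.
      by move=> x h i; have := h i; rewrite lin_scalep !lin0 !subr0 mulN1r normrN.
    apply: le_Ex.
    - apply: (bm_comp (bm_indic (measurable_linbox_all (fun=> 0)))).
      exact: measurable_shiftp.
    - by apply: bm_indic; exact: measurable_linbox.
    - move=> x; rewrite !indicE.
      have [h|_] := boolP (_ \in linbox_all _); last by rewrite ler0n.
      rewrite mem_set// => i im; move: h; rewrite inE => /(_ i).
      rewrite lin0 subr0 /shiftp linB => hi; have := hn i im => hg.
      apply: le_trans (ler_distD (lin (s i) (kcomb k (u n))) _ _) _.
      exact: lerD.
  have lim_e : expR (- (knorm k (u n) ^+ 2 * gvar / 2)) * a @[n --> \oo] -->
      expR (- (r ^+ 2 * gvar / 2)) * a.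
    apply: cvgM; last exact: cvg_cst.
    apply: (@continuous_cvg _ _ _ _ _ (fun n => - (knorm k (u n) ^+ 2 * gvar / 2)) expR);
      first exact: continuous_expR.
    apply: cvgN; apply: cvgM; last exact: cvg_cst.
    by apply: cvgM; [exact: cvgM|exact: cvg_cst].
  exact: (cvgr_to_le lim_e ev).
have lim_box : Ex mu \1_(linbox g m m.+1%:R^-1) @[m --> \oo] --> Ex mu \1_(linbox_all g).
  apply: (@Ex_lim _ _ _ _ (fun m => \1_(linbox g m m.+1%:R^-1)) _ 1).
  - by move=> m; apply: measurable_indic; exact: measurable_linbox.
  - by move=> m x; rewrite indicE; case: (_ \in _); rewrite ?normr1 ?normr0.
  - by move=> x; exact: indic_linbox_cvg.
apply: (cvgr_to_ge lim_box); near=> m; exact: step.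
Unshelve. all: by end_near. Qed.
End cameron_martin_limit.

Section random_functions.
Context {R : realType} {k : nat} {d : measure_display} {W : measurableType d}.
Variable F : W -> 'rV[R]_k -> R.
Hypothesis cF : forall w, cube_continuous (F w).
Hypothesis mF : forall x, cube x -> measurable_fun setT (fun w => F w x).

Lemma csup_leE (c : R) : [set w | (csup (F w) <= c%:E)%E] =
  \bigcap_n [set w | `|F w (cubept n)| <= c].
Proof.
apply/seteqP; split=> w /=.
  by move=> /csup_leP h n _; apply: h; exact: cube_cubept.
move=> h; apply/csup_leP; apply: dense_le => [|n]; first exact: cF.
exact: (h n I).
Qed.

Lemma measurable_norm_le (f : W -> R) (c : R) : measurable_fun setT f ->
  measurable [set w | `|f w| <= c].
Proof.
move=> mf; have mn : measurable_fun setT (fun w => `|f w|) by exact: measurableT_comp.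
have := mn measurableT _ (measurable_itv `]-oo, c]); rewrite setTI.
by congr measurable; apply/seteqP; split => w /=; rewrite in_itv.
Qed.

Lemma measurable_csup_le (c : R) : measurable [set w | (csup (F w) <= c%:E)%E].
Proof.
rewrite csup_leE; apply: bigcapT_measurable => n; apply: measurable_norm_le.
by apply: mF; exact: cube_cubept.
Qed.

Lemma measurable_csup_lt (c : R) : measurable [set w | (csup (F w) < c%:E)%E].
Proof.
rewrite (_ : mkset _ = \bigcup_n [set w | (csup (F w) <= (c - n.+1%:R^-1)%:E)%E]).
  by apply: bigcupT_measurable => n; exact: measurable_csup_le.
apply/seteqP; split=> w /=.
  move=> /csup_ltP[b bc hb].
  have cb : 0 < (c - b)^-1 by rewrite invr_gt0 subr_gt0.
  exists (Num.truncn (c - b)^-1) => //=; apply/csup_leP => x cx; apply: le_trans (hb x cx) _.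
  rewrite lerBrDr -lerBrDl -[leRHS]invrK lef_pV2 ?posrE//.
  exact: ltW (truncnS_gt _).
move=> [n _ /= /csup_leP h]; apply/csup_ltP; exists (c - n.+1%:R^-1) => //.
by rewrite ltrBlDr ltrDl invr_gt0.
Qed.
End random_functions.

(** Cauchy-Schwarz for [kinner], passed to the limit; it transfers smallness of a form in kernel
    norm to every function of the space. *)
Lemma rkhs_lin_le {R : realType} {T : eqType} (D : set T) (k : T -> T -> R)
    (s : seq (R * T)) (g : T -> R) :
  (forall t u, k t u = k u t) -> (forall u : seq (R * T), 0 <= kinner k u u) ->
  (forall p, p \in s -> D p.2) -> rkhs D k g ->
  `|lin s g| <= rkhs_norm D k g * knorm k s.
Proof.
move=> ksym kpos sD /(rkhs_seq ksym kpos)[u [[_ _ ucv] unorm]].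
have l1 : `|lin s (kcomb k (u n))| @[n --> \oo] --> `|lin s g|.
  apply: cvg_norm; rewrite /lin; move: sD; elim: s => [_|p l IH sD].
    rewrite big_nil (_ : (fun _ => _) = cst 0); first exact: cvg_cst.
    by apply/funext => n; rewrite big_nil.
  rewrite big_cons (_ : (fun _ => _) = (fun n => p.1 * kcomb k (u n) p.2 +
      \sum_(q <- l) q.1 * kcomb k (u n) q.2)); last by apply/funext => n; rewrite big_cons.
  apply: cvgD; first by apply: cvgMr; apply: ucv; apply: sD; rewrite mem_head.
  by apply: IH => q ql; apply: sD; rewrite in_cons ql orbT.
have l2 : knorm k (u n) * knorm k s @[n --> \oo] --> rkhs_norm D k g * knorm k s.
  by apply: cvgM => //; exact: cvg_cst.
apply: (ler_cvg_to l1 l2); near=> n.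
by rewrite lin_kcomb// kinner_norm_le.
Unshelve. all: by end_near. Qed.

Section smooth_process.
Context {R : realType} {k : nat} {d : measure_display} {W : measurableType d}.
Variables (P : probability W R) (Z : 'rV[R]_k -> {RV P >-> R}).
Hypothesis Zc : forall w, continuous (realization Z w).
Hypothesis Z1 : forall w, space_C1 (realization Z w).
Local Notation ej j := (delta_mx ord0 j : 'rV[R]_k).
Local Notation K := (cov_kernel Z).

Lemma realization_C1 w : cube_C1 (realization Z w).
Proof. exact: space_C1_cube. Qed.

Lemma realization_quot w j x : cube x -> cvg (cube_quotient (realization Z w) j x).
Proof. by move=> cx; have [_ /(_ j)[h _]] := realization_C1 w; exact: h. Qed.

Lemma measurable_realization x : measurable_fun setT (fun w => realization Z w x).
Proof. exact: measurable_funP. Qed.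

Lemma measurable_partial j x : cube x ->
  measurable_fun setT (fun w => cube_partial (realization Z w) j x).
Proof.
move=> cx; apply: (@measurable_fun_cvg _ _ _ setT
  (fun n w => quot (realization Z w) j x (inward x j n))).
- move=> n; apply: measurable_funM => //.
  by apply: measurable_funB; exact: measurable_realization.
- by move=> w _; apply: partial_inward_lim => //; exact: realization_quot.
Qed.

Definition quotlin j x (t : R) : seq (R * 'rV[R]_k) := [:: (t^-1, x + t *: ej j); (- t^-1, x)].

Lemma lin_quotlin j x t f : lin (quotlin j x t) f = quot f j x t.
Proof. by rewrite /lin /quotlin !big_cons big_nil addr0 /quot /= mulNr -mulrBr. Qed.

Hypothesis gZ : centered_gaussian_process Z.
Let gmu := gaussian_process_law gZ.
Let ksym : forall s t, K s t = K t s. Proof. by have [] := gmu. Qed.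
Let kpos : forall s : seq (R * 'rV[R]_k), 0 <= kinner K s s. Proof. by have [] := gmu. Qed.

(* A sequence of Gaussian variables tending to 0 almost surely tends to 0 in
   quadratic mean. *)
Lemma knorm_cvg0 (s : nat -> seq (R * 'rV[R]_k)) :
  (forall w, lin (s n) (realization Z w) @[n --> \oo] --> 0) ->
  forall eta : R, 0 < eta -> \forall n \near \oo, knorm K (s n) <= eta.
Proof.
move=> h eta eta0.
have pk : 0 < normal_peak (1 : R) by rewrite normal_peak_gt0.
(* The threshold for which the variance bound of [lin_small_variance] is exactly [eta ^+ 2]. *)
pose e : R := eta / (4 * normal_peak 1 * Num.sqrt gvar).
have sg : 0 < Num.sqrt (gvar : R) by rewrite sqrtr_gt0 gvar_gt0.
have e0 : 0 < e by rewrite divr_gt0// !mulr_gt0.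
have mA n : measurable [set w | `|lin (s n) (path_of Z w)| <= e].
  apply: measurable_norm_le; apply: (measurableT_comp (measurable_lin (s n))).
  exact: measurable_path_of.
have lim1 : Ex P \1_[set w | `|lin (s n) (path_of Z w)| <= e] @[n --> \oo] --> (1 : R).
  rewrite -[X in _ --> X](Ex_cst P 1).
  apply: (@Ex_lim _ _ _ P (fun n => \1_[set w | `|lin (s n) (path_of Z w)| <= e]) _ 1).
  - by move=> n; apply: measurable_indic.
  - by move=> n w; rewrite indicE; case: (_ \in _); rewrite ?normr1 ?normr0.
  - move=> w; apply: cvg_near_cst; have /cvgrPdist_le/(_ _ e0) := h w.
    by apply: filterS => n; rewrite sub0r normrN => hn; rewrite indicE mem_set.
have /cvgrPdist_le/(_ (2^-1)) := lim1; rewrite invr_gt0 ltr0n => /(_ isT).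
apply: filterS => n; rewrite ler_norml => /andP[_ hn].
have P2 : ((2^-1)%:E <= P [set w | (`|lin (s n) (path_of Z w)| <= e)%R])%E.
  by rewrite -Ex_indicE// lee_fin; lra.
have := lin_small_variance gZ (ltW e0) P2.
rewrite -(ler_sqrt (kinner _ _ _)); last first.
  by rewrite mulr_ge0// ?sqr_ge0// ltW// gvar_gt0.
move=> /le_trans; apply; rewrite sqrtrM ?sqr_ge0// sqrtr_sqr ger0_norm; last first.
  by apply: mulr_ge0; [apply: mulr_ge0 => //; exact: ltW|exact: ltW].
by rewrite le_eqVlt; apply/orP; left; apply/eqP; rewrite /e; field; rewrite !gt_eqF.
Qed.

(** Differences of two difference quotients are forms that tend to 0 on every realization, hence in
    kernel norm by [knorm_cvg0], and uniformly, since a failure would provide a bad sequence of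
    increments. With [rkhs_lin_le] the quotients of [g] are Cauchy. *)
Lemma rkhs_quot_cvg g j x : rkhs cube K g -> cube x -> cvg (cube_quotient g j x).
Proof.
move=> Hg cx; have pf := quot_filter_proper j cx.
apply: cvg_real_cauchy => e e0.
set r := rkhs_norm cube K g.
have r0 : 0 < `|r| + 1 by rewrite ltr_wpDl.
have e1 : 0 < e / 2 / (`|r| + 1) by rewrite !divr_gt0.
pose good (r : R) (t : R) := [/\ t != 0, `|t| < r & cube (x + t *: ej j)].
have [rho rho0 hrho] : exists2 rho : R, 0 < rho & forall t s, good rho t -> good rho s ->
    knorm K (quotlin j x t ++ lscale (-1) (quotlin j x s)) <= e / 2 / (`|r| + 1).
  apply: contrapT => /forall2NP nh.
  have : forall n, exists ts : R * R, [/\ good n.+1%:R^-1 ts.1, good n.+1%:R^-1 ts.2 &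
      ~ knorm K (quotlin j x ts.1 ++ lscale (-1) (quotlin j x ts.2)) <= e / 2 / (`|r| + 1)].
    move=> n; have [|] := nh n.+1%:R^-1; first by rewrite invr_gt0 ltr0n.
    move=> /existsNP[t /existsNP[s /not_implyP[gt /not_implyP[gs hn]]]].
    by exists (t, s).
  move=> /choice[ts hts].
  have := @knorm_cvg0 (fun n => quotlin j x (ts n).1 ++ lscale (-1) (quotlin j x (ts n).2)) _ _ e1.
  have conv w : lin (quotlin j x (ts n).1 ++ lscale (-1) (quotlin j x (ts n).2)) (realization Z w)
      @[n --> \oo] --> 0.
    have /(cube_partialP cx)/quotP := @realization_quot w j x cx.
    move=> hq; have lq (q : nat -> R) : (forall n, good n.+1%:R^-1 (q n)) ->
        quot (realization Z w) j x (q n) @[n --> \oo] --> cube_partial (realization Z w) j x.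
      move=> hgood; apply/cvgrPdist_lt => e' e'0; have [r' r'0 hr'] := hq e' e'0.
      near=> n; have [q0 qn cq] := hgood n; apply: hr' => //; apply: lt_trans qn _.
      near: n; exact: near_infty_natSinv_lt (PosNum r'0).
    rewrite (_ : (fun _ => _) = (fun n => quot (realization Z w) j x (ts n).1 -
      quot (realization Z w) j x (ts n).2)); last first.
      by apply/funext => n; rewrite lin_cat lin_scale !lin_quotlin mulN1r.
    rewrite -(subrr (cube_partial (realization Z w) j x)).
    by apply: cvgB; apply: lq => n; have [] := hts n.
  by move=> /(_ conv)[N _ /(_ N (leqnn N))]; have [_ _] := hts N.
have [n nr] := inward_small x j rho0; set t0 := inward x j n in nr.
have g0 : good rho t0 by split=> //; [exact: inward_neq0|exact: cube_inward].
exists (quot g j x t0); rewrite /cube_quotient /fmap /=.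
rewrite /within/= /dnbhs/= /within/= -nbhs_ballE; exists rho => //= t.
rewrite /ball/= sub0r normrN => tr tn0 ct.
have gt : good rho t by [].
change (`|quot g j x t0 - quot g j x t| < e).
rewrite -!lin_quotlin -mulN1r -lin_scale -lin_cat.
apply: (@le_lt_trans _ _ (e / 2)); last by rewrite ltr_pdivrMr// ltr_pMr// ltr1n.
apply: le_trans (@rkhs_lin_le _ _ cube K _ _ ksym kpos _ Hg) _.
  move=> p; rewrite /quotlin /lscale /= !inE.
  by move=> /or4P[] /eqP -> //=; case: g0.
apply: (@le_trans _ _ ((`|r| + 1) * (e / 2 / (`|r| + 1)))).
  apply: (@le_trans _ _ ((`|r| + 1) * knorm K (quotlin j x t0 ++ lscale (-1) (quotlin j x t)))).
    rewrite ler_wpM2r ?knorm_ge0//.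
    by apply: le_trans (ler_norm _) _; rewrite lerDl.
  by rewrite ler_wpM2l ?(ltW r0)// hrho.
by rewrite mulrC divfK// gt_eqF.
Unshelve. all: by end_near. Qed.

End smooth_process.

(** * Gaussian processes on the cube *)

Section boxes.
Context {R : realType} {k : nat}.
Implicit Types (g : 'rV[R]_k -> R).

Definition valform (n : nat) : seq (R * 'rV[R]_k) := [:: (1, cubept n)].

Definition lipbound (s : R) (x y : 'rV[R]_k) : R := \sum_j s * `|x ord0 j - y ord0 j|.

Definition pairform (p : nat * nat) : seq (R * 'rV[R]_k) :=
  [:: (1, cubept p.1); (-1, cubept p.2)].

(** Constraints on values and on increments are merged into the single sequence that [linbox_all]
    takes; a number that decodes to nothing gives the empty form with bound 0, a vacuous
    constraint. *)
Definition bothform (i : nat) : seq (R * 'rV[R]_k) :=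
  match (unpickle i : option (nat + nat * nat)) with
  | Some (inl n) => valform n | Some (inr p) => pairform p | None => [::] end.

Definition bothbound (e s : R) (i : nat) : R :=
  match (unpickle i : option (nat + nat * nat)) with
  | Some (inl n) => e
  | Some (inr p) => lipbound s (cubept p.1) (cubept p.2) | None => 0 end.

Definition valbox (e : R) g : set (paths R 'rV[R]_k) :=
  [set x | forall n, `|x (cubept n) - g (cubept n)| <= e].

Definition lipbox (s : R) g : set (paths R 'rV[R]_k) :=
  [set x | forall n m, `|(x (cubept n) - g (cubept n)) - (x (cubept m) - g (cubept m))| <=
     lipbound s (cubept n) (cubept m)].

Lemma valboxE e g : valbox e g = linbox_all valform (fun=> e) g.
Proof. by apply/seteqP; split=> x h n; have := h n; rewrite !lin1 !mul1r. Qed.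

Lemma lin_pairform p (x : 'rV[R]_k -> R) : lin (pairform p) x = x (cubept p.1) - x (cubept p.2).
Proof. by rewrite /lin /pairform !big_cons big_nil /= mul1r mulN1r addr0. Qed.

Lemma lipboundD (s t : R) (x y : 'rV[R]_k) : lipbound (s + t) x y = lipbound s x y + lipbound t x y.
Proof. by rewrite /lipbound -big_split; apply: eq_bigr => j _; rewrite mulrDl. Qed.

Lemma bothboxE e s g : valbox e g `&` lipbox s g = linbox_all bothform (bothbound e s) g.
Proof.
apply/seteqP; split=> x.
  move=> [h1 h2] i; rewrite /bothform /bothbound; case: (unpickle i) => [[n|p]|].
  - by rewrite !lin1 !mul1r.
  - by rewrite !lin_pairform; have := h2 p.1 p.2; congr (`|_| <= _); ring.
  - by rewrite /lin !big_nil subrr normr0.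
move=> h; split=> [n|n m].
  by have := h (pickle (inl n : nat + nat * nat));
    rewrite /bothform /bothbound pickleK !lin1 !mul1r.
have := h (pickle (inr (n, m) : nat + nat * nat)).
rewrite /bothform /bothbound pickleK !lin_pairform /=; congr (`|_| <= _); ring.
Qed.

Lemma lipboxE s g : lipbox s g = \bigcap_n linbox_all (fun m => pairform (n, m))
  (fun m => lipbound s (cubept n) (cubept m)) g.
Proof.
apply/seteqP; split=> x h.
  move=> n _ m; rewrite !lin_pairform /=; have := h n m; congr (`|_| <= _); ring.
move=> n m; have := h n I m; rewrite !lin_pairform /=; congr (`|_| <= _); ring.
Qed.

Lemma measurable_valbox e g : measurable (valbox e g).
Proof. by rewrite valboxE; exact: measurable_linbox_all. Qed.

Lemma measurable_lipbox s g : measurable (lipbox s g).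
Proof.
by rewrite lipboxE; apply: bigcapT_measurable => n; exact: measurable_linbox_all.
Qed.

Lemma lipbox_cubes_lip (f : 'rV[R]_k -> R) s : cube_continuous f -> lipbox s (fun=> 0) f ->
  cubes_lip (fun=> s) f.
Proof.
move=> cf h x y cx cy; apply/ler_addgt0Pr => e e0.
(* With [e1 = e / (2 B)], moving both points to the dense set costs [2 e1] in values and
   [2 |s| k e1] in [lipbound], together below [e]. *)
pose B := `|s| * k%:R + 2.
have B0 : 0 < B by rewrite ltr_wpDl// mulr_ge0.
pose e1 := e / B / 2; have e10 : 0 < e1 by rewrite !divr_gt0.
have /cube_continuousP cf' := cf.
have [r r0 hr] := cf' x cx e1 e10; have [q q0 hq] := cf' y cy e1 e10.
have rm : 0 < Num.min r e1 by rewrite lt_min r0.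
have qm : 0 < Num.min q e1 by rewrite lt_min q0.
have [n xn] := cubept_dense cx rm; have [m ym] := cubept_dense cy qm.
have h1 : `|f x - f (cubept n)| < e1.
  by apply: hr => [|j]; [exact: cube_cubept|apply: lt_le_trans (xn j) _; rewrite ge_min lexx].
have h2 : `|f y - f (cubept m)| < e1.
  by apply: hq => [|j]; [exact: cube_cubept|apply: lt_le_trans (ym j) _; rewrite ge_min lexx].
have h3 := h n m; rewrite !subr0 in h3.
have h4 : lipbound s (cubept n) (cubept m) <= lipbound s x y + `|s| * (k%:R * (e1 + e1)).
  rewrite -lerBlDl /lipbound -sumrB; apply: le_trans (ler_norm _) _.
  apply: le_trans (ler_norm_sum _ _ _) _.
  rewrite mulr_natl -[in X in _ <= X](card_ord k) -sumr_const mulr_sumr; apply: ler_sum => j _.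
  rewrite -mulrBr normrM ler_wpM2l//.
  apply: le_trans (ler_dist_dist _ _) _.
  rewrite (_ : _ - _ = (y ord0 j - (cubept m : 'rV[R]_k) ord0 j) - (x ord0 j - (cubept n : 'rV[R]_k) ord0 j)); last by ring.
  apply: le_trans (ler_normB _ _) _; apply: lerD; apply: ltW.
    by apply: lt_le_trans (ym j) _; rewrite ge_min lexx orbT.
  by apply: lt_le_trans (xn j) _; rewrite ge_min lexx orbT.
have -> : f x - f y = (f x - f (cubept n)) + (f (cubept n) - f (cubept m)) - (f y - f (cubept m)).
  by ring.
apply: le_trans (ler_normB _ _) _;
  have h5 := ler_normD (f x - f (cubept n)) (f (cubept n) - f (cubept m)).
have eE : `|s| * (k%:R * (e1 + e1)) + (e1 + e1) + (e1 + e1) = e.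
  by rewrite /e1 /B; field; rewrite gt_eqF.
change (`|f x - f (cubept n) + (f (cubept n) - f (cubept m))| + `|f y - f (cubept m)| <=
  lipbound s x y + e).
move: h1 h2 h3 h4 h5 eE e10; clear; lra.
Qed.

End boxes.

Section gaussian_boxes.
Context {R : realType} {k : nat} {d : measure_display} {W : measurableType d}.
Variables (P : probability W R) (Z : 'rV[R]_k -> {RV P >-> R}).
Hypothesis gZ : centered_gaussian_process Z.
Hypothesis Zc : forall w, continuous (realization Z w).
Local Notation K := (cov_kernel Z).
Let gmu := gaussian_process_law gZ.

Definition pathevent (A : set (paths R 'rV[R]_k)) : set W := [set w | A (path_of Z w)].

Lemma measurable_pathevent A : measurable A -> measurable (pathevent A).
Proof. by move=> mA; have := measurable_path_of Z measurableT mA; rewrite setTI. Qed.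

Lemma Ex_pathevent A : measurable A -> Ex (law Z) \1_A = Ex P \1_(pathevent A).
Proof. by move=> mA; rewrite Ex_law//; exact: bm_indic. Qed.

Lemma realization_continuous w : cube_continuous (realization Z w).
Proof. by apply: continuous_subspaceT; exact: Zc. Qed.

Lemma rkhs_valbox (e : R) g : rkhs cube K g ->
  expR (- (rkhs_norm cube K g ^+ 2 * gvar / 2)) * Ex P \1_(pathevent (valbox e (fun=> 0))) <=
  Ex P \1_(pathevent (valbox e g)).
Proof.
move=> Hg; rewrite -!Ex_pathevent; try exact: measurable_valbox.
rewrite !valboxE; apply: cameron_martin_rkhs => // i p.
by rewrite inE => /eqP -> /=; exact: cube_cubept.
Qed.

Lemma rkhs_bothbox (e s : R) g : rkhs cube K g ->
  expR (- (rkhs_norm cube K g ^+ 2 * gvar / 2)) *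
    Ex P \1_(pathevent (valbox e (fun=> 0) `&` lipbox s (fun=> 0))) <=
  Ex P \1_(pathevent (valbox e g `&` lipbox s g)).
Proof.
move=> Hg; rewrite -!Ex_pathevent; try (by apply: measurableI;
  [exact: measurable_valbox|exact: measurable_lipbox]).
rewrite !bothboxE; apply: cameron_martin_rkhs => // i p.
rewrite /bothform; case: (unpickle i) => [[n|q]|] //.
  by rewrite inE => /eqP -> /=; exact: cube_cubept.
by rewrite !inE => /orP[] /eqP -> /=; exact: cube_cubept.
Qed.

(** The target of [gaussian_correlation_lb] has to contain differences, whence the halved sizes.
    Such a difference comes both from two points with small values and from two points with small
    increments, so it inherits both bounds. *)
Lemma bothbox_correlation (e s : R) :
  (Ex P \1_(pathevent (valbox (e / 2) (fun=> 0))) *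
   Ex P \1_(pathevent (lipbox (s / 2) (fun=> 0)))) ^+ 2 <=
  Ex P \1_(pathevent (valbox e (fun=> 0) `&` lipbox s (fun=> 0))).
Proof.
rewrite -!Ex_pathevent; try exact: measurable_valbox; try exact: measurable_lipbox; last first.
  by apply: measurableI; [exact: measurable_valbox|exact: measurable_lipbox].
apply: (gaussian_correlation_lb gmu); try exact: measurable_valbox; try exact: measurable_lipbox.
  by apply: measurableI; [exact: measurable_valbox|exact: measurable_lipbox].
move=> x y x' y' Ax Ay Bx By xy; split=> [n|n m]; rewrite /mixp !mul1r !mulN1r !subr0.
  have := Ax n; have := Ay n; rewrite !subr0 => h1 h2.
  by apply: le_trans (ler_normB _ _) _; rewrite (splitr e) lerD.
rewrite !xy; have := Bx n m; have := By n m; rewrite !subr0 => h1 h2.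
rewrite (_ : _ - _ = (x' (cubept n) - x' (cubept m)) - (y' (cubept n) - y' (cubept m)));
  last by ring.
by apply: le_trans (ler_normB _ _) _; rewrite (splitr s) lipboundD lerD.
Qed.

(* Countably many balls around realizations cover the space of paths, so one of
   them is charged; differences of two of its points, divided by [sqrt 2], have
   the law of the process. *)
Lemma lipbox_gt0 (s : R) : (forall w, space_C1 (realization Z w)) -> 0 < s ->
  0 < Ex P \1_(pathevent (lipbox s (fun=> 0))).
Proof.
move=> Z1 s0.
pose c : R := (Num.sqrt 2)^-1.
have c2 : c ^+ 2 *+ 2 = 1 by rewrite exprVn sqr_sqrtr// -mulr_natr mulVf.
have c0 : 0 <= c by rewrite invr_ge0.
have c1 : c <= 1.
  rewrite -(ler_pXn2r (n := 2))// ?nnegrE// expr1n; move: c2; rewrite mulr2n => h.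
  by have := sqr_ge0 c; lra.
have s2 : 0 < s / 2 by rewrite divr_gt0.
(* Equal codes mean partial derivatives within [s / 2] of each other, so that a code class lies in
   the [lipbox] of size [s / 2] around any of its members. *)
have [|code hcode] := @C0_codes R k W 'I_k (fun w j => cube_partial (realization Z w) j) _ s2.
  by move=> w j; have [_ /(_ j)[_]] := realization_C1 Zc Z1 w.
pose inhab n := exists w, code w = n.
have : forall n, exists w, inhab n -> code w = n.
  by move=> n; have [[w]|nh] := pselect (inhab n); [exists w|exists point].
move=> /choice[r hr].
pose E n : set (paths R 'rV[R]_k) := lipbox (s / 2) (realization Z (r n)).
have mE n : measurable (E n) by exact: measurable_lipbox.
have cover w : exists n, E n (path_of Z w).
  exists (code w); have cw : code (r (code w)) = code w by apply: hr; exists w.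
  have qc j y u (cy : cube y) : cvg (cube_quotient (realization Z u) j y).
    exact: realization_quot.
  have L : cubes_lip (fun=> s / 2) (realization Z w \- realization Z (r (code w))).
    apply: partial_cubes_lip => j y cy.
      apply/cvg_ex; eexists; apply: cvg_quotB; apply: cube_partialP => //; exact: qc.
    rewrite (cube_partialE (d := cube_partial (realization Z w) j y -
       cube_partial (realization Z (r (code w))) j y) cy).
      exact: hcode.
    by apply: cvg_quotB; apply: cube_partialP => //; exact: qc.
  by move=> n m; apply: L; exact: cube_cubept.
have [n En] : exists n, 0 < Ex P \1_(pathevent (E n)).
  apply: contrapT => /forallNP hn.
  have P0 n : P (pathevent (E n)) = 0%E.
    rewrite -Ex_indicE; last exact: measurable_pathevent.
    apply/eqP; rewrite eqe eq_le; apply/andP; split; first by rewrite leNgt; apply/negP/hn.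
    by apply: Ex_ge0 => w; rewrite indicE.
  have : P.-negligible (\bigcup_n pathevent (E n)).
    apply: negligible_bigcup => n; apply/negligibleP; last exact: P0.
    exact: measurable_pathevent.
  have -> : \bigcup_n pathevent (E n) = setT.
    by apply/seteqP; split=> // w _; have [n hnw] := cover w; exists n.
  move=> hneg; have PT : P setT = 0%E by apply/(@negligibleP _ _ _ P _ measurableT).
  have [/eqP] : (0 : \bar R)%E = 1%E by rewrite -PT; exact: probability_setT.
  by rewrite eq_sym oner_eq0.
rewrite -Ex_pathevent; last exact: measurable_lipbox.
apply: (@lt_le_trans _ _ (Ex (law Z) \1_(E n) ^+ 2)).
  by rewrite exprn_gt0// Ex_pathevent.
apply: (gaussian_diff_lb gmu c2) => //; first exact: measurable_lipbox.
move=> x y Ex Ey p q; rewrite /mixp !subr0 mulNr mulNr.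
have := Ex p q; have := Ey p q; set z := realization Z (r n).
set a := x _ - _; set b := x _ - _; set a' := y _ - _; set b' := y _ - _ => h1 h2.
have -> : c * x (cubept p) - c * y (cubept p) - (c * x (cubept q) - c * y (cubept q)) =
  c * ((a - b) - (a' - b')) by rewrite /a /b /a' /b'; ring.
rewrite normrM (ger0_norm c0).
apply: (@le_trans _ _ (1 * (lipbound (s / 2) (cubept p) (cubept q) + lipbound (s / 2) (cubept p) (cubept q)))).
  by apply: ler_pM => //; exact: le_trans (ler_normB _ _) (lerD h2 h1).
by rewrite mul1r -lipboundD -splitr.
Qed.

End gaussian_boxes.

(** * Conditioned processes *)

Section conditioning.
Context {R : realType} {k : nat} {d d' : measure_display}.
Context {W : measurableType d} {W' : measurableType d'}.
Variables (P : probability W R) (P' : probability W' R).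
Variables (Z : 'rV[R]_k -> {RV P >-> R}) (Zc : 'rV[R]_k -> {RV P' >-> R}).
Variable B : set ('rV[R]_k -> R).

(** Events on this countable restriction are cylinders of the cube, on which the conditioned law is
    specified, and they belong to [sigma_process], to which the independence assumption applies. *)
Definition sampled (f : 'rV[R]_k -> R) : paths R nat := fun n => f (cubept n).

Lemma cylinders_sampled (A : set (paths R nat)) : measurable A ->
  cylinders cube [set f : 'rV[R]_k -> R | A (sampled f)].
Proof.
move=> mA; rewrite /cylinders; set G := [set C | _].
have mS : measurable_fun setT (sampled : g_sigma_algebraType G -> paths R nat).
  apply: measurable_paths => n _ Y mY; rewrite setTI; apply: sub_sigma_algebra.
  by exists (cubept n); [exact: cube_cubept|exists Y].
by have := mS measurableT A mA; rewrite setTI.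
Qed.

Lemma sigma_process_sampled {d1} {W1 : measurableType d1} (P1 : probability W1 R)
    (Y : 'rV[R]_k -> {RV P1 >-> R}) (A : set (paths R nat)) : measurable A ->
  sigma_process cube Y [set w | A (sampled (realization Y w))].
Proof.
move=> mA; rewrite /sigma_process; set G := [set C | _].
have mS : measurable_fun setT
    (fun w => sampled (realization Y w) : paths R nat) (T := g_sigma_algebraType G).
  apply: measurable_paths => n _ U mU; rewrite setTI; apply: sub_sigma_algebra.
  by exists (cubept n); [exact: cube_cubept|exists U].
by have := mS measurableT A mA; rewrite setTI.
Qed.

Lemma measurable_sampled {d1} {W1 : measurableType d1} (P1 : probability W1 R)
    (Y : 'rV[R]_k -> {RV P1 >-> R}) (A : set (paths R nat)) : measurable A ->
  measurable [set w | A (sampled (realization Y w))].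
Proof.
move=> mA; have mS : measurable_fun setT (fun w => sampled (realization Y w) : paths R nat).
  by apply: measurable_paths => n; exact: measurable_funP.
by have := mS measurableT A mA; rewrite setTI.
Qed.

Hypothesis ZcP : conditioned_process cube B Z Zc.
Let inB := [set w | B (realization Z w)].
Hypothesis mB : measurable inB.

Lemma inB_gt0 : 0 < Ex P \1_inB.
Proof. by rewrite -lte_fin Ex_indicE//; case: ZcP. Qed.

Lemma conditionedE (A : set (paths R nat)) : measurable A ->
  Ex P' \1_[set w | A (sampled (realization Zc w))] =
  Ex P \1_([set w | A (sampled (realization Z w))] `&` inB) / Ex P \1_inB.
Proof.
move=> mA; have mA1 := measurable_sampled Z mA; have mA2 := measurable_sampled Zc mA.
apply/EFin_inj; rewrite Ex_indicE//.
have [_ _ /(_ _ (cylinders_sampled mA))] := ZcP; rewrite /= => ->.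
rewrite EFinM (Ex_indicE P); last exact: measurableI.
congr (_ * _)%E; rewrite -[P _ in LHS](Ex_indicE P mB) inver.
by rewrite gt_eqF// inB_gt0.
Qed.

(** Intersecting with [inB] loses nothing of an event contained in it, and dividing by a probability
    can only increase the result. *)
Lemma conditioned_ge (A : set (paths R nat)) (E : set W) : measurable A -> measurable E ->
  (forall w, E w -> A (sampled (realization Z w)) /\ B (realization Z w)) ->
  Ex P \1_E <= Ex P' \1_[set w | A (sampled (realization Zc w))].
Proof.
move=> mA mE EA; rewrite conditionedE//; have b0 := inB_gt0.
have mI : measurable ([set w | A (sampled (realization Z w))] `&` inB).
  by apply: measurableI => //; exact: measurable_sampled.
apply: (@le_trans _ _ (Ex P \1_([set w | A (sampled (realization Z w))] `&` inB))).
  apply: le_Ex; [exact: bm_indic|exact: bm_indic|] => w; rewrite !indicE.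
  have [/set_mem Ew|_] := boolP (w \in E); last by rewrite ler0n.
  by rewrite mem_set//; have [] := EA w Ew.
rewrite ler_pdivlMr// -[leRHS]mulr1 ler_wpM2l//.
  by apply: Ex_ge0 => w; rewrite indicE.
apply: Ex_le_cst; first exact: bm_indic.
by move=> w; rewrite indicE; case: (_ \in _).
Qed.

Lemma conditioned_le (A : set (paths R nat)) : measurable A ->
  Ex P' \1_[set w | A (sampled (realization Zc w))] <=
  Ex P \1_[set w | A (sampled (realization Z w))] / Ex P \1_inB.
Proof.
move=> mA; rewrite conditionedE// ler_pM2r ?invr_gt0 ?inB_gt0//.
have mA1 := measurable_sampled Z mA.
apply: le_Ex; [by apply: bm_indic; exact: measurableI|exact: bm_indic|] => w; rewrite !indicE.
have [/set_mem[Aw _]|_] := boolP (w \in _ `&` _); last by rewrite ler0n.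
by rewrite mem_set.
Qed.

Hypothesis gZ : centered_gaussian_process Z.
Hypothesis cB : forall z, B z -> cube_continuous z.
Hypothesis cZ : forall w, continuous (realization Z w).

(** The Gaussian sieve is applied to the process sampled on [cubept], whose [seqball] is the
    sup-norm ball by continuity. Two points with the same code are each within [8 * eta] of a common
    centre, whence [16 * eta]. *)
Lemma conditioned_sieve (eta tau : R) : 0 < tau <= 1 ->
  0 < Ex P \1_[set w | (csup (realization Z w) <= eta%:E)%E] ->
  exists G : set W', measurable G /\ Ex P' \1_(~` G) <= tau / Ex P \1_inB /\
  exists code : W' -> nat, (forall w, G w -> (code w)%:R <=
     20 / (tau ^+ 3 * Ex P \1_[set w | (csup (realization Z w) <= eta%:E)%E] ^+ 4)) /\
  forall w w', G w -> G w' -> code w = code w' ->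
    forall x, cube x -> `|realization Zc w x - realization Zc w' x| <= 16 * eta.
Proof.
move=> tau01; set a := Ex P _ => a0.
have gs : centered_gaussian_process (fun n : nat => Z (cubept n)).
  exact: gaussian_process_comp.
have gmu := gaussian_process_law gs.
have aE : a = Ex (law (fun n : nat => Z (cubept n))) \1_(seqball id eta).
  rewrite Ex_law; last by apply: bm_indic; exact: measurable_seqball.
  congr Ex; apply/funext => w; rewrite !indicE; congr ((_ : bool)%:R).
  apply/idP/idP => /set_mem h; apply/mem_set.
    by move=> n; move/csup_leP : h; apply; exact: cube_cubept.
  apply/csup_leP; apply: dense_le => [|n]; first exact: realization_continuous.
  exact: h.
have a0' := a0; rewrite aE in a0'.
have [G [mG [Gtau [code [codeN [c hc]]]]]] := gaussian_sieve gmu tau01 a0'.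
exists [set w | G (sampled (realization Zc w))]; split; first exact: measurable_sampled.
split.
  have -> : ~` [set w | G (sampled (realization Zc w))] =
    [set w | (~` G) (sampled (realization Zc w))] by [].
  have mGC : measurable (~` G) by exact: measurableC.
  apply: le_trans (conditioned_le mGC) _.
  rewrite ler_pM2r ?invr_gt0 ?inB_gt0//; apply: le_trans Gtau.
  by rewrite Ex_law//; exact: bm_indic.
exists (fun w => code (sampled (realization Zc w))); split.
  by move=> w Gw; rewrite aE; exact: codeN.
move=> w w' Gw Gw' ww'; have [_ ZcB _] := ZcP.
apply: (dense_le (f := realization Zc w \- realization Zc w')).
  by apply: cube_continuousB; apply: cB; exact: ZcB.
move=> n; have h1 := hc _ Gw n; have h2 := hc _ Gw' n; rewrite -ww' in h2.
rewrite /= (_ : _ - _ = (c (code (sampled (realization Zc w))) n - sampled (realization Zc w') n)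
  - (c (code (sampled (realization Zc w))) n - sampled (realization Zc w) n)); last first.
  by rewrite /sampled; ring.
by apply: le_trans (ler_normB _ _) _; rewrite /= in h1 h2; lra.
Qed.

End conditioning.

(** For [p = 0] the logarithm is [-oo], and the hypothesis would bound [+oo] by a real number. *)
Lemma lne_bound {R : realType} (p : R) (a : R) : 0 <= p -> (- (2%:E * lne p%:E) <= a%:E)%E ->
  expR (- a / 2) <= p.
Proof.
move=> p0; have [->|pn0] := eqVneq p 0.
  by rewrite le0_lneNy// gt0_muleNy// leye_eq.
have pp : 0 < p by rewrite lt_neqAle eq_sym pn0.
rewrite lne_EFin// -EFinM -EFinN lee_fin => h.
rewrite -[leRHS](lnK pp) ler_expR; lra.
Qed.

Lemma oppe_lne_ge0 {R : realType} (p : \bar R) : (p <= 1)%E -> (0 <= - (2%:E * lne p))%E.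
Proof. by move=> p1; rewrite oppe_ge0 mule_ge0_le0// lne_le0. Qed.

Section layer_masses.
Context {R : realType} {k : nat} {d d' : measure_display}.
Context {W : measurableType d} {W' : measurableType d'}.
Variables (P : probability W R) (P' : probability W' R).
Variables (Z : 'rV[R]_k -> {RV P >-> R}) (Zc : 'rV[R]_k -> {RV P' >-> R}).
Variable B : set ('rV[R]_k -> R).
Hypothesis ZcP : conditioned_process cube B Z Zc.
Hypothesis gZ : centered_gaussian_process Z.
Hypothesis cB : forall z, B z -> cube_continuous z.
Hypothesis cZ : forall w, continuous (realization Z w).
Hypothesis mB : measurable [set w | B (realization Z w)].
Local Notation K := (cov_kernel Z).
Variable z0 : 'rV[R]_k -> R.
Hypothesis cz0 : cube_continuous z0.

Definition nearset (e : R) : set (paths R nat) :=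
  [set x | forall n, `|x n - z0 (cubept n)| <= e].

Lemma measurable_nearset e : measurable (nearset e).
Proof.
rewrite (_ : nearset e = \bigcap_n [set x : paths R nat | `|x n - z0 (cubept n)| <= e]).
  apply: bigcapT_measurable => n; apply: measurable_norm_le.
  by apply: measurable_funB => //; exact: measurable_eval.
by apply/seteqP; split=> x h n => [_|]; [exact: h|exact: (h n I)].
Qed.

Lemma nearsetE e (f : 'rV[R]_k -> R) : cube_continuous f ->
  nearset e (sampled f) <-> forall x, cube x -> `|f x - z0 x| <= e.
Proof.
move=> cf; split=> h; last by move=> n; apply: h; exact: cube_cubept.
exact: (dense_le (f := f \- z0) (cube_continuousB cf cz0)).
Qed.

Lemma csup_leW (e : R) : [set w | (csup (realization Z w) <= e%:E)%E] =
  pathevent Z (valbox e (fun=> 0)).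
Proof.
apply/seteqP; split=> w /=.
  by move=> /csup_leP h n; rewrite subr0; apply: h; exact: cube_cubept.
move=> h; apply/csup_leP; apply: dense_le => [|n]; first exact: realization_continuous.
by have := h n; rewrite subr0.
Qed.

(** Both summands are nonnegative, so [a] bounds each of them: one provides an RKHS function [g]
    near [z0], the other the mass of a ball at the origin, which Cameron-Martin moves to [g]. The
    radius [2 * e] adds the approximation error to the radius of the ball. *)
Lemma C0_mass (e a : R) : 0 < e -> 0 < a ->
  (forall f, cube_continuous f -> (forall x, cube x -> `|f x - z0 x| <= 2 * e) -> B f) ->
  ((3 / 2)%:E * ereal_inf [set (rkhs_norm cube K g ^+ 2)%:E |
      g in [set g | rkhs cube K g /\ (csup (g \- z0)%R < e%:E)%E]]
    - 2%:E * lne (P [set w | (csup (realization Z w) < e%:E)%E]) <= a%:E)%E ->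
  expR (- (a * gvar + a)) <= Ex P' \1_[set w | nearset (2 * e) (sampled (realization Zc w))] /\
  expR (- a) <= Ex P \1_[set w | (csup (realization Z w) <= e%:E)%E].
Proof.
move=> e0 a0 hB; set I := ereal_inf _ => h.
have mlt : measurable [set w | (csup (realization Z w) < e%:E)%E].
  apply: measurable_csup_lt => [w|x cx]; first exact: realization_continuous.
  exact: measurable_realization.
have mle : measurable [set w | (csup (realization Z w) <= e%:E)%E].
  by rewrite csup_leW; apply: measurable_pathevent; exact: measurable_valbox.
set p := P _ in h.
have p1 : (p <= 1)%E by exact: probability_le1.
have I0 : (0 <= I)%E by apply: le_ereal_inf_tmp => _ [g _ <-]; rewrite lee_fin sqr_ge0.
have hI : ((3 / 2)%:E * I <= a%:E)%E.
  by apply: le_trans h; rewrite leeDl// oppe_lne_ge0.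
have hp : (- (2%:E * lne p) <= a%:E)%E.
  by apply: le_trans h; rewrite leeDr// mule_ge0// lee_fin divr_ge0.
have [g [Hg gz] gn] : exists2 g, (rkhs cube K g /\ (csup (g \- z0)%R < e%:E)%E) &
    rkhs_norm cube K g ^+ 2 < a.
  have : (I < a%:E)%E.
    (* The factor [3 / 2] leaves room for a strict inequality: the infimum is at most [2 a / 3 < a],
       hence some [g] has squared norm below [a]. *)
    rewrite -(@lte_pmul2l _ (3 / 2)%:E) ?lte_fin ?divr_gt0//.
    by apply: le_lt_trans hI _; rewrite -EFinM lte_fin; lra.
  by move=> /ereal_inf_lt[_ [g hg <-]]; rewrite lte_fin; exists g.
have pE : p = (Ex P \1_[set w | (csup (realization Z w) < e%:E)%E])%:E by rewrite Ex_indicE.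
rewrite pE in hp.
have plb := lne_bound _ hp.
have lble : expR (- a) <= Ex P \1_[set w | (csup (realization Z w) <= e%:E)%E].
  apply: (@le_trans _ _ (expR (- a / 2))); first by rewrite ler_expR; lra.
  apply: le_trans (plb _) _; first by apply: Ex_ge0 => w; rewrite indicE.
  apply: le_Ex; [exact: bm_indic|exact: bm_indic|] => w; rewrite !indicE.
  have [/set_mem hw|_] := boolP (w \in _); last by rewrite ler0n.
  by rewrite mem_set//=; exact: ltW.
split=> //.
pose E : set W := pathevent Z (valbox e g).
have mE : measurable E by apply: measurable_pathevent; exact: measurable_valbox.
apply: (@le_trans _ _ (Ex P \1_E)); last first.
  apply: (conditioned_ge ZcP mB (measurable_nearset _) mE) => w Ew.
  have cr : cube_continuous (realization Z w) by exact: realization_continuous.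
  have nr : nearset (2 * e) (sampled (realization Z w)).
    move=> n; have h1 := Ew n; have [b be hb] := (proj1 (csup_ltP _ _) gz).
    have h2 := hb _ (cube_cubept n); rewrite /= in h2.
    have -> : sampled (realization Z w) n - z0 (cubept n) =
      (path_of Z w (cubept n) - g (cubept n)) + (g (cubept n) - z0 (cubept n)).
      by rewrite /sampled /path_of; ring.
    by apply: le_trans (ler_normD _ _) _; lra.
  by split=> //; apply: hB => //; apply/nearsetE.
apply: le_trans (rkhs_valbox gZ e Hg); rewrite -csup_leW.
rewrite opprD expRD; apply: ler_pM; rewrite ?expR_ge0//.
rewrite ler_expR lerN2; have v0 := @gvar_gt0 R.
apply: (@le_trans _ _ (a * gvar / 2)); first by rewrite !ler_pM2r// ltW.
have := mulr_ge0 (ltW a0) (ltW v0); lra.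
Qed.

(** The derivatives are controlled by the event [lipbox], whose mass does not depend on [e]: the
    path minus [g] has slopes at most [c / 4], the derivatives of [g] are within [c / 4] of those of
    [z0], and these are at most [c / 2], in total [c]. That [g] has derivatives is
    [rkhs_quot_cvg]. *)
Lemma C1_mass (e a c : R) : 0 < e -> 0 < a -> 0 < c ->
  (forall w, space_C1 (realization Z w)) -> cube_C1 z0 ->
  (forall j x, cube x -> `|cube_partial z0 j x| <= c / 2) ->
  (forall f, cube_C1 f -> (forall x, cube x -> `|f x - z0 x| <= 2 * e) ->
     (forall j x, cube x -> `|cube_partial f j x| <= c) -> B f) ->
  ((3 / 2)%:E * ereal_inf [set (rkhs_norm cube K g ^+ 2)%:E |
      g in [set g | [/\ rkhs cube K g, (csup (g \- z0)%R < (e / 2)%:E)%E &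
        forall j, (csup (cube_partial g j \- cube_partial z0 j)%R < (c / 4)%:E)%E]]]
    - 2%:E * lne (P [set w | (csup (realization Z w) <= (e / 2)%:E)%E])
    - 2%:E * \sum_(j < k) lne (P [set w |
        (csup (cube_partial (realization Z w) j) <= (c / 4)%:E)%E]) <= a%:E)%E ->
  Ex P \1_(pathevent Z (lipbox (c / 4 / 2) (fun=> 0))) ^+ 2 * expR (- (a * gvar + a)) <=
    Ex P' \1_[set w | nearset (2 * e) (sampled (realization Zc w))] /\
  expR (- a) <= Ex P \1_[set w | (csup (realization Z w) <= e%:E)%E].
Proof.
move=> e0 a0 c0 Z1 z1 zc hB; set I := ereal_inf _ => h.
have mle b : measurable [set w | (csup (realization Z w) <= b%:E)%E].
  by rewrite csup_leW; apply: measurable_pathevent; exact: measurable_valbox.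
set p := P [set w | (csup (realization Z w) <= _)%E] in h.
have p1 : (p <= 1)%E by exact: probability_le1.
have I0 : (0 <= (3 / 2)%:E * I)%E.
  rewrite mule_ge0 ?lee_fin ?divr_ge0//.
  by apply: le_ereal_inf_tmp => _ [g _ <-]; rewrite lee_fin sqr_ge0.
have S0 : (0 <= - (2%:E * \sum_(j < k) lne (P [set w |
        (csup (cube_partial (realization Z w) j) <= (c / 4)%:E)%E])))%E.
  rewrite oppe_ge0 mule_ge0_le0//; apply: sume_le0 => j _; rewrite lne_le0.
  apply: probability_le1; apply: measurable_csup_le => [w|x cx].
    by have [_ /(_ j)[]] := realization_C1 cZ Z1 w.
  exact: measurable_partial.
have L0 := oppe_lne_ge0 p1.
have h' := le_trans (leeDl _ S0) h.
have hI := le_trans (leeDl _ L0) h'.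
have hp := le_trans (leeDr _ I0) h'.
have [g [Hg gz gpart] gn] : exists2 g, [/\ rkhs cube K g, (csup (g \- z0)%R < (e / 2)%:E)%E &
        forall j, (csup (cube_partial g j \- cube_partial z0 j)%R < (c / 4)%:E)%E] &
    rkhs_norm cube K g ^+ 2 < a.
  have : (I < a%:E)%E.
    rewrite -(@lte_pmul2l _ (3 / 2)%:E) ?lte_fin ?divr_gt0//.
    by apply: le_lt_trans hI _; rewrite -EFinM lte_fin; lra.
  by move=> /ereal_inf_lt[_ [g hg <-]]; rewrite lte_fin; exists g.
have pE : p = (Ex P \1_[set w | (csup (realization Z w) <= (e / 2)%:E)%E])%:E by rewrite Ex_indicE.
rewrite pE in hp.
have plb : expR (- a / 2) <= Ex P \1_[set w | (csup (realization Z w) <= (e / 2)%:E)%E].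
  by apply: lne_bound hp; apply: Ex_ge0 => w; rewrite indicE.
split; last first.
  apply: (@le_trans _ _ (expR (- a / 2))); first by rewrite ler_expR; lra.
  apply: le_trans plb _.
  apply: le_Ex; [exact: bm_indic|exact: bm_indic|] => w; rewrite !indicE.
  have [/set_mem /= hw|_] := boolP (w \in _); last by rewrite ler0n.
  rewrite mem_set//=; apply: le_trans hw _; rewrite lee_fin ler_pdivrMr// ler_peMr//.
    exact: ltW.
  by rewrite ler1n.
pose E : set W := pathevent Z (valbox e g `&` lipbox (c / 4) g).
have mE : measurable E.
  by apply/measurable_pathevent/measurableI; [exact: measurable_valbox|exact: measurable_lipbox].
apply: (@le_trans _ _ (Ex P \1_E)); last first.
  apply: (conditioned_ge ZcP mB (measurable_nearset _) mE) => w [Ew1 Ew2].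
  have cr : cube_continuous (realization Z w) by exact: realization_continuous.
  have nr : nearset (2 * e) (sampled (realization Z w)).
    move=> n; have h1 := Ew1 n; have [b be hb] := (proj1 (csup_ltP _ _) gz).
    have h2 := hb _ (cube_cubept n); rewrite /= in h2.
    have -> : sampled (realization Z w) n - z0 (cubept n) =
      (path_of Z w (cubept n) - g (cubept n)) + (g (cubept n) - z0 (cubept n)).
      by rewrite /sampled /path_of; ring.
    by apply: le_trans (ler_normD _ _) _; lra.
  split=> //; apply: hB; [exact: realization_C1|exact/nearsetE|] => j x cx.
  have Lg : cubes_lip (fun=> c / 4) (g \- z0).
    have qz i y : cube y -> cube_quotient z0 i y --> cube_partial z0 i y.
      by move=> cy; apply: cube_partialP => //; have [_ /(_ i)[hq _]] := z1; exact: hq.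
    have qg i y : cube y -> cube_quotient g i y --> cube_partial g i y.
      by move=> cy; apply: cube_partialP => //; exact: rkhs_quot_cvg Hg cy.
    apply: partial_cubes_lip => i y cy.
      by apply/cvg_ex; eexists; apply: cvg_quotB; [exact: qg|exact: qz].
    rewrite (cube_partialE cy (cvg_quotB (qg i y cy) (qz i y cy))).
    have [b bc hb] := (proj1 (csup_ltP _ _) (gpart i)).
    exact: le_trans (hb y cy) (ltW bc).
  have Lf : cubes_lip (fun=> c / 4 + c / 4) (realization Z w \- z0).
    apply: lipbox_cubes_lip; first by apply: cube_continuousB => //.
    move=> n m; rewrite !subr0 lipboundD /=.
    have -> : realization Z w (cubept n) - z0 (cubept n) - (realization Z w (cubept m) - z0 (cubept m)) =
      ((path_of Z w (cubept n) - g (cubept n)) - (path_of Z w (cubept m) - g (cubept m))) +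
      ((g \- z0) (cubept n) - (g \- z0) (cubept m)).
      by rewrite /path_of /=; ring.
    apply: le_trans (ler_normD _ _) _; apply: lerD; first exact: Ew2.
    by apply: Lg; exact: cube_cubept.
  have qf : cube_quotient (realization Z w) j x --> cube_partial (realization Z w) j x.
    by apply: cube_partialP => //; exact: realization_quot.
  have qz : cube_quotient z0 j x --> cube_partial z0 j x.
    by apply: cube_partialP => //; have [_ /(_ j)[hq _]] := z1; exact: hq.
  have := cubes_lip_partial Lf cx (cvgP _ (cvg_quotB qf qz)).
  rewrite (cube_partialE cx (cvg_quotB qf qz)) => h1; have h2 := zc j x cx.
  rewrite -(subrK (cube_partial z0 j x) (cube_partial (realization Z w) j x)).
  by apply: le_trans (ler_normD _ _) _; lra.
apply: le_trans (rkhs_bothbox gZ e (c / 4) Hg).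
rewrite opprD expRD mulrCA; apply: ler_pM; rewrite ?expR_ge0//.
- by rewrite mulr_ge0 ?sqr_ge0 ?expR_ge0.
- rewrite ler_expR lerN2; have v0 := @gvar_gt0 R.
  apply: (@le_trans _ _ (a * gvar / 2)); first by rewrite !ler_pM2r// ltW.
  have := mulr_ge0 (ltW a0) (ltW v0); lra.
(* The correlation bound halves both sizes: [e / 2] is the radius in the hypothesis and [c / 4 / 2]
   the Lipschitz size in the conclusion. Its square turns [expR (- a / 2)] into [expR (- a)]. *)
apply: le_trans (bothbox_correlation gZ e (c / 4)).
rewrite exprMn mulrC -csup_leW ler_wpM2r ?sqr_ge0//.
rewrite (_ : expR (- a) = expR (- a / 2) ^+ 2); last by rewrite expr2 -expRD; congr expR; field.
by rewrite ler_pXn2r// ?nnegrE ?expR_ge0// (le_trans _ plb)// expR_ge0.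
Qed.

End layer_masses.

(** * Posterior contraction *)

Section positive_functions.
Context {d} {T : measurableType d} {R : realType}.

Lemma bm_inv (f : T -> R) (m : R) : 0 < m -> (forall x, m <= f x) -> bm f ->
  bm (fun x => (f x)^-1).
Proof.
move=> m0 mf [msf _].
have f0 x : 0 < f x by exact: lt_le_trans (mf x).
split.
  rewrite (_ : (fun x => _) = (fun x => expR (- ln (f x)))).
    apply: measurableT_comp; first exact: measurable_expR.
    by apply: measurableT_comp => //; apply: measurableT_comp => //; exact: measurable_ln.
  by apply/funext => x; rewrite expRN lnK// posrE.
exists m^-1 => x; rewrite ger0_norm ?invr_ge0 ?(ltW (f0 x))//.
by rewrite lef_pV2 ?posrE.
Qed.

Lemma bm_sqrt (f : T -> R) : (forall x, 0 < f x) -> bm f -> bm (fun x => Num.sqrt (f x)).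
Proof.
move=> f0 [msf [M fM]]; split.
  rewrite (_ : (fun x => _) = (fun x => expR (2^-1 * ln (f x)))).
    apply: measurableT_comp; first exact: measurable_expR.
    by apply: measurable_funM => //; apply: measurableT_comp => //; exact: measurable_ln.
  apply/funext => x; apply/eqP; rewrite -(eqrXn2 (n := 2))// ?expR_ge0// sqr_sqrtr ?(ltW (f0 x))//.
  rewrite expr2 -expRD (_ : _ + _ = ln (f x)); last by field.
  by rewrite lnK ?posrE.
exists (Num.sqrt M) => x; rewrite ger0_norm ?sqrtr_ge0// ler_sqrt.
  exact: le_trans (ler_norm _) (fM x).
by apply: le_trans (fM x).
Qed.
End positive_functions.

(** * Products over independent observations *)

Section iid.
Context {R : realType} {d dS} {W : measurableType d} {S : measurableType dS}.
Variables (P : probability W R) (Q : probability S R) (X : nat -> W -> S).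
Hypothesis mX : forall m, measurable_fun setT (X m).
Hypothesis lawX : forall m A, measurable A -> P (X m @^-1` A) = Q A.
Hypothesis indX : forall n (A : nat -> set S), (forall m, measurable (A m)) ->
  P (\bigcap_(m in [set m | (m < n)%N]) X m @^-1` A m) = (\prod_(m < n) P (X m @^-1` A m))%E.

Lemma iid_indic n (A : nat -> set S) : (forall m, measurable (A m)) ->
  Ex P (fun w => \prod_(m < n) \1_(A m) (X m w)) = \prod_(m < n) Ex Q \1_(A m).
Proof.
move=> mA; apply: EFin_inj.
have mI : measurable (\bigcap_(m in [set m | (m < n)%N]) X m @^-1` A m).
  apply: bigcap_measurableType => m _; rewrite -[X in measurable X]setTI; exact: mX.
rewrite (_ : (fun w => _) = \1_(\bigcap_(m in [set m | (m < n)%N]) X m @^-1` A m)).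
  rewrite Ex_indicE// indX// -prodEFin; apply: eq_bigr => m _.
  by rewrite lawX// Ex_indicE.
apply/funext => w; rewrite indicE.
have [/set_mem h|h] := boolP (w \in _).
  by rewrite big1// => m _; rewrite indicE mem_set//; apply: h => /=.
have : exists m : 'I_n, ~ A m (X m w).
  apply: contrapT => /forallNP hn; move/negP : h; apply; apply/mem_set => m mn.
  by apply: contrapT; exact: (hn (Ordinal mn)).
by move=> [m nm]; rewrite (bigD1 m)//= indicE memNset// mul0r.
Qed.

Lemma bm_prodX n (f : nat -> S -> R) : (forall m, bm (f m)) ->
  bm (fun w => \prod_(m < n) f m (X m w)).
Proof. by move=> bf; apply: bm_prod => m; exact: (bm_comp (bf m)). Qed.

Definition upd (f : nat -> S -> R) (k : nat) (g : S -> R) (m : nat) : S -> R :=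
  if m == k then g else f m.

Lemma prod_upd n (f : nat -> S -> R) (k : 'I_n) g w :
  \prod_(m < n) upd f k g m (X m w) = g (X k w) * \prod_(m < n | m != k) f m (X m w).
Proof.
rewrite (bigD1 k)//= /upd eqxx; congr (_ * _); apply: eq_bigr => m mk.
by rewrite (negbTE (mk : (m : nat) != k)).
Qed.

Lemma prod_updE n (f : nat -> S -> R) (k : 'I_n) g :
  \prod_(m < n) Ex Q (upd f k g m) = Ex Q g * \prod_(m < n | m != k) Ex Q (f m).
Proof.
rewrite (bigD1 k)//= /upd eqxx; congr (_ * _); apply: eq_bigr => m mk.
by rewrite (negbTE (mk : (m : nat) != k)).
Qed.

(** Independence is given for events. The induction on [k] frees the factors one at a time: those
    from position [k] on are still indicators, and at each stage one factor is extended from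
    indicators to bounded functions by [bm_ind]. *)
Lemma iid_prod n (f : nat -> S -> R) : (forall m, bm (f m)) ->
  Ex P (fun w => \prod_(m < n) f m (X m w)) = \prod_(m < n) Ex Q (f m).
Proof.
move=> bf.
have H k : (k <= n)%N -> forall f : nat -> S -> R, (forall m, bm (f m)) ->
    (forall m, (k <= m)%N -> exists2 A, measurable A & f m = \1_A) ->
    Ex P (fun w => \prod_(m < n) f m (X m w)) = \prod_(m < n) Ex Q (f m).
  elim: k => [|k IH] kn {bf}f bf hf.
    have /choice[A hA] : forall m, exists A : set S, measurable A /\ f m = \1_A.
      by move=> m; have [A mA fA] := hf m isT; exists A.
    under eq_fun do under eq_bigr do rewrite (proj2 (hA _)).
    rewrite iid_indic; last by move=> m; have [] := hA m.
    by apply: eq_bigr => m _; rewrite (proj2 (hA _)).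
  pose i := Ordinal kn.
  pose G := fun w => \prod_(m < n | m != i) f m (X m w).
  have bG : bm G.
    rewrite (_ : G = fun w => \prod_(m < n) upd f k (fun=> 1) m (X m w)).
      by apply: bm_prodX => m; rewrite /upd; case: ifP => // _; exact: bm_cst.
    by apply/funext => w; rewrite (@prod_upd n f i) mul1r.
  have fE : f = upd f k (f k).
    by apply/funext => m; rewrite /upd; case: eqP => // ->.
  pose c := \prod_(m < n | m != i) Ex Q (f m).
  suff : forall g : S -> R, bm g -> Ex P (fun w => g (X k w) * G w) = Ex Q g * c.
    move=> /(_ (f k) (bf k)); rewrite -(@prod_updE n f i) -fE => <-.
    by congr Ex; apply/funext => w; rewrite [in LHS]fE (@prod_upd n f i).
  have bgX (g : S -> R) : bm g -> bm (fun w => g (X k w)) by move=> bg; exact: (bm_comp bg).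
  apply: bm_ind.
  - move=> A mA; have := IH (ltnW kn) (upd f k \1_A) _ _; rewrite (@prod_updE n f i).
    rewrite (_ : (fun w => _) = (fun w => \1_A (X k w) * G w)); last first.
      by apply/funext => w; rewrite (@prod_upd n f i).
    apply; first by move=> m; rewrite /upd; case: ifP => // _; exact: bm_indic.
    move=> m km; rewrite /upd; have [_|mk] := eqVneq m k; first by exists A.
    by apply: hf; rewrite ltn_neqAle eq_sym mk.
  - move=> g h bg bh eg eh; rewrite ExD// mulrDl -eg -eh -(ExD _ (bmM (bgX _ bg) bG) (bmM (bgX _ bh) bG)).
    by congr Ex; apply/funext => w; rewrite mulrDl.
  - move=> a g bg eg; rewrite ExZ// -mulrA -eg -ExZ; last exact: bmM (bgX _ bg) bG.
    by congr Ex; apply/funext => w; rewrite mulrA.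
  - move=> f_ g M bf_ fM fc ef.
    have [mG [MG GM]] := bG.
    have c1 : Ex P (fun w => f_ m (X k w) * G w) @[m --> \oo] --> Ex P (fun w => g (X k w) * G w).
      apply: (@Ex_lim _ _ _ _ (fun m w => f_ m (X k w) * G w) _ (M * MG)).
      + by move=> m; exact: (bm_meas (bmM (bgX _ (bf_ m)) bG)).
      + by move=> m w; rewrite normrM ler_pM.
      + by move=> w; apply: cvgM; [exact: fc|exact: cvg_cst].
    have c2 : Ex Q (f_ m) * c @[m --> \oo] --> Ex Q g * c.
      apply: cvgM; last exact: cvg_cst.
      by apply: (@Ex_lim _ _ _ _ f_ _ M) => // m; exact: (bm_meas (bf_ m)).
    rewrite -(cvg_lim _ c1)// -(cvg_lim _ c2)//.
    by under eq_fun do rewrite ef.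
pose f' m := if (m < n)%N then f m else \1_setT : S -> R.
have E (m : 'I_n) : f' m = f m by rewrite /f' ltn_ord.
transitivity (\prod_(m < n) Ex Q (f' m)); last by apply: eq_bigr => m _; rewrite E.
rewrite -(H n (leqnn n) f').
- by congr Ex; apply/funext => w; apply: eq_bigr => m _; rewrite E.
- by move=> m; rewrite /f'; case: ifP => // _; exact: bm_indic.
- by move=> m nm; exists setT => //; rewrite /f' ltnNge nm.
Qed.

Lemma iid_power n (f : S -> R) : bm f ->
  Ex P (fun w => \prod_(m < n) f (X m w)) = Ex Q f ^+ n.
Proof.
move=> bf; rewrite (@iid_prod n (fun=> f))// prodr_const card_ord//.
Qed.
End iid.

Section quadratic_bounds.
Context {R : realType} {d} {S : measurableType d} (Q : probability S R).
Variables (f g : S -> R) (m b : R).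
Hypotheses (m0 : 0 < m) (mf : forall s, m <= f s) (mg : forall s, m <= g s).
Hypotheses (bf : bm f) (bg : bm g) (Ef : Ex Q f = 1) (Eg : Ex Q g = 1).

Definition sqhell (f : S -> R) : R := Ex Q (fun s => (Num.sqrt (f s) - 1) ^+ 2).

Let f0 s : 0 < f s. Proof. exact: lt_le_trans (mf s). Qed.
Let g0 s : 0 < g s. Proof. exact: lt_le_trans (mg s). Qed.

(** In [1 / f = 1 - (f - 1) + (f - 1)^2 / f] the linear term has mean 0 and the last one is at most
    [2 b^2]. *)
Lemma Ex_inv_le : (forall s, 2^-1 <= f s) -> (forall s, `|f s - 1| <= b) ->
  Ex Q (fun s => (f s)^-1) <= 1 + 2 * b ^+ 2.
Proof.
move=> f2 fb.
apply: (@le_trans _ _ (Ex Q (fun s => (2 + 2 * b ^+ 2) - f s))); last first.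
  by rewrite ExB//; [rewrite Ex_cst Ef; lra|exact: bm_cst].
apply: le_Ex; [exact: (bm_inv m0)|by apply: bmB => //; exact: bm_cst|] => s.
have b2 : (f s - 1) ^+ 2 <= b ^+ 2.
  by rewrite -(real_normK (num_real (f s - 1))) ler_pXn2r// nnegrE (le_trans _ (fb s)).
rewrite -[leLHS]mul1r ler_pdivrMr//.
have := f2 s; have := sqr_ge0 b; nra.
Qed.

(** The left-hand side is the Hellinger affinity; expanding the square in [sqhell] uses that [g] has
    mean 1. *)
Lemma Ex_sqrtE : Ex Q (fun s => Num.sqrt (g s)) = 1 - sqhell g / 2.
Proof.
have bs := bm_sqrt g0 bg.
have -> : sqhell g = 2 - 2 * Ex Q (fun s => Num.sqrt (g s)).
  rewrite /sqhell -(ExZ _ _ bs) (_ : (fun s => _) =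
      (fun s => (g s + 1) - 2 * Num.sqrt (g s))); last first.
    by apply/funext => s; rewrite sqrrB expr1n mulr1 sqr_sqrtr ?(ltW (g0 s))// mulr_natl; ring.
  rewrite (ExB _ (bmD bg (bm_cst 1)) (bmZ 2 bs)) (ExD _ bg (bm_cst 1)) Eg Ex_cst.
  by congr (_ - _).
by field.
Qed.

Lemma Ex_sqrt_le : Ex Q (fun s => Num.sqrt (g s)) <= expR (- (sqhell g / 2)).
Proof. by rewrite Ex_sqrtE; exact: expR_ge1Dx. Qed.

(** The error of a test built for [g] when the truth is replaced by the nearby alternative [f]. Up
    to [f - g], of mean 0, [f / sqrt g] is [sqrt g] plus a cross term, which costs half of the
    Hellinger gain, hence the [1 / 4], and [b^2]. *)
Lemma Ex_ratio_le : (forall s, `|f s - g s| <= b * g s) ->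
  Ex Q (fun s => f s / Num.sqrt (g s)) <= expR (- (sqhell g / 4) + b ^+ 2).
Proof.
move=> fb; have bs := bm_sqrt g0 bg.
have sg0 s : 0 < Num.sqrt (g s) by rewrite sqrtr_gt0.
have bsi : bm (fun s => (Num.sqrt (g s))^-1).
  by apply: (bm_inv (m := Num.sqrt m)) => //; [rewrite sqrtr_gt0|move=> s; rewrite ler_sqrt// ltW].
have bq : bm (fun s => (Num.sqrt (g s) - 1) ^+ 2).
  by apply: bmX; apply: bmB => //; exact: bm_cst.
apply: le_trans (expR_ge1Dx _).
pose rhs s := (Num.sqrt (g s) + (f s - g s)) + (4^-1 * (Num.sqrt (g s) - 1) ^+ 2 + b ^+ 2 * g s).
apply: (@le_trans _ _ (Ex Q rhs)); last first.
  rewrite /rhs (ExD _ (bmD bs (bmB bf bg)) (bmD (bmZ _ bq) (bmZ _ bg))).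
  rewrite (ExD _ bs (bmB bf bg)) (ExB _ bf bg) (ExD _ (bmZ _ bq) (bmZ _ bg)) !ExZ// Ef Eg.
  by rewrite Ex_sqrtE -/(sqhell g); lra.
apply: le_Ex.
- exact: bmM.
- by apply: bmD; [apply: bmD => //; exact: bmB|apply: bmD; exact: bmZ].
move=> s; rewrite /rhs; move: (fb s) (sg0 s) (sqr_sqrtr (ltW (g0 s))).
move: (Num.sqrt (g s)) (f s) => r u ub r0 gE; rewrite -gE in ub *.
(* AM-GM applied to the cross term [(u - r^2) / r * (1 - r)]. *)
have -> : u / r = r + (u - r ^+ 2) + (u - r ^+ 2) / r * (1 - r) by field; rewrite gt_eqF.
rewrite lerD2l; set v := (u - r ^+ 2) / r.
have vb : `|v| <= b * r.
  rewrite normrM normfV (gtr0_norm r0) ler_pdivrMr//; apply: le_trans ub _.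
  by rewrite expr2 mulrA.
have v2 : v ^+ 2 <= b ^+ 2 * r ^+ 2.
  by rewrite -exprMn -(real_normK (num_real v)) ler_pXn2r// nnegrE (le_trans _ vb).
have := sqr_ge0 (v - (1 - r) / 2); lra.
Qed.
End quadratic_bounds.

Section posterior_bound.
Context {R : realType} {dO dW dS} {Om : measurableType dO} {W : measurableType dW}
  {S : measurableType dS}.
Variables (PX : probability Om R) (P : probability W R) (Q : probability S R).
Variable X : nat -> Om -> S.
Hypothesis mX : forall m, measurable_fun setT (X m).
Hypothesis lawX : forall m A, measurable A -> PX (X m @^-1` A) = Q A.
Hypothesis indX : forall n (A : nat -> set S), (forall m, measurable (A m)) ->
  PX (\bigcap_(m in [set m | (m < n)%N]) X m @^-1` A m) = (\prod_(m < n) PX (X m @^-1` A m))%E.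
Variables (rho : W * S -> R) (m0 : R).
Hypotheses (m00 : 0 < m0) (mrho : forall z, m0 <= rho z) (brho : bm rho).
Hypothesis Erho : forall w, Ex Q (fun s => rho (w, s)) = 1.
Variable n : nat.

Definition lik (z : W * Om) : R := \prod_(m < n) rho (z.1, X m z.2).

Let rho_gt0 z : 0 < rho z. Proof. exact: lt_le_trans (mrho z). Qed.

Lemma lik_gt0 z : 0 < lik z.
Proof. by apply: prodr_gt0 => m _; exact: rho_gt0. Qed.

Let likmin : 0 < m0 ^+ n. Proof. by rewrite exprn_gt0. Qed.

Let lik_ge z : m0 ^+ n <= lik z.
Proof.
rewrite -[X in _ ^+ X](card_ord n) -prodr_const; apply: ler_prod => m _.
by rewrite (ltW m00) mrho.
Qed.

Lemma bm_lik : bm lik.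
Proof.
apply: bm_prod => m; apply: (bm_comp brho).
by apply: measurable_fun_pair => //; apply: measurableT_comp.
Qed.

Let brho1 w : bm (fun s => rho (w, s)). Proof. exact: bm_pair1. Qed.

Lemma Ex_lik w : Ex PX (fun o => lik (w, o)) = 1.
Proof. by rewrite (iid_power mX lawX indX n (brho1 w)) Erho expr1n. Qed.

Section denominator.
Variables (N : set W) (b beta : R).
Hypotheses (mN : measurable N) (beta0 : 0 < beta).
Hypothesis hN : forall w s, N w -> 2^-1 <= rho (w, s) /\ `|rho (w, s) - 1| <= b.
Let p := Ex P \1_N.
Hypothesis p0 : 0 < p.

Let bN : bm (\1_N : W -> R). Proof. exact: bm_indic. Qed.

Let bNL : bm (fun z : W * Om => \1_N z.1 * lik z).
Proof. by apply: bmM; [exact: (bm_comp bN)|exact: bm_lik]. Qed.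

Let bNI : bm (fun z : W * Om => \1_N z.1 * (lik z)^-1).
Proof. by apply: bmM; [exact: (bm_comp bN)|exact: (bm_inv likmin lik_ge bm_lik)]. Qed.

Definition evidence (o : Om) : R := Ex P (fun w => \1_N w * lik (w, o)).

Lemma bm_evidence : bm evidence.
Proof.
apply: (bm_Ex P (F := fun z : Om * W => \1_N z.2 * lik (z.2, z.1))).
by apply: (bm_comp bNL (phi := fun z : Om * W => (z.2, z.1))); exact: measurable_fun_pair.
Qed.

(* Averaging [1 / x >= 2 c - c^2 x] at the inverse of the mean gives Jensen's
   inequality for the inverse. *)
Lemma evidence_jensen o : p ^+ 2 <= evidence o * Ex P (fun w => \1_N w * (lik (w, o))^-1).
Proof.
have b1 : bm (fun w => \1_N w * lik (w, o)) := bm_pair2 o bNL.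
have b2 : bm (fun w => \1_N w * (lik (w, o))^-1) := bm_pair2 o bNI.
set U := Ex P _; have V0 : 0 < evidence o.
  apply: (@lt_le_trans _ _ (m0 ^+ n * p)); first by rewrite mulr_gt0.
  rewrite -ExZ//; apply: le_Ex => //; first exact: bmZ.
  by move=> w; rewrite mulrC ler_wpM2l// indicE.
pose c := p / evidence o.
have : Ex P (fun w => (2 * c) * \1_N w - c ^+ 2 * (\1_N w * lik (w, o))) <= U.
  apply: le_Ex => //; first by apply: bmB; exact: bmZ.
  move=> w; rewrite indicE; case: (_ \in _); last by rewrite !mul0r !mulr0 subrr.
  rewrite !mul1r mulr1 -[leRHS]mul1r ler_pdivlMr ?lik_gt0//.
  by have := sqr_ge0 (c * lik (w, o) - 1); lra.
rewrite (ExB _ (bmZ _ bN) (bmZ _ b1)) !ExZ// -/(evidence o) -/p.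
have -> : 2 * c * p - c ^+ 2 * evidence o = p ^+ 2 / evidence o.
  by rewrite /c; field; rewrite gt_eqF.
by rewrite ler_pdivrMr// mulrC.
Qed.

Lemma measurable_evidence_lt : measurable [set o | evidence o < p * beta].
Proof.
have := (bm_meas bm_evidence) measurableT _ (measurable_itv `]-oo, (p * beta)[).
by rewrite setTI; congr measurable; apply/seteqP; split => o /=; rewrite in_itv.
Qed.

(** By [evidence_jensen], evidence below [p * beta] forces the prior mean over [N] of the inverse
    likelihood ratio above [p / beta]. Markov's inequality applies, since the expectation of that
    mean is at most [p (1 + 2 b^2)^n] by Fubini, independence and [Ex_inv_le]. *)
Lemma evidence_small :
  Ex PX \1_[set o | evidence o < p * beta] <= beta * (1 + 2 * b ^+ 2) ^+ n.
Proof.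
have mE := measurable_evidence_lt.
have bU : bm (fun o => Ex P (fun w => \1_N w * (lik (w, o))^-1)).
  apply: (bm_Ex P (F := fun z : Om * W => \1_N z.2 * (lik (z.2, z.1))^-1)).
  by apply: (bm_comp bNI (phi := fun z : Om * W => (z.2, z.1))); exact: measurable_fun_pair.
apply: (@le_trans _ _ (beta / p * Ex PX (fun o => Ex P (fun w => \1_N w * (lik (w, o))^-1)))).
  rewrite -ExZ//; apply: le_Ex; [exact: bm_indic|exact: bmZ|] => o.
  have U0 : 0 <= Ex P (fun w => \1_N w * (lik (w, o))^-1).
    by apply: Ex_ge0 => w; rewrite mulr_ge0 ?indicE// invr_ge0 ltW// lik_gt0.
  rewrite indicE; have [/set_mem /= Vb|_] := boolP (o \in _); last first.
    by rewrite mulr_ge0 ?divr_ge0// ltW.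
  have := evidence_jensen o; set U := Ex P _ in U0 * => J.
  rewrite mulrAC ler_pdivlMr// mul1r.
  have : p * p <= p * (beta * U).
    by rewrite -expr2 (le_trans J)// mulrA ler_wpM2r// ltW.
  by rewrite ler_pM2l.
rewrite -(Ex_swap P PX bNI) mulrAC ler_pdivrMr// -mulrA ler_wpM2l ?(ltW beta0)//.
rewrite /p -(ExZ _ _ bN).
apply: le_Ex; [exact: (bm_Ex PX bNI)|exact: bmZ|] => w.
have bi : bm (fun s => (rho (w, s))^-1) by exact: (bm_inv m00 (fun s => mrho (w, s)) (brho1 w)).
have [Nw|nNw] := pselect (N w); last first.
  rewrite !indicE memNset// mulr0 (_ : (fun _ => _) = (fun=> 0)) ?Ex_cst//.
  by apply/funext => o; rewrite mul0r.
rewrite indicE mem_set// mulr1.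
rewrite (_ : (fun _ => _) = (fun o => \prod_(m < n) (rho (w, X m o))^-1)); last first.
  by apply/funext => o; rewrite mul1r /lik -prodfV.
rewrite (iid_power mX lawX indX n bi).
apply: lerXn2r; rewrite ?nnegrE.
- by apply: Ex_ge0 => s; rewrite invr_ge0 ltW.
- by rewrite addr_ge0// mulr_ge0// sqr_ge0.
apply: (Ex_inv_le m00 (fun s => mrho (w, s)) (brho1 w) (Erho w)).
- by move=> s; have [] := hN s Nw.
- by move=> s; have [] := hN s Nw.
Qed.
End denominator.

Section tests.
Variables (G A : set W) (T : finType) (code : W -> T) (b D2 : R).
Hypothesis hcode : forall w w' s, G w -> G w' -> code w = code w' ->
  `|rho (w, s) - rho (w', s)| <= b * rho (w', s).
Hypothesis hA : forall w, A w -> D2 <= sqhell Q (fun s => rho (w, s)).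

Let bs w : bm (fun s => Num.sqrt (rho (w, s))).
Proof. exact: (bm_sqrt (fun s => rho_gt0 (w, s)) (brho1 w)). Qed.

Let bslik w : bm (fun o => \prod_(m < n) Num.sqrt (rho (w, X m o))).
Proof. by apply: bm_prod => m; exact: (bm_comp (bs w)). Qed.

(* The test accepts an alternative when the square root of the likelihood ratio
   of the representative of one of the codes exceeds 1. *)
Lemma sieve_test : exists Phi : set Om, [/\ measurable Phi,
  Ex PX \1_Phi <= #|T|%:R * expR (- (D2 / 2)) ^+ n &
  forall w, G w -> A w ->
    Ex PX (fun o => \1_(~` Phi) o * lik (w, o)) <= expR (- (D2 / 4) + b ^+ 2) ^+ n].
Proof.
(* A code is represented by an alternative lying in the sieve, so that the test attached to it has a
   controlled error; codes without such a member are discarded by [good]. *)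
have /choice[r hr] : forall j : T, exists w, (exists w', [/\ G w', A w' & code w' = j]) ->
    [/\ G w, A w & code w = j].
  move=> j; have [[w h]|nh] := pselect (exists w', [/\ G w', A w' & code w' = j]).
    by exists w.
  by exists point => h.
pose good : pred T := fun j => `[< exists w', [/\ G w', A w' & code w' = j] >].
pose Tj j (o : Om) := \prod_(m < n) Num.sqrt (rho (r j, X m o)).
have Tj0 j o : 0 < Tj j o by apply: prodr_gt0 => m _; rewrite sqrtr_gt0.
have mTj j : measurable [set o | 1 < Tj j o].
  have := (bm_meas (bslik (r j))) measurableT _ (measurable_itv `]1, +oo[).
  by rewrite setTI; congr measurable; apply/seteqP; split => o /=; rewrite in_itv/= andbT.
pose Phi := \bigcup_(j in [set j | good j]) [set o | 1 < Tj j o].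
have mPhi : measurable Phi by apply: fin_bigcup_measurable => //; exact: finite_finset.
exists Phi; split=> //.
  apply: (@le_trans _ _ (Ex PX (fun o => \sum_(j : T) (good j)%:R * Tj j o))).
    apply: le_Ex; [exact: bm_indic|by apply: bm_sum => j; apply: bmZ; exact: bslik|] => o.
    rewrite indicE; have [/set_mem[j /= gj hj]|_] := boolP (_ \in _).
      rewrite (bigD1 j)//= gj mul1r -[leLHS]addr0 lerD//; first exact: ltW.
      by apply: sumr_ge0 => i _; rewrite mulr_ge0// ltW.
    by apply: sumr_ge0 => i _; rewrite mulr_ge0// ltW.
  rewrite Ex_sum; last by move=> j; apply: bmZ; exact: bslik.
  rewrite mulr_natl -sumr_const; apply: ler_sum => j _.
  rewrite ExZ; last exact: bslik.
  have [gj|_] := boolP (good j); last by rewrite mul0r exprn_ge0// expR_ge0.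
  rewrite mul1r (iid_power mX lawX indX n (bs (r j))).
  apply: lerXn2r; rewrite ?nnegrE ?expR_ge0//.
    by apply: Ex_ge0 => s; exact: sqrtr_ge0.
  apply: (le_trans (Ex_sqrt_le m00 (fun s => mrho (r j, s)) (brho1 (r j)) (Erho (r j)))).
  move/asboolP : gj => /hr[_ Ar _].
  by rewrite ler_expR lerN2 ler_pM2r// hA.
move=> w Gw Aw.
have gj : good (code w) by apply/asboolP; exists w.
have [Gr Ar cr] : [/\ G (r (code w)), A (r (code w)) & code (r (code w)) = code w].
  by apply: hr; exists w.
set j := code w in gj Gr Ar cr *.
have bi : bm (fun s => (Num.sqrt (rho (r j, s)))^-1).
  apply: (bm_inv (m := Num.sqrt m0) _ _ (bs (r j))); first by rewrite sqrtr_gt0.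
  by move=> s; rewrite ler_sqrt// ltW.
have bq : bm (fun s => rho (w, s) / Num.sqrt (rho (r j, s))) by exact: bmM.
have mC : measurable (~` Phi) by exact: measurableC.
apply: (@le_trans _ _ (Ex PX (fun o => \prod_(m < n) (rho (w, X m o) / Num.sqrt (rho (r j, X m o)))))).
  apply: le_Ex.
  - by apply: bmM; [exact: bm_indic|exact: (bm_pair1 w bm_lik)].
  - by apply: bm_prod => m; exact: (bm_comp bq).
  move=> o; have q0 : 0 <= \prod_(m < n) (rho (w, X m o) / Num.sqrt (rho (r j, X m o))).
    by apply: prodr_ge0 => m _; rewrite divr_ge0 ?sqrtr_ge0// ltW.
  rewrite indicE; have [/set_mem nP|_] := boolP (_ \in _); last by rewrite mul0r.
  rewrite mul1r big_split/= -/(lik (w, o)) prodfV -/(Tj j o) ler_pdivlMr//.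
  rewrite ler_piMr ?(ltW (lik_gt0 _))// leNgt; apply/negP => T1; apply: nP.
  by exists j.
rewrite (iid_power mX lawX indX n bq).
apply: lerXn2r; rewrite ?nnegrE ?expR_ge0//.
  by apply: Ex_ge0 => s; rewrite divr_ge0 ?sqrtr_ge0// ltW.
have hb s : `|rho (w, s) - rho (r j, s)| <= b * rho (r j, s) by exact: hcode.
apply: le_trans (Ex_ratio_le m00 (fun s => mrho (r j, s)) (brho1 w) (brho1 (r j))
  (Erho w) (Erho (r j)) hb) _.
by rewrite ler_expR lerD2r lerN2 ler_pM2r// hA.
Qed.
End tests.

(** Off [Phi] and off the event of small evidence, a posterior mass above [delta] forces the
    numerator above [delta * (p * beta)]. By Markov's inequality and Fubini this costs the prior
    mass outside the sieve, where the likelihood ratio has mean 1, plus the error of the tests on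
    alternatives inside it. *)
Lemma posterior_bound (N G A : set W) (T : finType) (code : W -> T) (b D2 beta delta : R) :
  measurable N -> measurable G -> measurable A -> 0 < beta -> 0 < delta ->
  0 < Ex P \1_N ->
  (forall w s, N w -> 2^-1 <= rho (w, s) /\ `|rho (w, s) - 1| <= b) ->
  (forall w w' s, G w -> G w' -> code w = code w' ->
    `|rho (w, s) - rho (w', s)| <= b * rho (w', s)) ->
  (forall w, A w -> D2 <= sqhell Q (fun s => rho (w, s))) ->
  (PX [set o | (delta < Ex P (fun w => \1_A w * lik (w, o)) / Ex P (fun w => lik (w, o)))%R] <=
  (#|T|%:R * expR (- (D2 / 2)) ^+ n + beta * (1 + 2 * b ^+ 2) ^+ n +
   (Ex P \1_(~` G) + expR (- (D2 / 4) + b ^+ 2) ^+ n) / (delta * (Ex P \1_N * beta)))%:E)%E.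
Proof.
move=> mN mG mA beta0 delta0 p0 hN hcode hA.
have [Phi [mPhi PhiE hPhi]] := sieve_test hcode hA.
have mV := measurable_evidence_lt beta mN.
have VE := evidence_small mN beta0 hN p0.
set p := Ex P \1_N in p0 mV VE *.
set V := [set o | _] in mV VE.
have bAL : bm (fun z : W * Om => \1_A z.1 * lik z).
  by apply: bmM; [exact: (bm_comp (bm_indic mA))|exact: bm_lik].
have bswap (F : W * Om -> R) : bm F -> bm (fun z : Om * W => F (z.2, z.1)).
  by move=> bF; apply: (bm_comp bF); exact: measurable_fun_pair.
have bnum : bm (fun o => Ex P (fun w => \1_A w * lik (w, o))) := bm_Ex P (bswap _ bAL).
have bden : bm (fun o => Ex P (fun w => lik (w, o))) := bm_Ex P (bswap _ bm_lik).
have bnPhi : bm (\1_(~` Phi) : Om -> R) by apply: bm_indic; exact: measurableC.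
have bPAL : bm (fun z : W * Om => \1_(~` Phi) z.2 * (\1_A z.1 * lik z)).
  by apply: bmM => //; exact: (bm_comp bnPhi).
have den_ge o : m0 ^+ n <= Ex P (fun w => lik (w, o)).
  by apply: Ex_ge_cst => //; exact: (bm_pair2 o bm_lik).
set ev := [set o | _].
have mev : measurable ev.
  have bi := bmM bnum (bm_inv likmin den_ge bden).
  have := (bm_meas bi) measurableT _ (measurable_itv `]delta, +oo[).
  by rewrite setTI; congr measurable; apply/seteqP; split => o /=; rewrite in_itv/= andbT.
rewrite -Ex_indicE// lee_fin.
pose q := (delta * (p * beta))^-1.
have q0 : 0 < q by rewrite invr_gt0 !mulr_gt0.
pose num' o := \1_(~` Phi) o * Ex P (fun w => \1_A w * lik (w, o)).
have bnum' : bm num' by exact: bmM.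
have num0 o : 0 <= Ex P (fun w => \1_A w * lik (w, o)).
  by apply: Ex_ge0 => w; rewrite mulr_ge0 ?indicE// ltW// lik_gt0.
apply: (@le_trans _ _ (Ex PX (fun o => (\1_Phi o + \1_V o) + q * num' o))).
  apply: le_Ex; first exact: bm_indic.
    by apply: bmD; [apply: bmD; exact: bm_indic|exact: bmZ].
  move=> o; rewrite [in leLHS]indicE; have [/set_mem /= evo|_] := boolP (_ \in _); last first.
    by rewrite !addr_ge0 ?indicE// mulr_ge0 ?(ltW q0)// mulr_ge0// indicE.
  have [Po|nPo] := pselect (Phi o).
    rewrite indicE mem_set// -addrA lerDl addr_ge0 ?indicE//.
    by rewrite mulr_ge0 ?(ltW q0)// mulr_ge0// indicE.
  have [Vo|nVo] := pselect (V o).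
    rewrite (_ : \1_V o = 1); last by rewrite indicE mem_set.
    rewrite addrAC lerDr addr_ge0 ?indicE//.
    by rewrite mulr_ge0 ?(ltW q0)// mulr_ge0// indicE.
  rewrite !indicE !memNset// !add0r /num' indicE mem_set// mul1r.
  rewrite /q mulrC ler_pdivlMr ?mul1r ?mulr_gt0//.
  have evge : p * beta <= Ex P (fun w => lik (w, o)).
    move/negP : nVo; rewrite -leNgt => /le_trans; apply.
    apply: le_Ex.
    - by apply: bmM; [exact: bm_indic|exact: (bm_pair2 o bm_lik)].
    - exact: (bm_pair2 o bm_lik).
    move=> w; rewrite indicE; case: (_ \in _); rewrite ?mul1r// mul0r ltW//.
    exact: lik_gt0.
  move: evo; rewrite /ev /= ltr_pdivlMr; last exact: lt_le_trans (den_ge o).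
  by move=> /ltW; apply: le_trans; rewrite ler_wpM2l// ltW.
rewrite (ExD _ (bmD (bm_indic mPhi) (bm_indic mV)) (bmZ q bnum')).
rewrite (ExD _ (bm_indic mPhi) (bm_indic mV)) (ExZ _ _ bnum').
apply: lerD; first exact: lerD.
rewrite mulrC ler_pM2r//.
rewrite (_ : Ex PX num' = Ex P (fun w => \1_A w * Ex PX (fun o => \1_(~` Phi) o * lik (w, o))));
  last first.
  transitivity (Ex PX (fun o => Ex P (fun w => \1_(~` Phi) o * (\1_A w * lik (w, o))))).
    congr Ex; apply/funext => o; rewrite /num' -ExZ//; exact: (bm_pair2 o bAL).
  rewrite -(Ex_swap P PX bPAL); congr Ex; apply/funext => w; rewrite -ExZ.
    by congr Ex; apply/funext => o; rewrite mulrCA.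
  by apply: bmM => //; exact: (bm_pair1 w bm_lik).
have bPL : bm (fun z : W * Om => \1_(~` Phi) z.2 * lik z).
  by apply: bmM; [exact: (bm_comp bnPhi)|exact: bm_lik].
have bI : bm (fun w => Ex PX (fun o => \1_(~` Phi) o * lik (w, o))) := bm_Ex PX bPL.
set c := expR _ ^+ n.
have c0 : 0 <= c by rewrite exprn_ge0// expR_ge0.
have mGC : measurable (~` G) by exact: measurableC.
apply: (@le_trans _ _ (Ex P (fun w => \1_(~` G) w + c))); last first.
  by rewrite (ExD _ (bm_indic mGC) (bm_cst c)) Ex_cst.
apply: le_Ex; first by apply: bmM => //; exact: bm_indic.
  by apply: bmD; [exact: bm_indic|exact: bm_cst].
move=> w; have I1 : Ex PX (fun o => \1_(~` Phi) o * lik (w, o)) <= 1.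
  rewrite -(Ex_lik w); apply: le_Ex.
  - by apply: bmM => //; exact: (bm_pair1 w bm_lik).
  - exact: (bm_pair1 w bm_lik).
  move=> o; rewrite indicE; case: (_ \in _); rewrite ?mul1r// mul0r ltW//.
  exact: lik_gt0.
rewrite [\1_A w]indicE; have [/set_mem Aw|_] := boolP (w \in A); last first.
  by rewrite mul0r addr_ge0 ?indicE.
rewrite mul1r; have [Gw|nGw] := pselect (G w).
  by apply: le_trans (hPhi w Gw Aw) _; rewrite lerDr indicE.
by rewrite indicE mem_set// (le_trans I1)// lerDl.
Qed.

End posterior_bound.

(** * Deep compositions *)

Section deep_lipschitz.
Context {R : realType} (H : nat) (dim : nat -> nat) (K : @constraint_bounds R dim).
Implicit Types z : @layer_functions R dim.

Definition admissible z : Prop :=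
  (forall h i x, (1 <= h < H)%N -> cube x -> `|z h i x| <= 1) /\
  (forall h i, (2 <= h <= H)%N -> cubes_lip (@K h i) (z h i)).

(** A layer adds its own error to that of its inputs multiplied by its Lipschitz constants, which
    are summed over all outputs so as to be uniform in them. *)
Fixpoint deep_cst (h : nat) : R :=
  if h is h'.+1 then 1 + (\sum_i \sum_j `|@K h'.+1 i j|) * deep_cst h' else 0.

Lemma deep_cst_ge0 h : 0 <= deep_cst h.
Proof.
elim: h => //= h IH; rewrite addr_ge0// mulr_ge0//.
by apply: sumr_ge0 => i _; apply: sumr_ge0.
Qed.

Lemma compose_cube z x h : admissible z -> cube x -> (h < H)%N -> cube (compose z h x).
Proof.
move=> [z1 _] cx; elim: h => [|h IH] hH //= j; rewrite mxE; apply: z1 => //.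
exact: IH (ltnW hH).
Qed.

Lemma compose_close z z' (e : R) x : admissible z -> admissible z' -> cube x ->
  (forall h i y, (1 <= h <= H)%N -> cube y -> `|z h i y - z' h i y| <= e) -> 0 <= e ->
  forall h, (h <= H)%N -> forall j,
    `|compose z h x ord0 j - compose z' h x ord0 j| <= deep_cst h * e.
Proof.
move=> az az' cx zz' e0; elim=> [|h IH] hH j; first by rewrite subrr normr0 mul0r.
rewrite /= !mxE; set y := compose z h x; set y' := compose z' h x.
have cy : cube y by exact: compose_cube.
have cy' : cube y' by exact: compose_cube.
apply: le_trans (ler_distD (z' h.+1 j y) _ _) _.
rewrite mulrDl mul1r; apply: lerD; first exact: zz'.
(* The first layer carries no Lipschitz bound, but both compositions feed it the same point. *)
case: h IH hH j @y @y' cy cy' => [|h] IH hH j y y' cy cy'.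
  by rewrite /y /y' /= subrr normr0 mulr0 mulr_ge0 ?mul0r.
have := (proj2 az') h.+2 j hH y y' cy cy'; move/le_trans; apply.
apply: (@le_trans _ _ (\sum_l `|K j l| * (deep_cst h.+1 * e))).
  apply: ler_sum => l _; apply: (@le_trans _ _ (`|K j l| * `|y ord0 l - y' ord0 l|)).
    by rewrite ler_wpM2r// ler_norm.
  by rewrite ler_wpM2l// IH// ltnW.
rewrite -mulr_suml -mulrA ler_wpM2r ?mulr_ge0 ?deep_cst_ge0//.
rewrite [leRHS](bigD1 j)//= lerDl; apply: sumr_ge0 => i _.
exact: sumr_ge0.
Qed.

Variable dimH : dim H.+1 = 1%N.

Lemma deep_close z z' (e : R) x : admissible z -> admissible z' -> cube x ->
  (forall h i y, (1 <= h <= H)%N -> cube y -> `|z h i y - z' h i y| <= e) -> 0 <= e ->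
  `|deep dimH z x - deep dimH z' x| <= deep_cst H * e.
Proof. by move=> az az' cx zz' e0; apply: compose_close. Qed.

Lemma compose_osc z x y h : admissible z -> (1 <= h < H)%N -> cube x -> cube y ->
  forall j, `|compose z h.+1 x ord0 j - compose z h.+1 y ord0 j| <=
     (\sum_(i < dim h.+2) \sum_(l < dim h.+1) `|K i l|) * 2.
Proof.
move=> az /andP[h1 hH] cx cy j; rewrite /= !mxE.
have cu := compose_cube az cx hH; have cv := compose_cube az cy hH.
set u := compose z h x in cu *; set v := compose z h y in cv *.
have h2 : (2 <= h.+1 <= H)%N by rewrite ltnS h1 hH.
have := (proj2 az) h.+1 j h2 u v cu cv; move/le_trans; apply.
apply: (@le_trans _ _ ((\sum_l `|K j l|) * 2)).
  rewrite mulr_suml; apply: ler_sum => l _.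
  apply: (@le_trans _ _ (`|K j l| * `|u ord0 l - v ord0 l|)).
    by rewrite ler_wpM2r// ler_norm.
  rewrite ler_wpM2l//; apply: le_trans (ler_normB _ _) _.
  by have := cu l; have := cv l; lra.
rewrite ler_pM2r// [leRHS](bigD1 j)//= lerDl; apply: sumr_ge0 => i _.
exact: sumr_ge0.
Qed.

End deep_lipschitz.

(** The last layer has bounded derivatives only, so its values may be large; its argument lies in a
    cube of side 2, which bounds the oscillation, and a density does not see additive constants. *)
Lemma deep_osc {R : realType} (H : nat) (dim : nat -> nat) (K : @constraint_bounds R dim)
    (dimH : dim H.+1 = 1%N) : (2 <= H)%N ->
  exists2 B : R, 0 <= B & forall z x y, admissible H K z -> cube x -> cube y ->
    `|deep dimH z x - deep dimH z y| <= B.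
Proof.
move=> H2; exists ((\sum_i \sum_(l < dim H) `|K H i l|) * 2).
  by rewrite mulr_ge0//; apply: sumr_ge0 => i _; exact: sumr_ge0.
move=> z x y az cx cy; rewrite /deep.
case: H dimH H2 az => [|h] // dimH H2 az.
by apply: (@compose_osc R h.+1 dim K) => //; rewrite ltnSn andbT.
Qed.

Section evaluation.
Context {R : realType} {k : nat} {d dV} {W : measurableType d} {V : measurableType dV}.

(* The value of a continuous random function at a random point of the cube is
   the limit of its values at nearby points of a countable dense set. *)
Lemma measurable_random_eval (F : W -> 'rV[R]_k -> R) (phi : V -> W) (u : V -> 'rV[R]_k) :
  (forall w, cube_continuous (F w)) ->
  (forall x, cube x -> measurable_fun setT (fun w => F w x)) ->
  measurable_fun setT phi -> (forall j, measurable_fun setT (fun v => u v ord0 j)) ->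
  (forall v, cube (u v)) -> measurable_fun setT (fun v => F (phi v) (u v)).
Proof.
move=> cF mF mphi mu cu.
pose close n i := [set v : V | forall j, `|u v ord0 j - cubept i ord0 j| < n.+1%:R^-1].
have mclose n i : measurable (close n i).
  rewrite (_ : close n i = \bigcap_(j in [set: 'I_k])
     [set v | `|u v ord0 j - cubept i ord0 j| < n.+1%:R^-1]).
    apply: fin_bigcap_measurable => // j _.
    have mf : measurable_fun setT (fun v => `|u v ord0 j - (cubept i : 'rV[R]_k) ord0 j|).
      by apply: measurableT_comp => //; exact: measurable_funB.
    have := mf measurableT _ (measurable_itv `]-oo, (n.+1%:R^-1 : R)[).
    by rewrite setTI; congr measurable; apply/seteqP; split => v /=; rewrite in_itv.
  by apply/seteqP; split=> v h j => [_|]; [exact: h|exact: (h j I)].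
have ex n v : exists i, `[< close n i v >].
  have n0 : 0 < n.+1%:R^-1 :> R by rewrite invr_gt0.
  by have [i hi] := cubept_dense (cu v) n0; exists i; apply/asboolP.
(* Taking the first admissible index makes each event [idx n v = i] a difference of measurable
   sets. *)
pose idx n v := ex_minn (ex n v).
have idxP n v : close n (idx n v) v by rewrite /idx; case: ex_minnP => i /asboolP.
have midx n i : measurable [set v | idx n v = i].
  rewrite (_ : [set v | _] = close n i `&` ~` (\bigcup_(l in [set l | (l < i)%N]) close n l)).
    apply: measurableI => //; apply: measurableC.
    by apply: bigcup_measurable => l _.
  apply/seteqP; split=> v /=.
    move=> <-; split=> [|[l /= li hl]]; first exact: idxP.
    move: li; rewrite /idx; case: ex_minnP => m _ hm; rewrite ltnNge => /negP; apply.
    by apply: hm; apply/asboolP.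
  move=> [hi hl]; rewrite /idx; case: ex_minnP => m /asboolP hm mmin.
  apply/eqP; rewrite eqn_leq mmin/=; last exact/asboolP.
  by rewrite leqNgt; apply/negP => mi; apply: hl; exists m.
apply: (@measurable_fun_cvg _ _ _ setT (fun n v => F (phi v) (cubept (idx n v)))).
  move=> n _ B mB; rewrite setTI.
  rewrite (_ : _ @^-1` B = \bigcup_i ([set v | idx n v = i] `&`
     ((fun v => F (phi v) (cubept i)) @^-1` B))).
    apply: bigcupT_measurable => i; apply: measurableI => //.
    have mi : measurable_fun setT (fun v => F (phi v) (cubept i)).
      by apply: (measurableT_comp (f := fun w => F w (cubept i))) => //; apply: mF;
        exact: cube_cubept.
    by have := mi measurableT B mB; rewrite setTI.
  apply/seteqP; split=> v /=; first by move=> hB; exists (idx n v).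
  by move=> [i _ [/= <-]].
move=> v _; apply/cvgrPdist_lt => e e0.
have /cube_continuousP/(_ _ (cu v) _ e0)[r r0 hr] := cF (phi v).
near=> n; apply: hr; first exact: cube_cubept.
move=> j; apply: lt_trans (idxP n v j) _.
by near: n; exact: near_infty_natSinv_lt (PosNum r0).
Unshelve. all: by end_near. Qed.

(** A retraction onto the cube: it extends functions on the cube to the whole space, where [bm] is
    stated. *)
Definition clamp (t : 'rV[R]_k) : 'rV[R]_k := \row_j Num.max (-1) (Num.min 1 (t ord0 j)).

Lemma cube_clamps t : cube (clamp t).
Proof. by move=> j; rewrite mxE cube_clamp. Qed.

Lemma clamp_id t : cube t -> clamp t = t.
Proof. by move=> ct; apply/rowP => j; rewrite mxE clampE. Qed.

Lemma measurable_clamp j : measurable_fun setT (fun t : 'rV[R]_k => clamp t ord0 j).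
Proof.
rewrite (_ : (fun t : 'rV[R]_k => _) = fun t : 'rV[R]_k => Num.max (-1) (Num.min 1 (t ord0 j))).
  apply: measurable_maxr => //; apply: measurable_minr => //.
  exact: measurable_entry.
by apply/funext => t; rewrite mxE.
Qed.
End evaluation.

Section random_deep.
Context {R : realType} (H : nat) (dim : nat -> nat) {d} {W : measurableType d}.
Variable Y : W -> @layer_functions R dim.
Hypothesis cY : forall w h i, (1 <= h <= H)%N -> cube_continuous (@Y w h i).
Hypothesis mY : forall h i x, (1 <= h <= H)%N -> cube x ->
  measurable_fun setT (fun w => @Y w h i x).
Hypothesis bY : forall w h i x, (1 <= h < H)%N -> cube x -> `|@Y w h i x| <= 1.

Lemma measurable_compose h : (h <= H)%N -> forall j,
  measurable_fun setT (fun z : W * 'rV[R]_(dim 1%N) => compose (@Y z.1) h (clamp z.2) ord0 j).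
Proof.
have cc w t l : (l < H)%N -> cube (compose (@Y w) l (clamp t)).
  elim: l => [|l IH] hH /=; first exact: cube_clamps.
  by move=> i; rewrite mxE; apply: bY => //; exact: IH (ltnW hH).
elim: h => [|h IH] hH j /=.
  exact: (measurableT_comp (measurable_clamp j)).
rewrite (_ : (fun z => _) = (fun z : W * 'rV[R]_(dim 1%N) =>
   @Y z.1 h.+1 j (compose (@Y z.1) h (clamp z.2)))); last first.
  by apply/funext => z; rewrite mxE.
apply: (@measurable_random_eval R _ _ _ W _ (fun w => @Y w h.+1 j) fst) => //.
- by move=> w; exact: cY.
- by move=> x cx; exact: mY.
- by move=> l; apply: IH; exact: ltnW.
- by move=> z; exact: cc.
Qed.

Lemma measurable_deep (dimH : dim H.+1 = 1%N) :
  measurable_fun setT (fun z : W * 'rV[R]_(dim 1%N) => deep dimH (@Y z.1) (clamp z.2)).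
Proof. exact: measurable_compose. Qed.
End random_deep.

(** * Likelihood ratios *)

Lemma bm_expR {d} {T : measurableType d} {R : realType} (f : T -> R) :
  bm f -> bm (fun x => expR (f x)).
Proof.
move=> [mf [M fM]]; split.
  by apply: measurableT_comp => //; exact: measurable_expR.
exists (expR M) => x; rewrite ger0_norm ?expR_ge0// ler_expR.
exact: le_trans (ler_norm _) (fM x).
Qed.

Section density_law.
Context {R : realType} {d} {T : measurableType d} (mu : {measure set T -> \bar R}).
Variables (D : set T) (p : T -> R) (Q : probability T R).
Hypotheses (mD : measurable D) (mp : measurable_fun D p) (p0 : forall t, D t -> 0 <= p t).
Hypothesis ip : mu.-integrable D (fun t => (p t)%:E).
Hypothesis QE : forall A, measurable A -> Q A = (\int[mu]_(t in A `&` D) (p t)%:E)%E.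

Lemma integrable_density f : bm f -> mu.-integrable D (fun t => (f t * p t)%:E).
Proof.
move=> [mf [M fM]].
have iM : mu.-integrable D (fun t => (M%:E * (p t)%:E)%E) by exact: integrableZl.
apply: (le_integrable _ _ _ iM) => //.
  apply/measurable_EFinP; apply: measurable_funM => //.
  exact: measurable_funS mf.
move=> x Dx /=; rewrite lee_fin !normrM ler_wpM2r//.
by rewrite (le_trans (fM x))// ler_norm.
Qed.

Lemma Ex_density f : bm f -> Ex Q f = \int[mu]_(t in D) (f t * p t).
Proof.
move: f; apply: bm_ind.
- move=> A mA; rewrite Ex_indic// /Rintegral QE//; congr fine.
  rewrite setIC integral_mkcondr; apply: eq_integral => x _.
  by rewrite patchE indicE; case: (x \in A); rewrite ?mul1r ?mul0r.
- move=> f g bf bg ef eg; rewrite ExD// ef eg -RintegralD//; try exact: integrable_density.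
  by apply: eq_Rintegral => x _; rewrite mulrDl.
- move=> c f bf ef; rewrite ExZ// ef -RintegralZl//; last exact: integrable_density.
  by apply: eq_Rintegral => x _; rewrite mulrA.
- move=> f_ f M bf fM fc ef.
  have c1 : Ex Q (f_ n) @[n --> \oo] --> Ex Q f.
    by apply: (@Ex_lim _ _ _ _ f_ f M) => // n; exact: (bm_meas (bf n)).
  have bff : bm f by apply: (bm_lim _ fM fc) => n; exact: (bm_meas (bf n)).
  have c2 : \int[mu]_(t in D) (f_ n t * p t) @[n --> \oo] --> \int[mu]_(t in D) (f t * p t).
    suff /fine_cvgP[] : (\int[mu]_(t in D) (f_ n t * p t)%:E)%E @[n --> \oo]
       --> (\int[mu]_(t in D) (f t * p t))%:E by [].
    rewrite [X in X%:E]/Rintegral fineK; last first.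
      by apply: integrable_fin_num => //; exact: integrable_density.
    apply: (@dominated_cvg _ _ _ mu D mD (fun n t => (f_ n t * p t)%:E) _
      (fun t => (M%:E * (p t)%:E)%E)) => //.
    + move=> n; apply/measurable_EFinP; apply: measurable_funM => //.
      exact: measurable_funS (bm_meas (bf n)).
    + by move=> t _; apply: cvg_EFin; [exact: nearW|apply: cvgMl; exact: fc].
    + exact: integrableZl.
    + move=> n t Dt /=; rewrite lee_fin normrM (ger0_norm (p0 Dt)).
      by rewrite ler_wpM2r// p0.
  rewrite -(cvg_lim _ c1)// -(cvg_lim _ c2)//.
  by under eq_fun do rewrite ef.
Qed.
End density_law.

Lemma measurable_cube {R : realType} (k : nat) : measurable (cube : set 'rV[R]_k).
Proof.
rewrite (_ : cube = \bigcap_(j in [set: 'I_k]) [set x : 'rV[R]_k | `|x ord0 j| <= 1]).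
  apply: fin_bigcap_measurable => // j _; apply: measurable_norm_le.
  exact: measurable_entry.
by apply/seteqP; split=> v h j => [_|]; [exact: h|exact: (h j I)].
Qed.

Section log_densities.
Context {R : realType} {k : nat} (Q : probability 'rV[R]_k R).
Local Notation leb := (lebesgue_rV k).
Variables (p0 f0 : 'rV[R]_k -> R).
Hypothesis dp0 : is_density p0.
Hypothesis p0E : forall t, cube t -> p0 t = density_of f0 t.
Hypothesis QE : forall A, measurable A -> Q A = (\int[leb]_(t in A `&` cube) (p0 t)%:E)%E.
Variable psi0 : 'rV[R]_k -> R.
Hypothesis psi0E : forall t, cube t -> psi0 t = f0 t.
Hypothesis bpsi0 : bm psi0.
Implicit Types psi : 'rV[R]_k -> R.

Let I0 : R := \int[leb]_(s in cube) expR (f0 s).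

Let ip0 : leb.-integrable cube (fun t => (p0 t)%:E).
Proof.
have [mp pp p1] := dp0; apply/integrableP; split; first exact/measurable_EFinP.
rewrite (eq_integral (fun t => (p0 t)%:E)) ?p1 ?ltry// => t /set_mem ct /=.
by rewrite gtr0_norm// pp.
Qed.

Let pge0 t : cube t -> 0 <= p0 t. Proof. by have [_ h _] := dp0; move=> /h/ltW. Qed.

Let Ex_p0 f : bm f -> Ex Q f = \int[leb]_(t in cube) (f t * p0 t).
Proof.
have [mp _ _] := dp0; apply: Ex_density => //; exact: measurable_cube.
Qed.

Lemma normalizer_gt0 : 0 < I0.
Proof.
have c0 := @cube0 R k; have [_ /(_ _ c0) pp _] := dp0.
by move: pp; rewrite p0E// /density_of pmulr_rgt0 ?expR_gt0// invr_gt0.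
Qed.

(** An extension of [p0] to the whole space that stays bounded away from 0, so that dividing by it
    preserves [bm]. *)
Definition base (t : 'rV[R]_k) : R := expR (psi0 t) / I0.

Lemma baseE t : cube t -> base t = p0 t.
Proof. by move=> ct; rewrite p0E// /base /density_of psi0E. Qed.

Lemma bm_base : bm base.
Proof. by apply: bmM; [exact: bm_expR|exact: bm_cst]. Qed.

Lemma base_ge : exists2 m : R, 0 < m & forall t, m <= base t.
Proof.
have [_ [M hM]] := bpsi0; have I00 := normalizer_gt0.
exists (expR (- M) / I0); first by rewrite divr_gt0// expR_gt0.
move=> t; rewrite ler_pM2r ?invr_gt0// ler_expR.
by have := hM t; rewrite ler_norml => /andP[].
Qed.

Lemma base_gt0 t : 0 < base t.
Proof. by have [m m0 hm] := base_ge; exact: lt_le_trans (hm t). Qed.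

Lemma bm_base_inv : bm (fun t => (base t)^-1).
Proof. by have [m m0 hm] := base_ge; exact: (bm_inv m0 hm bm_base). Qed.

(** The normalizing integral of [expR psi] over the cube (see [Ex_base]), written as an expectation
    under the law of the observations. *)
Definition mass psi : R := Ex Q (fun s => expR (psi s) / base s).

Lemma bm_mass psi : bm psi -> bm (fun s => expR (psi s) / base s).
Proof. by move=> bp; apply: bmM; [exact: bm_expR|exact: bm_base_inv]. Qed.

Lemma Ex_base g : bm g -> Ex Q (fun s => g s / base s) = \int[leb]_(t in cube) g t.
Proof.
move=> bg; rewrite Ex_p0; last by apply: bmM => //; exact: bm_base_inv.
apply: eq_Rintegral => t /set_mem ct; rewrite -baseE// divfK// gt_eqF//.
exact: base_gt0.
Qed.

Definition lratio psi (t : 'rV[R]_k) : R := expR (psi t) / (mass psi * base t).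

Lemma mass_gt0 psi : bm psi -> 0 < mass psi.
Proof.
move=> bp; have [_ [M hM]] := bm_base; have [_ [B hB]] := bp.
have M0 : 0 < M by apply: lt_le_trans (hM 0); rewrite normr_gt0 gt_eqF// base_gt0.
apply: (@lt_le_trans _ _ (expR (- B) / M)); first by rewrite divr_gt0// expR_gt0.
apply: Ex_ge_cst; first exact: bm_mass.
move=> t; apply: ler_pM; rewrite ?expR_ge0 ?invr_ge0 ?(ltW M0)//.
  by rewrite ler_expR; have := hB t; rewrite ler_norml => /andP[].
rewrite lef_pV2 ?posrE ?base_gt0//; exact: le_trans (ler_norm _) (hM t).
Qed.

Lemma lratioE psi f t : bm psi -> (forall t, cube t -> psi t = f t) -> cube t ->
  density_of f t = lratio psi t * p0 t.
Proof.
move=> bp pf ct; rewrite /density_of /lratio -baseE// -(pf t ct).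
have -> : \int[leb]_(s in cube) expR (f s) = mass psi.
  rewrite /mass Ex_base; last exact: bm_expR.
  by apply: eq_Rintegral => s /set_mem cs; rewrite pf.
by field; rewrite !gt_eqF ?base_gt0 ?mass_gt0.
Qed.

Lemma lratio_gt0 psi t : bm psi -> 0 < lratio psi t.
Proof. by move=> bp; rewrite divr_gt0 ?expR_gt0// mulr_gt0 ?mass_gt0 ?base_gt0. Qed.

Lemma bm_lratio psi : bm psi -> bm (lratio psi).
Proof.
move=> bp; rewrite (_ : lratio psi = (fun t => (mass psi)^-1 * (expR (psi t) / base t))).
  by apply: bmZ; exact: bm_mass.
by apply/funext => t; rewrite /lratio invfM; ring.
Qed.

Lemma Ex_lratio psi : bm psi -> Ex Q (lratio psi) = 1.
Proof.
move=> bp; rewrite (_ : lratio psi = (fun t => (mass psi)^-1 * (expR (psi t) / base t))).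
  by rewrite ExZ ?mulVf ?gt_eqF ?mass_gt0//; exact: bm_mass.
by apply/funext => t; rewrite /lratio invfM; ring.
Qed.

Lemma hellingerE psi f : bm psi -> (forall t, cube t -> psi t = f t) ->
  hellinger (density_of f) p0 = Num.sqrt (sqhell Q (lratio psi)).
Proof.
move=> bp pf; rewrite /hellinger; congr Num.sqrt.
have bl := bm_lratio bp.
rewrite /sqhell Ex_p0; last first.
  by apply: bmX; apply: bmB; [apply: bm_sqrt => // t; exact: lratio_gt0|exact: bm_cst].
apply: eq_Rintegral => t /set_mem ct; rewrite (lratioE bp pf ct).
rewrite sqrtrM ?(ltW (lratio_gt0 _ bp))// -[in RHS](sqr_sqrtr (pge0 ct)).
by ring.
Qed.

Lemma lratio_shift psi (c : R) : bm psi -> lratio (fun t => psi t - c) =1 lratio psi.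
Proof.
move=> bp t; rewrite /lratio.
have -> : mass (fun t => psi t - c) = expR (- c) * mass psi.
  rewrite /mass -ExZ; last exact: bm_mass.
  by congr Ex; apply/funext => s; rewrite expRD; ring.
by rewrite expRD; field; rewrite !gt_eqF ?base_gt0 ?mass_gt0 ?expR_gt0.
Qed.

Lemma lratio_base t : lratio psi0 t = 1.
Proof.
have I00 := normalizer_gt0; rewrite /lratio.
have -> : mass psi0 = I0.
  rewrite -[RHS](Ex_cst Q); congr Ex; apply/funext => s.
  by rewrite /base; field; rewrite !gt_eqF ?expR_gt0.
by rewrite /base; field; rewrite !gt_eqF ?expR_gt0.
Qed.

(** One factor [expR e] accounts for the numerator and one for the normalizing constant. *)
Lemma lratio_le psi psi' (e : R) t : bm psi -> bm psi' -> (forall t, `|psi t - psi' t| <= e) ->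
  lratio psi t <= expR (e + e) * lratio psi' t.
Proof.
move=> bp bp' h.
have pl s : expR (psi s) <= expR e * expR (psi' s).
  by rewrite -expRD ler_expR; have := h s; rewrite ler_norml => /andP[]; lra.
have pl' s : expR (psi' s) <= expR e * expR (psi s).
  by rewrite -expRD ler_expR; have := h s; rewrite ler_norml => /andP[]; lra.
have ml : mass psi' <= expR e * mass psi.
  rewrite /mass -ExZ; last exact: bm_mass.
  apply: le_Ex; [exact: bm_mass|by apply: bmZ; exact: bm_mass|] => s.
  by rewrite mulrA ler_pM2r ?invr_gt0 ?base_gt0.
have m0 := mass_gt0 bp; have m0' := mass_gt0 bp'.
have mb : 0 < mass psi * base t := mulr_gt0 m0 (base_gt0 t).
rewrite /lratio ler_pdivrMr//.
have -> : expR (e + e) * (expR (psi' t) / (mass psi' * base t)) * (mass psi * base t) =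
  expR (e + e) * expR (psi' t) * mass psi / mass psi'.
  by field; rewrite !gt_eqF ?base_gt0.
rewrite ler_pdivlMr// expRD; apply: (@le_trans _ _ (expR (psi t) * (expR e * mass psi))).
  by rewrite ler_wpM2l ?expR_ge0.
have := pl t => h1; rewrite mulrA -mulrA [leRHS](_ : _ = expR e * expR (psi' t) * (expR e * mass psi)); last by ring.
by rewrite ler_pM2r// mulr_gt0 ?expR_gt0.
Qed.

Lemma expR_le_1D2x (x : R) : 0 <= x <= 2^-1 -> expR x <= 1 + 2 * x.
Proof.
move=> /andP[x0 x2]; have h := expR_ge1Dx (- x); rewrite expRN in h.
have e0 := expR_gt0 x.
have : (1 - x) * expR x <= 1 by rewrite -ler_pdivlMr// mul1r.
have : expR x * (1 - 2^-1) <= (1 - x) * expR x by rewrite mulrC ler_pM2r//; lra.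
nra.
Qed.

Lemma lratio_close psi psi' (e : R) t : bm psi -> bm psi' -> (forall t, `|psi t - psi' t| <= e) ->
  0 <= e <= 4^-1 -> `|lratio psi t - lratio psi' t| <= 4 * e * lratio psi' t.
Proof.
move=> bp bp' h /andP[e0 e4].
have h' s : `|psi' s - psi s| <= e by rewrite distrC.
have := lratio_le t bp bp' h; have := lratio_le t bp' bp h'.
have ee : expR (e + e) <= 1 + 2 * (e + e) by apply: expR_le_1D2x; lra.
have l0 := lratio_gt0 t bp; have l0' := lratio_gt0 t bp'.
have E1 : 1 <= expR (e + e) by rewrite -[leLHS]expR0 ler_expR; lra.
set a := lratio psi t in l0 *; set b := lratio psi' t in l0' *; set E := expR _ in ee E1 *.
by move=> h1 h2; rewrite ler_norml; apply/andP; split; nra.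
Qed.

Section joint.
Context {dW} {W : measurableType dW} (psi : W * 'rV[R]_k -> R).
Hypothesis bpsi : bm psi.

Let bpsi1 w : bm (fun t => psi (w, t)). Proof. exact: bm_pair1. Qed.

Let invmass := Ex Q (fun t => (base t)^-1).

Let invmass_gt0 : 0 < invmass.
Proof.
have := mass_gt0 (bm_cst (0 : R)); rewrite /mass (_ : (fun s => _) = (fun t => (base t)^-1))//.
by apply/funext => t; rewrite expR0 mul1r.
Qed.

Let mass_bounds (B : R) w : (forall z, `|psi z| <= B) ->
  expR (- B) * invmass <= mass (fun t => psi (w, t)) <= expR B * invmass.
Proof.
move=> hB; rewrite /invmass -!(ExZ _ _ bm_base_inv); apply/andP; split; apply: le_Ex;
  try (by apply: bmZ; exact: bm_base_inv); try exact: bm_mass;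
  move=> t; rewrite ler_pM2r ?invr_gt0 ?base_gt0// ler_expR;
  by have := hB (w, t); rewrite ler_norml => /andP[].
Qed.

Lemma bm_joint_lratio : bm (fun z => lratio (fun t => psi (z.1, t)) z.2).
Proof.
have [_ [B hB]] := bpsi.
have bb : bm (fun z : W * 'rV[R]_k => (base z.2)^-1) by exact: (bm_comp bm_base_inv).
have bmass : bm (fun w => mass (fun t => psi (w, t))).
  by apply: (bm_Ex Q (F := fun z => expR (psi z) / base z.2)); apply: bmM => //; exact: bm_expR.
have mge w : expR (- B) * invmass <= mass (fun t => psi (w, t)).
  by have /andP[] := mass_bounds w hB.
have mpos : 0 < expR (- B) * invmass by rewrite mulr_gt0// expR_gt0.
rewrite (_ : (fun z => _) = (fun z : W * 'rV[R]_k =>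
    expR (psi z) * ((mass (fun t => psi (z.1, t)))^-1 * (base z.2)^-1))).
  apply: bmM; first exact: bm_expR.
  apply: bmM => //; exact: (bm_comp (bm_inv mpos mge bmass)).
by apply/funext => -[w t]; rewrite /lratio invfM.
Qed.

Lemma joint_lratio_ge : exists2 m : R, 0 < m &
  forall z, m <= lratio (fun t => psi (z.1, t)) z.2.
Proof.
have [_ [B hB]] := bpsi; have [_ [M hM]] := bm_base.
have M0 : 0 < M by apply: lt_le_trans (hM 0); rewrite normr_gt0 gt_eqF// base_gt0.
have mpos : 0 < expR B * invmass * M by rewrite !mulr_gt0// expR_gt0.
exists (expR (- B) / (expR B * invmass * M)); first by rewrite divr_gt0// expR_gt0.
move=> [w t]; rewrite /lratio /=; have m0 := mass_gt0 (bpsi1 w).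
have mb : 0 < mass (fun t => psi (w, t)) * base t := mulr_gt0 m0 (base_gt0 t).
apply: ler_pM; rewrite ?expR_ge0// ?invr_ge0 ?(ltW mpos)//.
  by rewrite ler_expR; have := hB (w, t); rewrite ler_norml => /andP[].
rewrite lef_pV2 ?posrE//; apply: ler_pM; rewrite ?(ltW m0) ?(ltW (base_gt0 t))//.
  by have /andP[] := mass_bounds w hB.
exact: le_trans (ler_norm _) (hM t).
Qed.
End joint.

End log_densities.

(** * Constrained layers *)

Section constraints.
Context {R : realType} (H : nat) (dim : nat -> nat) (K : @constraint_bounds R dim).
Hypothesis K_gt0 : forall h i j, (2 <= h <= H)%N -> 0 < @K h i j.

(** The inverse of 1 plus the sum of the inverses lies below every value; unlike a minimum, it also
    makes sense for the empty type. *)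
Lemma finite_pos_lb (I : finType) (f : I -> R) : (forall x, 0 < f x) ->
  exists2 c : R, 0 < c & forall x, c <= f x.
Proof.
move=> f0; exists (1 + \sum_x (f x)^-1)^-1.
  by rewrite invr_gt0 ltr_wpDr// sumr_ge0// => x _; rewrite invr_ge0 ltW.
move=> x; rewrite -[leRHS]invrK lef_pV2 ?posrE ?invr_gt0//.
  rewrite (bigD1 x)//= addrCA lerDl addr_ge0// sumr_ge0// => y _.
  by rewrite invr_ge0 ltW.
by rewrite ltr_wpDr// sumr_ge0// => y _; rewrite invr_ge0 ltW.
Qed.

Lemma Kmin_le h i j : (2 <= h <= H)%N -> Kmin H K <= @K h i j.
Proof.
move=> hH; apply: ge_inf; last by exists h, i, j.
by exists 0 => _ [h' [i' [j' [hH' ->]]]]; exact/ltW/K_gt0.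
Qed.

Lemma Kmin_gt0 : (2 <= H)%N -> (forall h, (1 <= h <= H)%N -> (0 < dim h)%N) ->
  dim H.+1 = 1%N -> 0 < Kmin H K.
Proof.
move=> H2 d0 d1.
pose I : finType := {h : 'I_H.+1 & 'I_(dim h.+1) * 'I_(dim h)}%type.
pose f (x : I) : R := if (2 <= tag x)%N then @K (tag x) (tagged x).1 (tagged x).2 else 1.
have [|c c0 hc] := @finite_pos_lb I f.
  by move=> x; rewrite /f; case: ifP => // h2; apply: K_gt0; rewrite h2 -ltnS ltn_ord.
apply: lt_le_trans c0 _; apply: lb_le_inf.
  have i0 : 'I_(dim H.+1) by rewrite d1; exact: ord0.
  have HH : (1 <= H <= H)%N by rewrite leqnn andbT ltnW.
  by exists (@K H i0 (Ordinal (d0 _ HH))), H, i0, (Ordinal (d0 _ HH)); rewrite H2 leqnn.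
move=> _ [h [i [j [/andP[h2 hH] ->]]]].
have := hc (Tagged (fun h : 'I_H.+1 => 'I_(dim h.+1) * 'I_(dim h))%type
  (i : 'I_(dim (Ordinal (hH : (h < H.+1)%N)).+1), j)).
by rewrite /f /= h2.
Qed.

Lemma Bc_continuous h (i : 'I_(dim h.+1)) z : Bc H K i z -> cube_continuous z.
Proof. by rewrite /Bc /=; case: ifP => _; [case|case=> -[]]. Qed.

Lemma Bc_le1 h (i : 'I_(dim h.+1)) z : (1 <= h < H)%N -> Bc H K i z -> (csup z <= 1)%E.
Proof.
by move=> /andP[_ hH]; rewrite /Bc /=; case: ifP => _; [case|case=> _ /(_ hH)].
Qed.

Lemma Bc_C1 h (i : 'I_(dim h.+1)) z : (2 <= h)%N -> Bc H K i z ->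
  cube_C1 z /\ forall j x, cube x -> `|cube_partial z j x| <= @K h i j.
Proof.
move=> h2; rewrite /Bc /=.
have -> : (h == 1)%N = false by apply/eqP => h1; move: h2; rewrite h1.
by move=> [c1 _ hK]; split=> // j x cx; exact: (proj1 (csup_leP _ _) (hK j)).
Qed.

Lemma Bc_admissible (z : @layer_functions R dim) :
  (forall h i, (1 <= h <= H)%N -> Bc H K i (z h i)) -> admissible H K z.
Proof.
move=> hz; split=> [h i x /andP[h1 hH] cx|h i /andP[h2 hH]].
  have hb := hz h i; rewrite h1 ltnW// in hb; have {hb} := hb isT.
  by move=> /Bc_le1; rewrite h1 hH => /(_ isT)/csup_leP; apply.
have hb := hz h i; rewrite (ltnW h2) hH in hb.
have [[_ c1] hK] := Bc_C1 h2 (hb isT).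
by apply: partial_cubes_lip => // j y; have [q _] := c1 j; exact: q.
Qed.

Section measurability.
Context {d} {W : measurableType d} (P : probability W R).
Context h (i : 'I_(dim h.+1)) (Z : 'rV[R]_(dim h) -> {RV P >-> R}).
Hypothesis hH : (1 <= h <= H)%N.
Hypothesis cZ : forall w, continuous (realization Z w).
Hypothesis Z1 : (2 <= h)%N -> forall w, space_C1 (realization Z w).

Lemma measurable_csup_realization (c : R) :
  measurable [set w | (csup (realization Z w) <= c%:E)%E].
Proof.
apply: measurable_csup_le => [w|x cx]; first exact: realization_continuous.
exact: measurable_realization.
Qed.

Lemma measurable_Bc : measurable [set w | Bc H K i (realization Z w)].
Proof.
rewrite /Bc /=; case: eqP => [h1|/eqP h1].
  rewrite (_ : [set w | _] = [set w | (csup (realization Z w) <= 1%:E)%E]).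
    exact: measurable_csup_realization.
  by apply/seteqP; split=> w /= => [[]|hw] //; split=> //; exact: realization_continuous.
have h2 : (2 <= h)%N by move: hH h1; case: h => [|[]].
rewrite (_ : [set w | _] = (if (h < H)%N then [set w | (csup (realization Z w) <= 1%:E)%E] else setT)
  `&` \bigcap_(j in [set: 'I_(dim h)])
     [set w | (csup (cube_partial (realization Z w) j) <= (@K h i j)%:E)%E]).
  apply: measurableI; first by case: ifP => // _; exact: measurable_csup_realization.
  apply: fin_bigcap_measurable => // j _; apply: measurable_csup_le => [w|x cx].
    by have [_ /(_ j)[]] := realization_C1 cZ (Z1 h2) w.
  by apply: measurable_partial => // w; exact: Z1.
apply/seteqP; split=> w /=.
  by move=> [_ h3 h4]; split=> [|j _]; [case: ifP => // /h3|exact: h4].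
move=> [h3 h4]; split=> [|hlt|j]; last exact: (h4 j I).
  by apply: realization_C1 => // w'; exact: Z1.
by move: h3; rewrite hlt.
Qed.

End measurability.
End constraints.

(** * Each term of the concentration function is below the whole *)

Section concentration_terms.
Context {R : realType} {d} {W : measurableType d} (P : probability W R) (H : nat) (dim : nat -> nat).
Variable Z : forall h, 'I_(dim h.+1) -> 'rV[R]_(dim h) -> {RV P >-> R}.
Variables (K : @constraint_bounds R dim) (z0 : @layer_functions R dim).
Hypothesis H1 : (1 <= H)%N.
Hypothesis Z_cont : forall h i, (1 <= h <= H)%N -> forall w, continuous (realization (@Z h i) w).
Hypothesis Z_C1 : forall h i, (2 <= h <= H)%N -> forall w, space_C1 (realization (@Z h i) w).
Local Open Scope ereal_scope.

Lemma first_layer_term_ge0 (e : R) i : 0 <= first_layer_term Z z0 e i.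
Proof.
apply: adde_ge0.
  rewrite mule_ge0 ?lee_fin ?divr_ge0//.
  by apply: le_ereal_inf_tmp => _ [g _ <-]; rewrite lee_fin sqr_ge0.
apply: oppe_lne_ge0; apply: probability_le1; apply: measurable_csup_lt => [w|x cx].
  by apply: realization_continuous; apply: Z_cont; rewrite H1.
exact: measurable_realization.
Qed.

Lemma layer_term_ge0 (e : R) h (i : 'I_(dim h.+1)) : (2 <= h <= H)%N ->
  0 <= layer_term H Z K z0 e i.
Proof.
move=> hH; have hH1 : (1 <= h <= H)%N by case/andP: hH => /ltnW -> ->.
apply: adde_ge0; first apply: adde_ge0.
- rewrite mule_ge0 ?lee_fin ?divr_ge0//.
  by apply: le_ereal_inf_tmp => _ [g _ <-]; rewrite lee_fin sqr_ge0.
- apply: oppe_lne_ge0; apply: probability_le1; apply: measurable_csup_realization.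
  exact: Z_cont.
rewrite oppe_ge0 mule_ge0_le0//; apply: sume_le0 => j _; rewrite lne_le0.
apply: probability_le1; apply: measurable_csup_le => [w|x cx].
  by have [_ /(_ j)[]] := realization_C1 (@Z_cont h i hH1) (@Z_C1 h i hH) w.
by apply: measurable_partial => // w; [exact: Z_cont|exact: Z_C1].
Qed.

Lemma lee_sum_term (I : finType) (f : I -> \bar R) i : (forall j, 0 <= f j) -> f i <= \sum_j f j.
Proof. by move=> f0; rewrite (bigD1 i)//= leeDl// sume_ge0. Qed.

Lemma first_layer_term_le (e : R) i :
  first_layer_term Z z0 e i <= concentration H Z K z0 e.
Proof.
apply: le_trans (lee_sum_term (f := first_layer_term Z z0 e) i _) _.
  by move=> j; exact: first_layer_term_ge0.
rewrite leeDl// big_nat_cond sume_ge0// => h /andP[hh _].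
by apply: sume_ge0 => j _; apply: layer_term_ge0; rewrite -ltnS.
Qed.

Lemma layer_term_le (e : R) h (i : 'I_(dim h.+1)) : (2 <= h <= H)%N ->
  layer_term H Z K z0 e i <= concentration H Z K z0 e.
Proof.
move=> hH.
apply: le_trans (lee_sum_term (f := fun i => layer_term H Z K z0 e (h := h) i) i _) _.
  by move=> j; exact: layer_term_ge0.
apply: (@le_trans _ _ (\sum_(2 <= h < H.+1) \sum_(i < dim h.+1) layer_term H Z K z0 e i)).
  rewrite (bigD1_seq h) ?iota_uniq ?mem_index_iota//=.
  rewrite leeDl// big_nat_cond sume_ge0// => l /andP[/andP[hl hl'] _].
  by apply: sume_ge0 => j _; apply: layer_term_ge0; rewrite hl -ltnS.
by rewrite leeDr// sume_ge0// => j _; exact: first_layer_term_ge0.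
Qed.

End concentration_terms.

(** * Prior mass and sieve for the whole family of layers *)

Section layers.
Context {R : realType} (H : nat) (dim : nat -> nat).
Hypothesis H_ge2 : (2 <= H)%N.
Hypothesis dim_gt0 : forall h, (1 <= h <= H)%N -> (0 < dim h)%N.
Hypothesis dim_out : dim H.+1 = 1%N.
Variable K : @constraint_bounds R dim.
Hypothesis K_gt0 : forall h i j, (2 <= h <= H)%N -> 0 < @K h i j.
Context {dZ} {WZ : measurableType dZ} (PZ : probability WZ R).
Variable Z : forall h, 'I_(dim h.+1) -> 'rV[R]_(dim h) -> {RV PZ >-> R}.
Hypothesis Z_gauss : forall h i, (1 <= h <= H)%N -> centered_gaussian_process (@Z h i).
Hypothesis Z_cont : forall h i, (1 <= h <= H)%N -> forall w, continuous (realization (@Z h i) w).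
Hypothesis Z_C1 : forall h i, (2 <= h <= H)%N -> forall w, space_C1 (realization (@Z h i) w).
Context {dC} {WC : measurableType dC} (PC : probability WC R).
Variable Zc : forall h, 'I_(dim h.+1) -> 'rV[R]_(dim h) -> {RV PC >-> R}.
Hypothesis Zc_law : forall h i, (1 <= h <= H)%N ->
  conditioned_process cube (Bc H K i) (@Z h i) (@Zc h i).
Hypothesis Zc_indep : layers_independent PC H (fun h i => sigma_process cube (@Zc h i)).
Variable z0 : @layer_functions R dim.
Hypothesis z0_B : forall h i, (1 <= h <= H)%N -> Bc H K i (@z0 h i).
Hypothesis z0_lt1 : forall h i, (1 <= h < H)%N -> (csup (@z0 h i) < 1)%E.
Hypothesis z0_partial : forall h i j, (2 <= h <= H)%N ->
  (csup (cube_partial (@z0 h i) j) <= (Kmin H K / 2)%:E)%E.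

Let mBc h (i : 'I_(dim h.+1)) : (1 <= h <= H)%N ->
  measurable [set w | Bc H K i (realization (Z i) w)].
Proof.
move=> hH; apply: measurable_Bc => //; first by move=> w; exact: Z_cont.
by move=> h2 w; apply: Z_C1; rewrite h2; case/andP: hH.
Qed.

Definition close_event (e : R) h (i : 'I_(dim h.+1)) : set WC :=
  [set w | nearset (@z0 h i) (2 * e) (sampled (realization (@Zc h i) w))].

(** The truth is bounded by some [b < 1], so for [e < (1 - b) / 2] a function within [2 * e] of it
    still satisfies the sup-norm constraint. From the second layer on, [c] also absorbs the squared
    mass [l ^+ 2] of the Lipschitz box. *)
Lemma layer_mass h (i : 'I_(dim h.+1)) : (1 <= h <= H)%N ->
  exists2 c : R, 0 < c & forall e a : R, 0 < e -> e < c -> 0 < a ->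
    (concentration H Z K z0 e <= a%:E)%E ->
    c * expR (- (a * gvar + a)) <= Ex PC \1_(close_event e i) /\
    expR (- a) <= Ex PZ \1_[set w | (csup (realization (@Z h i) w) <= e%:E)%E].
Proof.
move=> hH.
have k0 := Kmin_gt0 K_gt0 H_ge2 dim_gt0 dim_out.
have [b b1 hb] : exists2 b : R, b < 1 & (h < H)%N -> forall x, cube x -> `|z0 i x| <= b.
  (* The last layer has no sup-norm constraint, and any [b < 1] does. *)
  have [hlt|_] := boolP (h < H)%N; last by exists 0.
  have hlt' : (1 <= h < H)%N by rewrite hlt andbT; case/andP: hH.
  by have [b b1 hb] := (proj1 (csup_ltP _ _) (z0_lt1 i hlt')); exists b.
have le1 e f : e < (1 - b) / 2 -> (forall x, cube x -> `|f x - z0 i x| <= 2 * e) ->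
    (h < H)%N -> (csup f <= 1)%E.
  move=> eb hf hlt; apply/csup_leP => x cx; have h1 := hb hlt x cx; have h2 := hf x cx.
  rewrite -(subrK (z0 i x) (f x)); apply: le_trans (ler_normD _ _) _; lra.
have b2 : 0 < (1 - b) / 2 by rewrite divr_gt0// subr_gt0.
have cz0 : cube_continuous (z0 i) by apply: Bc_continuous; exact: z0_B.
have cB z : Bc H K i z -> cube_continuous z by exact: Bc_continuous.
have [h1|h1] := eqVneq h 1%N.
  exists (Num.min 1 ((1 - b) / 2)); first by rewrite lt_min ltr01.
  move=> e a e0; rewrite lt_min => /andP[_ eb] a0 hc.
  have hlt : (h < H)%N by rewrite h1.
  have cle : Num.min 1 ((1 - b) / 2) <= 1 by rewrite ge_min lexx.
  have h0 := expR_ge0 (- (a * gvar + a)).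
  subst h.
  have hB f : cube_continuous f -> (forall x, cube x -> `|f x - z0 i x| <= 2 * e) -> Bc H K i f.
    by move=> cf hf; rewrite /Bc /=; split=> //; exact: (le1 e).
  have ht : (first_layer_term Z z0 e i <= a%:E)%E.
    by apply: le_trans hc; apply: first_layer_term_le => //; exact: ltnW.
  have [m1 m2] := C0_mass (Zc_law i hH) (Z_gauss i hH) (@Z_cont _ i hH) (mBc i hH) cz0 e0 a0 hB ht.
  by split=> //; apply: le_trans m1; rewrite ler_piMl.
have h2 : (2 <= h <= H)%N.
  by move: hH; rewrite [(2 <= h)%N]ltn_neqAle eq_sym h1.
have lip0 : 0 < Ex PZ \1_(pathevent (@Z h i) (lipbox (Kmin H K / 4 / 2) (fun=> 0))).
  apply: (lipbox_gt0 (Z_gauss i hH) (@Z_cont _ i hH) (Z_C1 i h2)).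
  by rewrite !divr_gt0.
set l := Ex PZ _ in lip0.
exists (Num.min (l ^+ 2) ((1 - b) / 2)); first by rewrite lt_min exprn_gt0.
move=> e a e0; rewrite lt_min => /andP[_ eb] a0 hc.
have cle : Num.min (l ^+ 2) ((1 - b) / 2) <= l ^+ 2 by rewrite ge_min lexx.
have h2' : (2 <= h)%N by case/andP: h2.
have [c1 _] := Bc_C1 h2' (z0_B i hH).
have hB f : cube_C1 f -> (forall x, cube x -> `|f x - z0 i x| <= 2 * e) ->
    (forall j x, cube x -> `|cube_partial f j x| <= Kmin H K) -> Bc H K i f.
  move=> cf hf hp; rewrite /Bc /= (negbTE h1); split=> //; first exact: le1 hf.
  by move=> j; apply/csup_leP => x cx; apply: le_trans (hp j x cx) _; exact: Kmin_le.
have ht : (layer_term H Z K z0 e i <= a%:E)%E.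
  by apply: le_trans hc; apply: layer_term_le => //; exact: ltnW.
have hz j x : cube x -> `|cube_partial (z0 i) j x| <= Kmin H K / 2.
  by move: x; apply/csup_leP; exact: z0_partial.
have [m1 m2] := C1_mass (Zc_law i hH) (Z_gauss i hH) (@Z_cont _ i hH) (mBc i hH) cz0
  e0 a0 k0 (Z_C1 i h2) c1 hz hB ht.
by split=> //; apply: le_trans m1; rewrite ler_wpM2r ?expR_ge0.
Qed.

(** The pair [(h, i)] stands for component [i] of layer [h.+1]. Finiteness provides common constants
    and makes the vectors of codes a finite type. *)
Definition layer_index : finType := {h : 'I_H & 'I_(dim h.+2)}%type.

Lemma layer_indexP (Pr : forall h, 'I_(dim h.+1) -> Prop) :
  (forall x : layer_index, Pr (tag x).+1 (tagged x)) ->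
  forall h i, (1 <= h <= H)%N -> Pr h i.
Proof.
move=> hx [|h] i //= hH.
exact: (hx (Tagged (fun h : 'I_H => 'I_(dim h.+2)) (i : 'I_(dim (Ordinal (hH : (h < H)%N)).+2)))).
Qed.

Let tagH (x : layer_index) : (1 <= (tag x).+1 <= H)%N. Proof. by rewrite ltn_ord. Qed.

Lemma layers_mass : exists2 c : R, 0 < c & forall e a : R, 0 < e -> e < c -> 0 < a ->
    (concentration H Z K z0 e <= a%:E)%E -> forall h (i : 'I_(dim h.+1)), (1 <= h <= H)%N ->
    c * expR (- (a * gvar + a)) <= Ex PC \1_(close_event e i) /\
    expR (- a) <= Ex PZ \1_[set w | (csup (realization (@Z h i) w) <= e%:E)%E].
Proof.
have : forall x : layer_index, exists c : R, 0 < c /\ forall e a : R, 0 < e -> e < c -> 0 < a ->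
    (concentration H Z K z0 e <= a%:E)%E ->
    c * expR (- (a * gvar + a)) <= Ex PC \1_(close_event e (h := (tag x).+1) (tagged x)) /\
    expR (- a) <= Ex PZ \1_[set w | (csup (realization (@Z (tag x).+1 (tagged x)) w) <= e%:E)%E].
  by move=> x; have [c c0 hc] := layer_mass (tagged x) (tagH x); exists c.
move=> /choice[c hc]; have [c' c'0 cc'] := finite_pos_lb (fun x => proj1 (hc x)).
exists c' => // e a e0 ec a0 hconc.
apply: layer_indexP => x.
have [m1 m2] := proj2 (hc x) e a e0 (lt_le_trans ec (cc' x)) a0 hconc.
by split=> //; apply: le_trans m1; rewrite ler_wpM2r ?expR_ge0.
Qed.

Definition near_truth (e : R) : set WC :=
  \bigcap_(h in [set h | (1 <= h <= H)%N]) \bigcap_(i in setT) close_event e (h := h) i.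

Lemma measurable_near_truth e : measurable (near_truth e).
Proof.
apply: bigcap_measurableType => h _; apply: fin_bigcap_measurable => // i _.
by apply: measurable_sampled; exact: measurable_nearset.
Qed.

(** Independence turns the mass of the joint neighbourhood into a product over the [S] components;
    the constants of [layers_mass] multiply to [c ^+ S] and the exponents add up. *)
Lemma prior_mass : exists2 c : R, 0 < c & exists S : nat, forall e a : R, 0 < e -> e < c -> 0 < a ->
    (concentration H Z K z0 e <= a%:E)%E ->
    c * expR (- (S%:R * (a * gvar + a))) <= Ex PC \1_(near_truth e).
Proof.
have [c c0 hc] := layers_mass.
pose S := (\sum_(1 <= h < H.+1) dim h.+1)%N.
pose C := c ^+ S; have C0 : 0 < C by rewrite exprn_gt0.
exists (Num.min c C); first by rewrite lt_min c0.
exists S => e a e0; rewrite lt_min => /andP[ec _] a0 hconc.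
have mass := hc e a e0 ec a0 hconc.
have -> : Ex PC \1_(near_truth e) =
    \prod_(1 <= h < H.+1) \prod_(i < dim h.+1) Ex PC \1_(close_event e (h := h) i).
  apply: EFin_inj; rewrite Ex_indicE; last exact: measurable_near_truth.
  rewrite Zc_indep; last first.
    by move=> h i hH; apply: sigma_process_sampled; exact: measurable_nearset.
  rewrite -prodEFin; apply: eq_bigr => h _; rewrite -prodEFin; apply: eq_bigr => i _.
  by rewrite Ex_indicE//; apply: measurable_sampled; exact: measurable_nearset.
apply: (@le_trans _ _ (\prod_(1 <= h < H.+1) \prod_(i < dim h.+1)
    (c * expR (- (a * gvar + a))))).
  under [leRHS]eq_bigr do rewrite prodr_const card_ord.
  rewrite prodrXr -/S exprMn -expRM_natl mulrN ler_wpM2r ?expR_ge0//.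
  by rewrite ge_min lexx orbT.
have p0 : 0 <= c * expR (- (a * gvar + a)) by rewrite mulr_ge0 ?expR_ge0// ltW.
rewrite big_nat_cond [leRHS]big_nat_cond; apply: ler_prod => h /andP[hH _].
rewrite prodr_ge0//=; apply: ler_prod => i _; rewrite p0 /=.
by have [] := mass h i hH.
Qed.

(** A union bound: the sieve of component [x] misses at most [tau / b x], with [b x] the probability
    of its constraint. The joint code is the vector of the component codes, which [inord] preserves
    on the sieve because they are in range there. *)
Lemma layers_sieve : exists2 B : R, 0 < B & forall e tau p : R, 0 < tau <= 1 -> 0 < p ->
  (forall h i, (1 <= h <= H)%N ->
     p <= Ex PZ \1_[set w | (csup (realization (@Z h i) w) <= e%:E)%E]) ->
  exists G : set WC, measurable G /\ Ex PC \1_(~` G) <= B * tau /\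
  exists code : WC -> {ffun layer_index -> 'I_(Num.truncn (20 / (tau ^+ 3 * p ^+ 4))).+1},
  forall w w', G w -> G w' -> code w = code w' -> forall h (i : 'I_(dim h.+1)) x,
    (1 <= h <= H)%N -> cube x -> `|realization (Zc i) w x - realization (Zc i) w' x| <= 16 * e.
Proof.
pose b (x : layer_index) := Ex PZ \1_[set w | Bc H K (tagged x : 'I_(dim (tag x).+2))
  (realization (@Z (tag x).+1 (tagged x)) w)].
have b0 x : 0 < b x by apply: (inB_gt0 (Zc_law (tagged x) (tagH x))); exact: mBc.
exists (1 + \sum_x (b x)^-1).
  by rewrite ltr_wpDr// sumr_ge0// => x _; rewrite invr_ge0 ltW.
move=> e tau p tau01 p0 hp; have /andP[tau0 tau1] := tau01.
have : forall x : layer_index, exists Gc : set WC * (WC -> nat), [/\ measurable Gc.1,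
    Ex PC \1_(~` Gc.1) <= tau / b x,
    forall w, Gc.1 w -> (Gc.2 w)%:R <= 20 / (tau ^+ 3 * p ^+ 4) &
    forall w w', Gc.1 w -> Gc.1 w' -> Gc.2 w = Gc.2 w' -> forall y, cube y ->
     `|realization (@Zc (tag x).+1 (tagged x)) w y - realization (@Zc (tag x).+1 (tagged x)) w' y| <= 16 * e].
  move=> x; have px := hp (tag x).+1 (tagged x) (tagH x).
  have [G [mG [GE [code [codeN hcode]]]]] := conditioned_sieve (Zc_law (tagged x) (tagH x))
    (mBc (tagged x) (tagH x)) (Z_gauss (tagged x) (tagH x)) (@Bc_continuous _ _ _ _ _ _)
    (@Z_cont _ (tagged x) (tagH x)) tau01 (lt_le_trans p0 px).
  exists (G, code); split=> // w Gw; apply: le_trans (codeN w Gw) _.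
  rewrite ler_pM2l// lef_pV2 ?posrE ?mulr_gt0 ?exprn_gt0// ?(lt_le_trans p0 px)//.
  by rewrite ler_pM2l ?exprn_gt0// lerXn2r ?nnegrE ?(ltW p0)// (le_trans (ltW p0)).
move=> /choice[Gc hGc].
exists (\bigcap_(x in setT) (Gc x).1); split.
  by apply: fin_bigcap_measurable => // x _; have [] := hGc x.
split.
  apply: (@le_trans _ _ (\sum_x tau / b x)); last first.
    rewrite -mulr_sumr mulrC ler_pM2r// lerDr//.
  apply: (@le_trans _ _ (\sum_x Ex PC \1_(~` (Gc x).1))); last first.
    by apply: ler_sum => x _; have [] := hGc x.
  have mC x : measurable (~` (Gc x).1) by apply: measurableC; have [] := hGc x.
  rewrite -Ex_sum; last by move=> x; apply: bm_indic.
  apply: le_Ex; [|by apply: bm_sum => x; apply: bm_indic|].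
    apply: bm_indic; apply: measurableC; apply: fin_bigcap_measurable => // x _.
    by have [] := hGc x.
  move=> w; rewrite indicE; have [/set_mem nG|_] := boolP (_ \in _); last first.
    by apply: sumr_ge0 => x _; rewrite indicE.
  have [x nx] : exists x, ~ (Gc x).1 w.
    by apply: contrapT => /forallNP hn; apply: nG => x _; apply: contrapT; exact: hn.
  rewrite (bigD1 x)//= indicE mem_set//= lerDl; apply: sumr_ge0 => y _.
  by rewrite indicE.
exists (fun w => [ffun x => inord ((Gc x).2 w)]) => w w' Gw Gw' ww'.
move=> h i y hH; move: h i hH y.
apply: (@layer_indexP (fun h i => forall y : 'rV[R]_(dim h), cube y ->
  `|realization (@Zc h i) w y - realization (@Zc h i) w' y| <= 16 * e)) => x.
have [_ _ N1 C1] := hGc x; apply: C1; [exact: Gw|exact: Gw'|].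
have cb u : (\bigcap_(x in setT) (Gc x).1) u ->
    ((Gc x).2 u < (Num.truncn (20 / (tau ^+ 3 * p ^+ 4))).+1)%N.
  move=> Gu; have h := N1 u (Gu x I).
  by rewrite ltnS truncn_ge_nat// (le_trans _ h).
by move/ffunP : ww' => /(_ x); rewrite !ffunE => /(congr1 val); rewrite /= !inordK ?cb.
Qed.
End layers.

(** Exponents are counted in units of [a]. The level [expR (- (3 * Bb ^+ 2 * a))] beats the growth
    [expR (2 Bb^2 a)] of the evidence bound; [C2] exceeds by 1 the exponents [S kap] and [3 Bb^2]
    lost in the denominator; the lower bound on [M ^+ 2] beats the number of codes in the first term
    and the test error in the last. *)
Lemma rate_bound {R : realType} (n L S : nat) (e M c B1 delta Bb kap card p G : R) :
  let a := n%:R * e ^+ 2 in let C2 := S%:R * kap + 3 * Bb ^+ 2 + 1 in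
  0 < a -> 0 < c -> 0 < delta -> 0 <= B1 -> 1 <= Bb -> 0 <= kap ->
  0 <= card <= (21 * expR ((3 * C2 + 4) * a)) ^+ L ->
  G <= B1 * expR (- (C2 * a)) ->
  c * expR (- (S%:R * kap * a)) <= p ->
  4 * (4 * Bb ^+ 2 + S%:R * kap + L%:R * (3 * C2 + 4) + 2) <= M ^+ 2 ->
  card * expR (- ((M * e) ^+ 2 / 2)) ^+ n +
  expR (- (3 * Bb ^+ 2 * a)) * (1 + 2 * (Bb * e) ^+ 2) ^+ n +
  (G + expR (- ((M * e) ^+ 2 / 4) + (Bb * e) ^+ 2) ^+ n) /
    (delta * (p * expR (- (3 * Bb ^+ 2 * a)))) <=
  (21 ^+ L + 1 + (B1 + 1) / (delta * c)) * expR (- a).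
Proof.
move=> a C2 a0 c0 d0 B10 Bb1 k0 /andP[card0 cardle] GE pE ME.
have Cb1 : 1 <= Bb ^+ 2 by rewrite exprn_ege1.
have Sk0 : 0 <= S%:R * kap by rewrite mulr_ge0.
have C20 : 0 <= 3 * C2 + 4 by rewrite /C2; lra.
have LC0 : 0 <= L%:R * (3 * C2 + 4) by rewrite mulr_ge0.
have powE x : expR x ^+ n = expR (n%:R * x) by rewrite expRM_natl.
have le_exp x : x <= - 1 -> expR (x * a) <= expR (- a).
  by move=> x1; rewrite ler_expR -mulN1r ler_pM2r.
rewrite 2!(mulrDl _ _ (expR (- a))); apply: lerD; first apply: lerD.
- apply: (@le_trans _ _ ((21 * expR ((3 * C2 + 4) * a)) ^+ L * expR (- ((M * e) ^+ 2 / 2)) ^+ n)).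
    by rewrite ler_wpM2r// exprn_ge0// expR_ge0.
  rewrite exprMn -mulrA ler_wpM2l ?exprn_ge0// powE -expRM_natl -expRD.
  rewrite [X in expR X](_ : _ = (L%:R * (3 * C2 + 4) - M ^+ 2 / 2) * a); last by rewrite /a; field.
  by apply: le_exp; lra.
- apply: (@le_trans _ _ (expR (- (3 * Bb ^+ 2 * a)) * expR (2 * (Bb * e) ^+ 2) ^+ n)).
    rewrite ler_wpM2l ?expR_ge0//; apply: lerXn2r; rewrite ?nnegrE ?expR_ge0//.
      by rewrite addr_ge0// mulr_ge0// sqr_ge0.
    exact: expR_ge1Dx.
  rewrite powE -expRD [X in expR X](_ : _ = (- Bb ^+ 2) * a); last by rewrite /a; ring.
  by rewrite mul1r; apply: le_exp; lra.
have den0 : 0 < delta * (c * expR (- (S%:R * kap * a)) * expR (- (3 * Bb ^+ 2 * a))).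
  by rewrite !mulr_gt0 ?expR_gt0.
have denle : delta * (c * expR (- (S%:R * kap * a)) * expR (- (3 * Bb ^+ 2 * a))) <=
    delta * (p * expR (- (3 * Bb ^+ 2 * a))).
  by rewrite ler_pM2l// ler_pM2r ?expR_gt0.
apply: (@le_trans _ _ ((B1 * expR (- (C2 * a)) + expR (- ((M * e) ^+ 2 / 4) + (Bb * e) ^+ 2) ^+ n) /
    (delta * (c * expR (- (S%:R * kap * a)) * expR (- (3 * Bb ^+ 2 * a)))))).
  apply: (@le_trans _ _ ((B1 * expR (- (C2 * a)) + expR (- ((M * e) ^+ 2 / 4) + (Bb * e) ^+ 2) ^+ n) /
     (delta * (p * expR (- (3 * Bb ^+ 2 * a)))))).
    by rewrite ler_pM2r ?invr_gt0 ?(lt_le_trans den0)// lerD2r.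
  rewrite ler_wpM2l//.
    by rewrite addr_ge0 ?exprn_ge0 ?expR_ge0// mulr_ge0 ?expR_ge0.
  by rewrite lef_pV2 ?posrE// (lt_le_trans den0).
rewrite ler_pdivrMr//.
have -> : (B1 + 1) / (delta * c) * expR (- a) *
    (delta * (c * expR (- (S%:R * kap * a)) * expR (- (3 * Bb ^+ 2 * a)))) =
    (B1 + 1) * (expR (- a) * expR (- (S%:R * kap * a)) * expR (- (3 * Bb ^+ 2 * a))).
  by field; rewrite !gt_eqF.
rewrite -!expRD (_ : - a + _ + _ = - (C2 * a)); last by rewrite /C2; ring.
rewrite (mulrDl B1 1) lerD2l mul1r powE ler_expR.
rewrite (_ : n%:R * _ = (Bb ^+ 2 - M ^+ 2 / 4) * a); last by rewrite /a; field.
by rewrite -(mulNr C2) ler_pM2r//; move: ME LC0; set x := L%:R * _; rewrite /C2; lra.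
Qed.

Lemma Ex_restrict {d} {T : measurableType d} {R : realType} (P : probability T R) (A : set T)
  (f : T -> R) : measurable A -> \int[P]_(w in A) f w = Ex P (fun w => \1_A w * f w).
Proof.
move=> mA; rewrite Ex.unlock /Rintegral integral_mkcond; congr fine.
apply: eq_integral => w _; rewrite patchE indicE.
by case: (w \in A); rewrite ?mul1r ?mul0r.
Qed.

(** With [tau = expR (- (C * a))] and balls of mass [expR (- a)], the exponents [3 C] and 4 come
    from the cube of [tau] and the fourth power of the mass; 21 is the 20 of the sieve plus 1 for
    the successor. *)
Lemma card_codes {R : realType} (I : finType) (a C : R) : 0 < a -> 0 <= C ->
  #|{ffun I -> 'I_(Num.truncn (20 / (expR (- (C * a)) ^+ 3 * expR (- a) ^+ 4))).+1}|%:R <=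
  (21 * expR ((3 * C + 4) * a)) ^+ #|I| :> R.
Proof.
move=> a0 C0; rewrite card_ffun card_ord natrX; apply: lerXn2r;
  rewrite ?nnegrE ?mulr_ge0 ?expR_ge0//.
have -> : 20 / (expR (- (C * a)) ^+ 3 * expR (- a) ^+ 4) = 20 * expR ((3 * C + 4) * a).
  rewrite -!expRM_natl -expRD -expRN; congr (_ * expR _); ring.
set E := expR _; have E1 : 1 <= E.
  by rewrite -[leLHS]expR0 ler_expR mulr_ge0 ?(ltW a0)// addr_ge0// mulr_ge0.
rewrite -natr1; have : (Num.truncn (20 * E))%:R <= 20 * E.
  by rewrite truncn_le// mulr_ge0// (le_trans _ E1).
lra.
Qed.

Lemma rate_cvg0 (R : realType) (u : nat -> \bar R) (eps M : nat -> R) (Cst Mreq c c2 B : R) :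
  0 < c -> 0 < c2 -> 0 < B -> eps n @[n --> \oo] --> 0 ->
  n%:R * eps n ^+ 2 @[n --> \oo] --> +oo -> M n @[n --> \oo] --> +oo ->
  (forall n, 0 <= u n)%E ->
  (forall n, (0 < n)%N -> eps n < c -> eps n < c2 -> B * eps n <= 2^-1 ->
     0 <= M n -> Mreq <= M n ^+ 2 -> (u n <= (Cst * expR (- (n%:R * eps n ^+ 2)))%:E)%E) ->
  u n @[n --> \oo] --> 0%E.
Proof.
move=> c0 c20 B0 eps0 nepsy My u0 ub.
have lim0 : (Cst * expR (- (n%:R * eps n ^+ 2)))%:E @[n --> \oo] --> 0%E.
  apply: cvg_EFin; first exact: nearW.
  rewrite -(mulr0 Cst); apply: cvgM; first exact: cvg_cst.
  exact: (cvg_comp _ _ nepsy (@cvgr_expR R)).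
apply: (@squeeze_cvge _ _ _ _ (cst 0%E) _
  (fun n => (Cst * expR (- (n%:R * eps n ^+ 2)))%:E) _ 0%E) => //; last exact: cvg_cst.
(* The lower bound by 1 turns [Mreq <= M n] into [Mreq <= M n ^+ 2]. *)
have M1 : \forall n \near \oo, Num.max 1 Mreq <= M n by move: (Num.max 1 Mreq); apply/cvgryPge.
have B2 : 0 < (2 * B)^-1 by rewrite invr_gt0 mulr_gt0.
near=> n; rewrite u0 /=.
have : Num.max 1 Mreq <= M n by near: n.
rewrite ge_max => /andP[Mn1 MnQ].
apply: ub.
- by near: n; exact: nbhs_infty_gt.
- by near: n; exact: (cvgr_lt 0 eps0).
- by near: n; exact: (cvgr_lt 0 eps0).
- have : eps n < (2 * B)^-1 by near: n; exact: (cvgr_lt 0 eps0).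
  by rewrite invfM => /ltW; rewrite -ler_pdivlMl// mulrC.
- exact: le_trans Mn1.
- by rewrite expr2 (le_trans MnQ)// ler_peMl// (le_trans _ Mn1).
Unshelve. all: by end_near. Qed.

Unset Implicit Arguments.

Theorem theorem3p1 (R : realType) (H : nat) (dim : nat -> nat)
  (H_ge2 : (2 <= H)%N)
  (dim_gt0 : forall h, (1 <= h <= H)%N -> (0 < dim h)%N)
  (dim_out : dim H.+1 = 1%N)
  (K : @constraint_bounds R dim)
  (K_gt0 : forall h i j, (2 <= h <= H)%N -> 0 < K h i j)
  (dZ : measure_display) (WZ : measurableType dZ) (PZ : probability WZ R)
  (Z : forall h, 'I_(dim h.+1) -> 'rV[R]_(dim h) -> {RV PZ >-> R})
  (Z_gauss : forall h i, (1 <= h <= H)%N -> centered_gaussian_process (Z h i))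
  (Z_cont : forall h i, (1 <= h <= H)%N ->
     forall w, continuous (realization (Z h i) w))
  (Z_C1 : forall h i, (2 <= h <= H)%N ->
     forall w, space_C1 (realization (Z h i) w))
  (Z_indep : layers_independent PZ H
     (fun h i => sigma_process setT (Z h i)))
  (dC : measure_display) (WC : measurableType dC) (PC : probability WC R)
  (Zc : forall h, 'I_(dim h.+1) -> 'rV[R]_(dim h) -> {RV PC >-> R})
  (Zc_law : forall h i, (1 <= h <= H)%N ->
     conditioned_process cube (Bc H K i) (Z h i) (Zc h i))
  (Zc_indep : layers_independent PC H
     (fun h i => sigma_process cube (Zc h i)))
  (z0 : @layer_functions R dim)
  (z0_B : forall h i, (1 <= h <= H)%N -> Bc H K i (z0 h i))
  (p0 : 'rV[R]_(dim 1%N) -> R)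
  (p0_density : is_density p0)
  (p0E : forall t, cube t -> p0 t = density_of (deep dim_out z0) t)
  (z0_C1 : forall h i, (2 <= h <= H)%N ->
     in_C1_closure (layer_rkhs Z i) (z0 h i))
  (z0_C0 : forall i, in_C0_closure (@layer_rkhs _ _ _ PZ dim Z 1%N i) (z0 1%N i))
  (z0_lt1 : forall h i, (1 <= h < H)%N -> (csup (z0 h i) < 1)%E)
  (z0_partial : forall h i j, (2 <= h <= H)%N ->
     (csup (cube_partial (z0 h i) j) <= (Kmin H K / 2)%:E)%E)
  (dX : measure_display) (WX : measurableType dX) (PX : probability WX R)
  (X : nat -> {RV PX >-> 'rV[R]_(dim 1%N)})
  (X_iid : iid_sample X p0)
  (eps : nat -> R)
  (eps_gt0 : forall n, (0 < n)%N -> 0 < eps n)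
  (eps_cvg0 : eps n @[n --> \oo] --> 0)
  (neps_cvgy : n%:R * eps n ^+ 2 @[n --> \oo] --> +oo)
  (eps_conc : forall n, (0 < n)%N ->
     (concentration H Z K z0 (eps n) <= (n%:R * eps n ^+ 2)%:E)%E) :
  forall M : nat -> R, M n @[n --> \oo] --> +oo ->
  forall delta : R, 0 < delta ->
    PX [set w | delta <
      posterior PC
        (fun wc => density_of
           (deep dim_out (fun h i => realization (Zc h i) wc)))
        n (fun m => X m w)
        [set p | hellinger p p0 > M n * eps n]] @[n --> \oo] --> 0%E.
Proof.
move=> M My delta delta0.
have H1 : (1 <= H)%N by exact: ltnW.
set fw := fun wc => deep dim_out (fun h i => realization (Zc h i) wc).
set f0 := deep dim_out z0.
have ZcB w h i : (1 <= h <= H)%N -> Bc H K i (realization (Zc h i) w).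
  by move=> hH; have [_ hB _] := Zc_law h i hH; exact: hB.
have az0 : admissible H K z0 by exact: Bc_admissible.
have azc w : admissible H K (fun h i => realization (Zc h i) w).
  by apply: Bc_admissible => h i; exact: ZcB.
have [B B0 osc] := deep_osc K dim_out H_ge2.
pose Q : probability 'rV[R]_(dim 1%N) R := distribution PX (X 0%N).
have [Xcube Xlaw Xind] := X_iid.
have QE A : measurable A -> Q A = (\int[lebesgue_rV (dim 1%N)]_(t in A `&` cube) (p0 t)%:E)%E.
  by move=> mA; exact: Xlaw.
have lawX m A : measurable A -> PX (X m @^-1` A) = Q A by move=> mA; rewrite Xlaw// QE.
have mX m : measurable_fun setT (X m) by exact: measurable_funP.
pose psi0 t := f0 (clamp t).
have bpsi0 : bm psi0.
  split.
    have := @measurable_deep R H dim _ WC (fun=> z0) _ _ _ dim_out.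
    move=> md; apply: (measurableT_comp (f := fun z : WC * 'rV[R]_(dim 1%N) =>
      deep dim_out z0 (clamp z.2)) (g := fun t => (point, t))).
      apply: md.
      - by move=> _ h i hH; apply: Bc_continuous (z0_B h i hH).
      - by move=> h i x _ _; exact: measurable_cst.
      - by move=> _ h i x hH cx; exact: (proj1 az0).
    exact: measurable_pair1.
  exists (`|f0 0| + B) => t; have := osc z0 (clamp t) 0 az0 (cube_clamps t) cube0.
  by move=> h; rewrite -lerBlDl; apply: le_trans (lerB_dist _ _) h.
have psi0E t : cube t -> psi0 t = f0 t by move=> ct; rewrite /psi0 clamp_id.
pose psi (z : WC * 'rV[R]_(dim 1%N)) := fw z.1 (clamp z.2).
have mpsi : measurable_fun setT psi.
  apply: (@measurable_deep R H dim _ WC (fun w h i => realization (Zc h i) w)).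
  - by move=> w h i hH; apply: Bc_continuous (ZcB w h i hH).
  - by move=> h i x _ _; exact: measurable_funP.
  - by move=> w h i x hH cx; exact: (proj1 (azc w)).
(* Centering at 0 makes the log-density bounded uniformly in the realization, by the oscillation
   bound; density ratios are unchanged ([lratio_shift]). *)
pose psis (z : WC * 'rV[R]_(dim 1%N)) := psi z - psi (z.1, 0).
have bpsis : bm psis.
  split.
    apply: measurable_funB => //.
    by apply: (measurableT_comp mpsi); exact: measurable_fun_pair.
  exists B => -[w t]; rewrite /psis /psi /=.
  by apply: (osc (fun h i => realization (Zc h i) w)) => //; exact: cube_clamps.
have bpsi w : bm (fun t => psi (w, t)).
  rewrite (_ : (fun t => _) = (fun t => psis (w, t) + psi (w, 0))).
    by apply: bmD; [exact: bm_pair1|exact: bm_cst].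
  by apply/funext => t; rewrite /psis subrK.
have psiE w t : cube t -> psi (w, t) = fw w t by move=> ct; rewrite /psi clamp_id.
pose rho (z : WC * 'rV[R]_(dim 1%N)) := lratio Q f0 psi0 (fun t => psis (z.1, t)) z.2.
have rhoE w t : rho (w, t) = lratio Q f0 psi0 (fun t => psi (w, t)) t.
  exact: (lratio_shift Q p0_density p0E bpsi0 (psi (w, 0)) (bpsi w)).
have brho : bm rho := bm_joint_lratio Q p0_density p0E bpsi0 bpsis.
have [m0 m00 mrho] := joint_lratio_ge Q p0_density p0E bpsi0 bpsis.
have Erho w : Ex Q (fun s => rho (w, s)) = 1.
  exact: (Ex_lratio Q p0_density p0E bpsi0 (bm_pair1 w bpsis)).
have hellE w : hellinger (density_of (fw w)) p0 = Num.sqrt (sqhell Q (fun s => rho (w, s))).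
  rewrite (hellingerE p0_density p0E QE psi0E bpsi0 (bpsi w) (psiE w)).
  by congr (Num.sqrt (sqhell Q _)); apply/funext => s; rewrite rhoE.
have densE w t : cube t -> density_of (fw w) t = rho (w, t) * p0 t.
  by move=> ct; rewrite rhoE (lratioE p0_density p0E QE psi0E bpsi0 (bpsi w) (psiE w) ct).
have closeP w (e : R) t : 0 <= e -> 4 * (deep_cst K H * e) <= 1 ->
    (forall h i y, (1 <= h <= H)%N -> cube y -> `|realization (Zc h i) w y - z0 h i y| <= e) ->
    `|rho (w, t) - 1| <= 4 * (deep_cst K H * e).
  move=> e0 e1 hc; rewrite rhoE.
  have L0 : lratio Q f0 psi0 psi0 t = 1 by exact: (lratio_base Q p0_density p0E).
  have pp s : `|psi (w, s) - psi0 s| <= deep_cst K H * e.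
    by apply: (deep_close _ (azc w) az0) => //; exact: cube_clamps.
  have e4 : 0 <= deep_cst K H * e <= 4^-1.
    by rewrite mulr_ge0 ?deep_cst_ge0//=; lra.
  by have := lratio_close Q p0_density p0E bpsi0 t (bpsi w) bpsi0 pp e4; rewrite L0 mulr1.
have closeC w w' (e : R) t : 0 <= e -> 4 * (deep_cst K H * e) <= 1 ->
    (forall h i y, (1 <= h <= H)%N -> cube y ->
      `|realization (Zc h i) w y - realization (Zc h i) w' y| <= e) ->
    `|rho (w, t) - rho (w', t)| <= 4 * (deep_cst K H * e) * rho (w', t).
  move=> e0 e1 hc; rewrite !rhoE.
  apply: (lratio_close Q p0_density p0E bpsi0 t (bpsi w) (bpsi w')) => [s|].
    by apply: (deep_close _ (azc w) (azc w')) => //; exact: cube_clamps.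
  rewrite mulr_ge0 ?deep_cst_ge0//=; lra.
have [c c0 [S massN]] := prior_mass H_ge2 dim_gt0 dim_out K_gt0 Z_gauss Z_cont Z_C1 Zc_law
  Zc_indep z0_B z0_lt1 z0_partial.
have [c2 c20 masses] := layers_mass H_ge2 dim_gt0 dim_out K_gt0 Z_gauss Z_cont Z_C1 Zc_law
  z0_B z0_lt1 z0_partial.
have [B1 B10 sieve] := layers_sieve Z_gauss Z_cont Z_C1 Zc_law.
pose Cd := deep_cst K H.
have Cd1 : 1 <= Cd.
  rewrite /Cd; case: (H) H1 => // h _ /=; rewrite lerDl mulr_ge0 ?deep_cst_ge0//.
  by apply: sumr_ge0 => i _; exact: sumr_ge0.
(* Here [64 = 4 * 16]: the sieve determines each layer up to [16 * e], hence the composition up to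
   [Cd * (16 * e)], and [lratio_close] multiplies by 4. The neighbourhood of the truth, of radius
   [2 * e], fits in the same bound. *)
pose Bb := 64 * Cd; have Bb1 : 1 <= Bb by rewrite /Bb; lra.
pose kap : R := gvar + 1; have kap0 : 0 <= kap by rewrite addr_ge0// ltW// gvar_gt0.
pose C2 := S%:R * kap + 3 * Bb ^+ 2 + 1.
have C20 : 0 <= C2 by rewrite !addr_ge0// mulr_ge0// sqr_ge0.
pose L := #|layer_index H dim|.
pose Mreq := 4 * (4 * Bb ^+ 2 + S%:R * kap + L%:R * (3 * C2 + 4) + 2).
pose Cst := 21 ^+ L + 1 + (B1 + 1) / (delta * c).
pose ev n := [set o | delta < posterior PC (fun wc => density_of (fw wc)) n (fun m => X m o)
  [set p | M n * eps n < hellinger p p0]].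
have key n : (0 < n)%N -> eps n < c -> eps n < c2 -> Bb * eps n <= 2^-1 ->
    0 <= M n -> Mreq <= M n ^+ 2 ->
    (PX (ev n) <= (Cst * expR (- (n%:R * eps n ^+ 2)))%:E)%E.
  move=> n0 ec ec2 eB M0 MM; have e0 := eps_gt0 n n0; set e := eps n in ec ec2 eB e0 *.
  set a := n%:R * e ^+ 2.
  have a0 : 0 < a by rewrite mulr_gt0 ?ltr0n// exprn_gt0.
  have conc : (concentration H Z K z0 e <= a%:E)%E by exact: eps_conc.
  have mN := massN e a e0 ec a0 conc.
  have mlay := masses e a e0 ec2 a0 conc.
  have pN0 : 0 < Ex PC \1_(near_truth H Zc z0 e).
    by apply: lt_le_trans mN; rewrite mulr_gt0// expR_gt0.
  have tau01 : 0 < expR (- (C2 * a)) <= 1.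
    by rewrite expR_gt0 -[leRHS]expR0 ler_expR oppr_le0 mulr_ge0// ltW.
  have [G [mG [GE [code hcode]]]] := sieve e _ _ tau01 (expR_gt0 (- a))
    (fun h i hH => proj2 (mlay h i hH)).
  pose A := [set w | M n * e < hellinger (density_of (fw w)) p0].
  have bsq : bm (fun w => sqhell Q (fun s => rho (w, s))).
    apply: (bm_Ex Q (F := fun z => (Num.sqrt (rho z) - 1) ^+ 2)).
    apply: bmX; apply: bmB; last exact: bm_cst.
    by apply: bm_sqrt => // z; exact: lt_le_trans (mrho z).
  have Me0 : 0 <= M n * e by rewrite mulr_ge0// ltW.
  (* The alternatives are rewritten with [sqhell], an expectation of a function of [rho], whose
     measurability in [w] is part of Fubini ([bm_Ex]). *)
  have AE w : A w <-> (M n * e) ^+ 2 < sqhell Q (fun s => rho (w, s)).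
    have q0 : 0 <= sqhell Q (fun s => rho (w, s)) by apply: Ex_ge0 => s; exact: sqr_ge0.
    rewrite /A /= hellE -[X in _ <-> is_true (_ < X)](sqr_sqrtr q0).
    by rewrite ltr_pXn2r// nnegrE sqrtr_ge0.
  have mA : measurable A.
    have := (bm_meas bsq) measurableT _ (measurable_itv `](M n * e) ^+ 2, +oo[).
    rewrite setTI; congr measurable; apply/seteqP; split => w /=; rewrite in_itv/= andbT.
      by move=> h; apply/AE.
    by move=> /AE.
  pose T := {ffun layer_index H dim -> 'I_(Num.truncn (20 / (expR (- (C2 * a)) ^+ 3 * expR (- a) ^+ 4))).+1}.
  have hN w s : near_truth H Zc z0 e w -> 2^-1 <= rho (w, s) /\ `|rho (w, s) - 1| <= Bb * e.
    move=> Nw; have h : `|rho (w, s) - 1| <= 4 * (Cd * (2 * e)).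
      apply: closeP; [by rewrite mulr_ge0// ltW| |].
        by move: eB; rewrite /Bb -/Cd; have := mulr_gt0 (lt_le_trans ltr01 Cd1) e0; lra.
      move=> h i y hH cy; have Nhi := Nw h hH i I.
      have cr : cube_continuous (realization (Zc h i) w) := Bc_continuous (ZcB w h i hH).
      exact: (proj1 (nearsetE (Bc_continuous (z0_B h i hH)) (2 * e) cr) Nhi y cy).
    have h' : `|rho (w, s) - 1| <= Bb * e.
      by apply: (le_trans h); rewrite /Bb; have := mulr_gt0 (lt_le_trans ltr01 Cd1) e0; lra.
    split=> //; move: (le_trans h' eB); rewrite ler_norml => /andP[]; lra.
  have hcode' w w' s : G w -> G w' -> code w = code w' ->
      `|rho (w, s) - rho (w', s)| <= Bb * e * rho (w', s).
    move=> Gw Gw' ww'; rewrite (_ : Bb * e = 4 * (Cd * (16 * e))); last by rewrite /Bb; ring.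
    apply: closeC; [by rewrite mulr_ge0// ltW| |].
      by move: eB; rewrite /Bb -/Cd; have := mulr_gt0 (lt_le_trans ltr01 Cd1) e0; lra.
    by move=> h i y hH cy; exact: hcode.
  have hA w : A w -> (M n * e) ^+ 2 <= sqhell Q (fun s => rho (w, s)) by move=> /AE/ltW.
  have PB := @posterior_bound _ _ _ _ _ _ _ PX PC Q (fun m => X m) mX lawX Xind rho m0 m00 mrho brho
    Erho n _ G A T code (Bb * e) ((M n * e) ^+ 2) _ delta (measurable_near_truth H Zc z0 e) mG mA
    (expR_gt0 (- (3 * Bb ^+ 2 * a))) delta0 pN0 hN hcode' hA.
  (* The true likelihood [q] factors out of numerator and denominator and cancels; it is positive
     because the observations lie in the cube. *)
  have evE : ev n = [set o | (delta < Ex PC (fun w => \1_A w * lik (fun m => X m) rho n (w, o)) /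
      Ex PC (fun w => lik (fun m => X m) rho n (w, o)))%R].
    rewrite /ev; congr [set o | _]; apply/funext => o.
    pose q := \prod_(m < n) p0 (X m o).
    have q0 : 0 < q.
      by apply: prodr_gt0 => m _; have [_ pp _] := p0_density; apply: pp; exact: Xcube.
    have bl : bm (fun w => lik (fun m => X m) rho n (w, o)).
      by apply: (bm_pair2 o); apply: bm_lik.
    have dE w : \prod_(m < n) density_of (fw w) (X m o) = q * lik (fun m => X m) rho n (w, o).
      rewrite /q /lik -big_split; apply: eq_bigr => m _.
      by rewrite densE 1?mulrC//; exact: Xcube.
    rewrite /posterior.
    have -> : \int[PC]_(w in [set w | [set p | M n * eps n < hellinger p p0] (density_of (fw w))])
       \prod_(m < n) density_of (fw w) (X m o) =
       q * Ex PC (fun w => \1_A w * lik (fun m => X m) rho n (w, o)).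
      rewrite -ExZ; last by apply: bmM => //; exact: bm_indic.
      rewrite (Ex_restrict PC (A := A))//; congr Ex; apply/funext => w.
      by rewrite dE mulrCA.
    have -> : \int[PC]_w \prod_(m < n) density_of (fw w) (X m o) =
       q * Ex PC (fun w => lik (fun m => X m) rho n (w, o)).
      rewrite -ExZ// (Ex_restrict PC (A := setT))//; congr Ex; apply/funext => w.
      by rewrite dE indicT mul1r.
    by rewrite -mulf_div divff ?mul1r// gt_eqF.
  rewrite evE; apply: le_trans PB _; rewrite lee_fin.
  apply: (@rate_bound R n L S e (M n) c B1 delta Bb kap).
  - by [].
  - by [].
  - by [].
  - exact: ltW.
  - by [].
  - by [].
  - by rewrite ler0n/=; exact: card_codes.
  - exact: GE.
  - by move: mN; rewrite /kap -mulrA mulrDl mul1r (mulrC gvar).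
  - exact: MM.
apply: (@rate_cvg0 R _ eps M Cst Mreq c c2 Bb) => //.
exact: lt_le_trans Bb1.
Qed.
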